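(* Let $(J^s)_{s\in(1/2,1)}$ satisfy Hypotheses (H1) and (H2) below with constant $\delta>0$ and limit kernel $J^1$. Let $0\le k<m<1$, $\theta=\frac{m-k}{m+d/2}$, and let $u_0,\bar u_0\in L^1_k$ be probability densities. Let $u^s_\varepsilon$ be the solution of $\partial_tu=\varepsilon^{-2s}(J^s_\varepsilon*u-u)+\mathrm{div}(xu)$ with $u(0)=u_0$ and $u_\varepsilon$ the solution of $\partial_tu=\varepsilon^{-2}(J^1_\varepsilon*u-u)+\mathrm{div}(xu)$ with $u(0)=\bar u_0$. Then for all $\varepsilon\in\Big(0,\sqrt{\tfrac{2}{4+2\delta+d}}\Big)$ there exists $T^*>0$ such that for all $t\ge T^*$ $$\|u^s_\varepsilon(t)-u_\varepsilon(t)\|_{L^1_k}\le C(1-s)^\theta\big(1+\varepsilon^{\theta\delta}|\log\varepsilon|\big),$$ with a constant $C$ independent of $s$.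
   Context: $\langle x\rangle=(1+|x|^2)^{1/2}$; $\|f\|_{L^1_k}=\int\langle x\rangle^k|f|$; $\hat f(\xi)=\int e^{-ix\cdot\xi}f$; $J_\varepsilon(x)=\varepsilon^{-d}J(x/\varepsilon)$; solutions are mild solutions in $C([0,\infty);L^1_k)$. Hypothesis (H1): $(J^s)_{s\in(1/2,1)}$ is a family of probability densities on $\mathbb{R}^d$ with $J^s\in L^1\cap L^p$ for some $p\in(1,\infty]$, such that (i) $\int\min\{1,|y|^2\}J^s<\infty$; (ii) there exist $\delta,C_0>0$ independent of $s$ with $\hat J^s(\xi)=1-|\xi|^{2s}+R_s(\xi)$, $|R_s(\xi)|\le C_0|\xi|^{2s+\delta}$ for $|\xi|\le1$; (iii) there exist $C,R>0$, $\Psi$ with $\int(1+|x|^2)|\Psi|<\infty$, $\int x\Psi=0$, independent of $s$, with $J^s(x)\le C(1-s)|x|^{-d-2s}+\Psi(x)$ for $|x|\ge R$. Hypothesis (H2): $J^1$ is a probability density with $\hat J^1(\xi)=1-|\xi|^2+R_1(\xi)$, $|R_1(\xi)|\le C_0|\xi|^{2+\delta}$ for $|\xi|\le1$, and there is $\mathfrak C>0$ with $\left|\frac{1-\hat J^s(\xi)}{|\xi|^{2s}}-\frac{1-\hat J^1(\xi)}{|\xi|^2}\right|\le\mathfrak C(1-s)|\xi|^\delta\max(1,|\log|\xi||)$ for all $s\in(1/2,1)$, $\xi\in\mathbb{R}^d$. *)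

(* Defs.v *)
From HB Require Import structures.
From mathcomp Require Import all_boot all_order all_algebra.
From mathcomp Require Import all_classical all_reals all_analysis.
Set Implicit Arguments. Unset Strict Implicit. Unset Printing Implicit Defensive.
Import Order.TTheory GRing.Theory Num.Theory.
Import numFieldNormedType.Exports.
Local Open Scope classical_set_scope.
Local Open Scope ring_scope.

(* Points of R^d are d-tuples of reals, with the product (Borel) sigma-algebra
   generated by the coordinate maps (library instance on n.-tuple T). *)

Section Defs.
Context {R : realType} {n : nat}.
Notation V := (n.-tuple R).

Definition vscale (c : R) (x : V) : V := [tuple c * tnth x i | i < n].
Definition vsub (x y : V) : V := [tuple tnth x i - tnth y i | i < n].
Definition vdot (x y : V) : R := \sum_(i < n) tnth x i * tnth y i.
Definition vnorm (x : V) : R := Num.sqrt (\sum_(i < n) tnth x i ^+ 2).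
Definition jbr (x : V) : R := Num.sqrt (1 + vnorm x ^+ 2).

Variable mu : {measure set V -> \bar R}.

(* mu is Lebesgue measure on R^d: the measure of every closed box is the
   product of its side lengths (this characterizes Lebesgue measure on the
   Borel sets). *)
Definition is_lebesgue : Prop :=
  forall a b : V, (forall i, tnth a i <= tnth b i) ->
    mu [set x | forall i, tnth a i <= tnth x i <= tnth b i] =
    (\prod_(i < n) (tnth b i - tnth a i))%:E.

Definition L1k_norm (k : R) (f : V -> R) : \bar R :=
  (\int[mu]_x ((jbr x `^ k) * `|f x|)%:E)%E.

Definition prob_density (f : V -> R) : Prop :=
  measurable_fun setT f /\ (forall x, 0 <= f x) /\
  (\int[mu]_x (f x)%:E = 1)%E.

Definition ft_re (f : V -> R) (xi : V) : R :=
  Rintegral mu setT (fun x => cos (vdot x xi) * f x).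
Definition ft_im (f : V -> R) (xi : V) : R :=
  - Rintegral mu setT (fun x => sin (vdot x xi) * f x).
Definition cmod (a b : R) : R := Num.sqrt (a ^+ 2 + b ^+ 2).

Definition kscale (eps : R) (J : V -> R) (x : V) : R :=
  eps `^ (- n%:R) * J (vscale eps^-1 x).
Definition conv (f g : V -> R) (y : V) : R :=
  Rintegral mu setT (fun z => f (vsub y z) * g z).

(* u is a mild solution in C([0,oo); L^1_k) of
     d_t u = eps^{-2s} (J_eps * u - u) + div(x u),  u(0) = u0,
   i.e. the Duhamel formula along the transport semigroup
   (S(t) f)(x) = e^{d t} f(e^t x) generated by div(x u):
     u(t,x) = e^{(d-a)t} u0(e^t x)
              + a int_0^t e^{(d-a)(t-r)} (J_eps * u(r))(e^{t-r} x) dr,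
   a = eps^{-2s}, for a.e. x. *)
Definition mild_solution (k s eps : R) (J u0 : V -> R) (u : R -> V -> R) :
    Prop :=
  let a := eps `^ (- (2 * s)) in
  (forall t, 0 <= t -> measurable_fun setT (u t) /\
     (L1k_norm k (u t) < +oo)%E) /\
  (forall t, 0 <= t -> forall e : R, 0 < e -> exists2 eta : R, 0 < eta &
     forall t', 0 <= t' -> `|t' - t| < eta ->
       (L1k_norm k (fun x => (u t' x - u t x)%R) < e%:E)%E) /\
  (forall t, 0 <= t -> {ae mu, forall x,
     u t x = expR ((n%:R - a) * t) * u0 (vscale (expR t) x)
       + a * Rintegral lebesgue_measure [set r : R | 0 <= r <= t]
               (fun r => expR ((n%:R - a) * (t - r)) *
                  conv (kscale eps J) (u r) (vscale (expR (t - r)) x))}).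

Definition H1 (J : R -> V -> R) (delta : R) : Prop :=
  (forall s, 1/2 < s < 1 ->
     prob_density (J s) /\
     ((exists2 p : R, 1 < p &
         (\int[mu]_x (`|J s x| `^ p)%:E < +oo)%E) \/
      (exists M : R, {ae mu, forall x, `|J s x| <= M})) /\
     (\int[mu]_y (Order.min 1 (vnorm y ^+ 2) * J s y)%:E < +oo)%E) /\
  (exists2 C0 : R, 0 < C0 & forall s, 1/2 < s < 1 -> forall xi : V,
     vnorm xi <= 1 ->
     cmod (ft_re (J s) xi - 1 + vnorm xi `^ (2 * s)) (ft_im (J s) xi)
       <= C0 * vnorm xi `^ (2 * s + delta)) /\
  (exists C Rr : R, exists Psi : V -> R,
     [/\ 0 < C, 0 < Rr, measurable_fun setT Psi &
       (\int[mu]_x ((1 + vnorm x ^+ 2) * `|Psi x|)%:E < +oo)%E] /\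
       (forall i : 'I_n, Rintegral mu setT (fun x => tnth x i * Psi x) = 0) /\
       forall s, 1/2 < s < 1 -> forall x, Rr <= vnorm x ->
         J s x <= C * (1 - s) * vnorm x `^ (- n%:R - 2 * s) + Psi x).

Definition H2 (J : R -> V -> R) (J1 : V -> R) (delta : R) : Prop :=
  prob_density J1 /\
  (exists2 C0 : R, 0 < C0 & forall xi : V, vnorm xi <= 1 ->
     cmod (ft_re J1 xi - 1 + vnorm xi ^+ 2) (ft_im J1 xi)
       <= C0 * vnorm xi `^ (2 + delta)) /\
  (exists2 CC : R, 0 < CC & forall s, 1/2 < s < 1 -> forall xi : V,
     xi != [tuple 0 | _ < n] ->
     cmod ((1 - ft_re (J s) xi) / vnorm xi `^ (2 * s)
             - (1 - ft_re J1 xi) / vnorm xi ^+ 2)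
          ((- ft_im (J s) xi) / vnorm xi `^ (2 * s)
             - (- ft_im J1 xi) / vnorm xi ^+ 2)
       <= CC * (1 - s) * vnorm xi `^ delta * Order.max 1 `|ln (vnorm xi)|).

End Defs.

(* Main.v *)
Require Import Defs.
From HB Require Import structures.
From mathcomp Require Import all_boot all_order all_algebra.
From mathcomp Require Import all_classical all_reals all_analysis.
From mathcomp Require Import measurable_realfun ring lra.
Set Implicit Arguments. Unset Strict Implicit. Unset Printing Implicit Defensive.
Import Order.TTheory GRing.Theory Num.Theory.
Import numFieldNormedType.Exports.
Local Open Scope classical_set_scope.
Local Open Scope ring_scope.

(** Everything is done on the solutions themselves.  In Fourier variables the mild
    solution is explicit: with [a = eps ^ (-2s)],
      [u^(t, xi) = u0^(e^-t xi) exp (- A_t xi)],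
      [A_t xi = a int_0^t (1 - J^(eps e^(r-t) xi)) dr],
    and [u0^(e^-t xi) -> 1], so for large [t] only [exp (- A)] matters.  Hypothesis
    (H2) gives [|A^s - A| <= C (1-s) (1+|xi|)^Q] for any [Q > 2 + delta], uniformly in
    [eps].  Since [a > D ^ s] with [D = 2 + delta + d/2] and [J^ -> 0] along rays at a
    rate uniform in [s], [|exp (- A)| <= C (1+|xi|)^-P] for any [P < D] and [s] near 1.
    Interpolating [|e^-A^s - e^-A| <= C e^-p min(1, |A^s - A|)] with exponent
    [gam = theta (1 + d/2) / (1 - k) < 1] makes the difference of the transforms
    [O ((1-s)^gam)] in L2.

    This is turned into a local L1 bound by mollifying at scale [eta e^-t]: the flow
    contracts translations, [|u(t, . - e^-t y) - u(t)|_1 <= |u0(. - y) - u0|_1], so the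
    mollification error is small uniformly in [t].  On the ball of radius [M] one gets
    [M ^ (d/2) (1-s) ^ gam]; outside, the bound [1 - Re u^ <= K |xi|] for small [xi] gives
    [int_{|x|>M} <x>^k u <= C M^(k-1)] for large [t].  [M = (1-s)^(-gam/(1+d/2))] balances
    the two terms to [(1-s) ^ theta]. *)

(** * Real-valued integrals *)

(** The smallness of [eps] says [eps^-2 > D], which is what the L2 bound asks for: after
    interpolation the difference of the transforms is of size [(1+|xi|)^(-P + gam Q)], so
    [2 (P - gam Q) > d] is required, with [P] below [D] and [Q] above [2 + delta]. At [P = D],
    [Q = 2 + delta] the surplus is [2 (2 + delta)(1 - gam)], positive because [m < 1] forces
    [gam < 1]; the small parameters are fractions of it. A mild solution need not be in L2: it keeps
    the transported datum [e^((d-a)t) u0(e^t x)], and the decay in [xi] holds only up to a remainder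
    [e^(-P t)] constant in [xi]. The Gaussian of width [eta e^-t] cuts this remainder off at
    frequencies [e^t / eta], where its energy is of order [e^((d-2P) t)] and vanishes in the limit.
    The same scale is the one at which the flow contracts translations, so [eta] can be fixed before
    [t]. For [s] away from 1 the decay in [xi] need not be strong enough, but there [1 - s] is
    bounded below and boundedness of the difference suffices. *)

Lemma sigma_finite_pack d (T : measurableType d) (R : realType)
    (mu : {measure set T -> \bar R}) : sigma_finite setT mu ->
  exists m : {sigma_finite_measure set T -> \bar R},
    (m : {measure set T -> \bar R}) = mu.
Proof.
case: mu => f [c1 c2] h.
have sf := sfinite_measure_sigma_finite h.
by exists (SigmaFiniteMeasure.Pack (SigmaFiniteMeasure.Class c2
  (isSFinite.Axioms_ _ _ _ sf) (isSigmaFinite.Axioms_ _ _ _ h))).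
Qed.

Definition L1 d (T : measurableType d) (R : realType)
  (m : {measure set T -> \bar R}) (f : T -> R) :=
  m.-integrable setT (EFin \o f).

Notation "'I[' m ] f" := (Rintegral m setT f) (at level 36, f at level 36) : ring_scope.

Section real_integral.
Context d (T : measurableType d) (R : realType) (m : {measure set T -> \bar R}).
Implicit Types f g h : T -> R.

Lemma L1_measurable f : L1 m f -> measurable_fun setT f.
Proof. by move=> /integrableP[/measurable_EFinP]. Qed.

Lemma L1_EFin f : L1 m f -> (I[m] f)%:E = (\int[m]_x (f x)%:E)%E.
Proof. by move=> h; rewrite /Rintegral fineK//; exact: integrable_fin_num. Qed.

Lemma L1_bound f c : measurable_fun setT f -> (forall x, 0 <= f x) ->
  (\int[m]_x (f x)%:E <= c%:E)%E -> L1 m f /\ I[m] f <= c.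
Proof.
move=> mf f0 fc.
have h : L1 m f.
  apply/integrableP; split; first exact/measurable_EFinP.
  apply: le_lt_trans (ltry c); apply: le_trans fc.
  by under eq_integral do rewrite gee0_abs ?lee_fin//.
by split => //; rewrite -lee_fin L1_EFin.
Qed.

Lemma L1P f : measurable_fun setT f -> (\int[m]_x (`|f x|)%:E < +oo)%E -> L1 m f.
Proof. by move=> mf h; apply/integrableP; split => //; exact/measurable_EFinP. Qed.

Lemma L1_lty f : L1 m f -> (\int[m]_x (`|f x|)%:E < +oo)%E.
Proof. by move=> /integrableP[]. Qed.

Lemma L1_le f g : measurable_fun setT f -> (forall x, `|f x| <= g x) ->
  L1 m g -> L1 m f.
Proof.
move=> mf fg; apply: le_integrable => //; first exact/measurable_EFinP.
by move=> x _ /=; rewrite lee_fin (le_trans (fg x))// ler_norm.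
Qed.

Lemma L1_norm f : L1 m f -> L1 m (fun x => `|f x|).
Proof. exact: integrable_norm. Qed.

Lemma L1D f g : L1 m f -> L1 m g -> L1 m (fun x => f x + g x).
Proof. by move=> hf hg; exact: (integrableD _ hf hg). Qed.

Lemma L1B f g : L1 m f -> L1 m g -> L1 m (fun x => f x - g x).
Proof. by move=> hf hg; exact: (integrableB _ hf hg). Qed.

Lemma L1Z c f : L1 m f -> L1 m (fun x => c * f x).
Proof. by move=> hf; exact: (@integrableZl _ _ _ m setT measurableT c _ hf). Qed.

Lemma L1M f g c : measurable_fun setT g -> (forall x, `|g x| <= c) -> L1 m f ->
  L1 m (fun x => g x * f x).
Proof.
move=> mg gc hf; apply: (L1_le (g := fun x => c * `|f x|)).
- by apply: measurable_funM => //; exact: L1_measurable.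
- by move=> x; rewrite normrM ler_wpM2r.
- exact/L1Z/L1_norm.
Qed.

Lemma L10 : L1 m (fun=> 0).
Proof. exact: integrable0. Qed.

Lemma I_D f g : L1 m f -> L1 m g -> I[m] (fun x => f x + g x) = I[m] f + I[m] g.
Proof. by move=> hf hg; rewrite RintegralD. Qed.

Lemma I_B f g : L1 m f -> L1 m g -> I[m] (fun x => f x - g x) = I[m] f - I[m] g.
Proof. by move=> hf hg; rewrite RintegralB. Qed.

Lemma I_Z c f : L1 m f -> I[m] (fun x => c * f x) = c * I[m] f.
Proof. by move=> hf; rewrite RintegralZl. Qed.

Lemma I_Zr c f : L1 m f -> I[m] (fun x => f x * c) = I[m] f * c.
Proof. by move=> hf; rewrite RintegralZr. Qed.

Lemma I_0 : I[m] (fun=> 0 : R) = 0.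
Proof. by rewrite /Rintegral integral0. Qed.

Lemma I_ge0 f : (forall x, 0 <= f x) -> 0 <= I[m] f.
Proof. by move=> h; apply: Rintegral_ge0. Qed.

Lemma I_ext f g : (forall x, f x = g x) -> I[m] f = I[m] g.
Proof. by move=> fg; congr (Rintegral _ _ _); apply/funext. Qed.

Lemma L1_ext f g : (forall x, f x = g x) -> L1 m f -> L1 m g.
Proof. by move=> /funext->. Qed.

Lemma I_le f g : L1 m f -> L1 m g -> (forall x, f x <= g x) -> I[m] f <= I[m] g.
Proof. by move=> hf hg fg; apply: le_Rintegral. Qed.

Lemma I_norm f : L1 m f -> `|I[m] f| <= I[m] (fun x => `|f x|).
Proof. by move=> hf; apply: le_normr_Rintegral. Qed.

Lemma I_le_norm f g : L1 m g -> measurable_fun setT f ->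
  (forall x, `|f x| <= g x) -> `|I[m] f| <= I[m] g.
Proof.
move=> hg mf fg; have hf := L1_le mf fg hg.
by apply: (le_trans (I_norm hf)); apply: I_le => //; exact: L1_norm.
Qed.

Lemma I_ae f g : measurable_fun setT f -> measurable_fun setT g ->
  {ae m, forall x, f x = g x} -> I[m] f = I[m] g.
Proof.
move=> mf mg fg; rewrite /Rintegral; congr fine.
apply: ae_eq_integral => //; try exact/measurable_EFinP.
by apply: filterS fg => x h _; rewrite h.
Qed.

Lemma L1_ae_le f g : measurable_fun setT f -> L1 m g ->
  {ae m, forall x, `|f x| <= g x} -> L1 m f.
Proof.
move=> mf hg fg.
have mg := L1_measurable hg.
apply: L1P => //; apply: le_lt_trans (L1_lty hg).
apply: ae_ge0_le_integral => //.
- by apply/measurable_EFinP; exact: (measurableT_comp (@normr_measurable _ _)).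
- by apply/measurable_EFinP; exact: (measurableT_comp (@normr_measurable _ _)).
- by apply: filterS fg => x h _; rewrite lee_fin (le_trans h)// ler_norm.
Qed.

Lemma L1_ae f g : measurable_fun setT f -> L1 m g ->
  {ae m, forall x, f x = g x} -> L1 m f.
Proof.
move=> mf hg fg; apply: L1_ae_le (L1_norm hg) _ => //.
by apply: filterS fg => x e; rewrite e.
Qed.

Lemma I_ae_le f g : L1 m f -> L1 m g -> {ae m, forall x, f x <= g x} ->
  I[m] f <= I[m] g.
Proof.
move=> hf hg fg.
(* The maximum dominates [f] everywhere and equals [g] almost everywhere, which reduces the claim to
   the pointwise comparison [I_le]. *)
pose h x := Num.max (f x) (g x).
have mh : measurable_fun setT h.
  by apply: measurable_maxr; exact: L1_measurable.
have E : {ae m, forall x, h x = g x}.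
  by apply: filterS fg => x ?; rewrite /h max_r.
have hh : L1 m h by exact: L1_ae E.
rewrite -(I_ae mh (L1_measurable hg) E); apply: I_le => // x.
by rewrite /h le_max lexx.
Qed.

Lemma I_dct (f_ : nat -> T -> R) f g :
  (forall n, measurable_fun setT (f_ n)) -> L1 m g ->
  (forall n x, `|f_ n x| <= g x) -> (forall x, f_ n x @[n --> \oo] --> f x) ->
  L1 m f /\ I[m] (f_ n) @[n --> \oo] --> I[m] f.
Proof.
move=> mf hg fg cf.
have mlim : measurable_fun setT f.
  by apply: (measurable_fun_cvg mf) => x _; exact: cf.
have mf' n : measurable_fun setT (EFin \o f_ n) by exact/measurable_EFinP.
have ml' : measurable_fun setT (EFin \o f) by exact/measurable_EFinP.
have cf' : {ae m, forall x, setT x -> (EFin \o f_ n) x @[n --> \oo] --> (EFin \o f) x}.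
  by apply/aeW => x _; apply: cvg_EFin => //; [exact: nearW|exact: cf].
have fg' : {ae m, forall x n, setT x -> (`|(EFin \o f_ n) x| <= (EFin \o g) x)%E}.
  by apply/aeW => x n _; rewrite lee_fin.
have [hf _ H] := dominated_convergence measurableT mf' ml' cf' hg fg'.
split => //; rewrite /Rintegral.
have -> : (fun n => fine (\int[m]_x (f_ n x)%:E)%E) =
  fine \o (fun n => (\int[m]_x (f_ n x)%:E)%E) by [].
apply: fine_cvg; rewrite fineK; first exact: H.
exact: integrable_fin_num hf.
Qed.

End real_integral.

(** * Fubini for real-valued integrals *)

Section real_fubini.
Context d1 d2 (T1 : measurableType d1) (T2 : measurableType d2) (R : realType).
Variables (m1 : {sigma_finite_measure set T1 -> \bar R})
  (m2 : {sigma_finite_measure set T2 -> \bar R}).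
Implicit Types f : T1 * T2 -> R.

Lemma measurable_sec1 f x : measurable_fun setT f ->
  measurable_fun setT (fun y => f (x, y)).
Proof. by move=> mf; exact: measurableT_comp (measurable_pair1 x). Qed.

Lemma measurable_sec2 f y : measurable_fun setT f ->
  measurable_fun setT (fun x => f (x, y)).
Proof. by move=> mf; exact: measurableT_comp (measurable_pair2 y). Qed.

(** Tonelli gives measurability for nonnegative integrands, hence the split into positive and
    negative parts. Their difference may be infinite at some [x]; [fine] keeps it real and
    measurable there. *)
Lemma measurable_I f : measurable_fun setT f ->
  measurable_fun setT (fun x => I[m2] (fun y => f (x, y))).
Proof.
move=> mf; have /measurable_EFinP mfE := mf.
rewrite /Rintegral.
rewrite (_ : (fun x => _) = fine \o
   ((fun x => (\int[m2]_y (((EFin \o f)^\+ (x, y))))%E) \-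
    (fun x => (\int[m2]_y (((EFin \o f)^\- (x, y))))%E))%E); last first.
  apply/funext => x; rewrite integralE.
  by rewrite (funepos_comp (EFin \o f) (pair x)) (funeneg_comp (EFin \o f) (pair x)).
apply: measurableT_comp => //.
apply: emeasurable_funB; apply: measurable_fun_fubini_tonelli_F => //.
  exact: measurable_funepos.
exact: measurable_funeneg.
Qed.

Lemma L1_prod f (h : T1 -> R) : measurable_fun setT f -> L1 m1 h ->
  (forall x, (\int[m2]_y (`|f (x, y)|)%:E <= (h x)%:E)%E) ->
  L1 (m1 \x m2)%E f.
Proof.
move=> mf hh fh; apply/integrable12ltyP; first exact/measurable_EFinP.
apply: (@le_lt_trans _ _ (\int[m1]_x (`|h x|)%:E)%E); last exact: L1_lty hh.
apply: ge0_le_integral => //.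
- by move=> x _; apply: integral_ge0.
- apply: (@measurable_fun_fubini_tonelli_F _ _ _ _ _ m2 (fun z => `|(f z)%:E|%E)) => //.
  by apply: measurableT_comp => //; exact/measurable_EFinP.
- by apply/measurable_EFinP/measurableT_comp => //; exact: L1_measurable hh.
- by move=> x _; apply: (le_trans (fh x)); rewrite lee_fin ler_norm.
Qed.

Lemma L1_prod_sec f : L1 (m1 \x m2)%E f ->
  {ae m1, forall x, L1 m2 (fun y => f (x, y))}.
Proof. by move=> hf; exact: (ae_integrable1 hf). Qed.

Lemma I_prod1 f : L1 (m1 \x m2)%E f ->
  L1 m1 (fun x => I[m2] (fun y => f (x, y))) /\
  I[m1] (fun x => I[m2] (fun y => f (x, y))) = I[(m1 \x m2)%E] f.
Proof.
move=> hf; have mf := L1_measurable hf.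
(* Sections are integrable only for almost every [x]; elsewhere the real inner integral is a default
   value, so the real and extended inner integrals are identified up to a null set. *)
have E : {ae m1, forall x, (I[m2] (fun y => f (x, y)))%:E =
   (\int[m2]_y (f (x, y))%:E)%E}.
  by apply: filterS (L1_prod_sec hf) => x; exact: L1_EFin.
have iF := integrable_fubini_F hf.
have mF := measurable_fubini_F hf.
have mI := measurable_I mf.
have hI : L1 m1 (fun x => I[m2] (fun y => f (x, y))).
  apply/integrableP; split; first exact/measurable_EFinP.
  move/integrableP : iF => [_]; apply: le_lt_trans.
  apply: ae_ge0_le_integral => //.
  - by apply: measurableT_comp => //; exact/measurable_EFinP.
  - by apply: measurableT_comp.
  - by apply: filterS E => x e _; rewrite /fubini_F -e.
split => //; rewrite /Rintegral; congr fine.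
rewrite -integral12_prod_meas1//.
apply: ae_eq_integral => //; first exact/measurable_EFinP.
by apply: filterS E => x e _; rewrite /fubini_F -e.
Qed.

Lemma I_prod2 f : L1 (m1 \x m2)%E f ->
  L1 m2 (fun y => I[m1] (fun x => f (x, y))) /\
  I[m2] (fun y => I[m1] (fun x => f (x, y))) = I[(m1 \x m2)%E] f.
Proof.
move=> hf; have mf := L1_measurable hf.
have E : {ae m2, forall y, (I[m1] (fun x => f (x, y)))%:E =
   (\int[m1]_x (f (x, y))%:E)%E}.
  by apply: filterS (ae_integrable2 hf) => x; exact: L1_EFin.
have mF := measurable_fubini_G hf.
have mI : measurable_fun setT (fun y => I[m1] (fun x => f (x, y))).
  rewrite /Rintegral.
  rewrite (_ : (fun x => _) = fine \o
     ((fun y => (\int[m1]_x (((EFin \o f)^\+ (x, y))))%E) \-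
      (fun y => (\int[m1]_x (((EFin \o f)^\- (x, y))))%E))%E); last first.
    apply/funext => y; rewrite integralE.
    by rewrite (funepos_comp (EFin \o f) (pair^~ y)) (funeneg_comp (EFin \o f) (pair^~ y)).
  apply: measurableT_comp => //.
  apply: emeasurable_funB; apply: measurable_fun_fubini_tonelli_G => //.
    by apply: measurable_funepos; exact/measurable_EFinP.
  by apply: measurable_funeneg; exact/measurable_EFinP.
have hI : L1 m2 (fun y => I[m1] (fun x => f (x, y))).
  apply/integrableP; split; first exact/measurable_EFinP.
  have /integrable21ltyP-/(_ (measurable_int _ hf)) := hf.
  apply: le_lt_trans; apply: ae_ge0_le_integral => //.
  - by apply: measurableT_comp => //; exact/measurable_EFinP.
  - by move=> y _; exact: integral_ge0.
  - apply: (@measurable_fun_fubini_tonelli_G _ _ _ _ _ m1 (fun z => `|(f z)%:E|%E)) => //.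
    by apply: measurableT_comp => //; exact/measurable_EFinP.
  - apply: filterS E => y e _ /=; rewrite -abse_EFin e.
    apply: le_abse_integral => //; apply/measurable_EFinP.
    exact: measurable_sec2.
split => //; rewrite /Rintegral; congr fine.
rewrite -integral21_prod_meas1//.
apply: ae_eq_integral => //; first exact/measurable_EFinP.
by apply: filterS E => x e _; rewrite /fubini_G -e.
Qed.

Lemma I_fubini f : L1 (m1 \x m2)%E f ->
  I[m1] (fun x => I[m2] (fun y => f (x, y))) =
  I[m2] (fun y => I[m1] (fun x => f (x, y))).
Proof. by move=> hf; rewrite (I_prod1 hf).2 (I_prod2 hf).2. Qed.

End real_fubini.

(** Dominated convergence is stated for sequences; limits for large real [t] are drawn from it by
    contradiction, since a failure at every threshold yields times [t_n >= n] along which [F] stays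
    above [e]. *)
Lemma eventually_le_seq (R : realType) (F : R -> R) :
  (forall t_ : nat -> R, (forall n, n%:R <= t_ n) ->
     F (t_ n) @[n --> \oo] --> (0 : R)) ->
  forall e, 0 < e -> exists2 T, 0 < T & forall t, T <= t -> F t <= e.
Proof.
move=> H e e0; apply: contrapT => /forall2NP nT.
have key n : {t : R | n.+1%:R <= t /\ e < F t}.
  apply: cid; have [|/existsNP[t /not_implyP[nt /negP]]] := nT n.+1%:R.
    by move=> /negP; rewrite ltr0n.
  by rewrite -ltNge => Ft; exists t.
have /H/cvgrPdist_lt/(_ e e0)[N _ /(_ N (leqnn N))/=] :
    forall n, n%:R <= sval (key n).
  by move=> n; apply: le_trans (proj1 (svalP (key n))); rewrite ler_nat.
rewrite sub0r normrN => /(le_lt_trans (ler_norm _)).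
by rewrite ltNge (ltW (proj2 (svalP (key N)))).
Qed.

(** * Lebesgue measure on tuples *)

Section tuple_space.
Context {R : realType} {n : nat}.
Notation V := (n.-tuple R).

Lemma eq_tnthP (x y : V) : (forall i, tnth x i = tnth y i) -> x = y.
Proof. exact: eq_from_tnth. Qed.

Lemma tnth_vscale c (x : V) i : tnth (vscale c x) i = c * tnth x i.
Proof. by rewrite tnth_mktuple. Qed.

Lemma tnth_vsub (x y : V) i : tnth (vsub x y) i = tnth x i - tnth y i.
Proof. by rewrite tnth_mktuple. Qed.

Section measurability.
Context d (T : measurableType d).

Lemma measurable_fun_vscale (c : T -> R) (f : T -> V) :
  measurable_fun setT c -> measurable_fun setT f ->
  measurable_fun setT (fun t => vscale (c t) (f t)).
Proof.
move=> mc /measurable_fun_tnthP mf; apply/measurable_fun_tnthP => i.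
rewrite (_ : _ \o _ = fun t => c t * tnth (f t) i); last first.
  by apply/funext => t /=; rewrite tnth_vscale.
by apply: measurable_funM => //; exact: mf.
Qed.

Lemma measurable_fun_vsub (f g : T -> V) :
  measurable_fun setT f -> measurable_fun setT g ->
  measurable_fun setT (fun t => vsub (f t) (g t)).
Proof.
move=> /measurable_fun_tnthP mf /measurable_fun_tnthP mg.
apply/measurable_fun_tnthP => i.
rewrite (_ : _ \o _ = fun t => tnth (f t) i - tnth (g t) i); last first.
  by apply/funext => t /=; rewrite tnth_vsub.
by apply: measurable_funB => //; [exact: mf|exact: mg].
Qed.

Lemma measurable_fun_vdot (f g : T -> V) :
  measurable_fun setT f -> measurable_fun setT g ->
  measurable_fun setT (fun t => vdot (f t) (g t)).
Proof.
move=> /measurable_fun_tnthP mf /measurable_fun_tnthP mg.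
apply: measurable_sum => i.
by apply: measurable_funM; [exact: mf|exact: mg].
Qed.

Lemma measurable_fun_vnorm (f : T -> V) :
  measurable_fun setT f -> measurable_fun setT (fun t => vnorm (f t)).
Proof.
move=> /measurable_fun_tnthP mf.
have ms : measurable_fun setT (@Num.sqrt R).
  exact: (continuous_measurable_fun (@sqrt_continuous R)).
rewrite /vnorm; apply: (measurableT_comp ms).
apply: measurable_sum => i.
by apply: measurable_funX; exact: mf.
Qed.

End measurability.

Definition box (a b : V) := [set x : V | forall i, tnth a i <= tnth x i <= tnth b i].

Lemma measurable_box a b : measurable (box a b).
Proof.
rewrite (_ : box a b = \bigcap_(i in [set: 'I_n])
   ((@tnth _ R ^~ i) @^-1` `[tnth a i, tnth b i])); last first.
  apply/seteqP; split => x /= h i; first by move=> _ /=; rewrite in_itv/= h.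
  by have := h i I; rewrite /= in_itv.
apply: fin_bigcap_measurable => // i _.
rewrite -[X in measurable X]setTI.
exact: measurable_tnth.
Qed.

Definition cube (r : R) := box [tuple - r | _ < n] [tuple r | _ < n].

Lemma cubeP r x : cube r x <-> forall i, `|tnth x i| <= r.
Proof.
by split => h i; have := h i; rewrite !tnth_mktuple ler_norml.
Qed.

Lemma bigcup_cube : \bigcup_k cube k%:R = [set: V].
Proof.
apply/seteqP; split => // x _.
have s0 : 0 <= \sum_i `|tnth x i| by apply: sumr_ge0.
exists (Num.truncn (\sum_i `|tnth x i|)).+1 => //; apply/cubeP => i.
apply: (@le_trans _ _ (\sum_i `|tnth x i|)).
  by rewrite (bigD1 i)//= lerDl sumr_ge0.
by apply/ltW; exact: truncnS_gt.
Qed.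

Let boxes := [set A | exists a b : V, A = box a b].

(** [is_lebesgue] prescribes the measure of closed boxes only; that they generate the sigma-algebra
    of the coordinate maps is what lets it determine the measure. *)
Lemma box_generates : (@measurable _ V) = <<s boxes >>.
Proof.
apply/seteqP; split; last first.
  apply: smallest_sub; first exact: sigma_algebra_measurable.
  by move=> _ [a [b ->]]; exact: measurable_box.
apply: smallest_sub; first exact: smallest_sigma_algebra.
have key (i : 'I_n) : preimage_set_system [set: V] (@tnth _ R ^~ i) measurable
    `<=` <<s boxes >>.
  move=> _ [B mB <-]; rewrite setTI.
  pose S := image_set_system [set: V] (@tnth _ R ^~ i) <<s boxes >>.
  suff : S B by rewrite /S /image_set_system/= setTI.
  rewrite /S; clear S; set S := image_set_system _ _ _.
  have E : (@measurable _ R) = <<s @RGenCInfty.G R >> := RGenCInfty.measurableE R.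
  move: mB; rewrite E; move: B; apply: smallest_sub.
    exact/sigma_algebra_image/smallest_sigma_algebra.
  (* The half-space [x <= y_i] is exhausted by the boxes with side [[x, k]] in direction [i] and
     [[-k, k]] in the others. *)
  move=> _ [x ->]; rewrite /S /image_set_system/= setTI.
  rewrite (_ : _ @^-1` _ = \bigcup_k
     box [tuple (if j == i then x else - k%:R) | j < n] [tuple k%:R | _ < n]).
    apply: sigma_algebra_bigcup => k; apply: sub_sigma_algebra.
    by exists [tuple (if j == i then x else - k%:R) | j < n], [tuple k%:R | _ < n].
  apply/seteqP; split => y /=.
    rewrite in_itv/= andbT => xy.
    have : [set: V] y by [].
    rewrite -bigcup_cube => -[k _ /cubeP ky]; exists k => // j.
    rewrite !tnth_mktuple; have := ky j; rewrite ler_norml => /andP[k1 k2].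
    by case: eqVneq => [->|_]; rewrite ?xy ?k1 -?(eqP (eqxx _)) ?k2//=;
      have := ky i; rewrite ler_norml => /andP[].
  move=> [k _ /(_ i)]; rewrite !tnth_mktuple eqxx => /andP[xy _].
  by rewrite in_itv/= xy.
apply: (big_ind (fun A => A `<=` <<s boxes >>)) => [//|A B AS BS|i _].
  by rewrite subUset; split.
exact: key.
Qed.

Lemma box_setI : setI_closed boxes.
Proof.
move=> _ _ [a [b ->]] [a' [b' ->]].
exists [tuple Num.max (tnth a i) (tnth a' i) | i < n],
  [tuple Num.min (tnth b i) (tnth b' i) | i < n].
apply/seteqP; split => x /=.
  move=> [h h'] i; rewrite !tnth_mktuple ge_max le_min.
  by have /andP[-> ->] := h i; have /andP[-> ->] := h' i.
move=> h; split => i; have := h i; rewrite !tnth_mktuple ge_max le_min;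
  by move=> /andP[/andP[? ?] /andP[? ?]]; apply/andP.
Qed.

Lemma box_empty a b : ~ (forall i, tnth a i <= tnth b i) -> box a b = set0.
Proof.
move=> h; rewrite -subset0 => x abx; apply: h => i.
by have /andP[/le_trans h /h] := abx i.
Qed.

Lemma eq_measure_box (m1 m2 : {measure set V -> \bar R}) :
  (forall a b : V, (forall i, tnth a i <= tnth b i) ->
     m1 (box a b) = m2 (box a b)) ->
  (forall k : nat, (m1 (cube k%:R) < +oo)%E) ->
  forall A, measurable A -> m1 A = m2 A.
Proof.
move=> h1 h2; apply: (measure_unique boxes (fun k => cube k%:R)).
- exact: box_generates.
- exact: box_setI.
- by move=> k; exists [tuple - k%:R | _ < n], [tuple k%:R | _ < n].
- exact: bigcup_cube.
- move=> _ [a [b ->]]; have [ab|ab] := pselect (forall i, tnth a i <= tnth b i).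
    exact: h1.
  by rewrite box_empty// !measure0.
- exact: h2.
Qed.

Section lebesgue.
Variable m : {measure set V -> \bar R}.
Hypothesis lm : is_lebesgue m.

Lemma lebesgue_cube r : 0 <= r -> m (cube r) = ((2 * r) ^+ n)%:E.
Proof.
move=> r0; rewrite /cube /box lm; last first.
  by move=> i; rewrite !tnth_mktuple (le_trans _ r0)// oppr_le0.
congr EFin; under eq_bigr do rewrite !tnth_mktuple.
rewrite prodr_const card_ord; congr (_ ^+ _); ring.
Qed.

Lemma lebesgue_sigma_finite : sigma_finite setT m.
Proof.
exists (fun k => cube k%:R); first by rewrite bigcup_cube.
by move=> k; split; [exact: measurable_box|rewrite lebesgue_cube ?ltry].
Qed.

(** One map serves for translations ([c = 1]), dilations ([y = 0]) and the reflection
    [z -> x - tau z] of the mollifier (negative [c]). *)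
Definition affine (c : R) (y x : V) := vsub (vscale c x) y.

Lemma measurable_affine c y : measurable_fun setT (affine c y).
Proof.
apply: measurable_fun_vsub => //; apply: measurable_fun_vscale => //.
Qed.

Lemma affine_box c y a b : c != 0 -> (forall i, tnth a i <= tnth b i) ->
  m (affine c y @^-1` box a b) = (`|c| ^- n * \prod_(i < n) (tnth b i - tnth a i))%:E.
Proof.
move=> c0 ab.
pose a' := [tuple (tnth a i + tnth y i) / c | i < n].
pose b' := [tuple (tnth b i + tnth y i) / c | i < n].
have [c_gt0|c_lt0|/eqP] := ltgtP 0 c; last by rewrite eq_sym (negbTE c0).
- rewrite (_ : _ @^-1` _ = box a' b'); last first.
    apply/seteqP; split => x /= h i; have := h i;
    rewrite tnth_vsub tnth_vscale !tnth_mktuple ler_pdivrMr// ler_pdivlMr//;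
    by rewrite lerBrDr lerBlDr mulrC.
  rewrite /box lm; last first.
    by move=> i; rewrite !tnth_mktuple ler_pM2r ?invr_gt0// lerD2r.
  congr EFin; rewrite -exprVn -[X in _ ^+ X]card_ord -prodr_const -big_split/=.
  apply: eq_bigr => i _; rewrite !tnth_mktuple gtr0_norm//; field.
  by rewrite gt_eqF.
- rewrite (_ : _ @^-1` _ = box b' a'); last first.
    apply/seteqP; split => x /= h i; have := h i;
    rewrite tnth_vsub tnth_vscale !tnth_mktuple ler_ndivrMr// ler_ndivlMr//;
    by rewrite lerBrDr lerBlDr mulrC andbC.
  rewrite /box lm; last first.
    by move=> i; rewrite !tnth_mktuple ler_nM2r ?invr_lt0// lerD2r.
  congr EFin; rewrite -exprVn -[X in _ ^+ X]card_ord -prodr_const -big_split/=.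
  apply: eq_bigr => i _; rewrite !tnth_mktuple ltr0_norm//; field.
  by rewrite lt_eqF.
Qed.

(** The image of [m] under the affine map and the multiple [|c|^-n m] agree on boxes, hence
    everywhere. *)
Lemma ge0_integral_affine c y (F : V -> \bar R) : c != 0 ->
  measurable_fun setT F -> (forall x, (0 <= F x)%E) ->
  (\int[m]_x F (affine c y x) = (`|c| ^- n)%:E * \int[m]_x F x)%E.
Proof.
move=> c0 mF F0.
have k0 : 0 <= `|c| ^- n by rewrite invr_ge0 exprn_ge0.
rewrite -(@ge0_integral_mscale _ _ _ m setT measurableT (NngNum k0))//.
have -> : (\int[m]_x F (affine c y x) =
   \int[m]_(x in affine c y @^-1` setT) (F \o affine c y) x)%E by [].
rewrite -(ge0_integral_pushforward (measurable_affine c y))//; last first.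
apply: eq_measure_integral; first exact: measurable_affine.
move=> mf A mA _; apply: eq_measure_box mA.
- move=> a b ab; rewrite [LHS]affine_box//.
  by rewrite [RHS]/= /mscale/= /box lm//= -EFinM.
- move=> k; rewrite /cube [ltLHS]affine_box ?ltry//.
  by move=> i; rewrite !tnth_mktuple (@le_trans _ _ 0)// oppr_le0.
Qed.

Lemma L1_affine c y f : c != 0 -> L1 m f -> L1 m (fun x => f (affine c y x)).
Proof.
move=> c0 hf; have mf := L1_measurable hf; apply: L1P.
  by apply: measurableT_comp => //; exact: measurable_affine.
rewrite (@ge0_integral_affine c y (fun x => (`|f x|)%:E))//.
  have := L1_lty hf; rewrite -ge0_fin_numE ?integral_ge0// => /fineK <-.
  by rewrite -EFinM ltry.
by apply/measurable_EFinP; exact: measurableT_comp.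
Qed.

Lemma I_affine c y f : c != 0 -> L1 m f ->
  I[m] (fun x => f (affine c y x)) = `|c| ^- n * I[m] f.
Proof.
move=> c0 hf; have mf := L1_measurable hf; have haf := L1_affine y c0 hf.
pose p x := Num.max (f x) 0; pose q x := Num.max (- f x) 0.
have fE x : f x = p x - q x by rewrite /p /q; case: (leP (f x) 0) => ?;
  case: (leP (- f x) 0) => ?; lra.
have mp : measurable_fun setT p by apply: measurable_maxr.
have mq : measurable_fun setT q.
  by apply: measurable_maxr => //; exact: measurableT_comp.
have p0 x : 0 <= p x by rewrite /p le_max lexx orbT.
have q0 x : 0 <= q x by rewrite /q le_max lexx orbT.
have hp : L1 m p.
  apply: (L1_le mp _ (L1_norm hf)) => x; rewrite ger0_norm// /p.
  by rewrite ge_max ler_norm normr_ge0.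
have hq : L1 m q.
  apply: (L1_le mq _ (L1_norm hf)) => x; rewrite ger0_norm// /q.
  by rewrite ge_max -normrN ler_norm normr_ge0.
have key (g : V -> R) : L1 m g -> (forall x, 0 <= g x) ->
    I[m] (fun x => g (affine c y x)) = `|c| ^- n * I[m] g.
  move=> hg g0; have mg := L1_measurable hg.
  rewrite /Rintegral (@ge0_integral_affine c y (fun x => (g x)%:E))//.
    by rewrite fineM//; exact: integrable_fin_num.
  exact/measurable_EFinP.
rewrite (I_ext m (g := fun x => p (affine c y x) - q (affine c y x))); last first.
  by move=> x; rewrite fE.
rewrite I_B//; [|exact: L1_affine|exact: L1_affine].
rewrite (I_ext m fE) I_B// !key//; ring.
Qed.

End lebesgue.

End tuple_space.

(** * Gaussian Fourier transforms *)

Definition leb (R : realType) : {sigma_finite_measure set (measurableTypeR R) -> \bar R} :=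
  @lebesgue_measure R.

Section one_dimension.
Context {R : realType}.
Notation leb := (leb R).

Lemma FTC_R (F f : R -> R) (a b : R) : a <= b ->
  (forall x : R, is_derive x (1 : R) F (f x)) -> continuous f ->
  Rintegral leb `[a, b] f = F b - F a.
Proof.
move=> ab dF cf; have [->|ab'] := eqVneq a b.
  by rewrite set_itv1 Rintegral_set1 subrr.
have cF x : {for x, continuous F}.
  by apply: differentiable_continuous; apply/derivable1_diffP; exact: ex_derive.
rewrite /Rintegral (@continuous_FTC2 _ f F)//.
- by rewrite lt_neqAle ab'.
- exact: continuous_subspaceT.
- split.
  + by move=> x _; exact: ex_derive.
  + exact: cvg_at_right_filter (cF a).
  + exact: cvg_at_left_filter (cF b).
- by move=> x _; rewrite derive1E derive_val.
Qed.

Definition gauss1 (x : R) := expR (- x ^+ 2 / 2).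

Lemma L1_expR_sqr a : 0 < a -> L1 leb (fun x : R => expR (- (a * x ^+ 2))).
Proof.
(* Up to its peak value, [exp (- a x^2)] is the normal density of variance [1 / (2 a)], whose
   integrability is known. *)
move=> a0; pose s := Num.sqrt ((2 * a)^-1).
have s0 : 0 < s by rewrite sqrtr_gt0 invr_gt0 mulr_gt0.
have s2 : s ^+ 2 = (2 * a)^-1 by rewrite sqr_sqrtr// invr_ge0 mulr_ge0// ltW.
have := L1Z (normal_peak s)^-1 (integrable_normal_pdf 0 s : L1 leb (normal_pdf 0 s)).
apply: L1_ext => x; rewrite /normal_pdf gt_eqF// mulKf; last first.
  by rewrite gt_eqF// normal_peak_gt0// gt_eqF.
rewrite /normal_fun subr0 s2; congr expR; field.
by rewrite gt_eqF.
Qed.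

Lemma L1_gauss1 : L1 leb gauss1.
Proof.
apply: L1_ext (@L1_expR_sqr 2^-1 _) => //.
by move=> x; rewrite /gauss1; congr expR; ring.
Qed.

Lemma I_gauss1_gt0 : 0 < I[leb] gauss1.
Proof.
have E : 1 = normal_peak 1 * I[leb] gauss1.
  rewrite -I_Z; last exact: L1_gauss1.
  have := @integral_normal_pdf R 0 1; rewrite -/(Rintegral _ _ _) => h.
  rewrite -[LHS]/(fine 1%E) -h; congr fine; apply: eq_integral => x _.
  rewrite /normal_pdf oner_eq0 /normal_fun /gauss1 subr0.
  by congr (_ * expR _)%:E; rewrite expr1n.
have p0 : 0 < normal_peak (1 : R) by rewrite normal_peak_gt0 ?oner_neq0.
by rewrite -(pmulr_rgt0 _ p0) -E.
Qed.

Lemma gauss1_gt0 x : 0 < gauss1 x. Proof. exact: expR_gt0. Qed.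

Lemma measurable_gauss1 : measurable_fun setT gauss1.
Proof. exact: L1_measurable L1_gauss1. Qed.

Lemma norm_mul_gauss1 x : `|x| * gauss1 x <= expR (- (4^-1 * x ^+ 2)).
Proof.
have -> : gauss1 x = expR (- (4^-1 * x ^+ 2)) * expR (- (4^-1 * x ^+ 2)).
  by rewrite -expRD; congr expR; field.
rewrite mulrA ler_piMl ?expR_ge0// -[expR _]invrK -expRN opprK ler_pdivrMr ?expR_gt0// mul1r.
apply: le_trans (expR_ge1Dx _); rewrite -real_normK ?num_real//.
have := sqr_ge0 (`|x| / 2 - 1); lra.
Qed.

Lemma L1_restrict (f : R -> R) (a b : R) : L1 leb f ->
  Rintegral leb `[a, b] f = I[leb] (fun x => f x * \1_`[a, b] x).
Proof.
move=> hf; rewrite Rintegral_mkcond; apply: I_ext => x.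
by rewrite patchE indicE; case: ifPn; rewrite ?mulr1 ?mulr0.
Qed.

(** The fundamental theorem on [[-n, n]] followed by dominated convergence; it stands in for
    integration by parts on the line. *)
Lemma I_derivative_eq0 (h h' : R -> R) :
  (forall x : R, is_derive x (1 : R) h (h' x)) -> continuous h' -> L1 leb h' ->
  h n%:R @[n --> \oo] --> (0 : R) -> h (- n%:R) @[n --> \oo] --> (0 : R) ->
  I[leb] h' = 0.
Proof.
move=> dh ch hh h1 h2.
have E n : I[leb] (fun x => h' x * \1_`[- n%:R, n%:R] x) = h n%:R - h (- n%:R).
  by rewrite -L1_restrict// (@FTC_R h)// (@le_trans _ _ 0)// oppr_le0.
have H : h n%:R - h (- n%:R) @[n --> \oo] --> I[leb] h'.
  rewrite -(funext E); apply: (I_dct (m := leb) _ (L1_norm hh) _ _).2.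
  - move=> n; apply: measurable_funM; first exact: L1_measurable hh.
    exact: measurable_indic.
  - by move=> n x; rewrite normrM ler_piMr// ger0_norm// indicE lern1 leq_b1.
  - move=> x; apply: cvg_near_cst; near=> n.
    rewrite indicE mem_set ?mulr1//= in_itv/= -ler_norml.
    by near: n; exact: nbhs_infty_ger.
apply/esym/(cvg_unique _ _ H) => //.
by have := cvgB h1 h2; rewrite subr0; apply.
Unshelve. all: by end_near. Qed.

Lemma cvg_gauss1_mul (b : nat -> R) : (forall n, `|b n| <= 1) ->
  gauss1 n%:R * b n @[n --> \oo] --> (0 : R).
Proof.
move=> b1; apply: norm_cvg0.
have H : 2 * harmonic n @[n --> \oo] --> (0 : R).
  by have := cvgM (cvg_cst (2 : R)) (@cvg_harmonic R); rewrite mulr0; apply.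
apply: (squeeze_cvgr _ (@cvg_cst _ _ _ _ _) H).
apply: nearW => n; rewrite normr_ge0/= normrM (ger0_norm (ltW (gauss1_gt0 _))).
apply: (@le_trans _ _ (gauss1 n%:R)); first by rewrite ler_piMr// ltW// gauss1_gt0.
rewrite /harmonic/= ler_pdivlMr// /gauss1 mulNr expRN ler_pdivrMl ?expR_gt0//.
have := expR_ge1Dx (n%:R ^+ 2 / 2 : R); have := sqr_ge0 (n%:R - 1 : R).
have := ler0n R n; rewrite -[n.+1%:R]natr1; lra.
Qed.

Section fourier.
Variable th : R.
Let f (xi x : R) := gauss1 x * cos (th + x * xi).
Let F xi := I[leb] (f xi).

Let f_le xi x : `|f xi x| <= gauss1 x.
Proof.
by rewrite normrM (ger0_norm (ltW (gauss1_gt0 _))) ler_piMr ?cos_max// ltW ?gauss1_gt0.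
Qed.

Let df (x xi : R) : is_derive xi (1 : R) (f ^~ x) (gauss1 x * (- (x * sin (th + x * xi)))).
Proof. by apply: is_derive_eq; rewrite /GRing.scale/=; ring. Qed.

Let cf xi : continuous (f xi).
Proof.
move=> x; apply: differentiable_continuous; apply/derivable1_diffP.
exact: ex_derive.
Qed.

Let Lf xi : L1 leb (f xi).
Proof.
apply: (L1_le (m := leb) (g := gauss1)) (L1_gauss1) => //.
exact: continuous_measurable_fun (@cf xi).
Qed.

Let g (xi x : R) := gauss1 x * (x * sin (th + x * xi)).

Let cg xi : continuous (g xi).
Proof.
move=> x; apply: differentiable_continuous; apply/derivable1_diffP.
exact: ex_derive.
Qed.

Let g_le xi x : `|g xi x| <= expR (- (4^-1 * x ^+ 2)).
Proof.
apply: le_trans (norm_mul_gauss1 x).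
rewrite 2!normrM mulrCA (ger0_norm (ltW (gauss1_gt0 _))) mulrA.
by rewrite ler_piMr ?sin_max// mulr_ge0// ltW ?gauss1_gt0.
Qed.

Let Lg xi : L1 leb (g xi).
Proof.
apply: (L1_le (m := leb) (g := fun x => expR (- (4^-1 * x ^+ 2)))) => //.
  exact: continuous_measurable_fun (@cg xi).
exact: L1_expR_sqr.
Qed.

(** Integration by parts: [gauss1 x * sin (th + x * xi)] vanishes at infinity and has derivative
    [xi * f xi x - g xi x]. *)
Let gF xi : I[leb] (g xi) = xi * F xi.
Proof.
have H : I[leb] (fun x => xi * f xi x - g xi x) = 0.
  apply: (@I_derivative_eq0 (fun x => gauss1 x * sin (th + x * xi))).
  - move=> x; rewrite /f /g /gauss1; apply: is_derive_eq.
    by rewrite /GRing.scale/=; field.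
  - move=> x; apply: cvgB; last exact: cg.
    by apply: cvgMr; exact: cf.
  - by apply: L1B => //; exact: L1Z.
  - by apply: cvg_gauss1_mul => n; exact: sin_max.
  - rewrite (_ : (fun n => _) = fun n => gauss1 n%:R * sin (th + - n%:R * xi)).
      by apply: cvg_gauss1_mul => n; exact: sin_max.
    by apply/funext => n; rewrite /gauss1 sqrrN.
by move: H; rewrite I_B ?I_Z//; [move/eqP; rewrite subr_eq0 => /eqP ->|exact: L1Z].
Qed.

Let dF xi : is_derive xi (1 : R) F (- (xi * F xi)).
Proof.
have Hle x y : setT y -> `|partial1of2 f x y| <= expR (- (4^-1 * y ^+ 2)).
  move=> _; rewrite partial1of2E (@derive_val _ _ _ _ _ _ _ (df y x)) mulrN normrN.
  exact: g_le.
have xi1 : `]xi - 1, xi + 1[%classic xi by rewrite /= in_itv/=; lra.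
have H1 := @derivable_under_integral R _ _ leb f setT measurableT xi _ _ xi1
  (fun x _ => Lf x) (fun x y _ _ => @ex_derive _ _ _ _ _ _ _ (df y x))
  (fun y => expR (- (4^-1 * y ^+ 2))) (fun y => expR_ge0 _)
  (@L1_expR_sqr 4^-1 _) (fun x y _ => Hle x y).
have H2 := @differentiation_under_integral R _ _ leb f setT measurableT xi _ _ xi1
  (fun x _ => Lf x) (fun x y _ _ => @ex_derive _ _ _ _ _ _ _ (df y x))
  (fun y => expR (- (4^-1 * y ^+ 2))) (fun y => expR_ge0 _)
  (@L1_expR_sqr 4^-1 _) (fun x y _ => Hle x y).
apply: DeriveDef; first exact: H1.
rewrite -derive1E [LHS]H2// -gF -mulN1r -I_Z//.
apply: I_ext => y; rewrite [LHS]derive1E (@derive_val _ _ _ _ _ _ _ (df y xi)).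
by rewrite /g mulrN mulN1r.
Qed.

(** Since [F' = - xi F], the product [F xi * exp (xi^2 / 2)] is constant. The phase [th] collects
    the contribution of the other coordinates when the dimension is raised. *)
Lemma gauss1_fourier xi :
  I[leb] (fun x => gauss1 x * cos (th + x * xi)) =
  I[leb] gauss1 * cos th * gauss1 xi.
Proof.
have E : F xi * expR (xi ^+ 2 / 2) = F 0 * expR (0 ^+ 2 / 2).
  apply: (@is_derive_0_is_cst _ (fun x => F x * expR (x ^+ 2 / 2))) => x.
  have d2 : is_derive x (1 : R) (fun x : R => expR (x ^+ 2 / 2)) (x * expR (x ^+ 2 / 2)).
    by apply: is_derive_eq; rewrite /GRing.scale/=; field.
  apply: (is_derive_eq (is_deriveM (dF x) d2)).
  by rewrite /GRing.scale/=; ring.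
have F0 : F 0 = I[leb] gauss1 * cos th.
  rewrite -I_Zr; last exact: L1_gauss1.
  by apply: I_ext => x; rewrite /f mulr0 addr0.
move: E; rewrite expr0n/= mul0r expR0 mulr1 F0 => <-.
by rewrite -/(F xi) /gauss1 mulNr expRN mulfK// gt_eqF// expR_gt0.
Qed.

End fourier.
End one_dimension.

Section gaussian.
Context {R : realType} {n : nat}.
Notation V := (n.-tuple R).

Definition gauss (x : V) := expR (- vdot x x / 2).

Lemma vdot_ge0 (x : V) : 0 <= vdot x x.
Proof. by apply: sumr_ge0 => i _; rewrite -expr2 sqr_ge0. Qed.

Lemma sqr_vnorm (x : V) : vnorm x ^+ 2 = vdot x x.
Proof.
rewrite sqr_sqrtr; last by apply: sumr_ge0 => i _; rewrite sqr_ge0.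
by apply: eq_bigr => i _; rewrite expr2.
Qed.

Lemma gauss_gt0 x : 0 < gauss x. Proof. exact: expR_gt0. Qed.

Lemma gauss_ge0 x : 0 <= gauss x. Proof. exact: expR_ge0. Qed.

Lemma gauss_le1 x : gauss x <= 1.
Proof. by rewrite -expR0 ler_expR mulNr oppr_le0 divr_ge0// vdot_ge0. Qed.

Lemma measurable_gauss : measurable_fun setT gauss.
Proof.
apply: measurableT_comp => //; apply: measurable_funM => //.
by apply: measurableT_comp => //; exact: measurable_fun_vdot.
Qed.

Lemma measurable_cos_vdot (th : R) (xi : V) :
  measurable_fun setT (fun x : V => cos (th + vdot x xi)).
Proof.
apply: (measurableT_comp (continuous_measurable_fun (@continuous_cos R))).
by apply: measurable_funD => //; exact: measurable_fun_vdot.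
Qed.

Section transfer.
Variables m1 m2 : {measure set V -> \bar R}.
Hypotheses (l1 : is_lebesgue m1) (l2 : is_lebesgue m2).

Lemma lebesgue_unique A : measurable A -> m1 A = m2 A.
Proof.
apply: eq_measure_box => [a b ab|k].
  by rewrite /box l1// l2.
by rewrite lebesgue_cube// ltry.
Qed.

Lemma integral_lebesgue_unique (f : V -> \bar R) :
  (\int[m1]_x f x = \int[m2]_x f x)%E.
Proof. by apply: eq_measure_integral => A mA _; exact: lebesgue_unique. Qed.

Lemma L1_lebesgue_unique f : L1 m1 f -> L1 m2 f.
Proof.
move=> hf; apply: L1P (L1_measurable hf) _.
by rewrite -integral_lebesgue_unique; exact: L1_lty hf.
Qed.

Lemma I_lebesgue_unique f : I[m1] f = I[m2] f.
Proof. by rewrite /Rintegral integral_lebesgue_unique. Qed.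

End transfer.

(** The free phase [th] makes the property pass from dimension [n] to [n + 1]. The number [I[m]
    gauss], classically [(2 pi)^(n/2)], is carried along as an unevaluated positive constant. *)
Definition gauss_fourier_spec (m : {measure set V -> \bar R}) :=
  [/\ is_lebesgue m, L1 m gauss, 0 < I[m] gauss &
    forall th xi, I[m] (fun x => gauss x * cos (th + vdot x xi)) =
      I[m] gauss * cos th * gauss xi].

End gaussian.

Section cons.
Context {R : realType} {n : nat}.
Notation V := (n.-tuple R).
Notation leb := (leb R).

Definition vcons (z : measurableTypeR R * V) : n.+1.-tuple R := [tuple of z.1 :: z.2].

Lemma tnth_tail (a : n.+1.-tuple R) i :
  tnth [tuple of behead a] i = tnth a (lift ord0 i).
Proof.
by rewrite tnth_behead; congr tnth; apply/val_inj; rewrite /= inordK// ltnS.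
Qed.

Lemma measurable_vcons : measurable_fun setT vcons.
Proof.
apply/measurable_fun_tnthP => i.
have [j ->|->] := unliftP ord0 i.
  rewrite (_ : _ \o _ = fun z => tnth z.2 j); last first.
    by apply/funext => z /=; rewrite tnthS.
  by apply: (measurableT_comp (measurable_tnth j)).
by rewrite (_ : _ \o _ = fst)//; exact: measurable_fst.
Qed.

Lemma vdot_vcons z (xi : n.+1.-tuple R) :
  vdot (vcons z) xi = z.1 * thead xi + vdot z.2 [tuple of behead xi].
Proof.
rewrite /vdot big_ord_recl; congr (_ * _ + _).
by apply: eq_bigr => i _; rewrite tnthS tnth_tail.
Qed.

Lemma gauss_vcons z : gauss (vcons z) = gauss1 z.1 * gauss z.2.
Proof.
rewrite /gauss /gauss1 vdot_vcons -expRD; congr expR.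
rewrite (_ : [tuple of behead (vcons z)] = z.2); last exact/val_inj.
by rewrite /thead/= (_ : tnth (vcons z) ord0 = z.1)//; field.
Qed.

End cons.

Section existence.
Context {R : realType}.
Notation leb := (leb R).

(** In dimension 0 the space is a point and the empty product of side lengths is 1, so Lebesgue
    measure is the Dirac mass. *)
Lemma gauss_fourier_spec0 :
  exists m : {sigma_finite_measure set (0.-tuple R) -> \bar R}, gauss_fourier_spec m.
Proof.
pose o : 0.-tuple R := [tuple].
have E (x : 0.-tuple R) : x = o by apply/val_inj; case: x => -[].
have v0 (x y : 0.-tuple R) : vdot x y = 0 by rewrite /vdot big_ord0.
have g1 : @gauss R 0 = cst 1 by apply/funext => x; rewrite /gauss v0 oppr0 mul0r expR0.
pose m : {measure set (0.-tuple R) -> \bar R} := \d_ o.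
have lm : is_lebesgue m.
  move=> a b _; rewrite big_ord0 /m /= diracE mem_set//.
  by case.
have [m' m'E] := sigma_finite_pack (lebesgue_sigma_finite lm).
have Im (f : 0.-tuple R -> R) : measurable_fun setT f ->
    (\int[m]_x (f x)%:E = (f o)%:E)%E.
  move=> /measurable_EFinP mf.
  by rewrite integral_dirac// [X in (X * _)%E]diracT mul1e.
have mg := @measurable_gauss R 0.
exists m'; rewrite m'E; split => //.
- apply: L1P => //; rewrite (Im (fun x => `|gauss x|)) ?ltry//.
  exact: measurableT_comp.
- by rewrite /Rintegral Im//= gauss_gt0.
- move=> th xi; rewrite /Rintegral (Im (fun x => gauss x * _)); last first.
    by apply: measurable_funM => //; exact: measurable_cos_vdot.
  rewrite Im//= v0 addr0 g1 /cst; ring.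
Qed.

Section step.
Context {n : nat}.
Notation V := (n.-tuple R).
Variable m : {sigma_finite_measure set V -> \bar R}.
Hypothesis hm : gauss_fourier_spec m.

Let P := (leb \x m)%E.

Let ge0_vcons (F : n.+1.-tuple R -> \bar R) : measurable_fun setT F ->
  (forall x, (0 <= F x)%E) ->
  (\int[pushforward P vcons]_x F x = \int[P]_z F (vcons z))%E.
Proof.
move=> mF F0; rewrite ge0_integral_pushforward//; exact: measurable_vcons.
Qed.

(** The measure is built as the image of a product measure under [vcons], so that Fubini in the
    first coordinate is available; a measure known only on boxes comes with no such
    decomposition. *)
Lemma gauss_fourier_specS :
  exists m' : {sigma_finite_measure set (n.+1.-tuple R) -> \bar R},
    gauss_fourier_spec m'.
Proof.
have [lm Lg g0 Ig] := hm.
pose N : {measure set (n.+1.-tuple R) -> \bar R} :=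
  measure_function_pushforward__canonical__measure_function_Measure P measurable_vcons.
have lN : is_lebesgue N.
  move=> a b ab.
  rewrite (_ : N _ = P (`[tnth a ord0, tnth b ord0] `*`
     [set x | forall i, tnth [tuple of behead a] i <= tnth x i <= tnth [tuple of behead b] i])).
    rewrite /P product_measure1E//; last exact: measurable_box.
    rewrite lm; last by move=> i; rewrite !tnth_tail.
    rewrite [X in (X * _)%E](lebesgue_measure_itv `[tnth a ord0, tnth b ord0])/=.
    rewrite big_ord_recl EFinM.
    congr (_ * _)%E.
      rewrite lte_fin; case: ltgtP (ab ord0) => // -> _.
      by rewrite subrr.
    by congr EFin; apply: eq_bigr => i _; rewrite !tnth_tail.
  rewrite /N/= /pushforward; congr (P _); apply/seteqP; split => -[x v] /= h.
    split; first by rewrite in_itv/=; have := h ord0.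
    by move=> i; have := h (lift ord0 i); rewrite tnthS !tnth_tail.
  move: h => [+ h] i; rewrite in_itv/= => xab.
  have [j ->|->//] := unliftP ord0 i.
  by have := h j; rewrite tnthS !tnth_tail.
have [m' m'E] := sigma_finite_pack (lebesgue_sigma_finite lN).
exists m'; rewrite m'E.
pose G (z : measurableTypeR R * V) := gauss1 z.1 * gauss z.2.
have mG : measurable_fun setT G.
  apply: measurable_funM.
    by apply: (measurableT_comp measurable_gauss1).
  by apply: (measurableT_comp measurable_gauss).
have G0 z : 0 <= G z by apply: mulr_ge0; [exact/ltW/gauss1_gt0|exact: gauss_ge0].
have LG : L1 P G.
  apply: (@L1_prod _ _ _ _ _ leb m G (fun x => gauss1 x * I[m] gauss)) => //.
    by apply: L1_ext (L1Z (I[m] gauss) L1_gauss1) => x; rewrite mulrC.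
  move=> x; rewrite EFinM L1_EFin//.
  rewrite -ge0_integralZl//=; last 3 first.
  - by apply/measurable_EFinP; exact: measurable_gauss.
  - by move=> y _; rewrite lee_fin gauss_ge0.
  - by rewrite lee_fin ltW// gauss1_gt0.
  apply: ge0_le_integral => //=.
  - apply/measurable_EFinP; apply: (measurableT_comp (@normr_measurable _ _)).
    exact: measurable_sec1 mG.
  - by apply/measurable_EFinP; apply: measurable_funM => //; exact: measurable_gauss.
  by move=> y _; rewrite ger0_norm ?G0.
have IN f : L1 N f -> I[N] f = I[P] (fun z => f (vcons z)).
  move=> hf; rewrite /Rintegral; congr fine.
  have hf' := hf; have /measurable_EFinP mf := L1_measurable hf.
  rewrite integral_pushforward//; first exact: measurable_vcons.
  apply: L1P; first by apply: measurableT_comp measurable_vcons; exact: L1_measurable hf.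
  have mnf : measurable_fun setT (fun x => (`|f x|)%:E).
    by apply/measurable_EFinP; apply: measurableT_comp => //; exact: L1_measurable hf.
  by rewrite -(@ge0_vcons (fun x => (`|f x|)%:E))//; exact: L1_lty hf.
have LN f : measurable_fun setT f -> L1 P (fun z => f (vcons z)) -> L1 N f.
  move=> mf hf; apply: L1P => //.
  rewrite (@ge0_vcons (fun x => (`|f x|)%:E))//; first exact: L1_lty hf.
  by apply/measurable_EFinP; exact: measurableT_comp.
have LNg : L1 N gauss.
  apply: LN; first exact: measurable_gauss.
  by apply: L1_ext LG => z; rewrite gauss_vcons.
(* Integrating the last [n] coordinates first, with the phase [th + x * thead xi], leaves a
   one-dimensional transform with phase [th]. *)
have key th xi : I[N] (fun x => gauss x * cos (th + vdot x xi)) =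
    I[leb] gauss1 * I[m] gauss * cos th * gauss xi.
  have Lc : L1 N (fun x => gauss x * cos (th + vdot x xi)).
    apply: (L1_ext (f := fun x => cos (th + vdot x xi) * gauss x)).
      by move=> x; rewrite mulrC.
    apply: L1M LNg; first exact: measurable_cos_vdot.
    by move=> x; exact: cos_max.
  rewrite IN//.
  pose h (z : measurableTypeR R * V) := gauss1 z.1 * (gauss z.2 *
    cos (th + z.1 * thead xi + vdot z.2 [tuple of behead xi])).
  have hE z : gauss (vcons z) * cos (th + vdot (vcons z) xi) = h z.
    by rewrite gauss_vcons vdot_vcons /h mulrA addrA.
  rewrite (I_ext _ hE).
  have Lh : L1 P h.
    apply: (L1_le (g := G)) LG.
      by rewrite -(funext hE); exact: (measurableT_comp (L1_measurable Lc) measurable_vcons).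
    move=> z; rewrite /h mulrA normrM -/(G z) (ger0_norm (G0 z)).
    by rewrite ler_piMr ?cos_max ?G0.
  rewrite -(I_prod1 Lh).2 /h/=.
  rewrite (I_ext leb (g := fun x => (gauss1 x * cos (th + x * thead xi)) *
    (I[m] gauss * gauss [tuple of behead xi]))); last first.
    move=> x; rewrite I_Z; first by rewrite Ig; ring.
    apply: (L1_ext (f := fun v => cos (th + x * thead xi + vdot v [tuple of behead xi]) * gauss v)).
      by move=> v; rewrite mulrC.
    apply: L1M Lg; first exact: measurable_cos_vdot.
    by move=> v; exact: cos_max.
  rewrite I_Zr; last first.
    apply: (L1_ext (m := leb) (f := fun x => cos (th + x * thead xi) * gauss1 x)).
      by move=> v; rewrite mulrC.
    apply: L1M L1_gauss1; last by move=> v; exact: cos_max.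
    apply: (measurableT_comp (continuous_measurable_fun (@continuous_cos R))).
    by apply: measurable_funD => //; exact: measurable_funM.
  rewrite gauss1_fourier.
  have -> : gauss xi = gauss1 (thead xi) * gauss [tuple of behead xi].
    have {1}-> : xi = vcons (thead xi, [tuple of behead xi]).
      by rewrite [LHS]tuple_eta; exact/val_inj.
    by rewrite gauss_vcons.
  ring.
have gE : I[N] gauss = I[leb] gauss1 * I[m] gauss.
  have := key 0 [tuple 0 | _ < n.+1].
  have v0 x : vdot x [tuple 0 | _ < n.+1] = 0 :> R.
    by apply: big1 => i _; rewrite tnth_mktuple mulr0.
  have -> : gauss [tuple 0 | _ < n.+1] = 1 :> R.
    by rewrite /gauss v0 oppr0 mul0r expR0.
  rewrite cos0 !mulr1 => <-.
  by apply: I_ext => x; rewrite v0 addr0 cos0 mulr1.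
split => //.
- by rewrite gE mulr_gt0// I_gauss1_gt0.
- by move=> th xi; rewrite key gE.
Qed.
End step.

Lemma exists_gauss_fourier n : exists m : {sigma_finite_measure set (n.-tuple R) -> \bar R},
  gauss_fourier_spec m.
Proof.
elim: n => [|n [m hm]]; first exact: gauss_fourier_spec0.
exact: gauss_fourier_specS hm.
Qed.

(** Two measures satisfying [is_lebesgue] coincide, so the transform computed for the constructed
    one is that for [m]. *)
Lemma gauss_fourier n (m : {measure set (n.-tuple R) -> \bar R}) :
  is_lebesgue m -> gauss_fourier_spec m.
Proof.
move=> lm; have [m' [lm' Lg g0 Ig]] := exists_gauss_fourier n.
split => //.
- exact: L1_lebesgue_unique lm' lm _ Lg.
- by rewrite (I_lebesgue_unique lm lm').
- by move=> th xi; rewrite !(I_lebesgue_unique lm lm').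
Qed.

End existence.

(** * Translations in L1 *)

Section fatou.
Context d (T : measurableType d) (R : realType) (m : {measure set T -> \bar R}).

Lemma L1_fatou (f_ : nat -> T -> R) (f : T -> R) C :
  (forall n, L1 m (f_ n)) -> (forall n x, 0 <= f_ n x) ->
  (forall n, I[m] (f_ n) <= C) -> (forall x, f_ n x @[n --> \oo] --> f x) ->
  L1 m f /\ I[m] f <= C.
Proof.
move=> hf f0 fC cf.
have mf : measurable_fun setT f.
  by apply: (measurable_fun_cvg (fun n => L1_measurable (hf n))) => x _; exact: cf.
have f_ge0 x : 0 <= f x by apply: (cvgr_to_ge (cf x)); exact: nearW.
apply: L1_bound => //.
have mf' n : measurable_fun setT (fun x => (f_ n x)%:E).
  by apply/measurable_EFinP; exact: L1_measurable (hf n).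
have f0' n x : setT x -> (0 <= (f_ n x)%:E)%E by rewrite lee_fin.
have := fatou m measurableT mf' f0'.
rewrite (_ : (fun x => limn_einf _) = fun x => (f x)%:E); last first.
  apply/funext => x; have h : (f_ n x)%:E @[n --> \oo] --> (f x)%:E.
    by apply: cvg_EFin; [exact: nearW|exact: cf].
  by rewrite (is_cvg_limn_einfE (cvgP _ h)); exact: cvg_lim h.
move=> /le_trans; apply.
rewrite limn_einf_lim; apply: lime_le; first exact: is_cvg_einfs.
apply: nearW => n; apply: (@le_trans _ _ (\int[m]_x (f_ n x)%:E)%E).
  by apply: ereal_inf_lbound; exists n => //=.
by rewrite -L1_EFin// lee_fin.
Qed.

End fatou.

Section real_sequences.
Context {R : realType}.
Implicit Types (u v : nat -> R) (a b c : R).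

Lemma cvgnD u v a b : u k @[k --> \oo] --> a -> v k @[k --> \oo] --> b ->
  u k + v k @[k --> \oo] --> a + b.
Proof. by move=> ua vb; exact: (cvgD ua vb). Qed.

Lemma cvgnB u v a b : u k @[k --> \oo] --> a -> v k @[k --> \oo] --> b ->
  u k - v k @[k --> \oo] --> a - b.
Proof. by move=> ua vb; exact: (cvgB ua vb). Qed.

Lemma cvgnM u v a b : u k @[k --> \oo] --> a -> v k @[k --> \oo] --> b ->
  u k * v k @[k --> \oo] --> a * b.
Proof. by move=> ua vb; exact: (cvgM ua vb). Qed.

Lemma cvgnZ c u a : u k @[k --> \oo] --> a -> c * u k @[k --> \oo] --> c * a.
Proof. by apply: cvgnM; exact: cvg_cst. Qed.

Lemma cvgn_norm u a : u k @[k --> \oo] --> a -> `|u k| @[k --> \oo] --> `|a|.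
Proof. by move=> ua; exact: (cvg_norm ua). Qed.

Lemma cvgn_cst c : c @[k --> \oo] --> c.
Proof. exact: cvg_cst. Qed.

End real_sequences.
Arguments cvgnZ {R} c {u a} _.
Arguments cvgn_cst {R} c.

Lemma squeeze_cvg0 (R : realType) (u v : nat -> R) :
  (forall k, 0 <= u k <= v k) -> v k @[k --> \oo] --> (0 : R) ->
  u k @[k --> \oo] --> (0 : R).
Proof.
move=> uv v0; apply: (squeeze_cvgr _ (@cvg_cst _ _ _ _ _) v0).
by apply: nearW => k; exact: uv.
Qed.

Lemma cvg_prod_ord (R : realType) n (u : nat -> 'I_n -> R) (l : 'I_n -> R) :
  (forall i, u k i @[k --> \oo] --> l i) ->
  \prod_(i < n) u k i @[k --> \oo] --> \prod_(i < n) l i.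
Proof.
move=> h; apply: (cvg_big (U := R)) => // x; apply: cvgM; [exact: cvg_fst|exact: cvg_snd].
Qed.

(** * Translations of boxes *)

Section translation.
Context {R : realType} {n : nat}.
Notation V := (n.-tuple R).
Variable m : {measure set V -> \bar R}.
Hypothesis lm : is_lebesgue m.

Lemma vscale1 (x : V) : vscale 1 x = x.
Proof. by apply: eq_tnthP => i; rewrite tnth_vscale mul1r. Qed.

Lemma L1_shift f y : L1 m f -> L1 m (fun x => f (vsub x y)).
Proof.
move=> hf; have := L1_affine lm y (oner_neq0 R) hf.
by apply: L1_ext => x; rewrite /affine vscale1.
Qed.

Lemma I_shift f y : L1 m f -> I[m] (fun x => f (vsub x y)) = I[m] f.
Proof.
move=> hf; have := I_affine lm y (oner_neq0 R) hf.
rewrite normr1 expr1n invr1 mul1r => <-.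
by apply: I_ext => x; rewrite /affine vscale1.
Qed.

Definition shift_dist (f : V -> R) (y : V) := I[m] (fun x => `|f (vsub x y) - f x|).

Lemma L1_shift_dist f y : L1 m f -> L1 m (fun x => `|f (vsub x y) - f x|).
Proof. by move=> hf; apply: L1_norm; apply: L1B => //; exact: L1_shift. Qed.

Lemma shift_dist_ge0 f y : 0 <= shift_dist f y.
Proof. exact: I_ge0. Qed.

(** Continuity is recorded only along the sequences [y / (k+1)]: the average over [y] taken later,
    by dominated convergence, uses shifts [eta y] with [eta = 1 / (k+1)]. *)
Definition shift_cts (f : V -> R) :=
  L1 m f /\ forall y, shift_dist f (vscale k.+1%:R^-1 y) @[k --> \oo] --> (0 : R).

Lemma shift_distD f g y : L1 m f -> L1 m g ->
  shift_dist (fun x => f x + g x) y <= shift_dist f y + shift_dist g y.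
Proof.
move=> hf hg; rewrite /shift_dist -I_D; [|exact: L1_shift_dist..].
apply: I_le.
- by apply: (L1_shift_dist (f := fun x => f x + g x)); exact: L1D.
- by apply: L1D; exact: L1_shift_dist.
- by move=> x; rewrite opprD addrACA ler_normD.
Qed.

Lemma shift_ctsD f g : shift_cts f -> shift_cts g -> shift_cts (fun x => f x + g x).
Proof.
move=> [hf cf] [hg cg]; split; first exact: L1D.
move=> y; have H := cvgnD (cf y) (cg y); rewrite addr0 in H.
apply: squeeze_cvg0 H => k; rewrite shift_dist_ge0/=; exact: shift_distD.
Qed.

Lemma shift_ctsZ c f : shift_cts f -> shift_cts (fun x => c * f x).
Proof.
move=> [hf cf]; split; first exact: L1Z.
move=> y; have := cvgnZ `|c| (cf y); rewrite mulr0.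
rewrite (_ : (fun k => `|c| * _) = fun k => shift_dist (fun x => c * f x) (vscale k.+1%:R^-1 y))//.
apply/funext => k; rewrite /shift_dist -I_Z; last exact: L1_shift_dist.
by apply: I_ext => x; rewrite -mulrBr normrM.
Qed.

Lemma shift_cts0 : shift_cts (fun=> 0).
Proof.
split; first exact: L10.
move=> y; rewrite (_ : (fun k => _) = cst 0); first exact: cvg_cst.
apply/funext => k; rewrite /shift_dist -[RHS](I_0 m).
by apply: I_ext => x; rewrite subrr normr0.
Qed.

Lemma shift_ctsB f g : shift_cts f -> shift_cts g -> shift_cts (fun x => f x - g x).
Proof.
move=> hf hg; have := shift_ctsD hf (shift_ctsZ (-1) hg).
by congr shift_cts; apply/funext => x; rewrite mulN1r.
Qed.

(** Translations are isometries of L1, so replacing [f] by [g] changes the translation distance by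
    at most twice the L1 distance of [f] and [g]. *)
Lemma shift_cts_lim f : L1 m f ->
  (forall e, 0 < e -> exists2 g, shift_cts g & I[m] (fun x => `|f x - g x|) <= e) ->
  shift_cts f.
Proof.
move=> hf H; split => // y; apply/cvgrPdist_le => e e0.
have e4 : 0 < e / 4 by rewrite divr_gt0.
have [g [hg cg] fg] := H _ e4.
have hfg : L1 m (fun x => f x - g x) by exact: L1B.
have /cvgrPdist_le/(_ _ e4) := cg y; apply: filterS => k.
set h := vscale _ _; rewrite !sub0r !normrN !ger0_norm ?shift_dist_ge0// => gh.
have : shift_dist f h <= shift_dist (fun x => f x - g x) h + shift_dist g h.
  have fE : (fun x => (f x - g x) + g x) = f by apply/funext => x; rewrite subrK.
  by have := shift_distD h hfg hg; rewrite fE.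
have : shift_dist (fun x => f x - g x) h <= 2 * (e / 4).
  apply: (@le_trans _ _ (2 * I[m] (fun x => `|f x - g x|))); last by rewrite ler_wpM2l.
  have hn := L1_norm hfg.
  rewrite mulr_natl mulr2n -{1}(I_shift h hn) -I_D//; last exact: L1_shift hn.
  apply: I_le; [exact: L1_shift_dist|by apply: L1D => //; exact: L1_shift hn|].
  by move=> x; rewrite (le_trans (ler_normB _ _)).
lra.
Qed.

Lemma L1_indic A : measurable A -> (m A < +oo)%E -> L1 m \1_A.
Proof.
move=> mA fA; apply: L1P; first exact: measurable_indic.
rewrite (_ : (fun x => _) = fun x => (\1_A x)%:E).
  by rewrite integral_indic// setIT.
by apply/funext => x; rewrite ger0_norm.
Qed.

Lemma I_indic A : measurable A -> I[m] \1_A = fine (m A).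
Proof. by move=> mA; rewrite /Rintegral integral_indic// setIT. Qed.

Lemma measure_box_lty a b : (m (box a b) < +oo)%E.
Proof.
have [ab|/box_empty ->] := pselect (forall i, tnth a i <= tnth b i).
  by rewrite /box lm// ltry.
by rewrite measure0.
Qed.

Lemma shift_cts_box a b : shift_cts \1_(box a b).
Proof.
have L a' b' : L1 m \1_(box a' b').
  by apply: L1_indic; [exact: measurable_box|exact: measure_box_lty].
split; first exact: L.
have [ab|/box_empty ->] := pselect (forall i, tnth a i <= tnth b i); last first.
  rewrite (_ : \1_set0 = (fun=> 0)); first exact: shift_cts0.2.
  by apply/funext => x; rewrite indicE in_set0.
move=> y.
pose hk k i := tnth (vscale k.+1%:R^-1 y) i.
have hk0 i : hk k i @[k --> \oo] --> (0 : R).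
  have := cvgnZ (tnth y i) (@cvg_harmonic R); rewrite mulr0.
  rewrite (_ : (fun k => tnth y i * _) = hk^~ i)//.
  by apply/funext => k; rewrite /hk tnth_vscale mulrC.
pose c k := [tuple Num.max (tnth a i) (tnth a i + hk k i) | i < n].
pose d k := [tuple Num.min (tnth b i) (tnth b i + hk k i) | i < n].
(* A box meets its translate in a box, and the two have equal volume, so the distance is twice the
   volume lost in the intersection; continuity of the volume in the side lengths is then enough. *)
have E k : shift_dist \1_(box a b) (vscale k.+1%:R^-1 y) =
    2 * (I[m] \1_(box a b) - I[m] \1_(box (c k) (d k))).
  rewrite mulrBr {1}(mulr_natl _ 2) mulr2n -{1}(I_shift (vscale k.+1%:R^-1 y) (L a b)).
  rewrite -I_D//; last exact: L1_shift.
  rewrite -I_Z// -I_B; [|by apply: L1D => //; exact: L1_shift|exact: L1Z].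
  apply: I_ext => x; rewrite !indicE.
  have -> : (x \in box (c k) (d k)) = (x \in box a b) && (vsub x (vscale k.+1%:R^-1 y) \in box a b).
    apply/idP/andP => [/set_mem h|].
      split; apply/mem_set => i; have := h i; rewrite ?tnth_vsub !tnth_mktuple ge_max le_min.
        by move=> /andP[/andP[-> _] /andP[-> _]].
      rewrite -/(hk k i) => /andP[/andP[_ h1] /andP[_ h2]].
      move: h1 h2; rewrite /hk tnth_vscale.
      by move: (_ * tnth y i) => p h1 h2; apply/andP; split; lra.
    move=> [/set_mem h1 /set_mem h2]; apply/mem_set => i; have := h1 i; have := h2 i.
    rewrite tnth_vsub !tnth_mktuple ge_max le_min /hk ?tnth_vscale.
    move: (_ * tnth y i) => p /andP[h3 h4] /andP[h5 h6].
    by rewrite h5 h6/=; apply/andP; split; lra.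
  case: (x \in _); case: (_ \in _); rewrite ?normr1 ?subr0 ?subrr ?normr0 ?sub0r ?normrN ?normr1/=; lra.
rewrite (funext E).
(* A degenerate side is treated apart: there the side length [b_i - a_i - |h_i|] of the intersection
   could be negative for arbitrarily small shifts. *)
have [[i0 abi0]|abs] := pselect (exists i, tnth a i = tnth b i).
  have m0 : I[m] \1_(box a b) = 0.
    rewrite I_indic; last exact: measurable_box.
    by rewrite /box lm//= (bigD1 i0)//= abi0 subrr mul0r.
  have H k : 2 * (I[m] \1_(box a b) - I[m] \1_(box (c k) (d k))) = 0.
    apply/eqP; rewrite eq_le -{2}E shift_dist_ge0 andbT m0 sub0r.
    by rewrite mulrN oppr_le0 mulr_ge0// I_ge0.
  by rewrite (funext H); exact: cvg_cst.
have ab' i : tnth a i < tnth b i.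
  by rewrite lt_neqAle ab andbT; apply/eqP => h; apply: abs; exists i.
have P : \prod_(i < n) (tnth b i - tnth a i - `|hk k i|) @[k --> \oo] -->
    \prod_(i < n) (tnth b i - tnth a i).
  apply: cvg_prod_ord => i.
  have := cvgnB (cvgn_cst (tnth b i - tnth a i)) (cvgn_norm (hk0 i)).
  by rewrite normr0 subr0.
have Ib : I[m] \1_(box a b) = \prod_(i < n) (tnth b i - tnth a i).
  by rewrite I_indic; [rewrite /box lm|exact: measurable_box].
have Q : I[m] \1_(box (c k) (d k)) @[k --> \oo] --> I[m] \1_(box a b).
  rewrite Ib; apply: cvg_trans P; apply: near_eq_cvg.
  have small : \forall k \near \oo, forall i, `|hk k i| <= tnth b i - tnth a i.
    apply: filter_forall => i.
    have /cvgrPdist_le/(_ (tnth b i - tnth a i)) := hk0 i.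
    rewrite subr_gt0 => /(_ (ab' i)); apply: filterS => k.
    by rewrite sub0r normrN.
  apply: filterS small => k sk.
  have cd i : tnth (d k) i - tnth (c k) i = tnth b i - tnth a i - `|hk k i|.
    rewrite !tnth_mktuple; have [h|h] := leP 0 (hk k i).
      by rewrite max_r ?lerDl// min_l ?lerDl// ger0_norm//; ring.
    by rewrite max_l ?gerDl// 1?ltW// min_r ?gerDl 1?ltW// ltr0_norm//; ring.
  rewrite I_indic; last exact: measurable_box.
  rewrite /box lm/=; last by move=> i; rewrite -subr_ge0 cd subr_ge0.
  by apply: eq_bigr => i _; rewrite cd.
have := cvgnZ 2 (cvgnB (cvgn_cst (I[m] \1_(box a b))) Q).
by rewrite subrr mulr0.
Qed.

End translation.

(** * From boxes to integrable functions *)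

Section density.
Context {R : realType} {n : nat}.
Notation V := (n.-tuple R).
Variable m : {measure set V -> \bar R}.
Hypothesis lm : is_lebesgue m.

Notation C N := (cube (N%:R : R) : set V).

Lemma measurable_cube r : measurable (cube r : set V).
Proof. exact: measurable_box. Qed.

Lemma measure_cube_lty N : (m (C N) < +oo)%E.
Proof. exact: measure_box_lty. Qed.

Lemma L1_indic_cube N A : measurable A -> L1 m \1_(A `&` C N).
Proof.
move=> mA; have mAC : measurable (A `&` C N).
  by apply: measurableI => //; exact: measurable_cube.
apply: L1_indic => //; apply: le_lt_trans (measure_cube_lty N).
by apply: le_measure; rewrite ?inE//; exact: measurable_cube.
Qed.

(** A Dynkin class argument from boxes. Intersecting with a fixed cube keeps measures finite, so
    that complements and countable disjoint unions stay in L1. *)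
Lemma shift_cts_indic N A : measurable A -> shift_cts m \1_(A `&` C N).
Proof.
have mC := measurable_cube N%:R.
pose D := [set A : set V | measurable A /\ shift_cts m \1_(A `&` C N)].
pose boxes := [set A | exists a b : V, A = box a b].
suff dD : dynkin D.
  rewrite box_generates -(setI_closed_g_dynkin_g_sigma_algebra box_setI).
  move=> mA; have [] // : D A; apply: mA; split => // _ [a [b ->]].
  split; first exact: measurable_box.
  have [a' [b' ->]] : boxes (box a b `&` C N).
    by apply: box_setI; [exists a, b|exists [tuple - N%:R | _ < n], [tuple N%:R | _ < n]].
  exact: shift_cts_box.
split.
- split; first exact: measurableT.
  by rewrite setTI; exact: shift_cts_box.
- move=> B [mB cB]; split; first exact: measurableC.
  rewrite (_ : \1_(~` B `&` C N) = fun x => \1_(C N) x - \1_(B `&` C N) x).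
    by apply: shift_ctsB => //; exact: shift_cts_box.
  apply/funext => x; rewrite !indicE !in_setI in_setC.
  by case: (x \in B); case: (x \in C N) => /=; rewrite ?subr0 ?subrr.
- move=> F tF DF; have mF k : measurable (F k) := (DF k).1.
  split; first exact: bigcup_measurable.
  pose U k := \big[setU/set0]_(i < k) F i.
  have mU k : measurable (U k) by apply: bigsetU_measurable.
  have cU k : shift_cts m \1_(U k `&` C N).
    elim: k => [|k IH].
      rewrite /U big_ord0 set0I (_ : \1_set0 = (fun=> 0)); first exact: shift_cts0.
      by apply/funext => x; rewrite indicE in_set0.
    rewrite (_ : \1_(U k.+1 `&` C N) = fun x => \1_(U k `&` C N) x + \1_(F k `&` C N) x).
      by apply: shift_ctsD => //; exact: (DF k).2.
    apply/funext => x; rewrite !indicE !in_setI /U big_ord_recr/= in_setU.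
    case: (boolP (x \in F k)) => [/set_mem xk|_]; last first.
      by rewrite orbF/= addr0.
    have -> : (x \in \big[setU/set0]_(i < k) F i) = false.
      apply/negbTE/negP => /set_mem; rewrite -bigcup_mkord => -[i /= ik xi].
      have /trivIsetP/(_ i k I I) := tF; rewrite ltn_eqF// => /(_ isT) /seteqP[+ _].
      by move=> /(_ x); apply.
    by rewrite /= add0r.
  apply: shift_cts_lim => //; first by apply: L1_indic_cube; exact: bigcup_measurable.
  move=> e e0.
  pose f := \1_(\bigcup_k F k `&` C N) : V -> R.
  pose g k x : R := `|f x - \1_(U k `&` C N) x|.
  have [|||_] := @I_dct _ _ _ m g (fun=> 0) (\1_(setT `&` C N)) _ (L1_indic_cube N measurableT).
  + move=> k; apply: measurableT_comp => //; apply: measurable_funB.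
      by apply: measurable_indic; apply: measurableI => //; exact: bigcup_measurable.
    by apply: measurable_indic; apply: measurableI.
  + move=> k x; rewrite /g /f !indicE !in_setI in_setT normr_id.
    by case: (x \in C N); case: (x \in U k); case: (x \in \bigcup_k F k); rewrite /= ?subr0 ?sub0r ?subrr ?normrN ?normr1 ?normr0.
  + move=> x; apply: cvg_near_cst; have [xF|xF] := pselect ((\bigcup_k F k) x).
      move: (xF) => [i _ xi]; exists i.+1 => // k /= ik.
      rewrite /g /f !indicE !in_setI (mem_set xF).
      rewrite (_ : (x \in U k) = true) ?subrr ?normr0//.
      by apply/mem_set; rewrite /U -bigcup_mkord; exists i.
    apply: nearW => k; rewrite /g /f !indicE !in_setI (memNset xF)/=.
    rewrite (_ : (x \in U k) = false) ?subrr ?normr0//.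
    apply/negbTE/negP => /set_mem; rewrite /U -bigcup_mkord => -[i _ xi].
    by apply: xF; exists i.
  rewrite I_0 => /cvgrPdist_le/(_ e e0)[k _ /(_ k (leqnn k))].
  rewrite /= sub0r normrN ger0_norm; last by apply: I_ge0 => x; exact: normr_ge0.
  by move=> h; exists \1_(U k `&` C N).
Qed.

Import HBSimple.

(** Simple functions are dense in L1. The approximant is cut to a cube because its level set of
    value 0 may have infinite measure. *)
Lemma shift_cts_L1 f : L1 m f -> shift_cts m f.
Proof.
move=> hf; apply: shift_cts_lim => // e e0.
have mC N := measurable_cube N%:R.
pose fN N x := f x * \1_(C N) x.
have mfN N : measurable_fun setT (fN N).
  by apply: measurable_funM; [exact: L1_measurable hf|exact: measurable_indic].
have indic1 (A : set V) x : `|\1_A x| <= (1 : R).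
  by rewrite indicE ger0_norm// lern1 leq_b1.
have LfN N : L1 m (fN N).
  by apply: L1_le (L1_norm hf) => // x; rewrite normrM ler_piMr.
have e2 : 0 < e / 2 by rewrite divr_gt0.
have [|||_] := @I_dct _ _ _ m (fun N x => `|f x - fN N x|) (fun=> 0) (fun x => 2 * `|f x|) _ (L1Z 2 (L1_norm hf)).
- move=> N; apply: measurableT_comp => //; apply: measurable_funB => //.
  exact: L1_measurable hf.
- move=> N x; rewrite normr_id (le_trans (ler_normB _ _))// mulr_natl mulr2n.
  by rewrite lerD2l normrM ler_piMr.
- move=> x; apply: cvg_near_cst.
  have : [set: V] x by []; rewrite -bigcup_cube => -[i _ xi].
  exists i => // N /= iN; rewrite /fN indicE mem_set ?mulr1 ?subrr ?normr0//.
  by apply/cubeP => j; apply: le_trans ((cubeP _ _).1 xi j) _; rewrite ler_nat.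
rewrite I_0 => /cvgrPdist_le/(_ _ e2)[N _ /(_ N (leqnn N))].
rewrite /= sub0r normrN ger0_norm; last by apply: I_ge0 => x; exact: normr_ge0.
move=> hN.
have [g_ [Lg _ cg]] := approximation_sfun_integrable measurableT hf.
have /fine_cvgP[_ /cvgrPdist_le/(_ _ e2)[k _ /(_ k (leqnn k))]] := cg.
rewrite /= sub0r normrN => hk.
have {}Lg : L1 m (g_ k) by exact: Lg.
have {}hk : I[m] (fun x => `|f x - g_ k x|) <= e / 2.
  by apply: le_trans hk; exact: ler_norm.
pose g x := g_ k x * \1_(C N) x.
have Lg' : L1 m g.
  apply: L1_le (L1_norm Lg); last by move=> x; rewrite normrM ler_piMr.
  by apply: measurable_funM; [exact: L1_measurable Lg|exact: measurable_indic].
exists g.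
  have -> : g = fun x => \sum_(y <- finmap.enum_fset (fset_set (range (g_ k))))
       (y * \1_(g_ k @^-1` [set y] `&` C N) x).
    apply/funext => x; rewrite /g fimfunE fsbig_finite//=.
    rewrite mulr_suml; apply: eq_bigr => y _.
    by rewrite -mulrA indicI.
  elim: (X in shift_cts m (fun x => \sum_(y <- X) _)) => [|y s IH].
    by rewrite (_ : (fun x => _) = (fun=> 0)); [exact: shift_cts0|apply/funext => x; rewrite big_nil].
  rewrite (_ : (fun x => _) = fun x => (y * \1_(g_ k @^-1` [set y] `&` C N) x) +
     \sum_(j <- s) (j * \1_(g_ k @^-1` [set j] `&` C N) x)); last first.
    by apply/funext => x; rewrite big_cons.
  apply: shift_ctsD => //; apply: (shift_ctsZ lm).
  have my : measurable (g_ k @^-1` [set y]).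
    by rewrite -[X in measurable X]setTI; exact: (L1_measurable Lg).
  exact: (shift_cts_indic N my).
rewrite (splitr e); apply: le_trans (lerD hN hk).
have h1 : L1 m (fun x => `|f x - fN N x|) by apply: L1_norm; exact: L1B.
have h2 : L1 m (fun x => `|f x - g_ k x|) by apply: L1_norm; exact: L1B.
rewrite -I_D//; apply: I_le; [by apply: L1_norm; exact: L1B|exact: L1D|].
move=> x; rewrite (_ : f x - g x = (f x - fN N x) + (fN N x - g x)); last by ring.
apply: le_trans (ler_normD _ _) _; rewrite lerD2l /fN /g -mulrBl normrM.
by rewrite ler_piMr.
Qed.

End density.

Section gauss_average.
Context {R : realType} {n : nat}.
Notation V := (n.-tuple R).
Variable m : {sigma_finite_measure set V -> \bar R}.
Hypothesis lm : is_lebesgue m.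

Lemma measurable_fun_shift (f : V -> R) d (T : measurableType d) (p q : T -> V) :
  measurable_fun setT f -> measurable_fun setT p -> measurable_fun setT q ->
  measurable_fun setT (fun t => f (vsub (p t) (q t))).
Proof.
by move=> mf mp mq; apply: (measurableT_comp mf); exact: measurable_fun_vsub.
Qed.

Lemma shift_dist_le f y : L1 m f -> shift_dist m f y <= 2 * I[m] (fun x => `|f x|).
Proof.
move=> hf; have hn := L1_norm hf.
rewrite mulr_natl mulr2n -{1}(I_shift lm y hn) -I_D//; last exact: (L1_shift lm y hn).
apply: I_le; first exact: L1_shift_dist.
  by apply: L1D => //; exact: (L1_shift lm y hn).
by move=> x; exact: ler_normB.
Qed.

Lemma measurable_shift_dist f (c : R) : measurable_fun setT f ->
  measurable_fun setT (fun y => shift_dist m f (vscale c y)).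
Proof.
move=> mf; apply: (@measurable_I _ _ _ _ _ m (fun z : V * V =>
  `|f (vsub z.2 (vscale c z.1)) - f z.2|)).
apply: measurableT_comp => //; apply: measurable_funB.
  apply: measurable_fun_shift => //.
  exact: measurable_fun_vscale.
exact: measurableT_comp.
Qed.

Lemma L1_gauss_shift_dist f (c : R) : L1 m f ->
  L1 m (fun y => gauss y * shift_dist m f (vscale c y)).
Proof.
move=> hf; have [_ Lg _ _] := gauss_fourier lm.
apply: (L1_le (g := fun y => (2 * I[m] (fun x => `|f x|)) * gauss y)); last exact: L1Z.
  apply: measurable_funM; first exact: measurable_gauss.
  by apply: measurable_shift_dist; exact: L1_measurable hf.
move=> y; rewrite normrM (ger0_norm (gauss_ge0 _)) mulrC ler_wpM2r ?gauss_ge0//.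
by rewrite ger0_norm ?shift_dist_ge0// shift_dist_le.
Qed.

Lemma gauss_shift_cvg f : L1 m f ->
  I[m] (fun y => gauss y * shift_dist m f (vscale k.+1%:R^-1 y)) @[k --> \oo] --> (0 : R).
Proof.
move=> hf; have [_ Lg _ _] := gauss_fourier lm.
have Lb : L1 m (fun y => (2 * I[m] (fun x => `|f x|)) * gauss y) by exact: L1Z.
rewrite -(I_0 m).
have [] // := @I_dct _ _ _ m
  (fun k y => gauss y * shift_dist m f (vscale k.+1%:R^-1 y)) (fun=> 0) _ _ Lb.
- by move=> k; apply: L1_measurable (L1_gauss_shift_dist _ hf).
- move=> k y; rewrite normrM (ger0_norm (gauss_ge0 _)) mulrC ler_wpM2r ?gauss_ge0//.
  by rewrite ger0_norm ?shift_dist_ge0// shift_dist_le.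
- move=> y; have := cvgnZ (gauss y) ((shift_cts_L1 lm hf).2 y).
  by rewrite mulr0.
Qed.

End gauss_average.

Section vnorm.
Context {R : realType} {n : nat}.
Notation V := (n.-tuple R).
Implicit Types x y : V.

Lemma vnorm_ge0 x : 0 <= vnorm x.
Proof. exact: sqrtr_ge0. Qed.

Lemma vdotZl c x y : vdot (vscale c x) y = c * vdot x y.
Proof.
by rewrite /vdot mulr_sumr; apply: eq_bigr => i _; rewrite tnth_vscale mulrA.
Qed.

Lemma vdotC x y : vdot x y = vdot y x.
Proof. by apply: eq_bigr => i _; rewrite mulrC. Qed.

Lemma vdotZr c x y : vdot x (vscale c y) = c * vdot x y.
Proof. by rewrite vdotC vdotZl vdotC. Qed.

Lemma vdotBl x y z : vdot (vsub x y) z = vdot x z - vdot y z.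
Proof.
by rewrite /vdot -sumrB; apply: eq_bigr => i _; rewrite tnth_vsub mulrBl.
Qed.

Lemma vnormZ c x : vnorm (vscale c x) = `|c| * vnorm x.
Proof.
apply/eqP; rewrite -(@eqrXn2 _ 2)// ?vnorm_ge0//; last by rewrite mulr_ge0// vnorm_ge0.
by rewrite exprMn !sqr_vnorm vdotZl vdotZr mulrA -expr2 real_normK ?num_real.
Qed.

Lemma tnth_le_vnorm x i : `|tnth x i| <= vnorm x.
Proof.
rewrite -(@ler_pXn2r _ 2)// ?nnegrE ?vnorm_ge0// real_normK ?num_real// sqr_vnorm.
rewrite /vdot (bigD1 i)//= -expr2 lerDl; apply: sumr_ge0 => j _.
by rewrite -expr2 sqr_ge0.
Qed.

Lemma cube_vnorm x r : vnorm x <= r -> cube r x.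
Proof. by move=> h; apply/cubeP => i; apply: le_trans (tnth_le_vnorm x i) h. Qed.

Lemma measurable_vnorm : measurable_fun setT (@vnorm R n).
Proof. by apply: measurable_fun_vnorm. Qed.

End vnorm.

(** * Integrability of negative powers *)

Section decay.
Context {R : realType} {n : nat}.
Notation V := (n.-tuple R).
Variable m : {measure set V -> \bar R}.
Hypothesis lm : is_lebesgue m.

(** Scaling replaces polar coordinates: doubling the cube multiplies the previous integral of [w] by
    [q = 2^(n-p) < 1] and adds a fixed amount, so the integrals over the cubes of half-side [2^N]
    stay bounded. *)
Lemma L1_decay (p : R) : n%:R < p -> L1 m (fun x => (1 + vnorm x) `^ (- p)).
Proof.
move=> np.
have p0 : 0 < p by apply: le_lt_trans np.
pose w (x : V) : R := (Num.max 1 (vnorm x)) `^ (- p).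
have mw : measurable_fun setT w.
  apply: (measurableT_comp (measurable_powR (- p))).
  by apply: measurable_maxr => //; exact: measurable_vnorm.
have max0 (x : V) : 0 < Num.max 1 (vnorm x) by rewrite lt_max ltr01.
have w0 x : 0 <= w x by exact: powR_ge0.
have powN (a b : R) : 0 < a -> a <= b -> b `^ (- p) <= a `^ (- p).
  move=> a0 ab; have b0 : 0 < b by exact: lt_le_trans ab.
  rewrite !powRN lef_pV2 ?posrE ?powR_gt0//.
  by apply: ge0_ler_powR => //; rewrite ?nnegrE ltW.
have w1 x : w x <= 1.
  apply: le_trans (powN 1 _ ltr01 _) _; first by rewrite le_max lexx.
  by rewrite powRN powR1 invr1.
pose C N : set V := cube (2 ^+ N).
pose f N x := w x * \1_(C N) x.
have mC N : measurable (C N) by exact: measurable_cube.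
have LC r : 0 <= r -> L1 m \1_(cube r).
  by move=> r0; apply: (L1_indic (measurable_cube _)); rewrite lebesgue_cube ?ltry.
have IC r : 0 <= r -> I[m] \1_(cube r) = (2 * r) ^+ n.
  by move=> r0; rewrite (I_indic m (measurable_cube _)) lebesgue_cube.
have r2 N : 0 <= 2 ^+ N :> R by exact: exprn_ge0.
have f0 N x : 0 <= f N x by rewrite mulr_ge0.
have Lf N : L1 m (f N).
  apply: L1_le (LC _ (r2 N)); first by apply: measurable_funM => //; exact: measurable_indic.
  by move=> x; rewrite ger0_norm// ler_piMl.
pose q : R := 2 ^+ n * 2 `^ (- p).
have q0 : 0 <= q by rewrite mulr_ge0// powR_ge0.
have q1 : q < 1.
  rewrite /q -powR_mulrn// -powRD; last by rewrite pnatr_eq0 implybT.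
  rewrite -opprB powRN invf_lt1 ?powR_gt0//.
  have h : 0 < p - n%:R by rewrite subr_gt0.
  have := gt0_ltr_powR h (_ : 1 \in Num.nneg) (_ : 2 \in Num.nneg) (ltr1n R 2).
  by rewrite powR1; apply; rewrite nnegrE.
(* After [x -> 2 x], with Jacobian [2^n]: off the unit cube [w (2 x) <= 2^-p w x], and on it the
   integrand is at most 1, which contributes [2^n] times the volume [2^n]. *)
have step N : I[m] (f N.+1) <= q * I[m] (f N) + 4 ^+ n.
  have c2 : (2 : R) != 0 by [].
  have z0 : [tuple 0 | _ < n] = vscale 0 [tuple 0 | _ < n] :> V.
    by apply: eq_tnthP => i; rewrite tnth_vscale mul0r tnth_mktuple.
  have aff2 (x : V) : affine 2 [tuple 0 | _ < n] x = vscale 2 x.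
    by apply: eq_tnthP => i; rewrite /affine tnth_vsub !tnth_mktuple subr0.
  have LA := L1_affine lm [tuple 0 | _ < n] c2 (Lf N.+1).
  have := I_affine lm [tuple 0 | _ < n] c2 (Lf N.+1).
  rewrite normr_nat => /(congr1 ( *%R (2 ^+ n))); rewrite mulVKf ?expf_neq0// => <-.
  rewrite -(I_Z _ LA).
  have -> : q * I[m] (f N) + 4 ^+ n = I[m] (fun x => q * f N x + 2 ^+ n * \1_(cube 1) x).
    rewrite I_D; [|exact: L1Z|apply: L1Z; exact: LC].
    by rewrite !I_Z//; [rewrite IC// mulr1 -exprMn -natrM|exact: LC].
  apply: I_le; first exact: L1Z LA.
    by apply: L1D; apply: L1Z => //; exact: LC.
  move=> x; rewrite aff2 -mulrA -mulrDr ler_pM2l ?exprn_gt0// /f.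
  have -> : \1_(C N.+1) (vscale 2 x) = \1_(C N) x :> R.
    rewrite !indicE; congr (_%:R); congr nat_of_bool; apply/idP/idP => /set_mem/cubeP h;
      apply/mem_set/cubeP => i; have := h i;
      by rewrite tnth_vscale normrM normr_nat exprS ler_pM2l.
  have [x1|x1] := pselect (cube 1 x).
    rewrite [\1_(cube 1) x]indicE (mem_set x1) (@le_trans _ _ 1)//.
      by rewrite mulr_ile1// indicE lern1 leq_b1.
    by rewrite lerDr; apply: mulr_ge0; [exact: powR_ge0|exact: mulr_ge0].
  have nx : 1 < vnorm x.
    by rewrite ltNge; apply/negP => h; apply: x1; exact: cube_vnorm.
  have -> : w (vscale 2 x) = 2 `^ (- p) * w x.
    rewrite /w vnormZ normr_nat !max_r ?(ltW nx)//; last by lra.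
    by rewrite powRM// vnorm_ge0.
  by rewrite mulrA lerDl// indicE.
pose K := 4 ^+ n / (1 - q).
have q1' : 0 < 1 - q by rewrite subr_gt0.
have fK N : I[m] (f N) <= K.
  elim: N => [|N IH].
    apply: (@le_trans _ _ (2 ^+ n)).
      have := IC 1 ler01; rewrite mulr1 => <-; apply: I_le => //; first exact: LC.
      by move=> x; rewrite /f /C expr0 ler_piMl.
    rewrite /K ler_pdivlMr//; apply: (@le_trans _ _ (2 ^+ n)).
      by rewrite ler_piMr// gerBl.
    by rewrite lerXn2r ?nnegrE ?ler_nat.
  apply: le_trans (step N) _; apply: (@le_trans _ _ (q * K + 4 ^+ n)).
    by rewrite lerD2r ler_wpM2l.
  rewrite le_eqVlt; apply/orP; left; apply/eqP; rewrite /K; field.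
  by rewrite gt_eqF.
have [Lw _] : L1 m w /\ I[m] w <= K.
  apply: (L1_fatou Lf f0 fK) => x; apply: cvg_near_cst.
  have : [set: V] x by []; rewrite -bigcup_cube => -[i _ xi].
  exists i => // N /= iN; rewrite /f indicE mem_set ?mulr1//.
  apply/cubeP => j; apply: le_trans ((cubeP _ _).1 xi j) _.
  rewrite -natrX ler_nat (leq_trans iN)// ltnW// ltn_expl//.
apply: (L1_le _ _ Lw).
  apply: (measurableT_comp (measurable_powR (- p))).
  by apply: measurable_funD => //; exact: measurable_vnorm.
move=> x; rewrite ger0_norm ?powR_ge0//; apply: powN => //.
by rewrite ge_max lerDl lerDr ler01 vnorm_ge0.
Qed.

End decay.

(** * Mild solutions *)

Section joint_version.
Context {R : realType} d (T : measurableType d).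
Variable m : {measure set T -> \bar R}.
Variable u : R -> T -> R.
Hypothesis Lu : forall t, 0 <= t -> L1 m (u t).
Hypothesis cu : forall t, 0 <= t -> forall e : R, 0 < e -> exists2 eta : R, 0 < eta &
  forall t', 0 <= t' -> `|t' - t| < eta -> I[m] (fun x => `|u t' x - u t x|) < e.

Let D r r' := I[m] (fun x => `|u r x - u r' x|).

(** Compactness of [[0, T0]] upgrades continuity at each time to uniform continuity. *)
Lemma unif_cts_curve (T0 e : R) : 0 < e -> exists2 del : R, 0 < del &
  forall r r', 0 <= r <= T0 -> 0 <= r' <= T0 -> `|r' - r| < del -> D r' r <= e.
Proof.
move=> e0.
have /compact_near_coveringP cov := @segment_compact R 0 T0.
pose P (i r : R) := forall r', 0 <= r -> 0 <= r' -> `|r' - r| < i -> D r' r <= e.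
have : \forall i \near 0^'+, `[0, T0]%classic `<=` P i.
  apply: cov => x /=; rewrite in_itv/= => /andP[x0 _].
  have e2 : 0 < e / 2 by rewrite divr_gt0.
  have [eta eta0 H] := cu x0 e2.
  have h2 : 0 < eta / 2 by rewrite divr_gt0.
  exists ([set y | `|y - x| < eta / 2], [set i | i < eta / 2]).
    split => /=.
      by exists (eta / 2) => //= y /=; rewrite distrC.
    exact: nbhs_right_lt.
  move=> [y i] /= [yx ie] r' y0 r'0 r'y.
  have L r : 0 <= r -> L1 m (fun z => `|u r z - u x z|).
    by move=> r0; apply: L1_norm; apply: L1B; exact: Lu.
  rewrite (splitr e); apply: (@le_trans _ _ (D r' x + D y x)).
    rewrite /D -I_D; [|exact: L..].
    apply: I_le; first by apply: L1_norm; apply: L1B; exact: Lu.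
      by apply: L1D; exact: L.
    by move=> z; rewrite [`|u y z - _|]distrC; apply: ler_distD.
  apply: lerD; apply/ltW/H => //.
    rewrite -(subrKA y) (le_lt_trans (ler_normD _ _))// (splitr eta) ltrD//.
    exact: lt_trans ie.
  by apply: lt_trans yx _; rewrite ltr_pdivrMr// ltr_pMr// ltr1n.
move=> H; near (0 : R)^'+ => del; exists del; first by near: del; exact: nbhs_right_gt.
move=> r r' /andP[r0 rT] /andP[r'0 _] rr.
have HH : `[0, T0]%classic `<=` P del by near: del.
by apply: HH => //; rewrite /= in_itv/= r0.
Unshelve. all: by end_near. Qed.

(** The [N * N] cells of length [1 / N] cover [[0, N)], so one parameter both refines the mesh and
    exhausts the half-line. *)
Let step (N : nat) (z : measurableTypeR R * T) : R :=
  \sum_(k < N * N) \1_`[k%:R / N%:R, k.+1%:R / N%:R[ z.1 * u (k%:R / N%:R) z.2.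

Let measurable_step N : measurable_fun setT (step N).
Proof.
apply: measurable_sum => k; apply: measurable_funM.
  by apply: (measurableT_comp (@measurable_indic _ _ _ _ _ _)) => //.
by apply: measurableT_comp; first by apply: L1_measurable (Lu _); rewrite divr_ge0.
Qed.

Let step_cvg (T0 : R) (j : nat) : exists N : nat, forall r, 0 <= r <= T0 ->
  exists2 r', 0 <= r' & (forall z, step N (r, z) = u r' z) /\ D r' r <= 2^-1 ^+ j.
Proof.
have [|del del0 H] := @unif_cts_curve (T0 + 1) (2^-1 ^+ j); first exact: exprn_gt0.
pose N := (Num.truncn (Num.max T0 0 + del^-1 + 1)).+1.
have N0 : (0 : R) < N%:R by rewrite ltr0n.
have NN : Num.max T0 0 + del^-1 + 1 < N%:R by exact: truncnS_gt.
have m0 : 0 <= Num.max T0 0 by rewrite le_max lexx orbT.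
have mT : T0 <= Num.max T0 0 by rewrite le_max lexx.
have di : 0 < del^-1 by rewrite invr_gt0.
exists N => r /andP[r0 rT]; pose k := Num.truncn (r * N%:R).
have rN0 : 0 <= r * N%:R by rewrite mulr_ge0// ltW.
have /andP[k1 k2] : k%:R <= r * N%:R < k.+1%:R by exact: truncn_itv.
exists (k%:R / N%:R); first by rewrite divr_ge0.
have kr : k%:R / N%:R <= r by rewrite ler_pdivrMr.
split; last first.
  apply: H; rewrite ?r0 ?divr_ge0//=; try lra.
  rewrite ler0_norm ?subr_le0// opprB.
  apply: (@lt_trans _ _ (k.+1%:R / N%:R - k%:R / N%:R)).
    by rewrite ltrD2r ltr_pdivlMr.
  rewrite -mulrBl -natrB// subSnn mul1r invf_plt ?posrE//; lra.
move=> z; rewrite /step.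
have kN : (k < N * N)%N.
  rewrite -(ltr_nat R) natrM; apply: le_lt_trans k1 _.
  by rewrite ltr_pM2r//; lra.
rewrite (bigD1 (Ordinal kN))//= [X in _ + X]big1 ?addr0.
  rewrite indicE mem_set ?mul1r//= in_itv/= kr/=.
  by rewrite ltr_pdivlMr.
move=> i ik; rewrite indicE memNset ?mul0r//= in_itv/= => /andP[].
rewrite ler_pdivrMr// ltr_pdivlMr// => i1 i2.
move/eqP : ik; apply; apply/val_inj => /=; apply/eqP; rewrite eqn_leq.
rewrite -ltnS -(ltr_nat R) (le_lt_trans i1 k2)/=.
by rewrite -ltnS -(ltr_nat R) (le_lt_trans k1 i2).
Qed.

(** The L1 errors are summable, so the sum of the pointwise errors is integrable, hence finite
    almost everywhere, and its terms tend to 0. *)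
Lemma ae_cvg_summable (f : nat -> T -> R) (g : T -> R) :
  (forall j, L1 m (f j)) -> L1 m g ->
  (forall j, I[m] (fun z => `|f j z - g z|) <= 2^-1 ^+ j) ->
  {ae m, forall z, f j z @[j --> \oo] --> g z}.
Proof.
move=> Lf Lg H.
have L j : L1 m (fun z => `|f j z - g z|) by apply: L1_norm; exact: L1B.
have mL j : measurable_fun setT (fun z => (`|f j z - g z|)%:E).
  by apply/measurable_EFinP; exact: L1_measurable (L j).
have S : (\int[m]_z (\sum_(j <oo) (`|f j z - g z|)%:E) < +oo)%E.
  rewrite integral_nneseries//.
  apply: (@le_lt_trans _ _ 2%:E); last exact: ltry.
  apply: lime_le.
    by apply: is_cvg_nneseries => j _ _; exact: integral_ge0.
  apply: nearW => N.
  apply: (@le_trans _ _ (\sum_(0 <= j < N) (2^-1 ^+ j)%:E)%E).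
    by apply: lee_sum => j _; rewrite -L1_EFin// lee_fin.
  rewrite sumEFin lee_fin.
  have E : \sum_(0 <= j < N) 2^-1 ^+ j = 2 - 2 * 2^-1 ^+ N :> R.
    elim: N => [|N IH]; first by rewrite big_geq// expr0; ring.
    by rewrite big_nat_recr//= IH exprS; field.
  by rewrite E gerBl mulr_ge0// exprn_ge0.
have iS : m.-integrable setT (fun z => \sum_(j <oo) (`|f j z - g z|)%:E)%E.
  apply/integrableP; split.
    by apply: ge0_emeasurable_sum.
  rewrite (eq_integral (fun z => \sum_(j <oo) (`|f j z - g z|)%:E)%E)// => z _.
  by rewrite gee0_abs// nneseries_ge0.
apply: filterS (integrable_ae measurableT iS) => z /(_ I) fz.
have c : cvgn (series (fun j => `|f j z - g z|)).
  apply: nnseries_is_cvg => //; by rewrite ltey_eq fz.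
have := cvg_series_cvg_0 c => c0.
by apply/subr_cvg0; apply: norm_cvg0; exact: c0.
Qed.

(** A mild solution is measurable in [x] at each time separately, while Fubini over time and space
    needs joint measurability. Piecewise constant interpolants in time are jointly measurable and,
    for every [r], converge to [u r] almost everywhere. *)
Lemma joint_version (T0 : R) : exists w : measurableTypeR R * T -> R,
  measurable_fun setT w /\
  forall r, 0 <= r <= T0 -> {ae m, forall z, w (r, z) = u r z}.
Proof.
have [N HN] := choice (step_cvg T0).
(* The upper limit is measurable whether or not the interpolants converge at a given point. *)
pose w z := fine (limn_esup (fun j => (step (N j) z)%:E)).
exists w; split.
  apply: measurableT_comp => //; apply: measurable_fun_limn_esup => j.
  by apply/measurable_EFinP; exact: measurable_step.
move=> r rT.
have Lr : L1 m (u r) by apply: Lu; case/andP: rT.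
have : {ae m, forall z, step (N j) (r, z) @[j --> \oo] --> u r z}.
  apply: ae_cvg_summable => //.
    move=> j; have [r' r'0 [/funext E _]] := HN j r rT.
    by rewrite E; exact: Lu.
  move=> j; have [r' r'0 [E H]] := HN j r rT.
  by under eq_Rintegral do rewrite E.
apply: filterS => z h.
have h' : (step (N j) (r, z))%:E @[j --> \oo] --> (u r z)%:E.
  by apply: cvg_EFin => //; exact: nearW.
by rewrite /w (is_cvg_limn_esupE (cvgP _ h')) (cvg_lim _ h').
Qed.

End joint_version.

Section non_integrable.
Context d (T : measurableType d) (R : realType) (m : {measure set T -> \bar R}).

Lemma I_notL1 (f : T -> R) : measurable_fun setT f -> ~ L1 m f -> I[m] f = 0.
Proof.
move=> mf nf; rewrite /Rintegral.
have : ~ ((\int[m]_x (f x)%:E)%E \is a fin_num).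
  by rewrite -integral_fin_num_abs// => h; apply: nf; exact: L1P.
by case: (integral _ _ _).
Qed.

(** The real integral of a measurable nonintegrable function is 0 by convention, and so is that of
    its nonzero multiples. The rule thus applies to convolution integrands, known to be integrable
    only for almost every [x]. *)
Lemma I_Zgen c (f : T -> R) : measurable_fun setT f -> I[m] (fun x => c * f x) = c * I[m] f.
Proof.
move=> mf; have [hf|nf] := pselect (L1 m f); first exact: I_Z.
have [->|c0] := eqVneq c 0.
  by rewrite mul0r -[RHS](I_0 m); apply: I_ext => x; rewrite mul0r.
rewrite (I_notL1 mf nf) mulr0; apply: I_notL1; first exact: measurable_funM.
move=> h; apply: nf; apply: L1_ext (L1Z c^-1 h) => x.
by rewrite mulKf.
Qed.

End non_integrable.

Lemma L1_prodI d1 d2 (T1 : measurableType d1) (T2 : measurableType d2)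
    (R : realType) (m1 : {sigma_finite_measure set T1 -> \bar R})
    (m2 : {sigma_finite_measure set T2 -> \bar R}) (f : T1 * T2 -> R) (h : T1 -> R) :
  measurable_fun setT f -> L1 m1 h ->
  (forall x, L1 m2 (fun y => f (x, y)) /\ I[m2] (fun y => `|f (x, y)|) <= h x) ->
  L1 (m1 \x m2)%E f.
Proof.
move=> mf hh fh; apply: (L1_prod mf hh) => x; have [fx fxh] := fh x.
by rewrite -L1_EFin ?lee_fin//; exact: L1_norm.
Qed.

Lemma L1_prod_sec2 d1 d2 (T1 : measurableType d1) (T2 : measurableType d2)
    (R : realType) (m1 : {sigma_finite_measure set T1 -> \bar R})
    (m2 : {sigma_finite_measure set T2 -> \bar R}) (f : T1 * T2 -> R) :
  L1 (m1 \x m2)%E f -> {ae m2, forall y, L1 m1 (fun x => f (x, y))}.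
Proof. by move=> hf; exact: (ae_integrable2 hf). Qed.

Section product_measure.
Context d1 d2 (T1 : measurableType d1) (T2 : measurableType d2) (R : realType).
Variables (m1 : {sigma_finite_measure set T1 -> \bar R})
  (m2 : {sigma_finite_measure set T2 -> \bar R}).

Lemma sigma_finite_product : sigma_finite setT (m1 \x m2)%E.
Proof.
have /sigma_finiteP[F [TF ndF Foo]] := sigma_finiteT m1.
have /sigma_finiteP[G [TG ndG Goo]] := sigma_finiteT m2.
exists (fun k => F k `*` G k).
  rewrite -setXTT TF TG predeqE => -[x y]; split.
    move=> [/= [i _ Fx] [j _ Gy]]; exists (maxn i j) => //; split.
    - by move: x Fx; exact/subsetPset/ndF/leq_maxl.
    - by move: y Gy; exact/subsetPset/ndG/leq_maxr.
  by move=> [k _ []/= ? ?]; split; exists k.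
move=> k; have [? ?] := Foo k; have [? ?] := Goo k.
split; first exact: measurableX.
by rewrite product_measure1E// lte_mul_pinfty// ge0_fin_numE.
Qed.

(* The library leaves the canonical sigma-finite structure of the product
   unreachable, so it is packed by hand, with the same underlying measure. *)
Definition prod_sigma_finite : {sigma_finite_measure set (T1 * T2)%type -> \bar R} :=
  let mu : {measure set (T1 * T2)%type -> \bar R} := (m1 \x m2)%E in
  SigmaFiniteMeasure.Pack (SigmaFiniteMeasure.Class
    (Measure.measure_function_Content_isMeasure_mixin (Measure.class mu))
    (isSFinite.Axioms_ _ _ _ (sfinite_measure_sigma_finite sigma_finite_product))
    (isSigmaFinite.Axioms_ _ _ _ sigma_finite_product)).

End product_measure.

Lemma measurable_fun_indic_itv (R : realType) (b c : R) d (T : measurableType d)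
    (f : T -> measurableTypeR R) : measurable_fun setT f ->
  measurable_fun setT (fun x => \1_`[b, c] (f x) : R).
Proof.
move=> mf; have mI : measurable_fun setT (\1_`[b, c] : measurableTypeR R -> R).
  exact: measurable_indic.
exact: (measurableT_comp mI mf).
Qed.

(** * The Duhamel term and its pairing with test functions *)

Section duhamel.
Context {R : realType} {n : nat}.
Notation V := (n.-tuple R).
Notation leb := (leb R).
Variable m : {sigma_finite_measure set V -> \bar R}.
Hypothesis lm : is_lebesgue m.
Variables (a : R) (K : V -> R).
Hypotheses (a0 : 0 < a) (K0 : forall x, 0 <= K x) (LK : L1 m K) (IK : I[m] K = 1).

Let P := prod_sigma_finite leb m.
Let mK : measurable_fun setT K := L1_measurable LK.

Lemma I_shift_gen f y : measurable_fun setT f ->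
  I[m] (fun x => f (vsub x y)) = I[m] f.
Proof.
move=> mf; have [hf|nf] := pselect (L1 m f); first exact: I_shift.
have ms : measurable_fun setT (fun x => f (vsub x y)).
  by apply: (measurableT_comp mf); exact: measurable_fun_vsub.
rewrite (I_notL1 mf nf); apply: I_notL1 => // h; apply: nf.
apply: L1_ext (L1_shift lm (vscale (-1) y) h) => x; congr f.
by apply: eq_tnthP => i; rewrite !tnth_vsub tnth_vscale; ring.
Qed.

Definition vadd (x y : V) := vsub x (vscale (-1) y).

Lemma tnth_vadd x y i : tnth (vadd x y) i = tnth x i + tnth y i.
Proof. by rewrite tnth_vsub tnth_vscale mulN1r opprK. Qed.

Lemma vdot_vadd x y z : vdot (vadd x y) z = vdot x z + vdot y z.
Proof. by rewrite vdotBl vdotZl mulN1r opprK. Qed.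

Section fixed_time.
Variable t : R.

Definition duh_ker (w : measurableTypeR R * V -> R) (q : (measurableTypeR R * V) * V) : R :=
  \1_`[0, t] q.1.1 * expR ((n%:R - a) * (t - q.1.1)) *
  (K (vsub (vscale (expR (t - q.1.1)) q.2) q.1.2) * w q.1).

(** The Duhamel term as one integral over time and space, to which Fubini applies, whereas [Duh]
    keeps the iterated form of the mild formulation; [Duh_DP] identifies them almost everywhere. *)
Definition DP w x := I[P] (fun p => duh_ker w (p, x)).

Definition Duh (w : measurableTypeR R * V -> R) x := Rintegral leb `[0, t]
  (fun r => expR ((n%:R - a) * (t - r)) *
    Defs.conv m K (fun z => w (r, z)) (vscale (expR (t - r)) x)).

Definition admissible w B := measurable_fun setT w /\
  forall r, 0 <= r <= t -> L1 m (fun z => w (r, z)) /\ I[m] (fun z => `|w (r, z)|) <= B.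

Lemma measurable_expR_lin (b c : R) d (T : measurableType d) (f : T -> R) :
  measurable_fun setT f -> measurable_fun setT (fun x => expR (b * (c - f x))).
Proof.
move=> mf; apply: measurableT_comp => //; apply: measurable_funM => //.
exact: measurable_funB.
Qed.

Lemma measurable_duh_ker w : measurable_fun setT w -> measurable_fun setT (duh_ker w).
Proof.
move=> mw.
have m11 : measurable_fun setT (fun q : (measurableTypeR R * V) * V => q.1.1 : R).
  by apply: (measurableT_comp measurable_fst).
apply: measurable_funM; first apply: measurable_funM.
- exact: measurable_fun_indic_itv.
- exact: measurable_expR_lin.
apply: measurable_funM; last exact: measurableT_comp.
apply: (measurableT_comp mK); apply: measurable_fun_vsub.
  apply: measurable_fun_vscale; last exact: measurable_snd.
  by apply: measurableT_comp => //; exact: measurable_funB.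
by apply: measurableT_comp.
Qed.

Lemma expRVn (x : R) : `|expR x| ^- n = expR (- (n%:R * x)).
Proof. by rewrite ger0_norm ?expR_ge0// -expRM_natl expRN. Qed.

(** The substitution [y = e^tau x - z] has Jacobian [e^(-n tau)], which later cancels the growth
    [e^(n tau)] of the transport and leaves the damping [e^(-a tau)]. *)
Lemma I_mul_K_affine (th : V -> R) M (tau : R) z : measurable_fun setT th ->
  (forall x, `|th x| <= M) ->
  L1 m (fun x => th x * K (affine (expR tau) z x)) /\
  I[m] (fun x => th x * K (affine (expR tau) z x)) =
  expR (- (n%:R * tau)) * I[m] (fun y => th (vscale (expR (- tau)) (vadd y z)) * K y).
Proof.
move=> mth thM.
pose Th y := th (vscale (expR (- tau)) (vadd y z)) * K y.
have ThE x : th x * K (affine (expR tau) z x) = Th (affine (expR tau) z x).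
  rewrite /Th; congr (th _ * _); apply: eq_tnthP => i.
  rewrite tnth_vscale tnth_vadd tnth_vsub tnth_vscale subrK mulrA -expRD.
  by rewrite addNr expR0 mul1r.
have LTh : L1 m Th.
  apply: (L1M (c := M)) => //; apply: (measurableT_comp mth).
  by apply: measurable_fun_vscale => //; exact: measurable_fun_vsub.
have e0 : expR tau != 0 by rewrite gt_eqF// expR_gt0.
split; first by apply: L1_ext (L1_affine lm z e0 LTh) => x; rewrite ThE.
by rewrite (I_ext m ThE) (I_affine lm z e0 LTh) expRVn.
Qed.

Lemma expR_combine (tau : R) :
  expR ((n%:R - a) * tau) * expR (- (n%:R * tau)) = expR (- (a * tau)).
Proof. by rewrite -expRD; congr expR; ring. Qed.

Lemma duh_ker_sec (th : V -> R) M w p : measurable_fun setT th ->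
  (forall x, `|th x| <= M) ->
  L1 m (fun x => th x * duh_ker w (p, x)) /\
  I[m] (fun x => th x * duh_ker w (p, x)) =
  \1_`[0, t] p.1 * expR (- (a * (t - p.1))) *
   (w p * I[m] (fun y => th (vscale (expR (- (t - p.1))) (vadd y p.2)) * K y)).
Proof.
move=> mth thM; case: p => r z.
have [L E] := @I_mul_K_affine th M (t - r) z mth thM.
have D x : th x * duh_ker w ((r, z), x) =
  (\1_`[0, t] r * expR ((n%:R - a) * (t - r)) * w (r, z)) *
  (th x * K (affine (expR (t - r)) z x)).
  by rewrite /duh_ker /affine/=; ring.
split; first by apply: L1_ext (L1Z _ L) => x; rewrite D.
rewrite (I_ext m D) I_Z// E -expR_combine /=; ring.
Qed.

Lemma norm_duh_ker w p x : `|duh_ker w (p, x)| = duh_ker (fun p => `|w p|) (p, x).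
Proof.
rewrite /duh_ker !normrM (ger0_norm (expR_ge0 _)) (ger0_norm (K0 _)).
by rewrite indicE ger0_norm.
Qed.

Lemma L1_indic_itv (b c : R) : L1 leb \1_`[b, c].
Proof. exact: integrable_indic_itv. Qed.

Lemma expRN_le1 r : r \in `[0, t] -> expR (- (a * (t - r))) <= 1.
Proof.
rewrite in_itv/= => /andP[_ rt].
by rewrite -expR0 ler_expR oppr_le0 mulr_ge0 ?subr_ge0// ltW.
Qed.

Lemma indic_ge0 (A : set (measurableTypeR R)) r : 0 <= \1_A r :> R.
Proof. by rewrite indicE. Qed.

Section one_weight.
Variables (w : measurableTypeR R * V -> R) (B : R).
Hypothesis hw : admissible w B.

Let mw : measurable_fun setT w := hw.1.

Lemma measurable_weight : measurable_fun setT
  (fun p : measurableTypeR R * V => \1_`[0, t] p.1 * expR (- (a * (t - p.1)))).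
Proof.
apply: measurable_funM.
  by apply: measurable_fun_indic_itv.
rewrite (_ : (fun _ => _) = fun p : measurableTypeR R * V => expR (- a * (t - p.1))).
  exact: measurable_expR_lin.
by apply/funext => p; rewrite mulNr.
Qed.

Lemma L1_weight (g : measurableTypeR R * V -> R) M : measurable_fun setT g ->
  (forall p, `|g p| <= M) ->
  L1 P (fun p => \1_`[0, t] p.1 * expR (- (a * (t - p.1))) * (w p * g p)).
Proof.
move=> mg gM.
have M0 : 0 <= M by exact: le_trans (normr_ge0 _) (gM (0, [tuple 0 | _ < n])).
apply: (@L1_prodI _ _ _ _ _ leb m _ (fun r => B * M * \1_`[0, t] r)).
- by apply: measurable_funM; [exact: measurable_weight|exact: measurable_funM].
- by apply: L1Z; exact: L1_indic_itv.
- move=> r; have [rt|rt] := boolP (r \in `[0, t]); last first.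
    have z0 : \1_`[0, t] r = 0 :> R by rewrite indicE memNset//=; exact/negP.
    rewrite z0 mulr0; split.
      by apply: L1_ext (L10 m) => z; rewrite /= !mul0r.
    rewrite (I_ext m (g := fun=> 0)) ?I_0// => z.
    by rewrite !mul0r normr0.
  have [Lr Ir] := hw.2 r rt.
  have z1 : \1_`[0, t] r = 1 :> R by rewrite indicE mem_set.
  have L : L1 m (fun z => \1_`[0, t] r * expR (- (a * (t - r))) * (w (r, z) * g (r, z))).
    apply: L1Z; apply: (L1_ext (f := fun z => g (r, z) * w (r, z))).
      by move=> z; exact: mulrC.
    by apply: (L1M (c := M)) => //; exact: measurable_sec1.
  split=> //; rewrite [leRHS](_ : _ = B * M); last by rewrite z1 mulr1.
  apply: (@le_trans _ _ (I[m] (fun z => M * `|w (r, z)|))).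
    apply: I_le; [exact: (L1_norm L)|by apply: L1Z; exact: L1_norm|].
    move=> z /=; rewrite z1 mul1r 2!normrM (ger0_norm (expR_ge0 _)).
    apply: (@le_trans _ _ (`|w (r, z)| * `|g (r, z)|)).
      by rewrite ler_piMl ?mulr_ge0//; exact: expRN_le1.
    by rewrite mulrC ler_wpM2r.
  by rewrite I_Z; [rewrite mulrC ler_wpM2r|exact: L1_norm].
Qed.

Lemma L1_duh_ker (th : V -> R) M : measurable_fun setT th ->
  (forall x, `|th x| <= M) ->
  L1 (P \x m)%E (fun q => th q.2 * duh_ker w q).
Proof.
move=> mth thM.
have mk := measurable_duh_ker mw.
have mt : measurable_fun setT (fun q : (measurableTypeR R * V) * V => th q.2).
  by apply: (measurableT_comp mth); exact: measurable_snd.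
have M0 : 0 <= M by exact: le_trans (normr_ge0 _) (thM [tuple 0 | _ < n]).
have m1 : measurable_fun setT (fun p => `|w p|) by exact: measurableT_comp.
have abs1 (x : V) : `|1 : R| <= 1 by rewrite normr1.
apply: (@L1_prodI _ _ _ _ _ P m _ (fun p : measurableTypeR R * V => M *
  `|\1_`[0, t] p.1 * expR (- (a * (t - p.1))) * (w p * 1)|)).
- exact: measurable_funM.
- apply: L1Z; apply: L1_norm; apply: (@L1_weight (fun=> 1) 1) => // p.
  by rewrite normr1.
- move=> p; have [L _] := duh_ker_sec w p mth thM; split => //.
  have [Lk _] := duh_ker_sec w p (measurable_cst (1 : R)) abs1.
  have [La Ea] := duh_ker_sec (fun p => `|w p|) p (measurable_cst (1 : R)) abs1.
  apply: (@le_trans _ _ (I[m] (fun x => M * (1 * duh_ker (fun p => `|w p|) (p, x))))).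
    apply: I_le; [exact: L1_norm|exact: L1Z|].
    move=> x /=; rewrite normrM norm_duh_ker mul1r; apply: ler_wpM2r; last exact: thM.
    by rewrite -norm_duh_ker.
  rewrite I_Z// Ea ler_wpM2l// !normrM (ger0_norm (expR_ge0 _)).
  rewrite (ger0_norm (indic_ge0 _ _)) normr1.
  rewrite (_ : (fun y => 1 * K y) = K) ?IK//.
  by apply/funext => y; rewrite mul1r.
Qed.

Lemma L1_duh_ker1 : L1 (P \x m)%E (duh_ker w).
Proof.
apply: L1_ext (@L1_duh_ker (fun=> 1) 1 _ _) => //.
  by move=> q; rewrite mul1r.
by move=> x; rewrite normr1.
Qed.

Lemma L1_DP : L1 m (DP w).
Proof. exact: (I_prod2 L1_duh_ker1).1. Qed.

Lemma ae_L1_duh_ker : {ae m, forall x, L1 P (fun p => duh_ker w (p, x))}.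
Proof. exact: L1_prod_sec2 L1_duh_ker1. Qed.

Lemma Duh_DP : {ae m, forall x, Duh w x = DP w x}.
Proof.
apply: filterS ae_L1_duh_ker => x Lx.
rewrite /DP -(I_prod1 Lx).2 /Duh Rintegral_mkcond; apply: I_ext => r.
rewrite patchE; case: ifPn => rt; last first.
  rewrite -[LHS](I_0 m); apply: I_ext => z.
  by rewrite /duh_ker/= indicE (negbTE rt) !mul0r.
rewrite /Defs.conv -I_Zgen; last first.
  apply: measurable_funM; last exact: measurable_sec1.
  by apply: (measurableT_comp mK); exact: measurable_fun_vsub.
by apply: I_ext => z; rewrite /duh_ker/= indicE rt mul1r.
Qed.

(** Duality: Fubini moves the bounded test function [th] onto the kernel. The constant 1 gives
    masses, trigonometric functions give Fourier transforms. *)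
Lemma I_DP (th : V -> R) M : measurable_fun setT th -> (forall x, `|th x| <= M) ->
  I[m] (fun x => th x * DP w x) =
  I[leb] (fun r => \1_`[0, t] r * expR (- (a * (t - r))) *
    I[m] (fun z => w (r, z) *
      I[m] (fun y => th (vscale (expR (- (t - r))) (vadd y z)) * K y))) /\
  L1 leb (fun r => \1_`[0, t] r * expR (- (a * (t - r))) *
    I[m] (fun z => w (r, z) *
      I[m] (fun y => th (vscale (expR (- (t - r))) (vadd y z)) * K y))).
Proof.
move=> mth thM.
have L := L1_duh_ker mth thM.
pose g (p : measurableTypeR R * V) :=
  I[m] (fun y => th (vscale (expR (- (t - p.1))) (vadd y p.2)) * K y).
have mg : measurable_fun setT g.
  apply: (@measurable_I _ _ _ _ _ m (fun q : (measurableTypeR R * V) * V =>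
    th (vscale (expR (- (t - q.1.1))) (vadd q.2 q.1.2)) * K q.2)).
  apply: measurable_funM; last by apply: (measurableT_comp mK); exact: measurable_snd.
  apply: (measurableT_comp mth); apply: measurable_fun_vscale.
    apply: measurableT_comp => //; apply: measurableT_comp => //.
    apply: measurable_funB => //.
    by apply: (measurableT_comp measurable_fst).
  apply: measurable_fun_vsub; first exact: measurable_snd.
  by apply: measurable_fun_vscale => //; apply: measurableT_comp.
have gM p : `|g p| <= M.
  have <- : I[m] (fun y => M * K y) = M by rewrite I_Z// IK mulr1.
  apply: I_le_norm; first exact: L1Z.
    apply: measurable_funM => //; apply: (measurableT_comp mth).
    by apply: measurable_fun_vscale => //; exact: measurable_fun_vsub.
  by move=> y; rewrite normrM (ger0_norm (K0 _)) ler_wpM2r.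
have E1 : I[m] (fun x => th x * DP w x) =
    I[m] (fun x => I[P] (fun p => th x * duh_ker w (p, x))).
  apply: I_ext => x; rewrite I_Zgen//.
  exact: (measurable_sec2 x (measurable_duh_ker mw)).
rewrite E1 -(I_fubini L)/=.
have E2 p : I[m] (fun x => th x * duh_ker w (p, x)) =
    \1_`[0, t] p.1 * expR (- (a * (t - p.1))) * (w p * g p).
  exact: (duh_ker_sec w p mth thM).2.
rewrite (funext E2).
have Lg := L1_weight mg gM.
have [H1 H2] := I_prod1 Lg.
rewrite -H2.
have E3 : (fun r => I[m] (fun z => \1_`[0, t] r * expR (- (a * (t - r))) *
      (w (r, z) * g (r, z)))) =
   (fun r => \1_`[0, t] r * expR (- (a * (t - r))) *
     I[m] (fun z => w (r, z) * g (r, z))).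
  apply/funext => r; rewrite I_Zgen//; apply: measurable_funM; exact: measurable_sec1.
by split; [rewrite -E3|rewrite -E3].
Qed.

End one_weight.

End fixed_time.
End duhamel.

(** * Primitives and exponential weights *)

Section antiderivative.
Context {R : realType}.
Notation leb := (leb R).

Lemma FTC_R_gt (F f : R -> R) (A a b : R) : A < a -> a <= b ->
  (forall x : R, A < x -> is_derive x (1 : R) F (f x)) ->
  (forall x : R, A < x -> {for x, continuous f}) ->
  Rintegral leb `[a, b] f = F b - F a.
Proof.
move=> Aa ab dF cf; have [->|ab'] := eqVneq a b.
  by rewrite set_itv1 Rintegral_set1 subrr.
have cF x : A < x -> {for x, continuous F}.
  by move=> /dF ?; apply: differentiable_continuous; apply/derivable1_diffP; exact: ex_derive.
have gtA x : x \in `]a, b[ -> A < x.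
  by rewrite in_itv/= => /andP[/(lt_trans Aa)].
rewrite /Rintegral (@continuous_FTC2 _ f F)//.
- by rewrite lt_neqAle ab'.
- apply: continuous_in_subspaceT => x; rewrite inE/= in_itv/= => /andP[ax _].
  by apply: cf; exact: lt_le_trans ax.
- split.
  + by move=> x /gtA/dF ?; exact: ex_derive.
  + by apply: cvg_at_right_filter; exact: cF.
  + by apply: cvg_at_left_filter; apply: cF; exact: lt_le_trans ab.
- by move=> x /gtA/dF ?; rewrite derive1E derive_val.
Qed.

Lemma integrable_itv_cts (f : R -> R) a b : continuous f ->
  leb.-integrable `[a, b] (EFin \o f).
Proof.
move=> cf; apply: continuous_compact_integrable; first exact: segment_compact.
exact: continuous_subspaceT.
Qed.

(** The integration starts at -1 so that the primitive has a two-sided derivative at 0; the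
    subtraction makes it vanish there. *)
Definition antider (f : R -> R) (x : R) : R :=
  Rintegral leb `[-1, x] f - Rintegral leb `[-1, 0] f.

Lemma antider0 f : antider f 0 = 0.
Proof. by rewrite /antider subrr. Qed.

Lemma is_derive_antider f (x : R) : continuous f -> -1 < x ->
  is_derive x (1 : R) (antider f) (f x).
Proof.
move=> cf x1.
have xx1 : x < x + 1 by rewrite ltrDl.
have [dF eF] := continuous_FTC1_closed xx1 (integrable_itv_cts (-1) (x + 1) cf) x1 (cf x).
have D : is_derive x (1 : R) (fun y => Rintegral leb `[-1, y] f) (f x).
  by apply: DeriveDef; [exact: dF|rewrite -derive1E; exact: eF].
by apply: is_derive_eq; rewrite subr0.
Qed.

Lemma antiderE f t : continuous f -> 0 <= t ->
  antider f t = Rintegral leb `[0, t] f.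
Proof.
move=> cf t0.
have m10 : (-1 : R) < 0 by rewrite ltrN10.
have := FTC_R_gt m10 t0 (fun x => is_derive_antider cf) (fun x _ => cf x).
by rewrite antider0 subr0.
Qed.

Lemma L1_itv_cts (f : R -> R) a b : continuous f ->
  L1 leb (fun x => \1_`[a, b] x * f x).
Proof.
move=> cf; have := integrable_itv_cts a b cf.
rewrite integrable_mkcond//; apply: eq_integrable => // x _.
rewrite /= patchE /= indicE; case: ifPn => _ /=; by rewrite ?mul1r ?mul0r.
Qed.

Lemma I_itv_cts (f : R -> R) a b :
  I[leb] (fun x => \1_`[a, b] x * f x) = Rintegral leb `[a, b] f.
Proof.
rewrite [RHS]Rintegral_mkcond; apply: I_ext => x.
by rewrite /patch indicE; case: ifPn => _; rewrite ?mul1r ?mul0r.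
Qed.

Lemma I_exp_weight (b t : R) : 0 < b -> 0 <= t ->
  L1 leb (fun r => \1_`[0, t] r * expR (- (b * (t - r)))) /\
  b * I[leb] (fun r => \1_`[0, t] r * expR (- (b * (t - r)))) = 1 - expR (- (b * t)).
Proof.
move=> b0 t0.
have dE (x : R) : is_derive x (1 : R) (fun r => b^-1 * expR (- (b * (t - r))))
    (expR (- (b * (t - x)))).
  apply: is_derive_eq; rewrite /GRing.scale/=; field.
  by rewrite gt_eqF.
have cE : continuous (fun r : R => expR (- (b * (t - r)))).
  move=> x; apply: continuous_comp; last exact: continuous_expR.
  apply: continuousN; apply: continuousM; first exact: cst_continuous.
  by apply: continuousB; [exact: cst_continuous|exact: id].
split; first exact: L1_itv_cts.
rewrite I_itv_cts (FTC_R t0 dE cE) mulrBr !mulrA divff ?gt_eqF// !mul1r.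
by rewrite subrr mulr0 oppr0 expR0 addr0.
Qed.

End antiderivative.

Lemma L1_measurable_E d (T : measurableType d) (R : realType)
    (m : {measure set T -> \bar R}) (f : T -> R) :
  L1 m f -> measurable_fun setT (EFin \o f).
Proof. by move=> /L1_measurable mf; exact/measurable_EFinP. Qed.

Lemma measurable_indic_E d (T : measurableType d) (R : realType) (A : set T) :
  measurable A -> measurable_fun setT (fun x => (\1_A x : R)%:E).
Proof. by move=> mA; apply/measurable_EFinP; exact: measurable_indic. Qed.

(** * Contraction, positivity and translation estimates in L1 *)

Section stability.
Context {R : realType} {n : nat}.
Notation V := (n.-tuple R).
Notation leb := (leb R).
Variable m : {sigma_finite_measure set V -> \bar R}.
Hypothesis lm : is_lebesgue m.
Variables (a : R) (K : V -> R).
Hypotheses (a0 : 0 < a) (K0 : forall x, 0 <= K x) (LK : L1 m K) (IK : I[m] K = 1).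

Notation DuhK := (Duh m a K).
Notation DPK := (DP m a K).

Lemma admissibleS t t' w B : t <= t' -> admissible m t' w B -> admissible m t w B.
Proof.
move=> tt' [mw hw]; split=> // r /andP[r0 rt]; apply: hw.
by rewrite r0 (le_trans rt).
Qed.

Lemma I_dilate (f : V -> R) t : L1 m f ->
  L1 m (fun x => expR ((n%:R - a) * t) * f (vscale (expR t) x)) /\
  I[m] (fun x => expR ((n%:R - a) * t) * f (vscale (expR t) x)) =
  expR (- (a * t)) * I[m] f.
Proof.
move=> hf.
have E0 x : affine (expR t) [tuple 0 | _ < n] x = vscale (expR t) x.
  by apply: eq_tnthP => i; rewrite tnth_vsub [X in _ - X]tnth_mktuple subr0.
have e0 : expR t != 0 by rewrite gt_eqF// expR_gt0.
have L : L1 m (fun x => f (vscale (expR t) x)).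
  by apply: L1_ext (L1_affine lm [tuple 0 | _ < n] e0 hf) => x; rewrite E0.
split; first exact: L1Z.
rewrite I_Z// (I_ext m (g := fun x => f (affine (expR t) [tuple 0 | _ < n] x))); last first.
  by move=> x; rewrite E0.
by rewrite (I_affine lm _ e0 hf) expRVn mulrA expR_combine.
Qed.

Lemma I_DP1 t w B : 0 <= t -> admissible m t w B ->
  I[m] (DPK t w) = I[leb] (fun r => \1_`[0, t] r * expR (- (a * (t - r))) *
    I[m] (fun z => w (r, z))) /\
  L1 leb (fun r => \1_`[0, t] r * expR (- (a * (t - r))) * I[m] (fun z => w (r, z))).
Proof.
move=> t0 hw.
have abs1 (x : V) : `|1 : R| <= 1 by rewrite normr1.
have [E L] := I_DP lm a0 K0 LK IK hw (measurable_cst (1 : R)) abs1.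
have E1 : I[m] (fun y => 1 * K y) = 1.
  by rewrite -[RHS]IK; apply: I_ext => y; rewrite mul1r.
have E2 r : I[m] (fun z => w (r, z) * I[m] (fun y => 1 * K y)) = I[m] (fun z => w (r, z)).
  by apply: I_ext => z; rewrite E1 mulr1.
split.
  transitivity (I[m] (fun x => 1 * DPK t w x)).
    by apply: I_ext => x; rewrite mul1r.
  by rewrite E; apply: I_ext => r; rewrite E2.
by apply: L1_ext L => r; rewrite E2.
Qed.

(** A supremum argument replaces Gronwall: a bound [S] for the masses on [[0, T0]] improves to a
    convex combination of the initial mass and [S], in which the initial mass has weight at least
    [q = e^(-a T0)]. Applied to the supremum itself, this forces it below [I[m] w0]. *)
Lemma stability T0 B (w : measurableTypeR R * V -> R) (w0 : V -> R) :
  0 <= T0 -> admissible m T0 w B -> (forall p, 0 <= w p) -> L1 m w0 -> 0 <= I[m] w0 ->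
  (forall t, 0 <= t <= T0 -> {ae m, forall x,
    w (t, x) <= expR ((n%:R - a) * t) * w0 (vscale (expR t) x) + a * DPK t w x}) ->
  forall t, 0 <= t <= T0 -> I[m] (fun x => w (t, x)) <= I[m] w0.
Proof.
move=> T00 hw w_ge0 Lw0 I0 H.
pose N t := I[m] (fun x => w (t, x)).
have N0 t : 0 <= N t by exact: I_ge0.
have NB t : 0 <= t <= T0 -> N t <= B.
  move=> tT; have [_ +] := hw.2 t tT; apply: le_trans.
  by rewrite le_eqVlt; apply/orP; left; apply/eqP; apply: I_ext => x; rewrite ger0_norm.
have step S : (forall t, 0 <= t <= T0 -> N t <= S) ->
    forall t, 0 <= t <= T0 -> N t <= expR (- (a * t)) * I[m] w0 + (1 - expR (- (a * t))) * S.
  move=> NS t tT; have /andP[t0 tT0] := tT.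
  have ht := admissibleS tT0 hw.
  have [Ld Ed] := I_dilate t Lw0.
  have [EP LP] := I_DP1 t0 ht.
  have LDP := L1_DP lm a0 K0 LK IK ht.
  have [LW EW] := I_exp_weight a0 t0.
  apply: (@le_trans _ _ (I[m] (fun x =>
      expR ((n%:R - a) * t) * w0 (vscale (expR t) x) + a * DPK t w x))).
    apply: I_ae_le; [exact: (hw.2 t tT).1| |exact: H].
    by apply: L1D => //; exact: L1Z.
  rewrite I_D//; last exact: L1Z.
  rewrite Ed I_Z// EP lerD2l -EW -mulrA ler_pM2l// -I_Zr//.
  apply: I_le => //.
    by apply: L1_ext (L1Z S LW) => r; rewrite mulrC.
  move=> r; rewrite indicE; have [/set_mem/= rt|_] := boolP (_ \in _); last by rewrite !mul0r.
  rewrite !mul1r ler_wpM2l ?expR_ge0//; apply: NS.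
  by move: rt; rewrite in_itv/= => /andP[-> rt]; rewrite (le_trans rt).
pose E := [set N t | t in [set t | 0 <= t <= T0]].
have E0 : E !=set0 by exists (N 0), 0 => //=; rewrite lexx.
have hE : has_ubound E by exists B => _ [t tT <-]; exact: NB.
have NS t : 0 <= t <= T0 -> N t <= sup E.
  by move=> tT; apply: ub_le_sup => //; exists t.
suff : sup E <= I[m] w0.
  by move=> h t tT; exact: le_trans (NS t tT) h.
rewrite leNgt; apply/negP => lt.
pose q := expR (- (a * T0)).
have : sup E <= q * I[m] w0 + (1 - q) * sup E.
  apply: ge_sup => // _ [t tT <-]; apply: le_trans (step _ NS t tT) _.
  have qt : q <= expR (- (a * t)).
    by rewrite ler_expR lerN2 ler_pM2l//; case/andP: tT.
  rewrite -subr_ge0 (_ : _ - _ = (expR (- (a * t)) - q) * (sup E - I[m] w0)); last by ring.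
  by rewrite mulr_ge0 ?subr_ge0// ltW.
rewrite -subr_ge0 (_ : _ - _ = q * (I[m] w0 - sup E)); last by ring.
by rewrite pmulr_rge0 ?expR_gt0// subr_ge0 leNgt lt.
Qed.

Lemma admissible_norm t w B : admissible m t w B -> admissible m t (fun p => `|w p|) B.
Proof.
move=> [mw hw]; split; first exact: measurableT_comp.
move=> r /hw[L I]; split; first exact: L1_norm.
rewrite (I_ext m (g := fun z => `|w (r, z)|))// => z.
by rewrite normr_id.
Qed.

Lemma norm_DPB t w1 w2 B1 B2 B : admissible m t w1 B1 -> admissible m t w2 B2 ->
  admissible m t (fun p => w1 p - w2 p) B ->
  {ae m, forall x, `|DPK t w1 x - DPK t w2 x| <= DPK t (fun p => `|w1 p - w2 p|) x}.
Proof.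
move=> h1 h2 h.
have A1 := ae_L1_duh_ker lm a0 K0 LK IK h1.
have A2 := ae_L1_duh_ker lm a0 K0 LK IK h2.
apply: filterS2 A1 A2 => x L1x L2x; rewrite /DPK -I_B//.
apply: le_trans (I_norm (L1B L1x L2x)) _.
rewrite le_eqVlt; apply/orP; left; apply/eqP; apply: I_ext => p.
rewrite -(norm_duh_ker a K0 t (fun p => w1 p - w2 p)); congr `|_|.
by rewrite /duh_ker/=; ring.
Qed.

Section solution.
Variables (T0 B : R) (w : measurableTypeR R * V -> R) (u0 : V -> R).
Hypotheses (T00 : 0 <= T0) (hw : admissible m T0 w B) (Lu0 : L1 m u0).
Hypothesis eqw : forall t, 0 <= t <= T0 -> {ae m, forall x,
  w (t, x) = expR ((n%:R - a) * t) * u0 (vscale (expR t) x) + a * DuhK t w x}.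

(** [stability] with zero datum, applied to [|w| - w], which is twice the negative part: the
    nonnegative datum cancels in it, and positivity of the kernel bounds what remains by the Duhamel
    term of [|w| - w]. *)
Lemma solution_ge0 : (forall x, 0 <= u0 x) ->
  forall t, 0 <= t <= T0 -> {ae m, forall x, 0 <= w (t, x)}.
Proof.
move=> u00 t tT.
pose w1 (p : measurableTypeR R * V) : R := `|w p| - w p.
have w1_ge0 p : 0 <= w1 p by rewrite subr_ge0 ler_norm.
have an : admissible m T0 (fun p => `|w p|) B by exact: admissible_norm.
have a1 : admissible m T0 w1 (2 * B).
  split; first by apply: measurable_funB; [exact: an.1|exact: hw.1].
  move=> r rT; have [L I] := hw.2 r rT; split; first exact: L1B (L1_norm L) L.
  apply: (@le_trans _ _ (I[m] (fun z => 2 * `|w (r, z)|))).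
    apply: I_le; [exact: L1_norm (L1B (L1_norm L) L)|exact: L1Z (L1_norm L)|].
    move=> z; rewrite ger0_norm ?w1_ge0// mulr2n mulrDl mul1r lerD2l.
    by rewrite -normrN ler_norm.
  by rewrite I_Z; [rewrite ler_wpM2l|exact: L1_norm].
have := @stability T0 (2 * B) w1 (fun=> 0) T00 a1 w1_ge0 (L10 m).
rewrite I_0 lexx => /(_ isT) S.
have {}S := S _ t tT.
have I0 : I[m] (fun x => w1 (t, x)) = 0.
  apply/eqP; rewrite eq_le I_ge0// andbT; apply: S => r rT.
  have /andP[r0 rT0] := rT; have hr := admissibleS rT0 hw.
  have A1 := ae_L1_duh_ker lm a0 K0 LK IK hr.
  have A2 := Duh_DP lm a0 K0 LK IK hr.
  apply: filterS3 (eqw rT) A1 A2 => x Ex Lx; rewrite {1}/w1 Ex => ->.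
  rewrite mulr0 add0r.
  have -> : DPK r w1 x = I[prod_sigma_finite leb m] (fun p => `|duh_ker a K r w (p, x)|)
      - DPK r w x.
    rewrite -I_B//; last exact: L1_norm.
    by apply: I_ext => p; rewrite (norm_duh_ker a K0 r w) /duh_ker /w1/=; ring.
  have := I_norm Lx; rewrite -/(DPK r w x).
  set X := I[_] _; set Y := DPK r w x => YX.
  have e0 : 0 <= expR ((n%:R - a) * r) * u0 (vscale (expR r) x).
    by rewrite mulr_ge0 ?expR_ge0.
  move: e0; set e := _ * u0 _ => e0.
  have aYX : `|a * Y| <= a * X by rewrite normrM (gtr0_norm a0) ler_pM2l.
  have h : `|e + a * Y| <= e + `|a * Y| by rewrite (le_trans (ler_normD _ _))// ger0_norm.
  rewrite mulrBr; lra.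
have [L _] := a1.2 t tT.
have : {ae m, forall x, w1 (t, x) = 0}.
  have : (\int[m]_x `|(w1 (t, x))%:E| = 0)%E.
    rewrite -[RHS](congr1 EFin I0) (L1_EFin L); apply: eq_integral => x _.
    by rewrite gee0_abs// lee_fin.
  move=> /(ae_eq_integral_abs m measurableT (L1_measurable_E L)).
  by apply: filterS => x /(_ Logic.I)[].
apply: filterS => x; rewrite /w1 => /eqP; rewrite subr_eq0 => /eqP <-.
exact: normr_ge0.
Qed.

Lemma ae_shift (P : V -> Prop) c : {ae m, forall x, P x} -> {ae m, forall x, P (vsub x c)}.
Proof.
move=> [A [mA A0 sPA]]; exists ((fun x => vsub x c) @^-1` A); split.
- rewrite -[_ @^-1` _]setTI; apply: measurable_fun_vsub => //.
- have E x : affine 1 c x = vsub x c by rewrite /affine vscale1.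
  have H : (\int[m]_x (\1_A (affine 1 c x) : R)%:E = 0)%E.
    rewrite (@ge0_integral_affine _ _ _ lm 1 c (fun x => (\1_A x)%:E)) ?oner_neq0//.
    - rewrite integral_indic// setIT.
      by apply: etrans (mule0 _); congr (_ * _)%E; exact: A0.
    - exact: measurable_indic_E.
  rewrite -(setIT (_ @^-1` _)) -integral_indic//; last first.
    by rewrite -[_ @^-1` _]setTI; exact: measurable_fun_vsub.
  rewrite -[RHS]H.
  by apply: eq_integral => x _; rewrite E !indicE.
- by move=> x; exact: sPA.
Qed.

(** The dilation [e^(t-r)] turns the shift [e^-t y] into [e^-r y]: translating a solution by
    [e^-r y] at each time [r] gives again a solution, with datum shifted by [y], and the contraction
    applies to the difference. *)
Lemma Duh_shift t (w' : measurableTypeR R * V -> R) y x : measurable_fun setT w' ->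
  DuhK t w' (vsub x (vscale (expR (- t)) y)) =
  DuhK t (fun p => w' (p.1, vsub p.2 (vscale (expR (- p.1)) y))) x.
Proof.
move=> mw; rewrite /Duh; apply: eq_Rintegral => r _; congr (_ * _).
rewrite /Defs.conv/=; pose yr := vscale (expR (- r)) y.
pose G z := K (vsub (vscale (expR (t - r)) x) (vadd z yr)) * w' (r, z).
have mG : measurable_fun setT G.
  apply: measurable_funM; last exact: measurable_sec1.
  apply: (measurableT_comp (L1_measurable LK)); apply: measurable_fun_vsub => //.
  exact: measurable_fun_vsub.
transitivity (I[m] G).
  apply: I_ext => z; rewrite /G; congr (K _ * _); apply: eq_tnthP => i.
  rewrite 2!tnth_vsub tnth_vadd !tnth_vscale tnth_vsub tnth_vscale mulrBr.
  rewrite mulrA -expRD (_ : t - r - t = - r); ring.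
rewrite -(I_shift_gen lm yr mG); apply: I_ext => z; rewrite /G; congr (K _ * _).
by apply: eq_tnthP => i; rewrite 2!tnth_vsub tnth_vadd tnth_vsub subrK.
Qed.

Lemma solution_shift y t : 0 <= t <= T0 ->
  shift_dist m (fun x => w (t, x)) (vscale (expR (- t)) y) <= shift_dist m u0 y.
Proof.
move=> tT.
pose w' (p : measurableTypeR R * V) := w (p.1, vsub p.2 (vscale (expR (- p.1)) y)).
have mw' : measurable_fun setT w'.
  apply: (measurableT_comp hw.1); apply/prod_measurable_funP; split.
    exact: measurable_fst.
  apply: measurable_fun_vsub; first exact: measurable_snd.
  apply: measurable_fun_vscale => //; apply: measurableT_comp => //.
  by apply: measurableT_comp => //; exact: measurable_fst.
have a' : admissible m T0 w' B.
  split=> // r /hw.2[L I]; split.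
    by apply: L1_ext (L1_shift lm (vscale (expR (- r)) y) L) => x.
  by rewrite (I_shift lm (vscale (expR (- r)) y) (L1_norm L)).
pose w1 (p : measurableTypeR R * V) : R := w' p - w p.
have a1 : admissible m T0 w1 (B + B).
  split; first by apply: measurable_funB => //; exact: hw.1.
  move=> r rT; have [L I] := hw.2 r rT; have [L' I'] := a'.2 r rT.
  split; first exact: L1B.
  apply: (@le_trans _ _ (I[m] (fun z => `|w' (r, z)| + `|w (r, z)|))).
    apply: I_le; [exact: L1_norm (L1B L' L)|exact: L1D (L1_norm L') (L1_norm L)|].
    by move=> z; exact: ler_normB.
  by rewrite I_D; [exact: lerD|exact: L1_norm..].
have an := admissible_norm a1.
apply: (stability T00 an _ (L1_shift_dist lm y Lu0) (shift_dist_ge0 m u0 y) _ tT).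
  by move=> p; exact: normr_ge0.
move=> r rT; have /andP[r0 rT0] := rT.
have hr := admissibleS rT0 hw; have hr' := admissibleS rT0 a'.
have A := Duh_DP lm a0 K0 LK IK hr; have A' := Duh_DP lm a0 K0 LK IK hr'.
have N := norm_DPB hr' hr (admissibleS rT0 a1).
have E1 := eqw rT; have E2 := ae_shift (vscale (expR (- r)) y) (eqw rT).
apply: filterS3 (filterI A A') N (filterI E1 E2) => x [Ax Ax'] Nx [E1x E2x].
rewrite {1}/w1 {1}/w' /= E1x E2x Duh_shift; last exact: hw.1.
rewrite -/w' Ax Ax' (_ : vscale (expR r) (vsub x _) = vsub (vscale (expR r) x) y); last first.
  apply: eq_tnthP => i; rewrite tnth_vsub !tnth_vscale tnth_vsub tnth_vscale.
  by rewrite mulrBr mulrA -expRD subrr expR0 mul1r.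
set e := expR _; set p := u0 _; set q := u0 _; set X := DP _ _ _ _ _ _ in Nx *.
set Y := DP _ _ _ _ _ _ in Nx *.
rewrite (_ : _ - _ = e * (p - q) + a * (X - Y)); last by ring.
apply: (le_trans (ler_normD _ _)); rewrite !normrM (gtr0_norm a0) ger0_norm ?expR_ge0//.
by rewrite lerD2l ler_pM2l.
Qed.

Section fourier.
Variables (th th' : R -> R) (zeta : V).
Hypotheses (cth : continuous th) (cth' : continuous th')
  (th1 : forall x, `|th x| <= 1) (th1' : forall x, `|th' x| <= 1)
  (thD : forall A B, th (A + B) = th B * cos A + th' B * sin A).

Let meas (f : R -> R) xi : continuous f -> measurable_fun setT (fun x : V => f (vdot x xi)).
Proof.
by move=> cf; apply: (measurableT_comp (continuous_measurable_fun cf)); exact: measurable_fun_vdot.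
Qed.

Let F (f : R -> R) r := I[m] (fun x => f (vdot x (vscale (expR r) zeta)) * w (r, x)).
Let cK r := I[m] (fun x => cos (vdot x (vscale (expR r) zeta)) * K x).
Let sK r := I[m] (fun x => sin (vdot x (vscale (expR r) zeta)) * K x).

(** The addition rule for [th] and [th'] covers the cosine ([th' = - sin]) and the sine
    ([th' = cos]), so one computation yields both coupled equations. The frequency moves along the
    ray [e^r zeta], on which the transport term disappears. *)
Lemma solution_fourier t : 0 <= t <= T0 ->
  F th t = expR (- (a * t)) * I[m] (fun x => th (vdot x zeta) * u0 x) +
    a * I[leb] (fun r => \1_`[0, t] r * expR (- (a * (t - r))) *
      (F th r * cK r + F th' r * sK r)) /\
  L1 leb (fun r => \1_`[0, t] r * expR (- (a * (t - r))) *
      (F th r * cK r + F th' r * sK r)).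
Proof.
move=> tT; have /andP[t0 tT0] := tT; have ht := admissibleS tT0 hw.
pose xi := vscale (expR t) zeta.
have mt : measurable_fun setT (fun x : V => th (vdot x xi)) by exact: meas.
have [E L] := I_DP lm a0 K0 LK IK ht mt (fun x => th1 _).
have inner r : r \in `[0, t] -> I[m] (fun z => w (r, z) *
    I[m] (fun y => th (vdot (vscale (expR (- (t - r))) (vadd y z)) xi) * K y)) =
    F th r * cK r + F th' r * sK r.
  rewrite in_itv/= => /andP[r0 rt].
  have [Lw _] := hw.2 r (introT andP (conj r0 (le_trans rt tT0))).
  pose xr := vscale (expR r) zeta.
  have Ec : L1 m (fun y => cos (vdot y xr) * K y).
    by apply: (L1M (c := 1)) => //; [apply: meas; exact: continuous_cos|move=> x; exact: cos_max].
  have Es : L1 m (fun y => sin (vdot y xr) * K y).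
    by apply: (L1M (c := 1)) => //; [apply: meas; exact: continuous_sin|move=> x; exact: sin_max].
  have E1 z : I[m] (fun y => th (vdot (vscale (expR (- (t - r))) (vadd y z)) xi) * K y) =
      cK r * th (vdot z xr) + sK r * th' (vdot z xr).
    rewrite /cK /sK -!I_Zr// -I_D; [|by apply: L1_ext (L1Z (th (vdot z xr)) Ec) => y; rewrite mulrC|
      by apply: L1_ext (L1Z (th' (vdot z xr)) Es) => y; rewrite mulrC].
    apply: I_ext => y; rewrite vdotZl vdot_vadd !vdotZr mulrDr !mulrA -expRD.
    rewrite (_ : - (t - r) + t = r); last by ring.
    by rewrite thD; ring.
  have Lt : L1 m (fun x => th (vdot x xr) * w (r, x)).
    by apply: (L1M (c := 1)) => //; exact: meas.
  have Lt' : L1 m (fun x => th' (vdot x xr) * w (r, x)).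
    by apply: (L1M (c := 1)) => //; exact: meas.
  rewrite /F -!I_Zr// -I_D; [|by apply: L1_ext (L1Z (cK r) Lt) => y; rewrite mulrC|
      by apply: L1_ext (L1Z (sK r) Lt') => y; rewrite mulrC].
  by apply: I_ext => z; rewrite E1; ring.
have outer r : \1_`[0, t] r * expR (- (a * (t - r))) * I[m] (fun z => w (r, z) *
    I[m] (fun y => th (vdot (vscale (expR (- (t - r))) (vadd y z)) xi) * K y)) =
    \1_`[0, t] r * expR (- (a * (t - r))) * (F th r * cK r + F th' r * sK r).
  rewrite indicE; have [/set_mem/= rt|_] := boolP (_ \in _); last by rewrite !mul0r.
  by rewrite inner.
split; last by apply: L1_ext L.
rewrite -(I_ext leb outer) -E.
have LDP := L1_DP lm a0 K0 LK IK ht.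
have [Ld _] := I_dilate t Lu0.
have Lu : L1 m (fun x => th (vdot x zeta) * u0 x).
  by apply: (L1M (c := 1)) => //; exact: meas.
have [Ld' Ed'] := I_dilate t Lu.
rewrite -Ed'.
have Lth : L1 m (fun x => th (vdot x xi) * DPK t w x) by exact: (L1M (c := 1)).
rewrite -I_Z// -I_D//; last exact: L1Z.
apply: I_ae.
- by apply: measurable_funM => //; exact: measurable_sec1 hw.1.
- by apply: measurable_funD; apply: L1_measurable; [exact: Ld'|exact: (L1Z a Lth)].
have A := Duh_DP lm a0 K0 LK IK ht.
apply: filterS2 A (eqw tT) => x Ax ->.
rewrite Ax -/xi (_ : vdot (vscale (expR t) x) zeta = vdot x xi); last by rewrite vdotZl vdotZr.
by ring.
Qed.

End fourier.

End solution.
End stability.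

(** * Fourier transform of mild solutions *)

Section fourier_ode.
Context {R : realType}.
Notation leb := (leb R).
Variables (a T0 B : R) (X Y cK sK : R -> R) (X0 Y0 : R).
Hypothesis a0 : 0 < a.
Hypotheses (XB : forall t, 0 <= t <= T0 -> `|X t| <= B)
  (YB : forall t, 0 <= t <= T0 -> `|Y t| <= B)
  (cc : continuous cK) (cs : continuous sK)
  (c1 : forall r, `|cK r| <= 1) (s1 : forall r, `|sK r| <= 1).

Let mean (t : R) (f : R -> R) := I[leb] (fun r => \1_`[0, t] r * expR (- (a * (t - r))) * f r).
Let L1mean (t : R) (f : R -> R) :=
  L1 leb (fun r => \1_`[0, t] r * expR (- (a * (t - r))) * f r).

Hypotheses
  (eX : forall t, 0 <= t <= T0 ->
    X t = expR (- (a * t)) * X0 + a * mean t (fun r => X r * cK r - Y r * sK r) /\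
    L1mean t (fun r => X r * cK r - Y r * sK r))
  (eY : forall t, 0 <= t <= T0 ->
    Y t = expR (- (a * t)) * Y0 + a * mean t (fun r => X r * sK r + Y r * cK r) /\
    L1mean t (fun r => X r * sK r + Y r * cK r)).

Let Fc := antider cK.
Let Fs := antider sK.
(** [U] and [W] are the real and imaginary parts of [(X0 + i Y0) exp (a (Fc + i Fs))]. *)
Let U x := expR (a * Fc x) * (X0 * cos (a * Fs x) - Y0 * sin (a * Fs x)).
Let W x := expR (a * Fc x) * (X0 * sin (a * Fs x) + Y0 * cos (a * Fs x)).

Let dU (x : R) : -1 < x -> is_derive x (1 : R) U (a * (U x * cK x - W x * sK x)).
Proof.
move=> x1; have d1 := is_derive_antider cc x1; have d2 := is_derive_antider cs x1.
rewrite -/Fc -/Fs in d1 d2.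
by apply: is_derive_eq; rewrite /U /W /GRing.scale/=; ring.
Qed.

Let dW (x : R) : -1 < x -> is_derive x (1 : R) W (a * (U x * sK x + W x * cK x)).
Proof.
move=> x1; have d1 := is_derive_antider cc x1; have d2 := is_derive_antider cs x1.
rewrite -/Fc -/Fs in d1 d2.
by apply: is_derive_eq; rewrite /U /W /GRing.scale/=; ring.
Qed.

Let cts_derive (F f : R -> R) (x : R) : is_derive x (1 : R) F (f x) -> {for x, continuous F}.
Proof.
by move=> ?; apply: differentiable_continuous; apply/derivable1_diffP; exact: ex_derive.
Qed.

Let m10 : (-1 : R) < 0. Proof. by rewrite ltrN10. Qed.

Let U' t := expR (- (a * t)) * U t.
Let W' t := expR (- (a * t)) * W t.

(** The two exponentials multiply to the constant [e^(-a t)], so the Duhamel integral becomes an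
    increment of the primitive [F]. *)
Let meanE (F f : R -> R) (t : R) : 0 <= t ->
  (forall x : R, -1 < x -> is_derive x (1 : R) F (a * f x)) ->
  (forall x : R, -1 < x -> {for x, continuous f}) ->
  L1mean t (fun r => expR (- (a * r)) * f r) /\
  a * mean t (fun r => expR (- (a * r)) * f r) = expR (- (a * t)) * (F t - F 0).
Proof.
move=> t0 dF cf.
have caf x : -1 < x -> {for x, continuous (fun x => a * f x)}.
  by move=> x1; apply: continuousM; [exact: cst_continuous|exact: cf].
have Lf : L1 leb (fun r => \1_`[0, t] r * f r).
  have : leb.-integrable `[0, t] (EFin \o f).
    apply: continuous_compact_integrable; first exact: segment_compact.
    apply: continuous_in_subspaceT => x; rewrite inE/= in_itv/= => /andP[x0 _].
    by apply: cf; exact: lt_le_trans x0.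
  rewrite integrable_mkcond//; apply: eq_integrable => // x _.
  by rewrite /= patchE /= indicE; case: ifPn => _ /=; rewrite ?mul1r ?mul0r.
have E r : \1_`[0, t] r * expR (- (a * (t - r))) * (expR (- (a * r)) * f r) =
    expR (- (a * t)) * (\1_`[0, t] r * f r).
  rewrite (_ : expR (- (a * t)) = expR (- (a * (t - r))) * expR (- (a * r))); first by ring.
  by rewrite -expRD; congr expR; ring.
split; first by apply: L1_ext (L1Z (expR (- (a * t))) Lf) => r; rewrite E.
rewrite /mean (I_ext leb E) I_Z// mulrCA; congr (_ * _).
rewrite -(FTC_R_gt m10 t0 dF caf) -I_itv_cts -I_Z//.
by apply: I_ext => r; ring.
Qed.

Let cU x : -1 < x -> {for x, continuous U}.
Proof. by move=> /dU d; exact: (@cts_derive U (fun x => a * (U x * cK x - W x * sK x)) x d). Qed.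

Let cW x : -1 < x -> {for x, continuous W}.
Proof. by move=> /dW d; exact: (@cts_derive W (fun x => a * (U x * sK x + W x * cK x)) x d). Qed.

Let U0 : U 0 = X0.
Proof. by rewrite /U /Fc /Fs !antider0 !mulr0 expR0 cos0 sin0; ring. Qed.

Let W0 : W 0 = Y0.
Proof. by rewrite /W /Fc /Fs !antider0 !mulr0 expR0 cos0 sin0; ring. Qed.

Let eU t : 0 <= t ->
  U' t = expR (- (a * t)) * X0 + a * mean t (fun r => U' r * cK r - W' r * sK r) /\
  L1mean t (fun r => U' r * cK r - W' r * sK r).
Proof.
move=> t0.
have cf x : -1 < x -> {for x, continuous (fun x => U x * cK x - W x * sK x)}.
  move=> x1; apply: continuousB; apply: continuousM; [exact: cU|exact: cc|exact: cW|exact: cs].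
have [L E] := meanE t0 dU cf.
have EE r : expR (- (a * r)) * (U r * cK r - W r * sK r) = U' r * cK r - W' r * sK r.
  by rewrite /U' /W'; ring.
rewrite -(funext EE); split=> //.
by rewrite E U0 /U'; ring.
Qed.

Let eW t : 0 <= t ->
  W' t = expR (- (a * t)) * Y0 + a * mean t (fun r => U' r * sK r + W' r * cK r) /\
  L1mean t (fun r => U' r * sK r + W' r * cK r).
Proof.
move=> t0.
have cf x : -1 < x -> {for x, continuous (fun x => U x * sK x + W x * cK x)}.
  move=> x1; apply: continuousD; apply: continuousM; [exact: cU|exact: cs|exact: cW|exact: cc].
have [L E] := meanE t0 dW cf.
have EE r : expR (- (a * r)) * (U r * sK r + W r * cK r) = U' r * sK r + W' r * cK r.
  by rewrite /U' /W'; ring.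
rewrite -(funext EE); split=> //.
by rewrite E W0 /W'; ring.
Qed.

Let Fc_le t : 0 <= t -> Fc t <= t.
Proof.
move=> t0; rewrite /Fc antiderE// -I_itv_cts.
have c1t : continuous (fun _ : R => 1 : R) by exact: cst_continuous.
have E : Rintegral leb `[0, t] (fun=> 1) = t.
  have d1 (x : R) : is_derive x (1 : R) (fun x => x) (1 : R) by exact: is_derive_id.
  by rewrite (FTC_R t0 d1 c1t) subr0.
rewrite -[leRHS]E -I_itv_cts; apply: I_le; [exact: L1_itv_cts|exact: L1_itv_cts|] => r.
apply: ler_wpM2l; [exact: indic_ge0|exact: le_trans (ler_norm _) (c1 _)].
Qed.

Let U'B t : 0 <= t -> `|U' t| <= `|X0| + `|Y0| /\ `|W' t| <= `|X0| + `|Y0|.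
Proof.
move=> t0.
have e1 : expR (- (a * t)) * expR (a * Fc t) <= 1.
  rewrite -expRD -expR0 ler_expR addrC subr_le0 ler_pM2l//.
  exact: Fc_le.
have bnd b c : `|b| <= 1 -> `|c| <= 1 -> `|X0 * b + Y0 * c| <= `|X0| + `|Y0|.
  move=> b1 c1'; apply: le_trans (ler_normD _ _) _; rewrite !normrM.
  by apply: lerD; rewrite ler_piMr.
rewrite /U' /W' /U /W !mulrA !normrM !(ger0_norm (expR_ge0 _)).
have cm := cos_max (a * Fs t); have sm := sin_max (a * Fs t).
split; (apply: le_trans (_ : 1 * _ <= _); [apply: ler_wpM2r; [exact: normr_ge0|exact: e1]|rewrite mul1r]).
- by rewrite -mulrN; apply: bnd => //; rewrite normrN.
- exact: bnd.
Qed.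

Let N t := `|X t - U' t| + `|Y t - W' t|.

(** The weight makes the integral operator a contraction: [e^(-a(t-r)) e^(3 a r) = e^(3 a t) e^(-4 a
    (t-r))], so each of the two components gains [a / (4 a)], together [1/2]. *)
Let N_mean t : 0 <= t <= T0 -> forall S, (forall r, 0 <= r <= t -> N r <= S * expR (3 * a * r)) ->
  N t <= 2^-1 * S * expR (3 * a * t).
Proof.
move=> tT S NS; have /andP[t0 _] := tT.
have [EX LX] := eX tT; have [EY LY] := eY tT.
have [EU LU] := eU t0; have [EW LW] := eW t0.
have S0 : 0 <= S.
  have := NS 0; rewrite lexx t0 mulr0 expR0 mulr1 => /(_ isT); apply: le_trans.
  by rewrite addr_ge0.
have a4 : 0 < 4 * a by rewrite mulr_gt0.
have [LE EE] := I_exp_weight a4 t0.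
pose g r := (S * expR (3 * a * t)) * (\1_`[0, t] r * expR (- (4 * a * (t - r)))).
have Lg : L1 leb g by exact: L1Z.
have core f1 f2 : L1mean t f1 -> L1mean t f2 ->
    (forall r, 0 <= r <= t -> `|f1 r - f2 r| <= N r) ->
    a * `|mean t f1 - mean t f2| <= 4^-1 * S * expR (3 * a * t).
  move=> L1f L2f f12.
  rewrite /mean -I_B//.
  apply: (@le_trans _ _ (a * I[leb] g)); last first.
    have -> : a * I[leb] g = 4^-1 * S * expR (3 * a * t) * (4 * a *
        I[leb] (fun r => \1_`[0, t] r * expR (- (4 * a * (t - r))))).
      by rewrite {1}/g I_Z//; field.
    rewrite EE ler_piMr ?mulr_ge0 ?expR_ge0 ?invr_ge0//.
  rewrite ler_pM2l//; apply: I_le_norm => //; first exact: L1_measurable (L1B L1f L2f).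
  move=> r; rewrite -mulrBr !normrM (ger0_norm (expR_ge0 _)) (ger0_norm (indic_ge0 _ _)).
  rewrite /g indicE; have [/set_mem/= rt|_] := boolP (_ \in _); last by rewrite !mul0r mulr0.
  move: rt; rewrite in_itv/= => rt; rewrite !mul1r.
  rewrite (_ : S * _ * _ = expR (- (a * (t - r))) * (S * expR (3 * a * r))).
    by rewrite ler_wpM2l ?expR_ge0// (le_trans (f12 r rt))// NS.
  by rewrite mulrCA -mulrA -!expRD; congr (_ * expR _); ring.
rewrite {1}/N EX EY EU EW.
have -> : 2^-1 * S * expR (3 * a * t) =
   4^-1 * S * expR (3 * a * t) + 4^-1 * S * expR (3 * a * t) by field.
have nE p q r : `|p + a * q - (p + a * r)| = a * `|q - r| :> R.
  by rewrite (_ : _ - _ = a * (q - r)) ?normrM ?(gtr0_norm a0)//; ring.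
rewrite !nE; apply: lerD; apply: core => // r rt.
  rewrite (_ : _ - _ = (X r - U' r) * cK r - (Y r - W' r) * sK r); last by ring.
  apply: le_trans (ler_normB _ _) _; rewrite !normrM.
  by apply: lerD; rewrite ler_piMr.
rewrite (_ : _ - _ = (X r - U' r) * sK r + (Y r - W' r) * cK r); last by ring.
apply: le_trans (ler_normD _ _) _; rewrite !normrM.
by apply: lerD; rewrite ler_piMr.
Qed.

(** [X] and [Y] are only known to be bounded, with no derivative at hand, so uniqueness is drawn
    from the integral equations: iterating [N_mean] gives [N t <= 2^-j M e^(3 a t)] for every
    [j]. *)
Lemma fourier_ode t : 0 <= t <= T0 ->
  X t = expR (- (a * (t - Rintegral leb `[0, t] cK))) *
     (X0 * cos (a * Rintegral leb `[0, t] sK) - Y0 * sin (a * Rintegral leb `[0, t] sK)) /\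
  Y t = expR (- (a * (t - Rintegral leb `[0, t] cK))) *
     (X0 * sin (a * Rintegral leb `[0, t] sK) + Y0 * cos (a * Rintegral leb `[0, t] sK)).
Proof.
move=> tT; have /andP[t0 tT0] := tT.
pose M := (B + (`|X0| + `|Y0|)) + (B + (`|X0| + `|Y0|)).
have NM j : forall r, 0 <= r <= T0 -> N r <= 2^-1 ^+ j * M * expR (3 * a * r).
  elim: j => [|j IH] r rT; have /andP[r0 rT0] := rT.
    rewrite expr0 mul1r; have [u1 w1] := U'B r0.
    have NrM : N r <= M.
      apply: lerD; apply: le_trans (ler_normB _ _) _; apply: lerD => //.
      - exact: XB.
      - exact: YB.
    apply: (le_trans NrM); rewrite ler_peMr//.
      by apply: le_trans NrM; rewrite addr_ge0.
    by rewrite -expR0 ler_expR !mulr_ge0// ltW.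
  rewrite exprS -[_ * _ * M]mulrA; apply: N_mean => // q /andP[q0 qr].
  by apply: IH; rewrite q0 (le_trans qr).
have N0 : N t = 0.
  apply/eqP; rewrite eq_le; apply/andP; split; last by rewrite addr_ge0.
  have : (fun j => 2^-1 ^+ j * M * expR (3 * a * t)) j @[j --> \oo] --> 0 * M * expR (3 * a * t).
    apply: cvgMl; apply: cvgMl; apply: cvg_expr.
    by rewrite ger0_norm ?invr_ge0// invf_lt1// ltr1n.
  rewrite !mul0r => H; apply: (cvgr_to_ge H); apply: nearW => j.
  exact: NM.
have [XU YW] : X t = U' t /\ Y t = W' t.
  move: N0 => /eqP; rewrite paddr_eq0// !normr_eq0 !subr_eq0 => /andP[/eqP-> /eqP->].
  by [].
rewrite XU YW /U' /W' /U /W /Fc /Fs !antiderE//.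
have -> : expR (- (a * (t - Rintegral leb `[0, t] cK))) =
    expR (- (a * t)) * expR (a * Rintegral leb `[0, t] cK).
  by rewrite -expRD; congr expR; ring.
by rewrite !mulrA.
Qed.

End fourier_ode.

Section kernel_scaling.
Context {R : realType} {n : nat}.
Notation V := (n.-tuple R).
Variable m : {measure set V -> \bar R}.
Hypothesis lm : is_lebesgue m.

Definition ft_s (f : V -> R) (xi : V) : R := I[m] (fun x => sin (vdot x xi) * f x).

Lemma ft_imE f xi : ft_im m f xi = - ft_s f xi.
Proof. by []. Qed.

Lemma measurable_trig (th : R -> R) xi : continuous th ->
  measurable_fun setT (fun x : V => th (vdot x xi)).
Proof.
by move=> cf; apply: (measurableT_comp (continuous_measurable_fun cf)); exact: measurable_fun_vdot.
Qed.

Lemma L1_cos f xi : L1 m f -> L1 m (fun x => cos (vdot x xi) * f x).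
Proof.
move=> hf; apply: (L1M (c := 1)) => //; last by move=> x; exact: cos_max.
by apply: measurable_trig; exact: continuous_cos.
Qed.

Lemma L1_sin f xi : L1 m f -> L1 m (fun x => sin (vdot x xi) * f x).
Proof.
move=> hf; apply: (L1M (c := 1)) => //; last by move=> x; exact: sin_max.
by apply: measurable_trig; exact: continuous_sin.
Qed.

Lemma ft_re_le1 f xi : L1 m f -> `|ft_re m f xi| <= I[m] (fun x => `|f x|).
Proof.
move=> hf; apply: I_le_norm; [exact: L1_norm|exact: L1_measurable (L1_cos xi hf)|].
by move=> x; rewrite normrM ler_piMl// cos_max.
Qed.

Lemma ft_s_le1 f xi : L1 m f -> `|ft_s f xi| <= I[m] (fun x => `|f x|).
Proof.
move=> hf; apply: I_le_norm; [exact: L1_norm|exact: L1_measurable (L1_sin xi hf)|].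
by move=> x; rewrite normrM ler_piMl// sin_max.
Qed.

Lemma prob_densityP f : prob_density m f ->
  [/\ forall x, 0 <= f x, L1 m f & I[m] f = 1].
Proof.
move=> [mf [f0 If]]; split=> //.
  by apply: (L1_bound (c := 1) mf f0 _).1; rewrite If.
by rewrite /Rintegral If.
Qed.

Lemma continuous_curve (th : R -> R) (f : V -> R) zeta : continuous th ->
  (forall x, `|th x| <= 1) -> L1 m f ->
  continuous (fun r => I[m] (fun x => th (vdot x (vscale (expR r) zeta)) * f x)).
Proof.
move=> cth th1 hf r; apply/(@cvg_nbhsP _ R^o) => u ur.
apply: (I_dct (g := fun x => `|f x|) _ _ _ _).2.
- move=> k; apply: measurable_funM; last exact: (L1_measurable hf).
  exact: measurable_trig.
- exact: L1_norm.
- by move=> k x; rewrite normrM ler_piMl.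
- move=> x; apply: cvgnM; last exact: cvgn_cst.
  have cv : {for r, continuous (fun r => th (vdot x (vscale (expR r) zeta)))}.
    rewrite (_ : (fun _ => _) = th \o (fun r => expR r * vdot x zeta)); last first.
      by apply/funext => q /=; rewrite vdotZr.
    apply: continuous_comp; last exact: cth.
    by apply: continuousM; [exact: continuous_expR|exact: cst_continuous].
  by move/(@cvg_nbhsP _ R^o) : cv; exact.
Qed.

Variables (eps : R) (J : V -> R).
Hypotheses (eps0 : 0 < eps) (J0 : forall x, 0 <= J x) (LJ : L1 m J) (IJ : I[m] J = 1).

Let K := kscale eps J.

Let E0 x : affine eps^-1 [tuple 0 | _ < n] x = vscale eps^-1 x.
Proof. by apply: eq_tnthP => i; rewrite tnth_vsub [X in _ - X]tnth_mktuple subr0. Qed.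

Let ev0 : eps^-1 != 0. Proof. by rewrite invr_eq0 gt_eqF. Qed.

Lemma kscale_I (f : V -> R) : L1 m f ->
  L1 m (kscale eps f) /\ I[m] (kscale eps f) = I[m] f.
Proof.
move=> hf; have L := L1_affine lm [tuple 0 | _ < n] ev0 hf.
have E := I_affine lm [tuple 0 | _ < n] ev0 hf.
have L' : L1 m (fun x => f (vscale eps^-1 x)) by apply: L1_ext L => x; rewrite E0.
split; first exact: L1Z.
rewrite /kscale I_Z// -(I_ext m (fun x => congr1 f (E0 x))) E.
rewrite gtr0_norm ?invr_gt0// exprVn invrK powRN powR_mulrn ?ltW//.
by rewrite mulrA mulVf ?mul1r// gt_eqF// exprn_gt0.
Qed.

Lemma kscale_ge0 x : 0 <= K x.
Proof. by rewrite /K /kscale mulr_ge0// powR_ge0. Qed.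

Lemma L1_kscale : L1 m K.
Proof. exact: (kscale_I LJ).1. Qed.

Lemma I_kscale : I[m] K = 1.
Proof. by rewrite (kscale_I LJ).2. Qed.

Lemma ft_re_kscale xi : ft_re m K xi = ft_re m J (vscale eps xi).
Proof.
rewrite -[RHS](kscale_I (L1_cos (vscale eps xi) LJ)).2; apply: I_ext => x.
by rewrite /K /kscale vdotZl vdotZr mulKf ?gt_eqF//; ring.
Qed.

Lemma ft_s_kscale xi : ft_s K xi = ft_s J (vscale eps xi).
Proof.
rewrite -[RHS](kscale_I (L1_sin (vscale eps xi) LJ)).2; apply: I_ext => x.
by rewrite /K /kscale vdotZl vdotZr mulKf ?gt_eqF//; ring.
Qed.

End kernel_scaling.

(** * From mild solutions to explicit transforms *)

Section mild.
Context {R : realType} {n : nat}.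
Notation V := (n.-tuple R).
Notation leb := (leb R).
Variable m : {sigma_finite_measure set V -> \bar R}.
Hypothesis lm : is_lebesgue m.
Variables (k s eps : R) (J u0 : V -> R) (u : R -> V -> R).
Hypotheses (k0 : 0 <= k) (eps0 : 0 < eps) (pJ : prob_density m J) (pu0 : prob_density m u0)
  (ms : mild_solution m k s eps J u0 u).

Let a := eps `^ (- (2 * s)).
Let a0 : 0 < a. Proof. exact: powR_gt0. Qed.

Lemma jbr_ge1 (x : V) : 1 <= jbr x.
Proof. by rewrite /jbr -[leLHS]sqrtr1 ler_wsqrtr// lerDl sqr_ge0. Qed.

Lemma jbr_powR_ge1 (x : V) : 1 <= jbr x `^ k.
Proof. by rewrite -[leLHS](congr1 (@^~ k) (powR1 R)) ge0_ler_powR// ?nnegrE// ?jbr_ge1// (le_trans ler01) ?jbr_ge1. Qed.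

Lemma measurable_jbr_powR : measurable_fun setT (fun x : V => jbr x `^ k).
Proof.
apply: (measurableT_comp (measurable_powR k)).
rewrite /jbr; apply: (measurableT_comp (continuous_measurable_fun (@sqrt_continuous R))).
by apply: measurable_funD => //; apply: measurable_funX; exact: measurable_vnorm.
Qed.

Lemma L1k_lty f : measurable_fun setT f -> (L1k_norm m k f < +oo)%E ->
  [/\ L1 m (fun x => jbr x `^ k * `|f x|), L1 m f,
    L1k_norm m k f = (I[m] (fun x => jbr x `^ k * `|f x|))%:E &
    I[m] (fun x => `|f x|) <= I[m] (fun x => jbr x `^ k * `|f x|)].
Proof.
move=> mf fk.
have L : L1 m (fun x => jbr x `^ k * `|f x|).
  apply: L1P.
    by apply: measurable_funM; [exact: measurable_jbr_powR|exact: measurableT_comp].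
  apply: le_lt_trans fk; rewrite /L1k_norm le_eqVlt; apply/orP; left; apply/eqP.
  by apply: eq_integral => x _; rewrite ger0_norm// mulr_ge0// powR_ge0.
have fle x : `|f x| <= jbr x `^ k * `|f x| by rewrite ler_peMl// jbr_powR_ge1.
have Lf : L1 m f by exact: L1_le L.
by split=> //; [rewrite L1_EFin|apply: I_le => //; exact: L1_norm].
Qed.

Lemma mild_L1 t : 0 <= t -> L1 m (u t).
Proof. by move=> /ms.1[mu uk]; have [] := L1k_lty mu uk. Qed.

Lemma mild_cts t : 0 <= t -> forall e : R, 0 < e -> exists2 eta : R, 0 < eta &
  forall t', 0 <= t' -> `|t' - t| < eta -> I[m] (fun x => `|u t' x - u t x|) < e.
Proof.
move=> t0 e e0; have [eta eta0 H] := ms.2.1 t t0 e e0; exists eta => // t' t'0 tt'.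
have mB : measurable_fun setT (fun x => u t' x - u t x).
  by apply: measurable_funB; [exact: (ms.1 _ t'0).1|exact: (ms.1 _ t0).1].
have := H _ t'0 tt'; case: (L1k_lty mB _) => [|_ _ -> h].
  by apply: lt_trans (H _ t'0 tt') _; rewrite ltry.
by rewrite lte_fin; exact: le_lt_trans.
Qed.

(** Uniform continuity gives a step length over which the norm grows by at most 1; finitely many
    such steps reach [T0]. *)
Lemma curve_bounded T0 : 0 <= T0 -> exists B, forall t, 0 <= t <= T0 ->
  I[m] (fun x => `|u t x|) <= B.
Proof.
move=> T00; have [del del0 H] := unif_cts_curve mild_L1 mild_cts T0 ltr01.
pose N t := I[m] (fun x => `|u t x|).
have step t t' : 0 <= t <= T0 -> 0 <= t' <= T0 -> `|t' - t| < del -> N t' <= N t + 1.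
  move=> tT t'T /(H _ _ tT t'T) h.
  have L := mild_L1 (andP tT).1; have L' := mild_L1 (andP t'T).1.
  apply: (@le_trans _ _ (N t + I[m] (fun x => `|u t' x - u t x|))); last by rewrite lerD2l.
  rewrite -I_D; [|exact: L1_norm|exact: L1_norm (L1B L' L)].
  apply: I_le; [exact: L1_norm|apply: L1D; [exact: L1_norm|exact: L1_norm (L1B L' L)]|].
  by move=> x; rewrite -[leLHS]/(`|u t' x|) (le_trans _ (ler_normD _ _))// addrC subrK.
pose h := del / 2; have h0 : 0 < h by rewrite divr_gt0.
have iter j : forall t, 0 <= t <= T0 -> t <= j%:R * h -> N t <= N 0 + j%:R.
  elim: j => [|j IH] t tT; have /andP[t0 tT0] := tT.
    by rewrite mul0r addr0 => t00; rewrite (_ : t = 0)//; apply/eqP; rewrite eq_le t00.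
  have [tj _|jt tj] := leP t (j%:R * h).
    by apply: le_trans (IH t tT tj) _; rewrite lerD2l ler_nat.
  have j0 : 0 <= j%:R * h by rewrite mulr_ge0// ltW.
  have jT : 0 <= j%:R * h <= T0 by rewrite j0 (le_trans (ltW jt)).
  apply: le_trans (step _ _ jT tT _) _.
    rewrite ger0_norm ?subr_ge0 ?(ltW jt)//.
    move: tj; rewrite -natr1 mulrDl mul1r => tj.
    rewrite ltrBlDl (le_lt_trans tj)// ltrD2l /h ltr_pdivrMr// ltr_pMr// ltr1n//.
  by rewrite -natr1 addrA lerD2r IH.
exists (N 0 + (Num.bound (T0 / h))%:R) => t tT; apply: iter => //.
have /andP[_ /le_trans] := tT; apply; rewrite -ler_pdivrMr//.
apply: ltW; apply: archi_boundP.
by rewrite divr_ge0// ltW.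
Qed.

Let K := kscale eps J.

(** At each [r] the inner convolution sees [u r] only up to null sets, so the Duhamel formula passes
    to the jointly measurable version. *)
Lemma mild_version T0 : 0 <= T0 -> exists (w : measurableTypeR R * V -> R) (B : R),
  [/\ admissible m T0 w B,
    forall t, 0 <= t <= T0 -> {ae m, forall x, w (t, x) = u t x} &
    forall t, 0 <= t <= T0 -> {ae m, forall x, w (t, x) =
      expR ((n%:R - a) * t) * u0 (vscale (expR t) x) + a * Duh m a K t w x}].
Proof.
move=> T00; have [B uB] := curve_bounded T00.
have [w [mw wu]] := joint_version mild_L1 mild_cts T0.
have Iw (f g : V -> R) : measurable_fun setT f -> measurable_fun setT g ->
    {ae m, forall x, f x = g x} -> I[m] f = I[m] g by exact: I_ae.
exists w, B; split=> //.
- split=> // r rT; have Lu := mild_L1 (andP rT).1.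
  have ms1 : measurable_fun setT (fun z => w (r, z)) by exact: measurable_sec1.
  split; first by exact: L1_ae ms1 Lu (wu r rT).
  rewrite (I_ae _ _ (g := fun z => `|u r z|)).
  + exact: uB.
  + exact: measurableT_comp.
  + exact: L1_measurable (L1_norm Lu).
  + by apply: filterS (wu r rT) => x ->.
- move=> t tT; have /andP[t0 tT0] := tT.
  apply: filterS2 (wu t tT) (ms.2.2 t t0) => x -> ->; congr (_ + _ * _).
  apply: eq_Rintegral => r; rewrite inE/= => /andP[r0 rt].
  congr (_ * _); rewrite /Defs.conv; have rT : 0 <= r <= T0 by rewrite r0 (le_trans rt).
  have mK : measurable_fun setT K.
    have [_ LJ _] := prob_densityP pJ; exact: L1_measurable (L1_kscale lm eps0 LJ).
  have mKx : measurable_fun setT (fun z => K (vsub (vscale (expR (t - r)) x) z)).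
    by apply: (measurableT_comp mK); exact: measurable_fun_vsub.
  apply: I_ae.
  + by apply: measurable_funM => //; exact: (ms.1 _ r0).1.
  + by apply: measurable_funM => //; exact: measurable_sec1.
  + by apply: filterS (wu r rT) => z ->.
Qed.

Let hJ := prob_densityP pJ.
Let K0 x : 0 <= K x. Proof. by case: hJ => J0 _ _; exact: kscale_ge0. Qed.
Let LK : L1 m K. Proof. by case: hJ => _ LJ _; exact: L1_kscale. Qed.
Let IK : I[m] K = 1. Proof. by case: hJ => _ LJ IJ; rewrite (I_kscale lm eps0 LJ). Qed.

Lemma mild_ge0 t : 0 <= t -> {ae m, forall x, 0 <= u t x}.
Proof.
move=> t0; have [w [B [hw wu E]]] := mild_version t0.
have [u00 Lu0 _] := prob_densityP pu0.
have tt : 0 <= t <= t by rewrite t0 lexx.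
have := solution_ge0 lm a0 K0 LK IK t0 hw E u00 tt.
by apply: filterS2 (wu t tt) => x ->.
Qed.

Lemma shift_dist_ae f g y : measurable_fun setT f -> measurable_fun setT g ->
  {ae m, forall x, f x = g x} -> shift_dist m f y = shift_dist m g y.
Proof.
move=> mf mg fg; apply: I_ae.
- apply: measurableT_comp => //; apply: measurable_funB => //.
  by apply: (measurableT_comp mf); exact: measurable_fun_vsub.
- apply: measurableT_comp => //; apply: measurable_funB => //.
  by apply: (measurableT_comp mg); exact: measurable_fun_vsub.
- by apply: filterS2 fg (ae_shift lm y fg) => x -> ->.
Qed.

Lemma mild_shift t y : 0 <= t ->
  shift_dist m (u t) (vscale (expR (- t)) y) <= shift_dist m u0 y.
Proof.
move=> t0; have [w [B [hw wu E]]] := mild_version t0.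
have [u00 Lu0 _] := prob_densityP pu0.
have tt : 0 <= t <= t by rewrite t0 lexx.
have := solution_shift lm a0 K0 LK IK t0 hw Lu0 E y tt.
apply: le_trans; rewrite (shift_dist_ae _ _ _ (wu t tt))//.
- exact: measurable_sec1 hw.1.
- exact: (ms.1 _ t0).1.
Qed.

(** As [ft_s] is the sine transform, [1 - J^] has real part [1 - ft_re] and imaginary part [ft_s]:
    the decay and phase exponents are the real and imaginary parts of [A_t xi]. *)
Definition decay_exponent t (xi : V) :=
  a * (t - Rintegral leb `[0, t] (fun r => ft_re m J (vscale (eps * expR (r - t)) xi))).
Definition phase_exponent t (xi : V) :=
  a * Rintegral leb `[0, t] (fun r => ft_s m J (vscale (eps * expR (r - t)) xi)).

Lemma mild_fourier t xi : 0 <= t ->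
  ft_re m (u t) xi = expR (- decay_exponent t xi) *
    (ft_re m u0 (vscale (expR (- t)) xi) * cos (phase_exponent t xi) -
     ft_s m u0 (vscale (expR (- t)) xi) * sin (phase_exponent t xi)) /\
  ft_s m (u t) xi = expR (- decay_exponent t xi) *
    (ft_re m u0 (vscale (expR (- t)) xi) * sin (phase_exponent t xi) +
     ft_s m u0 (vscale (expR (- t)) xi) * cos (phase_exponent t xi)).
Proof.
move=> t0; have [w [B [hw wu E]]] := mild_version t0.
have [u00 Lu0 _] := prob_densityP pu0.
have [J0 LJ IJ] := hJ.
have tt : 0 <= t <= t by rewrite t0 lexx.
(* The ray [e^r zeta] passes through [e^-t xi] at time 0 and through [xi] at time [t]. *)
pose zeta := vscale (expR (- t)) xi.
pose cK r := ft_re m K (vscale (expR r) zeta).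
pose sK r := ft_s m K (vscale (expR r) zeta).
pose X r := ft_re m (fun x => w (r, x)) (vscale (expR r) zeta).
pose Y r := ft_s m (fun x => w (r, x)) (vscale (expR r) zeta).
have cc : continuous cK by apply: continuous_curve => //; [exact: continuous_cos|exact: cos_max].
have cs : continuous sK by apply: continuous_curve => //; [exact: continuous_sin|exact: sin_max].
have nK : I[m] (fun x => `|K x|) = 1.
  by rewrite -[RHS]IK; apply: I_ext => x; rewrite ger0_norm.
have cK1 r : `|cK r| <= 1 by rewrite -nK; exact: ft_re_le1.
have sK1 r : `|sK r| <= 1 by rewrite -nK; exact: ft_s_le1.
have XB r : 0 <= r <= t -> `|X r| <= B.
  by move=> rt; have [L] := hw.2 r rt; apply: le_trans; exact: ft_re_le1.
have YB r : 0 <= r <= t -> `|Y r| <= B.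
  by move=> rt; have [L] := hw.2 r rt; apply: le_trans; exact: ft_s_le1.
have nsin : continuous (fun x : R => - sin x).
  by move=> x; apply: continuousN; exact: continuous_sin.
have nsin1 (x : R) : `|- sin x| <= 1 by rewrite normrN sin_max.
have NI r : I[m] (fun x => - sin (vdot x (vscale (expR r) zeta)) * w (r, x)) = - Y r.
  rewrite /Y /ft_s -mulN1r -I_Zgen.
    by apply: I_ext => x; rewrite mulN1r mulNr.
  apply: measurable_funM; last exact: measurable_sec1 hw.1.
  by apply: measurable_trig; exact: continuous_sin.
have cosA A C : cos (A + C) = cos C * cos A + - sin C * sin A :> R by rewrite cosD; ring.
have sinA A C : sin (A + C) = sin C * cos A + cos C * sin A :> R by rewrite sinD; ring.
have eX r : 0 <= r <= t -> X r = expR (- (a * r)) * ft_re m u0 zeta +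
    a * I[leb] (fun q => \1_`[0, r] q * expR (- (a * (r - q))) * (X q * cK q - Y q * sK q)) /\
    L1 leb (fun q => \1_`[0, r] q * expR (- (a * (r - q))) * (X q * cK q - Y q * sK q)).
  move=> rt.
  have [e1 e2] := solution_fourier lm a0 K0 LK IK hw Lu0 E zeta (@continuous_cos R) nsin
    (@cos_max R) nsin1 cosA rt.
  split.
    by apply: etrans e1 _; congr (_ + _ * _); apply: I_ext => q; rewrite NI mulNr.
  by apply: L1_ext e2 => q; rewrite NI mulNr.
have eY r : 0 <= r <= t -> Y r = expR (- (a * r)) * ft_s m u0 zeta +
    a * I[leb] (fun q => \1_`[0, r] q * expR (- (a * (r - q))) * (X q * sK q + Y q * cK q)) /\
    L1 leb (fun q => \1_`[0, r] q * expR (- (a * (r - q))) * (X q * sK q + Y q * cK q)).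
  move=> rt.
  have [e1 e2] := solution_fourier lm a0 K0 LK IK hw Lu0 E zeta (@continuous_sin R)
    (@continuous_cos R) (@sin_max R) (@cos_max R) sinA rt.
  split.
    by apply: etrans e1 _; congr (_ + _ * _); apply: I_ext => q; rewrite [X in _ * X = _]addrC.
  by apply: L1_ext e2 => q; rewrite [X in _ * X = _]addrC.
have [] := fourier_ode a0 XB YB cc cs cK1 sK1 eX eY tt.
have ez : vscale (expR t) zeta = xi.
  by apply: eq_tnthP => i; rewrite !tnth_vscale mulrA -expRD subrr expR0 mul1r.
have zr r : vscale eps (vscale (expR r) zeta) = vscale (eps * expR (r - t)) xi.
  by apply: eq_tnthP => i; rewrite !tnth_vscale expRD !mulrA.
have mu := (ms.1 _ t0).1; have mw := measurable_sec1 t hw.1.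
have -> : X t = ft_re m (u t) xi.
  rewrite /X ez; apply: I_ae.
  - by apply: measurable_funM => //; apply: measurable_trig; exact: continuous_cos.
  - by apply: measurable_funM => //; apply: measurable_trig; exact: continuous_cos.
  - by apply: filterS (wu t tt) => x ->.
have -> : Y t = ft_s m (u t) xi.
  rewrite /Y ez; apply: I_ae.
  - by apply: measurable_funM => //; apply: measurable_trig; exact: continuous_sin.
  - by apply: measurable_funM => //; apply: measurable_trig; exact: continuous_sin.
  - by apply: filterS (wu t tt) => x ->.
have EcK : cK = (fun r => ft_re m J (vscale (eps * expR (r - t)) xi)).
  by apply/funext => r; rewrite /cK ft_re_kscale// zr.
have EsK : sK = (fun r => ft_s m J (vscale (eps * expR (r - t)) xi)).
  by apply/funext => r; rewrite /sK ft_s_kscale// zr.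
by rewrite EcK EsK => -> ->.
Qed.

End mild.

(** * Symbols of the kernels *)

Section elementary.
Context {R : realType}.
Implicit Types (x y a b e : R).

Lemma powR_between y a b e : 0 <= y -> a <= e <= b -> 0 < a ->
  y `^ e <= y `^ a + y `^ b.
Proof.
move=> y0 /andP[ae eb] a0; have [y1|y1] := leP 1 y.
  by apply: le_trans (ler_powR y1 eb) _; rewrite lerDr powR_ge0.
have [->|yn0] := eqVneq y 0; first by rewrite powR0 ?addr_ge0 ?powR_ge0// gt_eqF// (lt_le_trans a0).
have yp : 0 < y <= 1 by rewrite lt_neqAle eq_sym yn0 y0 ltW.
apply: (@le_trans _ _ (y `^ a)); last by rewrite lerDl powR_ge0.
rewrite /powR (negbTE yn0) ler_expR.
by rewrite ler_wnM2r// ln_le0//; case/andP: yp.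
Qed.

Lemma expR_sub_le a b : `|expR a - expR b| <= `|a - b| * (expR a + expR b).
Proof.
wlog ab : a b / a <= b.
  move=> H; have [/H//|/ltW/H] := leP a b.
  by rewrite distrC (distrC b) (addrC (expR b)).
have eab : expR a <= expR b by rewrite ler_expR.
rewrite distrC (distrC a) !ger0_norm ?subr_ge0//.
have := expR_ge1Dx (a - b); rewrite -(ler_pM2l (expR_gt0 b)) -expRD.
rewrite (_ : b + (a - b) = a); last by ring.
move=> h; apply: (@le_trans _ _ ((b - a) * expR b)).
  by lra.
by rewrite ler_wpM2l ?subr_ge0// lerDr expR_ge0.
Qed.

Lemma norm_ln_le (i y : R) : 0 < i -> 0 < y -> `|ln y| <= i^-1 * (y `^ i + y `^ (- i)).
Proof.
move=> i0 y0; rewrite ler_pdivlMl// /powR gt_eqF//.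
have h1 := expR_ge1Dx (i * ln y); have h2 := expR_ge1Dx (- i * ln y).
have e1 := expR_gt0 (i * ln y); have e2 := expR_gt0 (- i * ln y).
have -> : i * `|ln y| = `|i * ln y| by rewrite normrM gtr0_norm.
by rewrite ler_norml; apply/andP; split; lra.
Qed.

Lemma max1_ln_le (i y : R) : 0 < i -> 0 < y ->
  Order.max 1 `|ln y| <= (1 + i^-1) * (y `^ i + y `^ (- i)).
Proof.
move=> i0 y0; have h := norm_ln_le i0 y0; set S := _ + _ in h *.
have S1 : 1 <= S.
  rewrite /S /powR gt_eqF//.
  have h1 := expR_ge1Dx (i * ln y); have h2 := expR_ge1Dx (- i * ln y).
  have e1 := expR_gt0 (i * ln y); have e2 := expR_gt0 (- i * ln y).
  have [l0|l0] := leP 0 (i * ln y).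
    by have := h1; lra.
  by have := h2; lra.
have i1 : 0 < i^-1 by rewrite invr_gt0.
have iS : 0 <= i^-1 * S by rewrite mulr_ge0 ?(ltW i1)// (le_trans ler01).
rewrite ge_max mulrDl mul1r; apply/andP; split; first by rewrite -[leLHS]addr0 lerD.
by rewrite (le_trans h)// lerDr (le_trans ler01).
Qed.

(** Differentiating in the exponent costs a logarithm; the margin [i] pays for it, through
    [|ln y| <= (y^i + y^-i) / i]. *)
Lemma powR_sub_le (i y e1 e2 : R) : 0 < i -> 0 < y ->
  `|y `^ e1 - y `^ e2| <= `|e1 - e2| * i^-1 *
    (y `^ (e1 + i) + y `^ (e1 - i) + (y `^ (e2 + i) + y `^ (e2 - i))).
Proof.
move=> i0 y0.
have D e : y `^ (e + i) + y `^ (e - i) = y `^ e * (y `^ i + y `^ (- i)).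
  by rewrite !powRD ?(gt_eqF y0) ?implybT// mulrDr.
have E e : y `^ e = expR (e * ln y) by rewrite /powR gt_eqF.
have := expR_sub_le (e1 * ln y) (e2 * ln y); rewrite -!E -mulrBl normrM => h.
apply: le_trans h _; rewrite (D e1) (D e2).
rewrite [leRHS](_ : _ = `|e1 - e2| * (i^-1 * (y `^ i + y `^ (- i))) * (y `^ e1 + y `^ e2)); last by ring.
rewrite ler_wpM2r ?addr_ge0 ?powR_ge0// ler_wpM2l//.
exact: norm_ln_le.
Qed.

Lemma norm_le_cmod (a b : R) : `|a| <= cmod a b /\ `|b| <= cmod a b.
Proof.
rewrite /cmod -!sqrtr_sqr; split; rewrite ler_wsqrtr//.
  by rewrite lerDl sqr_ge0.
by rewrite lerDr sqr_ge0.
Qed.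

End elementary.

(** * Comparison of the rescaled symbols *)

Section characteristic.
Context {R : realType} {n : nat}.
Notation V := (n.-tuple R).
Variable m : {measure set V -> \bar R}.
Hypothesis lm : is_lebesgue m.

Definition small_freq (J : V -> R) (s C0 delta : R) := forall xi, vnorm xi <= 1 ->
  `|ft_re m J xi - 1 + vnorm xi `^ (2 * s)| <= C0 * vnorm xi `^ (2 * s + delta) /\
  `|ft_s m J xi| <= C0 * vnorm xi `^ (2 * s + delta).

Lemma H1_small_freq J delta : H1 m J delta -> exists2 C0, 0 < C0 &
  forall s, 1/2 < s < 1 -> small_freq (J s) s C0 delta.
Proof.
move=> [_ [[C0 C00 H] _]]; exists C0 => // s hs xi xi1.
have h := H s hs xi xi1; have [h1 h2] := norm_le_cmod
  (ft_re m (J s) xi - 1 + vnorm xi `^ (2 * s)) (ft_im m (J s) xi).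
by rewrite -(normrN (ft_s _ _ _)) -ft_imE (le_trans h1)// (le_trans h2).
Qed.

Lemma H2_small_freq J J1 delta : H2 m J J1 delta -> exists2 C0, 0 < C0 &
  small_freq J1 1 C0 delta.
Proof.
move=> [_ [[C0 C00 H] _]]; exists C0 => // xi xi1.
have h := H xi xi1; have [h1 h2] := norm_le_cmod
  (ft_re m J1 xi - 1 + vnorm xi ^+ 2) (ft_im m J1 xi).
rewrite -(normrN (ft_s _ _ _)) -ft_imE mulr1 powR_mulrn ?vnorm_ge0//.
by rewrite (le_trans h1)// (le_trans h2).
Qed.

Lemma small_freqW J s C0 C1 delta : C0 <= C1 -> small_freq J s C0 delta ->
  small_freq J s C1 delta.
Proof.
move=> C01 H xi /H[h1 h2]; have p0 : 0 <= vnorm xi `^ (2 * s + delta) by exact: powR_ge0.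
by split; [apply: le_trans h1 _|apply: le_trans h2 _]; rewrite ler_wpM2r.
Qed.

Lemma vnorm0 : vnorm ([tuple 0 | _ < n] : V) = 0.
Proof. by rewrite /vnorm big1 ?sqrtr0// => i _; rewrite tnth_mktuple expr0n. Qed.

Lemma vnorm_eq0 (x : V) : vnorm x = 0 -> x = [tuple 0 | _ < n].
Proof.
move=> x0; apply: eq_tnthP => i; rewrite tnth_mktuple; apply/eqP.
by rewrite -normr_eq0 eq_le normr_ge0 andbT -x0 tnth_le_vnorm.
Qed.

Variables (J : R -> V -> R) (J1 : V -> R) (delta iota : R).
Hypotheses (hJ : forall s, 1/2 < s < 1 -> prob_density m (J s)) (h2 : H2 m J J1 delta).
Hypotheses (i0 : 0 < iota) (i2 : iota <= 1/2) (idelta : iota <= delta / 2).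

Let di : 2 * iota <= delta.
Proof. by rewrite mulrC -ler_pdivlMr. Qed.

Let dp : 0 <= delta + iota.
Proof. have := i0; have := di; lra. Qed.

Let dm : 0 <= delta - iota.
Proof. have := i0; have := di; lra. Qed.

(** It dominates every [y^e] with [1/2 <= e <= 2 + delta + iota]. Both exponents are positive, so
    along [e^(r-t) xi] it decays exponentially in [t - r] and its time integrals are bounded
    uniformly in [t]. *)
Let bnd (y : R) := y `^ (1/2) + y `^ (2 + delta + iota).

Let mod_bound : exists2 G, 0 < G & forall eta, 0 < vnorm eta ->
  `|(1 - ft_re m J1 eta) / vnorm eta ^+ 2| <= G /\ `|ft_s m J1 eta / vnorm eta ^+ 2| <= G.
Proof.
have d0 : 0 < delta by rewrite -(@pmulr_lgt0 _ 2^-1)// (lt_le_trans i0).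
have [C0 C00 H] := H2_small_freq h2; exists (2 + C0); first by rewrite addr_gt0.
have [J10 LJ1 IJ1] := prob_densityP h2.1.
have nJ1 : I[m] (fun x => `|J1 x|) = 1.
  by rewrite -[RHS]IJ1; apply: I_ext => x; rewrite ger0_norm.
move=> eta eta0; have e2 : 0 < vnorm eta ^+ 2 by rewrite exprn_gt0.
rewrite !normrM !(gtr0_norm (_ : 0 < (vnorm eta ^+ 2)^-1)) ?invr_gt0// !ler_pdivrMr//.
have [e1|e1] := leP (vnorm eta) 1; last first.
  have c1 := ft_re_le1 eta LJ1; have s1 := ft_s_le1 eta LJ1; rewrite nJ1 in c1 s1.
  have e21 : 1 <= vnorm eta ^+ 2 by rewrite expr_ge1 ?ltW// ltW.
  have : 2 + C0 <= (2 + C0) * vnorm eta ^+ 2 by rewrite ler_peMr// addr_ge0// ltW.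
  move: c1; rewrite ler_norml => /andP[c1 c1'].
  by split; [rewrite ler_norml; apply/andP; split|]; lra.
have [c1 s1] := H eta e1; rewrite mulr1 in c1 s1.
have pd : vnorm eta `^ (2 + delta) <= vnorm eta ^+ 2.
  rewrite powRD ?(gt_eqF eta0) ?implybT// powR_mulrn ?vnorm_ge0// ler_piMr ?(ltW e2)//.
  by rewrite -[leRHS](congr1 (@^~ delta) (powR1 R)) ge0_ler_powR// ?nnegrE ?vnorm_ge0// ltW.
rewrite powR_mulrn ?vnorm_ge0// in c1.
have pd' : C0 * vnorm eta `^ (2 + delta) <= C0 * vnorm eta ^+ 2 by rewrite ler_pM2l.
split; last by apply: le_trans s1 _; lra.
by move: c1; rewrite !ler_norml => /andP[? ?]; apply/andP; split; lra.
Qed.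

(** Each rescaled symbol is a power of [y = |xi|] times a quotient from (H2) taken at [eps xi], so
    the difference is [y^(2s) (gs - g1) + (y^(2s) - y^2) g1]. As [eps <= 1] and [delta - iota >= 0],
    powers of [|eps xi|] are bounded by those of [|xi|], whence the uniformity in [eps]. *)
Lemma frac_bound : exists2 C, 0 < C & forall s, 1/2 < s < 1 -> forall eps xi,
  0 < eps <= 1 ->
  `|eps `^ (- (2 * s)) * (1 - ft_re m (J s) (vscale eps xi)) -
    eps `^ (- (2 * 1)) * (1 - ft_re m J1 (vscale eps xi))| <= C * (1 - s) * bnd (vnorm xi) /\
  `|eps `^ (- (2 * s)) * ft_s m (J s) (vscale eps xi) -
    eps `^ (- (2 * 1)) * ft_s m J1 (vscale eps xi)| <= C * (1 - s) * bnd (vnorm xi).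
Proof.
have [i0' i2' di'] := And3 i0 i2 di.
have [G G0 HG] := mod_bound; have [_ [_ [CC CC0 H]]] := h2.
pose A := 2 * CC * (1 + iota^-1) + G * (2 * iota^-1 * 4).
have ii : 0 < iota^-1 by rewrite invr_gt0.
have A0 : 0 < A by rewrite addr_gt0// !mulr_gt0// addr_gt0.
exists A => // s /[dup] hs /andP[s1 s2] eps xi /andP[eps0 eps1].
have q1 : 1/2 <= 2 * s + (delta + iota) <= 2 + delta + iota by lra.
have q2 : 1/2 <= 2 * s + (delta - iota) <= 2 + delta + iota by lra.
have q3 : 1/2 <= 2 * s + iota <= 2 + delta + iota by lra.
have q4 : 1/2 <= 2 * s - iota <= 2 + delta + iota by lra.
have q5 : 1/2 <= 2 + iota <= 2 + delta + iota by lra.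
have q6 : 1/2 <= 2 - iota <= 2 + delta + iota by lra.
have n2 : `|2 * s - 2| = 2 * (1 - s) by rewrite ler0_norm; lra.
have sp : 0 < 1 - s by rewrite subr_gt0.
have b0 y : 0 <= bnd y by rewrite addr_ge0// powR_ge0.
(* The quotients of (H2) exclude the origin, where all the symbols vanish. *)
have [xi0|xin0] := eqVneq (vnorm xi) 0.
  have -> : vscale eps xi = [tuple 0 | _ < n].
    by apply: eq_tnthP => i; rewrite tnth_vscale (vnorm_eq0 xi0) !tnth_mktuple mulr0.
  have c1 f : prob_density m f -> ft_re m f [tuple 0 | _ < n] = 1 /\ ft_s m f [tuple 0 | _ < n] = 0.
    move=> /prob_densityP[_ Lf If]; have v0 (x : V) : vdot x [tuple 0 | _ < n] = 0.
      by rewrite /vdot big1// => i _; rewrite tnth_mktuple mulr0.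
    split; first by rewrite -[RHS]If; apply: I_ext => x; rewrite v0 cos0 mul1r.
    by rewrite -[RHS](I_0 m); apply: I_ext => x; rewrite v0 sin0 mul0r.
  have [-> ->] := c1 _ (hJ hs); have [-> ->] := c1 _ h2.1.
  by rewrite !subrr !mulr0 subrr normr0; split; rewrite !mulr_ge0// ltW.
have y0 : 0 < vnorm xi by rewrite lt_neqAle eq_sym xin0 vnorm_ge0.
set y := vnorm xi in y0 *.
have bt e : 1/2 <= e <= 2 + delta + iota -> y `^ e <= bnd y.
  by move=> he; apply: powR_between => //; exact: ltW.
pose eta := vscale eps xi.
have ez : vnorm eta = eps * y by rewrite vnormZ gtr0_norm.
have z0 : 0 < vnorm eta by rewrite ez mulr_gt0.
have eta0 : eta != [tuple 0 | _ < n].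
  by apply/eqP => e; move: z0; rewrite e vnorm0 ltxx.
have [H1 H2'] := norm_le_cmod ((1 - ft_re m (J s) eta) / vnorm eta `^ (2 * s)
             - (1 - ft_re m J1 eta) / vnorm eta ^+ 2)
          ((- ft_im m (J s) eta) / vnorm eta `^ (2 * s)
             - (- ft_im m J1 eta) / vnorm eta ^+ 2).
have Hs := H s hs eta eta0; have {}H1 := le_trans H1 Hs; have {}H2' := le_trans H2' Hs.
rewrite !ft_imE !opprK in H2'.
have [G1 G2] := HG eta z0.
have core F Fs : `|Fs / vnorm eta `^ (2 * s) - F / vnorm eta ^+ 2| <=
      CC * (1 - s) * vnorm eta `^ delta * Order.max 1 `|ln (vnorm eta)| ->
    `|F / vnorm eta ^+ 2| <= G ->
    `|eps `^ (- (2 * s)) * Fs - eps `^ (- (2 * 1)) * F| <= A * (1 - s) * bnd y.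
  move=> h1 hG.
  have sc e G' : eps `^ (- e) * G' = y `^ e * (G' / vnorm eta `^ e).
    by rewrite ez powRM ?ltW// powRN; field; rewrite !gt_eqF ?powR_gt0.
  rewrite !sc mulr1 -(powR_mulrn 2 (ltW z0)) in hG h1 *.
  set g1 := F / _ in hG h1 *; set gs := Fs / _ in h1 *.
  rewrite (_ : _ - _ = y `^ (2 * s) * (gs - g1) + (y `^ (2 * s) - y `^ 2) * g1); last by ring.
  apply: le_trans (ler_normD _ _) _.
  rewrite (normrM _ (gs - g1)) (normrM _ g1) (ger0_norm (powR_ge0 y (2 * s))).
  have L1' : y `^ (2 * s) * `|gs - g1| <= 2 * CC * (1 + iota^-1) * (1 - s) * bnd y.
    apply: le_trans (ler_wpM2l (powR_ge0 _ _) h1) _.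
    have M := max1_ln_le i0 z0.
    have z1 : vnorm eta <= y by rewrite ez ler_piMl// ltW.
    have zd e : 0 <= e -> vnorm eta `^ e <= y `^ e.
      by move=> e0; rewrite ge0_ler_powR// ?nnegrE// ltW.
    have M2 : vnorm eta `^ delta * Order.max 1 `|ln (vnorm eta)| <=
        (1 + iota^-1) * (y `^ (delta + iota) + y `^ (delta - iota)).
      apply: le_trans (ler_wpM2l (powR_ge0 _ _) M) _.
      rewrite mulrCA; apply: ler_wpM2l; first by rewrite addr_ge0// ltW.
      rewrite mulrDr -!powRD ?(gt_eqF z0) ?implybT//.
      by apply: lerD; apply: zd; [exact: dp|exact: dm].
    rewrite mulrA [_ * (1 - s) * _]mulrAC -!mulrA.
    have -> : 2 * (CC * ((1 + iota^-1) * ((1 - s) * bnd y))) =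
       CC * (1 - s) * ((1 + iota^-1) * (bnd y + bnd y)) by ring.
    have -> : y `^ (2 * s) * (CC * (vnorm eta `^ delta * ((1 - s) * Order.max 1 `|ln (vnorm eta)|))) =
       CC * (1 - s) * (y `^ (2 * s) * (vnorm eta `^ delta * Order.max 1 `|ln (vnorm eta)|)) by ring.
    apply: ler_wpM2l; first by rewrite mulr_ge0// ltW.
    apply: (le_trans (ler_wpM2l (powR_ge0 _ _) M2)).
    rewrite mulrCA; apply: ler_wpM2l; first by rewrite addr_ge0// ltW.
    have yD e e' : y `^ e * y `^ e' = y `^ (e + e') by rewrite powRD// (gt_eqF y0) implybT.
    rewrite mulrDr !yD.
    exact: lerD (bt _ q1) (bt _ q2).
  have L2 : `|y `^ (2 * s) - y `^ 2| * `|g1| <= G * (2 * iota^-1 * 4) * (1 - s) * bnd y.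
    have P := powR_sub_le (2 * s) 2 i0 y0.
    have B : y `^ (2 * s + iota) + y `^ (2 * s - iota) + (y `^ (2 + iota) + y `^ (2 - iota)) <=
        4 * bnd y.
      by rewrite (_ : 4 * _ = bnd y + bnd y + (bnd y + bnd y)); [do 2 apply: lerD; apply: bt|ring].
    rewrite n2 in P.
    rewrite (_ : G * _ * _ * _ = (2 * (1 - s) * iota^-1 * (4 * bnd y)) * G); last by ring.
    apply: ler_pM => //; apply: le_trans P _; rewrite ler_wpM2l//.
    by rewrite !mulr_ge0// ltW.
  have -> : A * (1 - s) * bnd y = 2 * CC * (1 + iota^-1) * (1 - s) * bnd y +
      G * (2 * iota^-1 * 4) * (1 - s) * bnd y by rewrite /A; ring.
    exact: lerD.
by split; apply: core.
Qed.

End characteristic.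

(** * Integrals over windows of logarithmic frequency *)

Section windows.
Context {R : realType}.
Notation leb := (leb R).

Lemma cts_curve_scale (t : R) : continuous (fun r : R => expR (r - t)).
Proof.
move=> x; apply: continuous_comp; last exact: continuous_expR.
by apply: continuousB; [exact: id|exact: cst_continuous].
Qed.

Lemma Rintegral_le_cts (f g : R -> R) a b : continuous f -> continuous g ->
  (forall r, a <= r <= b -> f r <= g r) ->
  Rintegral leb `[a, b] f <= Rintegral leb `[a, b] g.
Proof.
move=> cf cg fg; rewrite -!I_itv_cts; apply: I_le; [exact: L1_itv_cts..|] => r.
rewrite indicE; have [/set_mem/= rt|_] := boolP (_ \in _); last by rewrite !mul0r.
by rewrite !mul1r fg//; move: rt; rewrite in_itv.
Qed.

Lemma Rintegral_window (f : R -> R) a b c d : continuous f -> (forall r, 0 <= f r) ->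
  a <= b -> c <= d -> Rintegral leb `[b, c] f <= Rintegral leb `[a, d] f.
Proof.
move=> cf f0 ab cd; rewrite -!I_itv_cts; apply: I_le; [exact: L1_itv_cts..|] => r.
apply: ler_wpM2r => //; rewrite !indicE.
have [/set_mem/= rt|_] := boolP (r \in [set` `[b, c]]); last by [].
rewrite mem_set//=; move: rt; rewrite !in_itv/= => /andP[br rc].
by rewrite (le_trans ab)// (le_trans rc).
Qed.

Lemma Rintegral_itv_cst (k a b : R) : a <= b -> Rintegral leb `[a, b] (fun=> k) = k * (b - a).
Proof.
move=> ab; have d1 (x : R) : is_derive x (1 : R) (fun x => k * x) k.
  by apply: is_derive_eq; rewrite /GRing.scale/= mulr1.
have ck : continuous (fun _ : R => k) by exact: cst_continuous.
by rewrite (FTC_R ab d1 ck) mulrBr.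
Qed.

(* The derivative of [sin v / v] along [v = exp (r - t) * y] is [cos v - sin v / v]. *)
Lemma one_sub_cos_window (y l t : R) : 0 <= l -> expR l <= `|y| ->
  l - 3 <= Rintegral leb `[t - l, t] (fun r => 1 - cos (expR (r - t) * y)).
Proof.
move=> l0 ly; have y0 : 0 < `|y| by exact: lt_le_trans (expR_gt0 l) ly.
have yn0 : y != 0 by rewrite -normr_gt0.
pose G r := r - sin (expR (r - t) * y) * (expR (t - r) / y) + expR (t - r) / `|y|.
pose g r := 1 - cos (expR (r - t) * y) + sin (expR (r - t) * y) * (expR (t - r) / y)
  - expR (t - r) / `|y|.
have e1 r : expR (t - r) * expR (r - t) = 1 by rewrite -expRD (_ : _ + _ = 0) ?expR0//; ring.
have dG (x : R) : is_derive x (1 : R) G (g x).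
  apply: is_derive_eq; rewrite /GRing.scale/= /g.
  have := e1 x; set E := expR (t - x); set F := expR (x - t) => EF.
  set c := cos _; set sn := sin _; apply/eqP; rewrite -subr_eq0; apply/eqP.
  rewrite (_ : _ - _ = c * (1 - E * F * (y * y^-1))); last by ring.
  by rewrite EF mulfV// mulr1 subrr mulr0.
have cE : continuous (fun r : R => expR (t - r)).
  move=> x; apply: continuous_comp; last exact: continuous_expR.
  by apply: continuousB; [exact: cst_continuous|exact: id].
have cy : continuous (fun r : R => expR (r - t) * y).
  by move=> x; apply: cvgM; [exact: cts_curve_scale|exact: cvg_cst].
have cc : continuous (fun r : R => 1 - cos (expR (r - t) * y)).
  move=> x; apply: continuousB; first exact: cst_continuous.
  by apply: continuous_comp; [exact: cy|exact: continuous_cos].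
have cg : continuous g.
  rewrite /g => x; apply: cvgB.
    apply: cvgD; first exact: cc.
    apply: cvgM; first by apply: continuous_comp; [exact: cy|exact: continuous_sin].
    by apply: cvgM; [exact: cE|exact: cvg_cst].
  by apply: cvgM; [exact: cE|exact: cvg_cst].
have sy r : `|sin (expR (r - t) * y) * (expR (t - r) / y)| <= expR (t - r) / `|y|.
  rewrite normrM normf_div (ger0_norm (expR_ge0 _)); apply: ler_piMl; last exact: sin_max.
  by rewrite divr_ge0 ?expR_ge0.
apply: (@le_trans _ _ (Rintegral leb `[t - l, t] g)); last first.
  apply: Rintegral_le_cts => // r _; rewrite /g -[leRHS]addr0 -addrA lerD2l subr_le0.
  exact: le_trans (ler_norm _) (sy r).
have tl : t - l <= t by rewrite gerBl.
rewrite (FTC_R tl dG cg) /G.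
have sl := sy (t - l); have st := sy t.
rewrite (_ : t - (t - l) = l) in sl *; last by ring.
rewrite subrr in st *.
have el : expR l / `|y| <= 1 by rewrite ler_pdivrMr// mul1r.
move: sl st; rewrite !ler_norml => /andP[sl1 sl2] /andP[st1 st2].
move: sl1 sl2 st1 st2 el; set A := _ * (expR l / y); set B := _ * (_ / y).
set C := expR l / _; set D := _ / `|y|.
lra.
Qed.

End windows.

(** * Lower bounds for the symbol along rays *)

Section directional.
Context {R : realType} {n : nat}.
Notation V := (n.-tuple R).
Notation leb := (leb R).
Variable m : {sigma_finite_measure set V -> \bar R}.
Hypothesis lm : is_lebesgue m.

(** A smooth substitute for the indicator of the slab [|x . om| <= rho]; being Gaussian, it has
    integrals expressed by the transform on the line spanned by [om]. *)
Definition dir_weight (rho : R) (om x : V) := expR (- (vdot x om / rho) ^+ 2 / 2).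
Definition dir_mass (f : V -> R) rho om := I[m] (fun x => dir_weight rho om x * f x).

Lemma measurable_dir_weight rho om : measurable_fun setT (dir_weight rho om).
Proof.
rewrite /dir_weight; apply: measurableT_comp => //; apply: measurable_funM => //.
apply: measurableT_comp => //; apply: measurable_funX; apply: measurable_funM => //.
exact: measurable_fun_vdot.
Qed.

Lemma dir_weight_ge0 rho om x : 0 <= dir_weight rho om x.
Proof. exact: expR_ge0. Qed.

Lemma dir_weight_le1 rho om x : dir_weight rho om x <= 1.
Proof.
by rewrite /dir_weight -[leRHS]expR0 ler_expR mulNr oppr_le0 divr_ge0// sqr_ge0.
Qed.

Lemma L1_dir_weight f rho om : L1 m f -> L1 m (fun x => dir_weight rho om x * f x).
Proof.
move=> hf; apply: (L1M (c := 1)) => //; first exact: measurable_dir_weight.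
by move=> x; rewrite ger0_norm ?dir_weight_ge0// dir_weight_le1.
Qed.

(** Closeness of two transforms on a line thus yields closeness of the slab masses, which is how a
    bound for [J1] is transferred to [J s]. *)
Lemma dir_mass_fourier f rho om : L1 m f ->
  L1 leb (fun sg => gauss1 sg * ft_re m f (vscale (sg / rho) om)) /\
  I[leb] gauss1 * dir_mass f rho om =
  I[leb] (fun sg => gauss1 sg * ft_re m f (vscale (sg / rho) om)).
Proof.
move=> hf.
pose F (q : measurableTypeR R * V) :=
  gauss1 q.1 * (cos (vdot q.2 (vscale (q.1 / rho) om)) * f q.2).
have mc : measurable_fun setT (fun q : measurableTypeR R * V =>
    cos (vdot q.2 (vscale (q.1 / rho) om))).
  apply: (measurableT_comp (continuous_measurable_fun (@continuous_cos R))).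
  apply: measurable_fun_vdot; first exact: measurable_snd.
  have m1 : measurable_fun setT (fun q : measurableTypeR R * V => q.1 : R) by exact: measurable_fst.
  by apply: measurable_fun_vscale => //; exact: measurable_funM m1 (measurable_cst _).
have mF : measurable_fun setT F.
  apply: measurable_funM.
    by apply: (measurableT_comp measurable_gauss1); exact: measurable_fst.
  apply: measurable_funM => //.
  by apply: (measurableT_comp (L1_measurable hf)); exact: measurable_snd.
have LF : L1 (leb \x m)%E F.
  apply: (@L1_prodI _ _ _ _ _ leb m _ (fun s => I[m] (fun x => `|f x|) * gauss1 s)) => //.
    by apply: L1Z; exact: L1_gauss1.
  move=> s; have L : L1 m (fun x => F (s, x)) by rewrite /F/=; exact: (L1Z (gauss1 s) (L1_cos _ hf)).
  split=> //; rewrite mulrC -I_Z; last exact: L1_norm.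
  apply: I_le; [exact: L1_norm|by apply: L1Z; exact: L1_norm|].
  move=> x; rewrite /F/= !normrM ger0_norm ?(ltW (gauss1_gt0 _))//.
  by rewrite ler_wpM2l ?(ltW (gauss1_gt0 _))// ler_piMl// cos_max.
have [L1' E1] := I_prod1 LF; have [L2' E2] := I_prod2 LF.
have A s : I[m] (fun x => F (s, x)) = gauss1 s * ft_re m f (vscale (s / rho) om).
  by rewrite /F/= I_Z//; exact: L1_cos.
have B x : I[leb] (fun s => F (s, x)) = I[leb] gauss1 * (dir_weight rho om x * f x).
  have C s : F (s, x) = f x * (gauss1 s * cos (0 + s * (vdot x om / rho))).
    by rewrite /F/= vdotZr add0r (_ : s / rho * _ = s * (vdot x om / rho)); ring.
  rewrite (I_ext leb C) I_Z.
    by rewrite gauss1_fourier cos0 /dir_weight /gauss1; ring.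
  apply: (L1_ext (m := leb) (f := fun s => cos (0 + s * (vdot x om / rho)) * gauss1 s)).
    by move=> s; rewrite mulrC.
  apply: (L1M (m := leb) (c := 1)) => //; last exact: L1_gauss1.
    apply: (measurableT_comp (continuous_measurable_fun (@continuous_cos R))).
    by apply: measurable_funD => //; exact: measurable_funM.
  by move=> s; exact: cos_max.
split; first by apply: L1_ext L1' => s; rewrite A.
rewrite -(I_ext leb A) E1 -E2 (I_ext m B) I_Z//.
exact: L1_dir_weight.
Qed.

Section lower_bound.
Variables (J : V -> R).
Hypothesis pJ : prob_density m J.

Definition log_decay t xi :=
  Rintegral leb `[0, t] (fun r => 1 - ft_re m J (vscale (expR (r - t)) xi)).

Let J0 x : 0 <= J x. Proof. by have [] := prob_densityP pJ. Qed.
Let LJ : L1 m J. Proof. by have [] := prob_densityP pJ. Qed.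
Let IJ : I[m] J = 1. Proof. by have [] := prob_densityP pJ. Qed.

Lemma ft_re_prob_le1 xi : `|ft_re m J xi| <= 1.
Proof.
rewrite -[leRHS]IJ (le_trans (ft_re_le1 xi LJ))// le_eqVlt; apply/orP; left; apply/eqP.
by apply: I_ext => x; rewrite ger0_norm.
Qed.

Lemma ft_s_prob_le1 xi : `|ft_s m J xi| <= 1.
Proof.
rewrite -[leRHS]IJ (le_trans (ft_s_le1 xi LJ))// le_eqVlt; apply/orP; left; apply/eqP.
by apply: I_ext => x; rewrite ger0_norm.
Qed.

Lemma one_sub_ft_ge0 xi : 0 <= 1 - ft_re m J xi.
Proof. by rewrite subr_ge0 (le_trans (ler_norm _))// ft_re_prob_le1. Qed.

Lemma cts_ft_curve (t : R) xi : continuous (fun r : R => ft_re m J (vscale (expR (r - t)) xi)).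
Proof.
rewrite (_ : (fun _ => _) = (fun r : R => I[m] (fun x =>
    cos (vdot x (vscale (expR r) (vscale (expR (- t)) xi))) * J x))).
  by apply: continuous_curve => //; [exact: continuous_cos|exact: cos_max].
apply/funext => r; congr (ft_re m J _).
by apply: eq_tnthP => i; rewrite !tnth_vscale mulrA -expRD.
Qed.

Lemma cts_one_sub_ft (t : R) xi : continuous (fun r : R => 1 - ft_re m J (vscale (expR (r - t)) xi)).
Proof. by move=> x; apply: cvgB; [exact: cvg_cst|exact: cts_ft_curve]. Qed.

Lemma log_decay_ge0 t xi : 0 <= log_decay t xi.
Proof. by rewrite /log_decay -I_itv_cts; apply: I_ge0 => r; rewrite mulr_ge0 ?indic_ge0// one_sub_ft_ge0. Qed.

(** Decay of the transform enters only in a mean sense: over a window of length [l] in logarithmic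
    frequency, [1 - cos] integrates to at least [l - 3] once [|x . xi| >= e^l], and the points
    violating this lie in a slab of small mass. *)
Lemma log_decay_window t xi rho l kappa : 0 < vnorm xi -> 0 < rho ->
  dir_mass J rho (vscale (vnorm xi)^-1 xi) <= kappa / 2 ->
  3 <= l -> l <= t -> expR l <= vnorm xi * rho ->
  (1 - kappa) * (l - 3) <= log_decay t xi.
Proof.
move=> y0 rho0 hW l3 lt el; set om := vscale _ xi in hW.
have l0 : 0 <= l by exact: le_trans l3.
have l30 : 0 <= l - 3 by rewrite subr_ge0.
apply: (@le_trans _ _ (Rintegral leb `[t - l, t] (fun r => 1 - ft_re m J (vscale (expR (r - t)) xi)))); last first.
  apply: Rintegral_window => //; first exact: cts_one_sub_ft.
    by move=> r; exact: one_sub_ft_ge0.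
  by rewrite subr_ge0.
pose F (q : measurableTypeR R * V) : R :=
  \1_`[t - l, t] q.1 * ((1 - cos (expR (q.1 - t) * vdot q.2 xi)) * J q.2).
have mF : measurable_fun setT F.
  apply: measurable_funM; first by apply: measurable_fun_indic_itv.
  apply: measurable_funM; last by apply: (measurableT_comp (L1_measurable LJ)); exact: measurable_snd.
  apply: measurable_funB => //.
  apply: (measurableT_comp (continuous_measurable_fun (@continuous_cos R))).
  apply: measurable_funM; last by apply: measurable_fun_vdot => //; exact: measurable_snd.
  by apply: measurableT_comp => //; apply: measurable_funB => //; exact: measurable_fst.
have c2 (x : R) : 0 <= 1 - cos x <= 2.
  have := cos_max x; rewrite ler_norml => /andP[? ?]; apply/andP; split; lra.
have Lsec r : L1 m (fun x => (1 - cos (expR (r - t) * vdot x xi)) * J x).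
  apply: (L1_ext (f := fun x => J x - cos (vdot x (vscale (expR (r - t)) xi)) * J x)).
    by move=> x; rewrite vdotZr; ring.
  by apply: L1B => //; exact: L1_cos.
have Esec r : I[m] (fun x => F (r, x)) =
    \1_`[t - l, t] r * (1 - ft_re m J (vscale (expR (r - t)) xi)).
  rewrite /F/= I_Z//; congr (_ * _).
  transitivity (I[m] J - ft_re m J (vscale (expR (r - t)) xi)); last by rewrite IJ.
  rewrite -I_B//; last exact: L1_cos.
  by apply: I_ext => x; rewrite vdotZr; ring.
have LF : L1 (leb \x m)%E F.
  apply: (@L1_prodI _ _ _ _ _ leb m _ (fun r => 2 * \1_`[t - l, t] r)) => //.
    by apply: L1Z; exact: L1_indic_itv.
  move=> r; split; first by rewrite /F/=; exact: (L1Z _ (Lsec r)).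
  rewrite (I_ext m (g := fun x => F (r, x))); last first.
    move=> x; rewrite ger0_norm// /F !mulr_ge0 ?indic_ge0//.
  rewrite Esec mulrC ler_wpM2r ?indic_ge0//.
  by have := ft_re_prob_le1 (vscale (expR (r - t)) xi); rewrite ler_norml; lra.
have [_ E1] := I_prod1 LF; have [L2 E2] := I_prod2 LF.
rewrite -I_itv_cts -(I_ext leb Esec) E1 -E2.
have LW := L1_dir_weight rho om LJ.
apply: (@le_trans _ _ (I[m] (fun x => (l - 3) * (J x - 2 * (dir_weight rho om x * J x))))).
  rewrite I_Z; last by apply: L1B => //; exact: L1Z.
  rewrite I_B//; last exact: L1Z.
  rewrite I_Z// IJ mulrC ler_wpM2l// lerD2l lerN2 -/(dir_mass J rho om).
  by lra.
apply: I_le => //.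
  by apply: L1Z; apply: L1B => //; exact: L1Z.
move=> x.
have -> : I[leb] (fun r => F (r, x)) =
    J x * Rintegral leb `[t - l, t] (fun r => 1 - cos (expR (r - t) * vdot x xi)).
  have cc : continuous (fun r : R => 1 - cos (expR (r - t) * vdot x xi)).
    move=> r; apply: continuousB; first exact: cst_continuous.
    apply: continuous_comp; last exact: continuous_cos.
    by apply: continuousM; [exact: cts_curve_scale|exact: cst_continuous].
  rewrite -I_itv_cts -I_Z; last exact: L1_itv_cts.
  by apply: I_ext => r; rewrite /F/=; ring.
rewrite (_ : J x - _ = J x * (1 - 2 * dir_weight rho om x)); last by ring.
rewrite mulrCA ler_wpM2l//.
(* Off the slab the window bound applies; on it [1 - 2 dir_weight <= 0] because [exp (-1/2) >= 1/2].
   Hence the doubled weight, and the slab mass at most [kappa / 2]. *)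
have [h|h] := leP rho `|vdot x om|.
  apply: (@le_trans _ _ (l - 3)).
    by rewrite ler_piMr// gerBl mulr_ge0// dir_weight_ge0.
  apply: one_sub_cos_window => //; apply: le_trans el _.
  have -> : vdot x xi = vnorm xi * vdot x om by rewrite vdotZr mulrA mulfV ?mul1r// gt_eqF.
  by rewrite normrM gtr0_norm// ler_pM2l.
apply: (@le_trans _ _ 0).
  rewrite mulr_ge0_le0// subr_le0 /dir_weight.
  have q1 : (vdot x om / rho) ^+ 2 <= 1.
    rewrite -real_normK ?num_real// expr_le1// normf_div (gtr0_norm rho0) ler_pdivrMr// mul1r.
    exact: ltW.
  have := expR_ge1Dx (- (vdot x om / rho) ^+ 2 / 2).
  by move: q1; set q := (_ / _) ^+ 2; lra.
rewrite -I_itv_cts; apply: I_ge0 => r; by rewrite mulr_ge0 ?indic_ge0.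
Qed.

(** On the unit window [[b, b+1]] the frequency stays below [c0], where the remainder of the
    expansion is at most half of the main term. *)
Lemma log_decay_small s C0 delta c0 t xi b : small_freq m J s C0 delta ->
  0 < delta -> 0 < c0 <= 1 -> C0 * c0 `^ delta <= 1/2 -> 0 <= s -> 0 <= C0 ->
  0 <= b -> b + 1 <= t -> expR (b + 1 - t) * vnorm xi <= c0 ->
  1/2 * (expR (b - t) * vnorm xi) `^ (2 * s) <= log_decay t xi.
Proof.
move=> hs d0 /andP[c00 c01] hC s0 C00 b0 bt bc.
have bb : b <= b + 1 by rewrite lerDl.
apply: (@le_trans _ _ (Rintegral leb `[b, b + 1] (fun r => 1 - ft_re m J (vscale (expR (r - t)) xi)))); last first.
  apply: Rintegral_window => //; first exact: cts_one_sub_ft.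
  by move=> r; exact: one_sub_ft_ge0.
set k := 1/2 * _.
have -> : k = Rintegral leb `[b, b + 1] (fun=> k).
  by rewrite Rintegral_itv_cst// addrAC subrr add0r mulr1.
apply: Rintegral_le_cts; [exact: cst_continuous|exact: cts_one_sub_ft|].
move=> r /andP[br rb]; pose eta := vscale (expR (r - t)) xi.
have ez : vnorm eta = expR (r - t) * vnorm xi by rewrite vnormZ ger0_norm ?expR_ge0.
have z0 : 0 <= vnorm eta by exact: vnorm_ge0.
have zc : vnorm eta <= c0.
  by rewrite ez (le_trans _ bc)// ler_wpM2r ?vnorm_ge0// ler_expR lerD2r.
have [h _] := hs eta (le_trans zc c01).
have hd : C0 * vnorm eta `^ (2 * s + delta) <= 1/2 * vnorm eta `^ (2 * s).
  have [->|zn0] := eqVneq (vnorm eta) 0.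
    rewrite powR0 ?mulr0 ?mulr_ge0 ?powR_ge0//.
    by rewrite gt_eqF// ltr_wpDl// mulr_ge0.
  rewrite powRD ?zn0 ?implybT// mulrCA mulrC ler_wpM2r ?powR_ge0//.
  apply: le_trans hC; rewrite ler_wpM2l// ge0_ler_powR// ?nnegrE// ltW//.
have hk : k <= 1/2 * vnorm eta `^ (2 * s).
  rewrite /k ler_wpM2l// ge0_ler_powR// ?nnegrE ?mulr_ge0 ?expR_ge0 ?vnorm_ge0//.
  by rewrite ez ler_wpM2r ?vnorm_ge0// ler_expR lerD2r.
move: h; rewrite ler_norml => /andP[_ h].
by move: hd hk h; rewrite -/eta; lra.
Qed.

End lower_bound.
End directional.

(** * Slab masses, uniformly in the direction and in s *)

Section uniform_mass.
Context {R : realType} {n : nat}.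
Notation V := (n.-tuple R).
Notation leb := (leb R).
Variable m : {sigma_finite_measure set V -> \bar R}.
Hypothesis lm : is_lebesgue m.

Lemma I_gauss1_dilate : I[leb] (fun sg : R => gauss1 sg * gauss1 (sg * k.+1%:R)) @[k --> \oo]
  --> (0 : R).
Proof.
(* The integrands tend to the indicator of the origin, a null set. *)
have -> : (0 : R) = I[leb] (\1_[set 0] : measurableTypeR R -> R).
  rewrite /Rintegral integral_indic// setIT.
  exact: (esym (congr1 fine (lebesgue_measure_set1 0))).
have mg k : measurable_fun setT (fun sg : measurableTypeR R => gauss1 sg * gauss1 (sg * k.+1%:R)).
  apply: measurable_funM; first exact: measurable_gauss1.
  by apply: (measurableT_comp measurable_gauss1); exact: measurable_funM.
have gle (x : R) : gauss1 x <= 1.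
  by rewrite /gauss1 -[leRHS]expR0 ler_expR mulNr oppr_le0 divr_ge0// sqr_ge0.
apply: (I_dct mg L1_gauss1 _ _).2.
  move=> k x; rewrite ger0_norm ?mulr_ge0 ?(ltW (gauss1_gt0 _))//.
  by rewrite ler_piMr ?(ltW (gauss1_gt0 _)).
move=> x; rewrite indicE; have [->|x0] := eqVneq x 0.
  rewrite mem_set//= (_ : (fun _ => _) = fun=> (1 : R)); first exact: cvgn_cst.
  by apply/funext => k; rewrite mul0r /gauss1 expr0n/= oppr0 mul0r expR0 mulr1.
rewrite memNset/=; last by apply/eqP.
have c0 : 0 < x ^+ 2 / 2 by rewrite divr_gt0// exprn_even_gt0.
apply: (@squeeze_cvg0 _ _ (fun k => (x ^+ 2 / 2)^-1 * k.+1%:R^-1)).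
  move=> k; rewrite mulr_ge0 ?(ltW (gauss1_gt0 _))//=.
  have k0 : 0 < k.+1%:R :> R by rewrite ltr0n.
  rewrite -invfM -[leRHS]mul1r ler_pM ?(ltW (gauss1_gt0 _))//.
  rewrite /gauss1 -[X in expR X]opprK expRN lef_pV2 ?posrE ?expR_gt0//; last exact: mulr_gt0.
  apply: le_trans (expR_ge1Dx _); rewrite mulNr opprK exprMn.
  rewrite (_ : x ^+ 2 * _ / 2 = x ^+ 2 / 2 * k.+1%:R ^+ 2); last by ring.
  apply: (@le_trans _ _ (x ^+ 2 / 2 * k.+1%:R ^+ 2)); last by rewrite lerDr.
  by rewrite ler_pM2l// -natrX ler_nat -{1}(expn1 k.+1) leq_pexp2l.
rewrite -[X in _ --> X](mulr0 (x ^+ 2 / 2)^-1); apply: cvgnZ.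
exact: cvg_harmonic.
Qed.

Lemma dir_mass_gauss om rho : vnorm om = 1 ->
  I[leb] gauss1 * dir_mass m gauss rho om =
  I[m] gauss * I[leb] (fun sg : R => gauss1 sg * gauss1 (sg * rho^-1)).
Proof.
move=> om1; have [_ Lg _ Fg] := gauss_fourier lm.
have [L ->] := dir_mass_fourier rho om Lg.
have E sg : gauss1 sg * ft_re m gauss (vscale (sg / rho) om) =
    I[m] gauss * (gauss1 sg * gauss1 (sg * rho^-1)).
  have := Fg 0 (vscale (sg / rho) om); rewrite cos0 mulr1.
  rewrite (I_ext m (g := fun x => cos (vdot x (vscale (sg / rho) om)) * gauss x)); last first.
    by move=> x; rewrite add0r mulrC.
  rewrite -/(ft_re m gauss _) => ->; rewrite mulrCA; congr (_ * (_ * _)).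
  by rewrite /gauss -sqr_vnorm vnormZ om1 mulr1 real_normK ?num_real.
rewrite (I_ext leb E) I_Z//.
apply: (L1_ext (m := leb) (f := fun sg => gauss1 (sg * rho^-1) * gauss1 sg)).
  by move=> x; rewrite mulrC.
apply: (L1M (m := leb) (c := 1)) => //; last exact: L1_gauss1.
  by apply: (measurableT_comp measurable_gauss1); exact: measurable_funM.
move=> x; rewrite ger0_norm ?(ltW (gauss1_gt0 _))//.
by rewrite /gauss1 -[leRHS]expR0 ler_expR mulNr oppr_le0 divr_ge0// sqr_ge0.
Qed.

Lemma dir_mass_le (f g : V -> R) rho om : L1 m f -> L1 m g -> (forall x, f x <= g x) ->
  dir_mass m f rho om <= dir_mass m g rho om.
Proof.
move=> hf hg fg; apply: I_le; [exact: L1_dir_weight|exact: L1_dir_weight|].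
by move=> x; rewrite ler_wpM2l ?dir_weight_ge0.
Qed.

(** Uniformity in [om] comes from [f <= (f - N gauss)^+ + N gauss]: the first part is small in L1,
    the second is rotation invariant, so its slab mass depends on [rho] only. *)
Lemma dir_mass_density (f : V -> R) : prob_density m f -> forall kappa, 0 < kappa ->
  exists2 rho, 0 < rho <= 1 & forall om, vnorm om = 1 -> dir_mass m f rho om <= kappa.
Proof.
move=> /prob_densityP[f0 Lf If] kappa k0; have [_ Lg g0 _] := gauss_fourier lm.
have k2 : 0 < kappa / 2 by rewrite divr_gt0.
pose h N (x : V) := Num.max (f x - N%:R * gauss x) 0.
have mh N : measurable_fun setT (h N).
  apply: measurable_maxr => //; apply: measurable_funB; first exact: (L1_measurable Lf).
  by apply: measurable_funM => //; exact: measurable_gauss.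
have h0 N x : 0 <= h N x by rewrite /h le_max lexx orbT.
have hf N x : `|h N x| <= f x.
  rewrite ger0_norm// /h ge_max f0 andbT gerBl mulr_ge0// gauss_ge0 //.
have ch x : h N x @[N --> \oo] --> (0 : R).
  have : exists N0 : nat, f x / gauss x < N0%:R.
    exists (Num.bound (f x / gauss x)); apply: archi_boundP.
    by rewrite divr_ge0// gauss_ge0.
  move=> [N0 hN0]; apply: cvg_near_cst; exists N0 => // N /= NN0.
  rewrite /h; apply/eqP; rewrite eq_le ge_max lexx andbT le_max lexx orbT andbT subr_le0.
  rewrite -ler_pdivrMr ?gauss_gt0// ltW// (lt_le_trans hN0)// ler_nat.
  exact: NN0.
have [_ cI] := I_dct mh Lf hf ch.
rewrite I_0 in cI.
have [N hN] : exists N, I[m] (h N) <= kappa / 2.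
  move/cvgrPdist_le: cI => /(_ _ k2)[N _ /(_ N (leqnn N))] hN; exists N.
  by move: hN; rewrite /= sub0r normrN; apply: le_trans; exact: ler_norm.
have Lh : L1 m (h N) by exact: L1_le Lf.
have g10 := @I_gauss1_gt0 R.
have c0 : 0 < N%:R * (I[m] gauss / I[leb] gauss1) + 1.
  by rewrite ltr_wpDl// mulr_ge0// divr_ge0// ltW.
have [j hj] : exists j : nat, (N%:R * (I[m] gauss / I[leb] gauss1) + 1) *
    I[leb] (fun sg : R => gauss1 sg * gauss1 (sg * j.+1%:R)) <= kappa / 2.
  have e0 : 0 < kappa / 2 / (N%:R * (I[m] gauss / I[leb] gauss1) + 1) by rewrite divr_gt0.
  move/cvgrPdist_le: I_gauss1_dilate => /(_ _ e0)[j _ /(_ j (leqnn j))] hj; exists j.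
  by rewrite mulrC -ler_pdivlMr//; move: hj; rewrite /= sub0r normrN; apply: le_trans; exact: ler_norm.
exists j.+1%:R^-1; first by rewrite invr_gt0 ltr0n/= invf_le1 ?ltr0n// ler1n.
move=> om om1.
have LhN : L1 m (fun x => h N x + N%:R * gauss x) by apply: L1D => //; exact: L1Z.
have fle x : f x <= h N x + N%:R * gauss x by rewrite -lerBlDr /h le_max lexx.
apply: le_trans (dir_mass_le _ _ Lf LhN fle) _.
have -> : dir_mass m (fun x => h N x + N%:R * gauss x) j.+1%:R^-1 om =
    dir_mass m (h N) j.+1%:R^-1 om + N%:R * dir_mass m gauss j.+1%:R^-1 om.
  rewrite /dir_mass -I_Z; last exact: L1_dir_weight.
  rewrite -I_D; [|exact: L1_dir_weight|by apply: L1Z; exact: L1_dir_weight].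
  by apply: I_ext => x; ring.
rewrite (splitr kappa); apply: lerD.
  apply: le_trans hN; apply: I_le => //; first exact: L1_dir_weight.
  by move=> x; rewrite ler_piMl// dir_weight_le1.
apply: le_trans hj.
have E := dir_mass_gauss j.+1%:R^-1 om1; rewrite invrK in E.
have -> : dir_mass m gauss j.+1%:R^-1 om = I[m] gauss / I[leb] gauss1 *
    I[leb] (fun sg : R => gauss1 sg * gauss1 (sg * j.+1%:R)).
  by rewrite mulrAC -E mulrAC mulfV ?mul1r// gt_eqF.
rewrite mulrA ler_wpM2r// ?lerDl//.
by apply: I_ge0 => x; rewrite mulr_ge0// ltW// gauss1_gt0.
Qed.

Variables (J : R -> V -> R) (J1 : V -> R) (delta iota : R).
Hypotheses (hJ : forall s, 1/2 < s < 1 -> prob_density m (J s)) (h2 : H2 m J J1 delta).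
Hypotheses (i0 : 0 < iota) (i2 : iota <= 1/2) (idelta : iota <= delta / 2).

Lemma powR_le_gauss (q y : R) : 0 <= q -> 0 <= y ->
  y `^ q <= (1 + expR (q ^+ 2)) * expR (4^-1 * y ^+ 2).
Proof.
move=> q0 y0; have e0 : 1 <= expR (4^-1 * y ^+ 2).
  by rewrite -expR0 ler_expR mulr_ge0// ?invr_ge0// sqr_ge0.
have [y_0|yn0] := eqVneq y 0.
  apply: (@le_trans _ _ 1); last first.
    by rewrite -[leLHS]mulr1; apply: ler_pM => //; rewrite lerDl expR_ge0.
  rewrite y_0.
  by rewrite -[leRHS](congr1 (@^~ q) (powR1 R)) ge0_ler_powR// nnegrE.
rewrite mulrDl mul1r; apply: (@le_trans _ _ (expR (q ^+ 2) * expR (4^-1 * y ^+ 2))).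
  rewrite -expRD /powR (negbTE yn0) ler_expR.
  have yp : 0 < y by rewrite lt_neqAle eq_sym yn0.
  have ln_y : ln y <= y.
    have := @le_ln1Dx R (y - 1); rewrite (_ : 1 + (y - 1) = y); last by ring.
    by move=> H; apply: le_trans (H _) _; lra.
  apply: (@le_trans _ _ (q * y)); first by rewrite ler_wpM2l.
  have := sqr_ge0 (q - 2^-1 * y); rewrite -subr_ge0 sqrrB exprMn => h; rewrite -subr_ge0.
  by move: h; rewrite (_ : 2^-1 ^+ 2 = 4^-1 :> R); [lra|field].
by rewrite lerDr expR_ge0.
Qed.

(** [frac_bound] with [eps = 1] compares the transforms up to [1 - s] times powers of the frequency;
    integrated against the Gaussian of [dir_mass_fourier], the error is small for [s] near 1,
    uniformly in [om]. *)
Lemma dir_mass_uniform kappa : 0 < kappa ->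
  exists2 rho, 0 < rho <= 1 & exists2 s1, s1 < 1 & forall om, vnorm om = 1 ->
    dir_mass m J1 rho om <= kappa /\
    forall s, 1/2 < s < 1 -> s1 <= s -> dir_mass m (J s) rho om <= kappa.
Proof.
move=> k0; have [i0' i2' i3'] := And3 i0 i2 idelta.
have k2 : 0 < kappa / 2 by rewrite divr_gt0.
have [rho rho01 Hrho] := dir_mass_density h2.1 k2; exists rho => //.
have /andP[rho0 _] := rho01.
have [C C0 HC] := frac_bound hJ h2 i0 i2 idelta.
pose q := 2 + delta + iota; have q0 : 0 <= q by rewrite /q; lra.
pose B := rho^-1 `^ (1/2) * (1 + expR ((1/2) ^+ 2)) + rho^-1 `^ q * (1 + expR (q ^+ 2)).
have B0 : 0 <= B by rewrite addr_ge0// mulr_ge0 ?powR_ge0// addr_ge0// expR_ge0.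
have Lg : L1 leb (fun sg : R => expR (- (4^-1 * sg ^+ 2))) by apply: L1_expR_sqr; rewrite invr_gt0.
set G := I[leb] (fun sg : R => expR (- (4^-1 * sg ^+ 2))) in Lg.
have G0 : 0 <= G by apply: I_ge0 => x; exact: expR_ge0.
have g10 := @I_gauss1_gt0 R.
pose A := C * (B * G) / I[leb] gauss1 + 1.
have A0 : 0 < A by rewrite ltr_wpDl// !mulr_ge0 ?invr_ge0// ltW.
exists (1 - kappa / 2 / A); first by rewrite ltrBlDr ltrDl divr_gt0.
move=> om om1; have H1om := Hrho om om1.
split; first by apply: le_trans H1om _; lra.
move=> s hs s1s; have /andP[s12 s1'] := hs.
have sp : 0 < 1 - s by rewrite subr_gt0.
have [_ Ls _] := prob_densityP (hJ hs); have [_ L1' _] := prob_densityP h2.1.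
have [Ds Es] := dir_mass_fourier rho om Ls; have [D1 E1] := dir_mass_fourier rho om L1'.
have bnd sg : `|ft_re m (J s) (vscale (sg / rho) om) - ft_re m J1 (vscale (sg / rho) om)| <=
    C * (1 - s) * (B * expR (4^-1 * sg ^+ 2)).
  have := (HC s hs 1 (vscale (sg / rho) om) _).1; rewrite ltr01 lexx => /(_ isT).
  rewrite !(congr1 (@^~ _) (powR1 R)) (mul1r (1 - ft_re m (J s) _)) (mul1r (1 - ft_re m J1 _)) vscale1.
  rewrite (_ : _ - _ - _ = ft_re m J1 (vscale (sg / rho) om) - ft_re m (J s) (vscale (sg / rho) om)); last by ring.
  rewrite distrC => h; apply: le_trans h _; rewrite ler_wpM2l ?mulr_ge0 ?(ltW C0) ?(ltW sp)//.
  rewrite vnormZ om1 mulr1 normrM (ger0_norm (_ : 0 <= rho^-1)); last by rewrite invr_ge0 ltW.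
  have ri : 0 <= rho^-1 by rewrite invr_ge0 ltW.
  rewrite mulrC !powRM// /B mulrDl -!mulrA -/q.
  have sq : `|sg| ^+ 2 = sg ^+ 2 by rewrite real_normK ?num_real.
  by apply: lerD; rewrite ler_wpM2l ?powR_ge0// -sq powR_le_gauss.
have key : I[leb] gauss1 * (dir_mass m (J s) rho om - dir_mass m J1 rho om) <=
    (1 - s) * (C * (B * G)).
  rewrite mulrBr Es E1 -I_B// (_ : (1 - s) * _ = (C * (1 - s) * B) * G); last by ring.
  rewrite -I_Z//; apply: I_le; [exact: L1B|exact: L1Z|].
  move=> sg; rewrite -mulrBr; have g0 : 0 <= gauss1 sg by rewrite ltW// gauss1_gt0.
  apply: le_trans (ler_wpM2l g0 (le_trans (ler_norm _) (bnd sg))) _.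
  (* One half of the Gaussian absorbs the polynomial growth, the other half is integrated. *)
  rewrite (_ : gauss1 sg = expR (- (4^-1 * sg ^+ 2)) * expR (- (4^-1 * sg ^+ 2))).
    rewrite (_ : _ * (C * (1 - s) * _) = C * (1 - s) * B * (expR (- (4^-1 * sg ^+ 2)) *
       (expR (- (4^-1 * sg ^+ 2)) * expR (4^-1 * sg ^+ 2)))); last by ring.
    by rewrite -[expR (- _) * expR (4^-1 * _)]expRD addNr expR0 mulr1.
  by rewrite /gauss1 -expRD; congr expR; field.
have : dir_mass m (J s) rho om - dir_mass m J1 rho om <= (1 - s) * A.
  rewrite -(ler_pM2l g10); apply: le_trans key _; rewrite [leRHS]mulrCA ler_wpM2l ?(ltW sp)//.
  by rewrite /A mulrDr mulr1 [_ * (_ / _)]mulrC divfK ?gt_eqF// lerDl ltW.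
have : (1 - s) * A <= kappa / 2 by rewrite -ler_pdivlMr//; clear -s1s; lra.
by clear -H1om; lra.
Qed.

End uniform_mass.

(** * Decay of the transforms at large frequencies *)

Section exponents.
Context {R : realType} {n : nat}.
Notation V := (n.-tuple R).
Notation leb := (leb R).
Variable m : {sigma_finite_measure set V -> \bar R}.
Hypothesis lm : is_lebesgue m.

Lemma expR_le_powR (b P : R) : 0 < b -> 0 < P ->
  exists2 C, 0 < C & forall w, 0 < w -> expR (- (b * w)) <= C * w `^ (- P).
Proof.
(* The maximum of [w^P e^(-b w)], attained at [w = P / b]. *)
move=> b0 P0; exists (expR (P * ln (P / b) - P)); first exact: expR_gt0.
move=> w w0; rewrite /powR gt_eqF// -expRD ler_expR.
have wb : 0 < w * (b / P) by rewrite !mulr_gt0// invr_gt0.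
have h : ln (w * (b / P)) <= w * (b / P) - 1.
  have := @le_ln1Dx R (w * (b / P) - 1).
  rewrite (_ : 1 + (w * (b / P) - 1) = w * (b / P)); last by ring.
  by apply; lra.
have e : ln (w * (b / P)) = ln w - ln (P / b).
  have ePb : b / P = (P / b)^-1 by rewrite invf_div.
  have Pb : 0 < P / b by rewrite divr_gt0.
  have bP : 0 < b / P by rewrite divr_gt0.
  have -> : ln (w * (b / P)) = ln w + ln (b / P) by apply: lnM; rewrite posrE.
  have -> : ln (b / P) = - ln (P / b) by rewrite ePb; apply: lnV; rewrite posrE.
  by [].
rewrite e in h; have := ler_wpM2l (ltW P0) h.
rewrite !mulrBr mulr1 (_ : P * (w * (b / P)) = b * w); last by field; rewrite gt_eqF.
by rewrite mulNr; lra.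
Qed.

Lemma cos_sub_le (x y : R) : `|cos x - cos y| <= `|x - y| /\ `|sin x - sin y| <= `|x - y|.
Proof.
wlog xy : x y / x <= y.
  move=> H; have [/H//|/ltW/H] := leP x y.
  by rewrite (distrC (cos x)) (distrC (sin x)) (distrC x).
have c1 := @cst_continuous R R.
have key (F f : R -> R) : (forall x : R, is_derive x (1 : R) F (f x)) -> continuous f ->
    (forall x, `|f x| <= 1) -> `|F x - F y| <= `|x - y|.
  move=> dF cf f1; rewrite distrC [leRHS]distrC -(FTC_R xy dF cf) [leRHS]ger0_norm ?subr_ge0//.
  rewrite -I_itv_cts; have E : y - x = Rintegral leb `[x, y] (fun=> 1).
    by rewrite Rintegral_itv_cst// mul1r.
  rewrite E -I_itv_cts; apply: I_le_norm; [exact: L1_itv_cts|exact: L1_measurable (L1_itv_cts _ _ cf)|].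
  by move=> r; rewrite normrM ger0_norm ?indic_ge0// ler_wpM2l ?indic_ge0.
split.
  apply: (key cos (fun x => - sin x)).
  - by move=> z; apply: cvgN; exact: continuous_sin.
  - by move=> z; rewrite normrN sin_max.
apply: (key sin cos).
- exact: continuous_cos.
- exact: cos_max.
Qed.

(** If [Z >= 1] the trivial bound [2 E] is enough; if [Z < 1] the Lipschitz bound gives [2 E Z], and
    [Z <= Z^g]. *)
Lemma trig_exp_diff (E g p p' q q' : R) : expR (- p) <= E -> expR (- p') <= E ->
  0 < g <= 1 ->
  `|expR (- p) * cos q - expR (- p') * cos q'| <= 2 * E * (`|p - p'| + `|q - q'|) `^ g /\
  `|expR (- p) * sin q - expR (- p') * sin q'| <= 2 * E * (`|p - p'| + `|q - q'|) `^ g.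
Proof.
move=> pE pE' /andP[g0 g1]; pose Z := `|p - p'| + `|q - q'|; rewrite -/Z.
have Z0 : 0 <= Z by rewrite addr_ge0.
have E0 : 0 <= E by exact: le_trans (expR_ge0 _) pE.
have [dc ds] := cos_sub_le q q'.
have de : `|expR (- p) - expR (- p')| <= 2 * E * `|p - p'|.
  apply: le_trans (expR_sub_le _ _) _.
  rewrite (_ : - p - - p' = - (p - p')); last by ring.
  by rewrite normrN mulrC ler_wpM2r//; lra.
have core a b : `|a| <= 1 -> `|b| <= 1 -> `|a - b| <= `|q - q'| ->
    `|expR (- p) * a - expR (- p') * b| <= 2 * E * Z `^ g.
  move=> a1 b1 ab; have [Z1|Z1] := leP 1 Z.
    apply: (@le_trans _ _ (2 * E)).
      apply: le_trans (ler_normB _ _) _; rewrite !normrM !(ger0_norm (expR_ge0 _)).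
      have h1 : expR (- p) * `|a| <= E by rewrite -[leRHS]mulr1 ler_pM// expR_ge0.
      have h2 : expR (- p') * `|b| <= E by rewrite -[leRHS]mulr1 ler_pM// expR_ge0.
      by lra.
    by rewrite ler_peMr ?mulr_ge0// -(powRr0 Z) ler_powR// ltW.
  apply: (@le_trans _ _ (2 * E * Z)).
    rewrite (_ : _ - _ = (expR (- p) - expR (- p')) * a + expR (- p') * (a - b)); last by ring.
    apply: le_trans (ler_normD _ _) _; rewrite !normrM (ger0_norm (expR_ge0 _)).
    have h1 : `|expR (- p) - expR (- p')| * `|a| <= 2 * E * `|p - p'|.
      by rewrite -[leRHS]mulr1 ler_pM.
    have h2 : expR (- p') * `|a - b| <= E * `|q - q'| by rewrite ler_pM ?expR_ge0.
    have h3 : 0 <= E * `|q - q'| by rewrite mulr_ge0.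
    by rewrite /Z mulrDr -(mulrA 2 E `|q - q'|); lra.
  rewrite ler_wpM2l ?mulr_ge0//; have [->|Zn0] := eqVneq Z 0; first exact: powR_ge0.
  have Zp : 0 < Z by rewrite lt_neqAle eq_sym Zn0.
  have lZ : ln Z <= 0 by rewrite ln_le0// ltW.
  rewrite -{1}(lnK (x := Z)) ?posrE// /powR (negbTE Zn0) ler_expR.
  by rewrite -subr_ge0 (_ : _ - _ = (1 - g) * - ln Z); [rewrite mulr_ge0 ?subr_ge0 ?oppr_ge0|ring].
by split; apply: core => //; [exact: cos_max..|exact: sin_max|exact: sin_max].
Qed.

Lemma decay_exponentE s eps J t xi : prob_density m J -> 0 <= t ->
  decay_exponent m s eps J t xi = eps `^ (- (2 * s)) * log_decay m J t (vscale eps xi).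
Proof.
move=> pJ t0; rewrite /decay_exponent /log_decay; congr (_ * _).
have cf := cts_ft_curve pJ (t := t) (xi := vscale eps xi).
have E r : vscale (expR (r - t)) (vscale eps xi) = vscale (eps * expR (r - t)) xi.
  by apply: eq_tnthP => i; rewrite !tnth_vscale mulrA [expR _ * _]mulrC.
have -> : (fun r => ft_re m J (vscale (eps * expR (r - t)) xi)) =
    (fun r => ft_re m J (vscale (expR (r - t)) (vscale eps xi))).
  by apply/funext => r; rewrite E.
have c1 : continuous (fun _ : R => 1 : R) by exact: cst_continuous.
have Et : Rintegral leb `[0, t] (fun=> 1) = t by rewrite Rintegral_itv_cst// subr0 mul1r.
rewrite -[X in X - _]Et.
rewrite -!I_itv_cts -I_B; [|exact: L1_itv_cts|exact: L1_itv_cts].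
by apply: I_ext => r; ring.
Qed.

Section uniform_decay.
Variables (rho c0 C0 delta a0 kappa : R).
Hypotheses (rho01 : 0 < rho <= 1) (c01 : 0 < c0 <= 1) (C00 : 0 <= C0) (d0 : 0 < delta)
  (hC : C0 * c0 `^ delta <= 1/2) (a00 : 0 < a0) (k01 : 0 < kappa < 1).

Let P := a0 * (1 - kappa).

(** The properties shared by [J s] for [s] near 1 and by [J1] with exponent 1, so that the decay
    bound is proved once, with the same constants for both. *)
Definition nice_kernel (J : V -> R) (s eps : R) :=
  [/\ prob_density m J, small_freq m J s C0 delta, 1/2 <= s <= 1, 0 < eps <= 1 &
    a0 <= eps `^ (- (2 * s)) /\
    forall om, vnorm om = 1 -> dir_mass m J rho om <= kappa / 2].

(** Three ranges of [|eps xi|]. Below [c0] the expansion of the symbol is used. Between [c0] and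
    [c0 e^(t-1)] the window bound gives the power [-P]. Above, the time [t] limits the length of the
    window, and only [e^(-P t)] is left. *)
Lemma expR_exponent_le : exists2 C, 0 < C & exists2 T, 1 <= T &
  forall J s eps t xi, nice_kernel J s eps -> T <= t ->
  expR (- decay_exponent m s eps J t xi) <= C * ((1 + vnorm xi) `^ (- P) + expR (- (P * t))).
Proof.
have /andP[rho0 rho1] := rho01; have /andP[c00 c1] := c01; have /andP[k0 k1] := k01.
have [d0' hC' C00'] := And3 d0 hC C00.
have kk : 0 < 1 - kappa by rewrite subr_gt0.
have P0 : 0 < P by rewrite mulr_gt0.
pose b1 : R := 1/2 * expR (-1) ^+ 2; have b10 : 0 < b1 by rewrite mulr_gt0// exprn_gt0// expR_gt0.
pose b0 : R := 1/2 * (c0 * expR (-1)) ^+ 2.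
have b00 : 0 < b0 by rewrite mulr_gt0// exprn_gt0// mulr_gt0// expR_gt0.
have [C1 C10 HC1] := expR_le_powR b10 P0.
have [C2 C20 HC2] := expR_le_powR b00 P0.
pose A1 := C1 * expR (2 * b1).
pose A2 := C2 * expR (P * (3 - ln rho) + a0 * b0) * (1 + c0^-1) `^ P.
pose A3 := expR (P * (4 - ln (c0 * rho))).
have A10 : 0 < A1 by rewrite mulr_gt0// expR_gt0.
have A20 : 0 < A2 by rewrite !mulr_gt0 ?expR_gt0// powR_gt0// addr_gt0// invr_gt0.
have A30 : 0 < A3 by exact: expR_gt0.
exists (A1 + A2 + A3); first by rewrite !addr_gt0.
exists (4 - ln (c0 * rho)).
  have : ln (c0 * rho) <= 0 by rewrite ln_le0// -[leRHS]mulr1 ler_pM// ltW.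
  by lra.
move=> J s eps t xi [pJ sf /andP[s1 s2] /andP[e0 e1] [aa dm]] Tt.
have lcr : ln (c0 * rho) <= 0 by rewrite ln_le0// -[leRHS]mulr1 ler_pM// ltW.
have t1 : 1 <= t by lra.
have t0 : 0 <= t by lra.
have [J0 LJ IJ] := prob_densityP pJ.
rewrite (decay_exponentE _ _ _ pJ t0).
set a := eps `^ _ in aa *; have ap : 0 < a by exact: lt_le_trans aa.
set y := vnorm xi; have y0 : 0 <= y by exact: vnorm_ge0.
pose eta := vscale eps xi; set I := log_decay m J t _.
have I0 : 0 <= I by exact: log_decay_ge0.
have vY : vnorm eta = eps * y by rewrite vnormZ gtr0_norm.
have w0 : 0 <= (1 + y) `^ (- P) by exact: powR_ge0.
have s0 : 0 <= s by lra.
have e2s : expR (-1) ^+ 2 <= expR (-1) `^ (2 * s) :> R.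
  by rewrite -powR_mulrn ?expR_ge0// /powR gt_eqF ?expR_gt0// expRK ler_expR; lra.
have [Yc|Yc] := leP (vnorm eta) c0.
  have h := log_decay_small pJ sf d0' c01 hC' s0 C00'.
  have {}h := h t eta (t - 1).
  rewrite subr_ge0 t1 subrK lexx subrr expR0 mul1r in h.
  have {}h := h isT isT Yc; rewrite -/I (_ : t - 1 - t = -1) in h; last by ring.
  (* The identity [a eps^(2s) = 1] makes this linear lower bound uniform in [eps]. *)
  have p1 : b1 * (y - 1) <= a * I.
    apply: (@le_trans _ _ (b1 * y `^ (2 * s))).
      rewrite ler_wpM2l ?(ltW b10)//; have [y1|y1] := leP 1 y.
        apply: (@le_trans _ _ (y `^ 1)); first by rewrite powRr1//; lra.
        by apply: ler_powR => //; lra.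
      by apply: (@le_trans _ _ 0); [lra|exact: powR_ge0].
    apply: (@le_trans _ _ (a * (1 / 2 * (expR (-1) * vnorm eta) `^ (2 * s)))); last by rewrite ler_pM2l.
    rewrite vY powRM ?expR_ge0 ?mulr_ge0 ?(ltW e0)// powRM ?(ltW e0)//.
    rewrite (_ : a * _ = (a * eps `^ (2 * s)) * (1/2 * expR (-1) `^ (2 * s) * y `^ (2 * s))); last by ring.
    have -> : a * eps `^ (2 * s) = 1 by rewrite /a powRN mulVf// gt_eqF// powR_gt0.
    rewrite [leRHS]mul1r ler_wpM2r ?powR_ge0//.
    by rewrite /b1 ler_wpM2l.
  apply: (@le_trans _ _ (A1 * (1 + y) `^ (- P))); last first.
    by apply: ler_pM => //; [exact: ltW|rewrite -addrA lerDl addr_ge0// ltW|rewrite lerDl expR_ge0].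
  have y1 : 0 < 1 + y by rewrite ltr_pwDl.
  have h1 := HC1 _ y1; rewrite /A1 [leRHS]mulrAC.
  apply: le_trans (ler_wpM2r (expR_ge0 (2 * b1)) h1).
  by rewrite -expRD ler_expR; lra.
have Y0 : 0 < eps * y by rewrite -vY (lt_trans c00).
have yp : 0 < y by rewrite -(pmulr_rgt0 _ e0).
have om1 : vnorm (vscale (vnorm eta)^-1 eta) = 1.
  by rewrite vnormZ gtr0_norm ?invr_gt0 vY// mulVf// gt_eqF.
have hW := dm _ om1.
have win l : 3 <= l -> l <= t -> expR l <= vnorm eta * rho -> (1 - kappa) * (l - 3) <= I.
  by apply: log_decay_window => //; rewrite vY.
have lnc : ln c0 + ln rho = ln (c0 * rho) by rewrite lnM.
have [Yt|Yt] := leP (vnorm eta) (c0 * expR (t - 1)); last first.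
  (* The window length [t - 1 + ln (c0 rho)] is the one that [|eta| > c0 e^(t-1)] permits. *)
  have p1 : P * (t - 1 + ln (c0 * rho) - 3) <= a * I.
    apply: (@le_trans _ _ (a0 * I)); last by rewrite ler_wpM2r.
    rewrite /P -mulrA ler_pM2l//; apply: win; [lra|lra|].
    rewrite expRD lnK ?posrE ?mulr_gt0// mulrA ler_pM2r// mulrC ltW//.
  apply: (@le_trans _ _ (A3 * expR (- (P * t)))).
    by rewrite /A3 -expRD ler_expR; lra.
  by apply: ler_pM; [exact: ltW|exact: expR_ge0|rewrite lerDr addr_ge0// ltW|rewrite lerDr].
pose L := ln (vnorm eta / c0).
have Yp : 0 < vnorm eta by rewrite vY.
have eL : expR L = vnorm eta / c0 by rewrite lnK// posrE divr_gt0.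
have L0 : 0 <= L by rewrite ln_ge0// ler_pdivlMr// mul1r ltW.
have Lt : L <= t - 1.
  by rewrite -ler_expR eL ler_pdivrMr// mulrC.
have Ib0 : b0 <= I.
  have h := log_decay_small pJ sf d0' c01 hC' s0 C00'.
  have {}h := h t eta (t - L - 1).
  rewrite subrK in h; have {}h := h _ _ _.
  have -> : b0 = 1/2 * (c0 * expR (-1)) ^+ 2 by [].
  apply: le_trans (h _ _ _); [|lra|lra|]; last first.
    by rewrite (_ : t - L - t = - L) ?expRN ?eL; [rewrite invf_div divfK// gt_eqF|ring].
  rewrite (_ : t - L - 1 - t = - L + -1); last by ring.
  rewrite expRD expRN eL invf_div.
  rewrite (_ : c0 / vnorm eta * expR (-1) * vnorm eta = c0 * expR (-1)); last by field; rewrite gt_eqF.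
  rewrite ler_wpM2l// -powR_mulrn ?mulr_ge0 ?expR_ge0 ?(ltW c00)//.
  rewrite /powR gt_eqF ?mulr_gt0 ?expR_gt0// ler_expR ler_wnM2r//; last by lra.
  by rewrite ln_le0// -[leRHS]mulr1 ler_pM ?expR_ge0 ?(ltW c00)// -expR0 ler_expR; lra.
have Iw : (1 - kappa) * (ln (vnorm eta * rho) - 3) <= I.
  have [l3|l3] := leP 3 (ln (vnorm eta * rho)).
    apply: win => //; last by rewrite lnK// posrE mulr_gt0.
    rewrite -ler_expR lnK ?posrE ?mulr_gt0//.
    apply: (@le_trans _ _ (1 * expR (t - 1) * 1)).
      apply: ler_pM => //; [exact: ltW|exact: ltW|].
      by apply: le_trans Yt _; rewrite ler_wpM2r ?expR_ge0.
    by rewrite mul1r mulr1 ler_expR; lra.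
  apply: le_trans I0; rewrite mulr_ge0_le0//; [exact: ltW|lra].
(* The window bound alone gives [(eps |xi|)^-P], which is not uniform in [eps]. The surplus
   [a - a0], multiplied by the low-frequency contribution [b0], yields a factor of order
   [e^(-b0 / eps)], since [a >= 1 / eps], and this absorbs [eps^-P]. *)
have p1 : P * (ln (vnorm eta * rho) - 3) + (a - a0) * b0 <= a * I.
  rewrite (_ : a * I = a0 * I + (a - a0) * I); last by ring.
  by apply: lerD; [rewrite /P -mulrA ler_pM2l|rewrite ler_wpM2l// subr_ge0].
have lnY : ln (vnorm eta * rho) = ln eps + ln y + ln rho.
  by rewrite vY lnM ?posrE ?mulr_gt0// lnM.
have ae : eps^-1 <= a.
  rewrite /a powRN lef_pV2 ?posrE ?powR_gt0//.
  rewrite -[leRHS]powRr1 ?(ltW e0)// /powR gt_eqF// ler_expR ler_wnM2r//; last by lra.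
  by rewrite ln_le0.
have := HC2 eps^-1; rewrite invr_gt0 => /(_ e0).
have -> : eps^-1 `^ (- P) = expR (P * ln eps).
  by rewrite /powR gt_eqF ?invr_gt0// lnV ?posrE// mulrNN.
move=> h2.
apply: (@le_trans _ _ (A2 * (1 + y) `^ (- P))); last first.
  apply: ler_pM => //; [exact: ltW|by rewrite addrAC lerDr addr_ge0// ltW|by rewrite lerDl expR_ge0].
apply: (@le_trans _ _ (C2 * expR (P * (3 - ln rho) + a0 * b0) * y `^ (- P))).
  rewrite /powR gt_eqF// -mulrA -expRD.
  set Z := _ + - P * ln y.
  have h3 := ler_wpM2r (expR_ge0 (Z - P * ln eps)) h2.
  have E3 : C2 * expR (P * ln eps) * expR (Z - P * ln eps) = C2 * expR Z.
    by rewrite -mulrA -expRD; congr (_ * expR _); ring.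
  rewrite E3 -expRD in h3; apply: le_trans h3; rewrite ler_expR /Z.
  have : b0 * eps^-1 <= a * b0 by rewrite mulrC ler_pM2r.
  by move: p1; rewrite lnY; lra.
rewrite /A2 -[leRHS]mulrA ler_wpM2l ?mulr_ge0 ?expR_ge0 ?(ltW C20)//.
have c0i : 0 < 1 + c0^-1 by rewrite addr_gt0// invr_gt0.
have y1 : 0 < 1 + y by rewrite addr_gt0.
have yc : 1 + y <= (1 + c0^-1) * y.
  have : 1 <= c0^-1 * y.
    rewrite ler_pdivlMl// mulr1; apply: le_trans (ltW Yc) _; rewrite vY.
    by rewrite ler_piMl.
  by rewrite mulrDl mul1r; lra.
rewrite /powR !gt_eqF// -expRD ler_expR.
have : ln (1 + y) <= ln (1 + c0^-1) + ln y by rewrite -lnM ?posrE// ler_ln ?posrE// mulr_gt0.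
by rewrite -(ler_pM2l P0); lra.
Qed.

End uniform_decay.
End exponents.

(** * Difference of the two exponents *)

Section exponent_difference.
Context {R : realType} {n : nat}.
Notation V := (n.-tuple R).
Notation leb := (leb R).
Variable m : {sigma_finite_measure set V -> \bar R}.
Hypothesis lm : is_lebesgue m.

Lemma window_weight (f : R -> R) (K A1 A2 b1 b2 t : R) : continuous f -> 0 <= t ->
  0 < b1 -> 0 < b2 -> 0 <= K -> 0 <= A1 -> 0 <= A2 ->
  (forall r, 0 <= r <= t ->
    `|f r| <= K * (A1 * expR (- (b1 * (t - r))) + A2 * expR (- (b2 * (t - r))))) ->
  `|Rintegral leb `[0, t] f| <= K * (A1 / b1 + A2 / b2).
Proof.
move=> cf t0 b10 b20 K0 A10 A20 H.
have [L1' E1] := I_exp_weight b10 t0; have [L2' E2] := I_exp_weight b20 t0.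
have le1 b : b != 0 -> 0 < b -> b * I[leb] (fun r => \1_`[0, t] r * expR (- (b * (t - r)))) =
    1 - expR (- (b * t)) -> I[leb] (fun r => \1_`[0, t] r * expR (- (b * (t - r)))) <= b^-1.
  move=> bn b0 E; rewrite -[leRHS]mulr1 -ler_pdivrMl ?invr_gt0// invrK E gerBl.
  exact: expR_ge0.
pose g r := K * (A1 * (\1_`[0, t] r * expR (- (b1 * (t - r)))) +
  A2 * (\1_`[0, t] r * expR (- (b2 * (t - r))))).
have Lg : L1 leb g by apply: L1Z; apply: L1D; exact: L1Z.
apply: (@le_trans _ _ (I[leb] g)).
  rewrite -I_itv_cts; apply: I_le_norm => //; first exact: L1_measurable (L1_itv_cts _ _ cf).
  move=> r; rewrite normrM (ger0_norm (indic_ge0 _ _)) /g.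
  rewrite indicE; have [/set_mem/= rt|_] := boolP (_ \in _); last by rewrite !mul0r !mulr0 addr0 mulr0.
  by rewrite !mul1r; apply: H; move: rt; rewrite in_itv.
rewrite /g I_Z; last by apply: L1D; exact: L1Z.
rewrite I_D; [|exact: L1Z|exact: L1Z].
rewrite !I_Z//; apply: ler_wpM2l => //.
by apply: lerD; apply: ler_wpM2l => //; apply: le1 => //; rewrite gt_eqF.
Qed.

Lemma cts_ft_s_curve (J : V -> R) (t : R) xi : L1 m J ->
  continuous (fun r : R => ft_s m J (vscale (expR (r - t)) xi)).
Proof.
move=> LJ; rewrite (_ : (fun _ => _) = (fun r : R => I[m] (fun x =>
    sin (vdot x (vscale (expR r) (vscale (expR (- t)) xi))) * J x))).
  by apply: continuous_curve => //; [exact: continuous_sin|exact: sin_max].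
apply/funext => r; congr (ft_s m J _).
by apply: eq_tnthP => i; rewrite !tnth_vscale mulrA -expRD.
Qed.

Lemma decay_exponent_int s eps J t xi : prob_density m J -> 0 <= t ->
  decay_exponent m s eps J t xi = Rintegral leb `[0, t] (fun r =>
    eps `^ (- (2 * s)) * (1 - ft_re m J (vscale eps (vscale (expR (r - t)) xi)))) /\
  continuous (fun r : R =>
    eps `^ (- (2 * s)) * (1 - ft_re m J (vscale eps (vscale (expR (r - t)) xi)))).
Proof.
move=> pJ t0.
have cf := cts_one_sub_ft pJ (t := t) (xi := vscale eps xi).
have E r : vscale (expR (r - t)) (vscale eps xi) = vscale eps (vscale (expR (r - t)) xi).
  by apply: eq_tnthP => i; rewrite !tnth_vscale mulrCA.
have Ef : (fun r : R => eps `^ (- (2 * s)) * (1 - ft_re m J (vscale eps (vscale (expR (r - t)) xi)))) =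
    (fun r : R => eps `^ (- (2 * s)) * (1 - ft_re m J (vscale (expR (r - t)) (vscale eps xi)))).
  by apply/funext => r; rewrite E.
rewrite Ef; split; last by move=> x; apply: cvgM; [exact: cvg_cst|exact: cf].
rewrite decay_exponentE// /log_decay -!I_itv_cts -I_Z; last exact: L1_itv_cts.
by apply: I_ext => r; rewrite mulrCA.
Qed.

Lemma phase_exponent_int s eps J t xi : L1 m J -> 0 <= t ->
  phase_exponent m s eps J t xi = Rintegral leb `[0, t] (fun r =>
    eps `^ (- (2 * s)) * ft_s m J (vscale eps (vscale (expR (r - t)) xi))) /\
  continuous (fun r : R =>
    eps `^ (- (2 * s)) * ft_s m J (vscale eps (vscale (expR (r - t)) xi))).
Proof.
move=> LJ t0.
have cf := @cts_ft_s_curve J t (vscale eps xi) LJ.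
have E r : vscale (expR (r - t)) (vscale eps xi) = vscale eps (vscale (expR (r - t)) xi).
  by apply: eq_tnthP => i; rewrite !tnth_vscale mulrCA.
have E' r : vscale (eps * expR (r - t)) xi = vscale eps (vscale (expR (r - t)) xi).
  by apply: eq_tnthP => i; rewrite !tnth_vscale mulrA.
have Ef : (fun r : R => ft_s m J (vscale (expR (r - t)) (vscale eps xi))) =
    (fun r : R => ft_s m J (vscale eps (vscale (expR (r - t)) xi))).
  by apply/funext => r; rewrite E.
rewrite Ef in cf; split; last by move=> x; apply: cvgM; [exact: cvg_cst|exact: cf].
rewrite /phase_exponent -!I_itv_cts -I_Z.
  by apply: I_ext => r; rewrite E' mulrCA.
apply: L1_ext (L1_itv_cts 0 t cf) => r.
by rewrite E'.
Qed.

Variables (J : R -> V -> R) (J1 : V -> R) (delta iota : R).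
Hypotheses (hJ : forall s, 1/2 < s < 1 -> prob_density m (J s)) (h2 : H2 m J J1 delta).
Hypotheses (i0 : 0 < iota) (i2 : iota <= 1/2) (idelta : iota <= delta / 2).

(** [frac_bound] integrated along the ray: the weights [e^(-(t-r)/2)] and [e^(-Q(t-r))] have
    integrals at most 2 and [1 / Q <= 1], which gives 3 for each of the two exponents. *)
Lemma exponent_diff : exists2 C, 0 < C & forall s, 1/2 < s < 1 -> forall eps t xi,
  0 < eps <= 1 -> 0 <= t ->
  `|decay_exponent m s eps (J s) t xi - decay_exponent m 1 eps J1 t xi| +
  `|phase_exponent m s eps (J s) t xi - phase_exponent m 1 eps J1 t xi| <=
    C * (1 - s) * (1 + vnorm xi) `^ (2 + delta + iota).
Proof.
have [i0' i2' i3'] := And3 i0 i2 idelta.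
have [C C0 HC] := frac_bound hJ h2 i0 i2 idelta.
pose Q := 2 + delta + iota; have Q1 : 1 <= Q by rewrite /Q; lra.
exists (6 * C); first by rewrite mulr_gt0.
move=> s hs eps t xi e01 t0; have sp : 0 <= 1 - s by case/andP: hs; lra.
have pJs := hJ hs; have pJ1 := h2.1.
have [_ Ls _] := prob_densityP pJs; have [_ LJ1 _] := prob_densityP pJ1.
have [-> c1] := decay_exponent_int s eps xi pJs t0.
have [-> c2] := decay_exponent_int 1 eps xi pJ1 t0.
have [-> c3] := phase_exponent_int s eps xi Ls t0.
have [-> c4] := phase_exponent_int 1 eps xi LJ1 t0.
set y := vnorm xi; have y0 : 0 <= y by exact: vnorm_ge0.
have bE r : (vnorm (vscale (expR (r - t)) xi)) `^ (1/2) +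
    (vnorm (vscale (expR (r - t)) xi)) `^ Q =
    y `^ (1/2) * expR (- (1/2 * (t - r))) + y `^ Q * expR (- (Q * (t - r))).
  rewrite vnormZ (ger0_norm (expR_ge0 _)) !powRM ?expR_ge0// !(mulrC _ (y `^ _)).
  by congr (_ * _ + _ * _); rewrite /powR gt_eqF ?expR_gt0// expRK; congr expR; ring.
have half : 0 < 1/2 :> R by lra.
have Qp : 0 < Q by lra.
have K0 : 0 <= C * (1 - s) by rewrite mulr_ge0// ltW.
have sub (f g : R -> R) : continuous f -> continuous g ->
    Rintegral leb `[0, t] f - Rintegral leb `[0, t] g = Rintegral leb `[0, t] (fun r => f r - g r) /\
    continuous (fun r => f r - g r).
  move=> cf cg; split; last by move=> x; apply: cvgB; [exact: cf|exact: cg].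
  by rewrite -!I_itv_cts -I_B; [apply: I_ext => r; ring|exact: L1_itv_cts|exact: L1_itv_cts].
have fin : y `^ (1/2) / (1/2) + y `^ Q / Q <= 3 * (1 + y) `^ Q.
  have w1 : 1 <= 1 + y by rewrite lerDl.
  have h1 : y `^ (1/2) <= (1 + y) `^ Q.
    apply: (@le_trans _ _ ((1 + y) `^ (1/2))).
      by rewrite ge0_ler_powR ?nnegrE//; lra.
    by apply: ler_powR => //; lra.
  have h2' : y `^ Q <= (1 + y) `^ Q by rewrite ge0_ler_powR ?nnegrE//; lra.
  have h3 : y `^ Q / Q <= y `^ Q by rewrite ler_pdivrMr// ler_peMr// powR_ge0.
  by lra.
have -> : 6 * C * (1 - s) * (1 + y) `^ Q =
  C * (1 - s) * (3 * (1 + y) `^ Q) + C * (1 - s) * (3 * (1 + y) `^ Q) by ring.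
have [-> d1] := sub _ _ c1 c2; have [-> d2] := sub _ _ c3 c4.
apply: lerD; (apply: le_trans (ler_wpM2l K0 fin); apply: window_weight => //; try exact: powR_ge0).
- by move=> r _; rewrite -bE; exact: (HC s hs eps _ e01).1.
- by move=> r _; rewrite -bE; exact: (HC s hs eps _ e01).2.
Qed.

End exponent_difference.

(** * Dyadic sums *)

Section dyadic_sums.
Context {R : realType}.
Variable k : R.
Hypothesis k01 : 0 < k < 1.

Let A := (1 - 2 `^ (k - 1))^-1 : R.
Let B' := (2 `^ k - 1)^-1 : R.

Let q1 : 0 < 1 - 2 `^ (k - 1).
Proof.
have /andP[_ k1] := k01.
have l2 : 0 < ln (2 : R) by rewrite ln_gt0// ltr1n.
by rewrite subr_gt0 /powR gt_eqF// -[ltRHS]expR0 ltr_expR pmulr_llt0// subr_lt0.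
Qed.

Let q2 : 0 < 2 `^ k - 1.
Proof.
have /andP[k0 _] := k01.
have l2 : 0 < ln (2 : R) by rewrite ln_gt0// ltr1n.
by rewrite subr_gt0 /powR gt_eqF// -[ltLHS]expR0 ltr_expR mulr_gt0.
Qed.

Let A0 : 0 < A. Proof. by rewrite invr_gt0; exact: q1. Qed.
Let B0 : 0 < B'. Proof. by rewrite invr_gt0; exact: q2. Qed.

Lemma dyadic_shift (f : R -> R) N M :
  \sum_(j < N.+1) f (2 ^+ j * M) = f M + \sum_(j < N) f (2 ^+ j * (2 * M)).
Proof.
rewrite big_ord_recl expr0 mul1r; congr (_ + _); apply: eq_bigr => j _.
by rewrite mulrA -exprSr.
Qed.

Lemma dyadic_sum1 N M : 0 < M -> \sum_(j < N) (2 ^+ j * M) `^ (k - 1) <= A * M `^ (k - 1).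
Proof.
elim: N M => [|N IH] M M0.
  by rewrite big_ord0 mulr_ge0 ?powR_ge0// (ltW A0).
rewrite (dyadic_shift (fun v => v `^ (k - 1))); have := IH (2 * M); rewrite mulr_gt0// => /(_ isT) h.
apply: (@le_trans _ _ (M `^ (k - 1) + A * (2 * M) `^ (k - 1))); first by rewrite lerD2l.
rewrite powRM ?(ltW M0)// le_eqVlt; apply/orP; left; apply/eqP.
rewrite /A; field.
by rewrite gt_eqF.
Qed.

Let T (z v : R) := v `^ k * Order.min 1 (z / v).

Let sum_small N M z : 0 <= z -> 0 < M -> z <= M -> \sum_(j < N) T z (2 ^+ j * M) <= A * z `^ k.
Proof.
move=> z0 M0 zM; have A0' : 0 <= A by exact: ltW A0.
have [->|zn0] := eqVneq z 0.
  rewrite big1 ?mulr_ge0 ?powR_ge0// => j _.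
  by rewrite /T mul0r min_r// mulr0.
have zp : 0 < z by rewrite lt_neqAle eq_sym zn0.
have /andP[_ k1] := k01.
apply: (@le_trans _ _ (z * \sum_(j < N) (2 ^+ j * M) `^ (k - 1))).
  rewrite big_distrr/=; apply: ler_sum => j _.
  have v0 : 0 < 2 ^+ j * M by rewrite mulr_gt0// exprn_gt0.
  apply: (@le_trans _ _ ((2 ^+ j * M) `^ k * (z / (2 ^+ j * M)))).
    by rewrite /T ler_wpM2l ?powR_ge0// ge_min lexx orbT.
  rewrite powRB ?(gt_eqF v0) ?implybT// powRr1 ?(ltW v0)//.
  by rewrite mulrCA.
apply: le_trans (ler_wpM2l z0 (dyadic_sum1 N M0)) _.
rewrite mulrCA ler_wpM2l//.
have Ez : z = z `^ k * z `^ (1 - k).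
  by rewrite -powRD ?(gt_eqF zp) ?implybT// addrC subrK powRr1.
rewrite {1}Ez -mulrA ler_piMr ?powR_ge0//.
rewrite -(opprB 1 k) powRN ler_pdivrMr ?powR_gt0// mul1r ge0_ler_powR ?nnegrE//; lra.
Qed.

(** Geometric sums on both sides of the threshold [v = z]: below it the terms are [v^k], above it
    [z v^(k-1)]. *)
Lemma dyadic_sum2 : exists2 C, 0 < C & forall N M z, 0 <= z -> 0 < M ->
  \sum_(j < N) ((2 ^+ j * M) `^ k * Order.min 1 (z / (2 ^+ j * M))) <= C * z `^ k.
Proof.
have /andP[k0 k1] := k01.
have [A0' B0'] := conj A0 B0.
pose B := A + 2 `^ k * B'.
have Bp : 0 < B by rewrite addr_gt0// mulr_gt0// powR_gt0.
have BE : B' * 2 `^ k = 1 + B' by rewrite /B'; field; rewrite gt_eqF.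
(* The term [- B' M^k] closes the induction: splitting off the first summand [M^k] doubles [M], and
   [B' (2 M)^k = (1 + B') M^k]. *)
have big N M z : 0 <= z -> 0 < M -> M <= 2 * z ->
    \sum_(j < N) T z (2 ^+ j * M) <= B * z `^ k - B' * M `^ k.
  move=> z0; elim: N M => [|N IH] M M0 Mz.
    have h : M `^ k <= 2 `^ k * z `^ k by rewrite -powRM// ge0_ler_powR ?nnegrE ?mulr_ge0// ltW.
    rewrite big_ord0 subr_ge0 /B mulrDl -[leLHS]add0r lerD//.
      by rewrite mulr_ge0 ?powR_ge0// ltW.
    by rewrite mulrAC [leRHS]mulrC ler_wpM2l// ltW.
  have [Mz'|zM] := leP M z; last first.
    apply: le_trans (sum_small _ z0 M0 (ltW zM)) _.
    have h : M `^ k <= 2 `^ k * z `^ k by rewrite -powRM// ge0_ler_powR ?nnegrE ?mulr_ge0// ltW.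
    have := ler_wpM2l (ltW B0) h; rewrite /B mulrDl; lra.
  rewrite dyadic_shift.
  have := IH (2 * M); rewrite mulr_gt0// ler_pM2l// => /(_ isT Mz') h.
  apply: (@le_trans _ _ (M `^ k + (B * z `^ k - B' * (2 * M) `^ k))).
    apply: lerD => //; rewrite /T min_l ?mulr1//.
    by rewrite ler_pdivlMr// mul1r.
  have E2 : B' * (2 * M) `^ k = (1 + B') * M `^ k by rewrite powRM ?(ltW M0)// mulrA BE.
  by rewrite E2 (mulrDl 1 B') mul1r; lra.
exists B => // N M z z0 M0; have [Mz|zM] := leP M (2 * z).
  apply: le_trans (big N M z z0 M0 Mz) _.
  by rewrite gerBl mulr_ge0 ?powR_ge0// ltW.
have zM' : z <= M by lra.
apply: le_trans (sum_small N z0 M0 zM') _.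
by rewrite ler_wpM2r ?powR_ge0// lerDl mulr_ge0 ?powR_ge0// ltW.
Qed.

End dyadic_sums.

(** * Tails of mild solutions *)

Section gauss_transform.
Context {R : realType} {n : nat}.
Notation V := (n.-tuple R).
Variable m : {sigma_finite_measure set V -> \bar R}.
Hypothesis lm : is_lebesgue m.

Let gF := gauss_fourier lm.
Let Lg : L1 m gauss. Proof. by have [] := gF. Qed.
Let c0 : 0 < I[m] gauss. Proof. by have [] := gF. Qed.

Lemma gauss_cos (th : R) xi :
  I[m] (fun x => gauss x * cos (th + vdot x xi)) = I[m] gauss * cos th * gauss xi.
Proof. by have [_ _ _] := gF. Qed.

Lemma measurable_fun_trig (th : R -> R) d (T : measurableType d) (f : T -> R) : continuous th ->
  measurable_fun setT f -> measurable_fun setT (fun x => th (f x)).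
Proof. by move=> cth mf; exact: (measurableT_comp (continuous_measurable_fun cth)). Qed.

(* Gaussian inversion: no integrability of the transform of [h] is needed. *)
Lemma gauss_conv (h : V -> R) (b : R) x : L1 m h ->
  L1 m (fun xi => gauss xi * (cos (vdot x (vscale b xi)) * ft_re m h (vscale b xi) +
    sin (vdot x (vscale b xi)) * ft_s m h (vscale b xi))) /\
  I[m] gauss * I[m] (fun z => gauss (vscale b (vsub x z)) * h z) =
  I[m] (fun xi => gauss xi * (cos (vdot x (vscale b xi)) * ft_re m h (vscale b xi) +
    sin (vdot x (vscale b xi)) * ft_s m h (vscale b xi))).
Proof.
move=> hh.
pose F (q : V * V) := gauss q.1 * (cos (vdot (vsub x q.2) (vscale b q.1)) * h q.2).
have mF : measurable_fun setT F.
  apply: measurable_funM; first by apply: (measurableT_comp measurable_gauss); exact: measurable_fst.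
  apply: measurable_funM; last by apply: (measurableT_comp (L1_measurable hh)); exact: measurable_snd.
  apply: measurable_fun_trig; first exact: continuous_cos.
  apply: measurable_fun_vdot.
    by apply: measurable_fun_vsub => //; exact: measurable_snd.
  by apply: measurable_fun_vscale => //; exact: measurable_fst.
have Lc xi : L1 m (fun z => cos (vdot (vsub x z) xi) * h z).
  apply: (L1M (c := 1)) => //; last by move=> z; exact: cos_max.
  apply: measurable_fun_trig; first exact: continuous_cos.
  by apply: measurable_fun_vdot => //; exact: measurable_fun_vsub.
have LF : L1 (m \x m)%E F.
  apply: (@L1_prodI _ _ _ _ _ m m _ (fun xi => I[m] (fun z => `|h z|) * gauss xi)) => //.
    exact: L1Z.
  move=> xi; have L : L1 m (fun z => F (xi, z)) by rewrite /F/=; exact: (L1Z _ (Lc _)).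
  split=> //; rewrite mulrC -I_Z; last exact: L1_norm.
  apply: I_le; [exact: L1_norm|by apply: L1Z; exact: L1_norm|].
  move=> z; rewrite /F/= !normrM (ger0_norm (gauss_ge0 _)) ler_wpM2l ?gauss_ge0//.
  by rewrite ler_piMl// cos_max.
have [L1' E1] := I_prod1 LF; have [L2' E2] := I_prod2 LF.
have A xi : I[m] (fun z => F (xi, z)) =
    gauss xi * (cos (vdot x (vscale b xi)) * ft_re m h (vscale b xi) +
    sin (vdot x (vscale b xi)) * ft_s m h (vscale b xi)).
  rewrite /F/= I_Z; last exact: Lc.
  congr (_ * _); rewrite /ft_re /ft_s -I_Z; last exact: L1_cos.
  rewrite -I_Z; last exact: L1_sin.
  rewrite -I_D; [|by apply: L1Z; exact: L1_cos|by apply: L1Z; exact: L1_sin].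
  by apply: I_ext => z; rewrite vdotBl cosB; ring.
have B z : I[m] (fun xi => F (xi, z)) = I[m] gauss * (gauss (vscale b (vsub x z)) * h z).
  have C xi : F (xi, z) = h z * (gauss xi * cos (0 + vdot xi (vscale b (vsub x z)))).
    by rewrite /F/= add0r vdotZr vdotZr vdotC; ring.
  rewrite (I_ext m C) I_Z; first by rewrite gauss_cos cos0; ring.
  apply: (L1_ext (f := fun xi => cos (0 + vdot xi (vscale b (vsub x z))) * gauss xi)).
    by move=> xi; rewrite mulrC.
  apply: (L1M (c := 1)) => //; last by move=> xi; exact: cos_max.
  exact: measurable_cos_vdot.
split; first by apply: L1_ext L1' => xi; rewrite A.
rewrite -(I_ext m A) E1 -E2 (I_ext m B) I_Z//.
apply: (L1M (c := 1)) => //.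
  apply: (measurableT_comp measurable_gauss); apply: measurable_fun_vscale => //.
  exact: measurable_fun_vsub.
by move=> z; rewrite ger0_norm ?gauss_ge0// gauss_le1.
Qed.

(** A smooth tail cut-off: at least 1/3 beyond radius [v], at most [|x| / v], and such that its
    integral against a probability density [f] is a normalized Gaussian average of [1 - f^]. *)
Definition psi (v : R) (x : V) := 1 - gauss (vscale v^-1 x).

Lemma psi_ge0 v x : 0 <= psi v x.
Proof. by rewrite subr_ge0 gauss_le1. Qed.

Lemma psi_le1 v x : psi v x <= 1.
Proof. by rewrite gerBl gauss_ge0. Qed.

Lemma measurable_psi v : measurable_fun setT (psi v).
Proof.
apply: measurable_funB => //; apply: (measurableT_comp measurable_gauss).
exact: measurable_fun_vscale.
Qed.

Lemma psi_ge v x : 0 < v -> v <= vnorm x -> 1 <= 3 * psi v x.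
Proof.
move=> v0 vx; rewrite /psi /gauss -sqr_vnorm vnormZ gtr0_norm ?invr_gt0//.
have w1 : 1 <= v^-1 * vnorm x by rewrite mulrC ler_pdivlMr// mul1r.
have w2 : 1 <= (v^-1 * vnorm x) ^+ 2 by rewrite expr_ge1// (le_trans ler01).
set W := _ ^+ 2 in w2 *.
have h := expR_ge1Dx (W / 2); have e0 := expR_gt0 (W / 2).
have e : expR (- W / 2) <= 2 / 3.
  have -> : 2 / 3 = (3 / 2)^-1 :> R by field.
  have h32 : 3 / 2 <= expR (W / 2) by move: h w2; lra.
  by rewrite mulNr expRN lef_pV2 ?posrE ?expR_gt0 ?divr_gt0.
by move: e; lra.
Qed.

Lemma psi_le_min v x : 0 < v -> psi v x <= Order.min 1 (vnorm x / v).
Proof.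
move=> v0; rewrite le_min psi_le1/=.
rewrite /psi /gauss -sqr_vnorm vnormZ gtr0_norm ?invr_gt0// [v^-1 * _]mulrC.
set W := vnorm x / v; have W0 : 0 <= W by rewrite divr_ge0 ?vnorm_ge0// ltW.
have h := expR_ge1Dx (- W ^+ 2 / 2); have e0 := expR_gt0 (- W ^+ 2 / 2).
have [W1|W1] := leP W 1; last by move: e0; lra.
have : W ^+ 2 <= W by rewrite expr2 ler_piMl.
by move: h; lra.
Qed.

Lemma L1_psi v f : L1 m f -> L1 m (fun x => psi v x * f x).
Proof.
move=> hf; apply: (L1M (c := 1)) => //; first exact: measurable_psi.
by move=> x; rewrite ger0_norm ?psi_ge0// psi_le1.
Qed.

Lemma vdot0l (x : V) : vdot [tuple 0 | _ < n] x = 0.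
Proof. by rewrite /vdot big1// => i _; rewrite tnth_mktuple mul0r. Qed.

Lemma I_psi v f : L1 m f ->
  L1 m (fun xi => gauss xi * (I[m] f - ft_re m f (vscale v^-1 xi))) /\
  I[m] gauss * I[m] (fun x => psi v x * f x) =
  I[m] (fun xi => gauss xi * (I[m] f - ft_re m f (vscale v^-1 xi))).
Proof.
move=> hf; have [L E] := gauss_conv v^-1 [tuple 0 | _ < n] hf.
have e xi : gauss xi * (cos (vdot [tuple 0 | _ < n] (vscale v^-1 xi)) * ft_re m f (vscale v^-1 xi) +
    sin (vdot [tuple 0 | _ < n] (vscale v^-1 xi)) * ft_s m f (vscale v^-1 xi)) =
    gauss xi * ft_re m f (vscale v^-1 xi).
  by rewrite vdot0l cos0 sin0 mul1r mul0r addr0.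
have L' : L1 m (fun xi => gauss xi * ft_re m f (vscale v^-1 xi)) by apply: L1_ext L => xi; rewrite e.
rewrite (I_ext m e) in E.
have gs z : gauss (vscale v^-1 (vsub [tuple 0 | _ < n] z)) = gauss (vscale v^-1 z).
  rewrite /gauss -!sqr_vnorm !vnormZ (_ : vnorm (vsub _ z) = vnorm z)//.
  rewrite -[RHS]mul1r -[X in X * _](normrN1 R) -vnormZ; congr vnorm.
  by apply: eq_tnthP => i; rewrite tnth_vsub [X in X - _]tnth_mktuple tnth_vscale; ring.
have Lgf : L1 m (fun x => gauss (vscale v^-1 x) * f x).
  apply: (L1M (c := 1)) => //; last by move=> x; rewrite ger0_norm ?gauss_ge0// gauss_le1.
  by apply: (measurableT_comp measurable_gauss); exact: measurable_fun_vscale.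
have Lgc : L1 m (fun xi => gauss xi * I[m] f).
  by apply: L1_ext (L1Z (I[m] f) Lg) => x; rewrite mulrC.
have Ed xi : gauss xi * (I[m] f - ft_re m f (vscale v^-1 xi)) =
  gauss xi * I[m] f - gauss xi * ft_re m f (vscale v^-1 xi) by ring.
split; first by apply: L1_ext (L1B Lgc L') => xi; rewrite Ed.
rewrite (I_ext m Ed) I_B// -E I_Zr//.
have -> : I[m] (fun x => psi v x * f x) = I[m] f - I[m] (fun x => gauss (vscale v^-1 x) * f x).
  by rewrite -I_B//; apply: I_ext => x; rewrite /psi; ring.
have Eg : I[m] (fun z => gauss (vscale v^-1 (vsub [tuple 0 | _ < n] z)) * f z) =
    I[m] (fun x => gauss (vscale v^-1 x) * f x).
  by apply: I_ext => z; rewrite gs.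
by rewrite Eg mulrBr.
Qed.

Lemma L1_gauss_vnorm : L1 m (fun x => gauss x * vnorm x).
Proof.
pose b : R := Num.sqrt (2^-1).
have b2 : b ^+ 2 = 2^-1 by rewrite sqr_sqrtr// invr_ge0.
have b0 : b != 0 by rewrite gt_eqF// sqrtr_gt0 invr_gt0.
have L := L1Z (1 + expR (1 ^+ 2)) (L1_affine lm [tuple 0 | _ < n] b0 Lg).
apply: L1_le L.
  by apply: measurable_funM; [exact: measurable_gauss|exact: measurable_vnorm].
move=> x; rewrite ger0_norm ?mulr_ge0 ?gauss_ge0 ?vnorm_ge0//.
have := @powR_le_gauss R 1 (vnorm x) ler01 (vnorm_ge0 x).
rewrite powRr1 ?vnorm_ge0// => h.
apply: le_trans (ler_wpM2l (gauss_ge0 x) h) _.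
rewrite mulrCA ler_wpM2l ?addr_ge0 ?expR_ge0//.
have -> : affine b [tuple 0 | _ < n] x = vscale b x.
  by apply: eq_tnthP => i; rewrite tnth_vsub [X in _ - X]tnth_mktuple subr0.
rewrite /gauss -!sqr_vnorm vnormZ exprMn real_normK ?num_real// b2 -expRD ler_expR le_eqVlt.
by apply/orP; left; apply/eqP; field.
Qed.

End gauss_transform.

Lemma I_sum d (T : measurableType d) (R : realType) (m : {measure set T -> \bar R})
    N (F : 'I_N -> T -> R) : (forall j, L1 m (F j)) ->
  L1 m (fun x => \sum_(j < N) F j x) /\
  I[m] (fun x => \sum_(j < N) F j x) = \sum_(j < N) I[m] (F j).
Proof.
elim: N F => [|N IH] F hF.
  split; first by apply: L1_ext (L10 m) => x; rewrite big_ord0.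
  by rewrite big_ord0 -[RHS](I_0 m); apply: I_ext => x; rewrite big_ord0.
have [L E] := IH (fun j => F (lift ord0 j)) (fun j => hF _).
have ES x : F ord0 x + \sum_(j < N) F (lift ord0 j) x = \sum_(j < N.+1) F j x.
  by rewrite big_ord_recl.
split; first by apply: L1_ext (L1D (hF ord0) L) => x; rewrite ES.
by rewrite -(I_ext m ES) I_D// E big_ord_recl.
Qed.

(** * Weighted tails, uniformly in s and eps *)

Section tails.
Context {R : realType} {n : nat}.
Notation V := (n.-tuple R).
Notation leb := (leb R).
Variable m : {sigma_finite_measure set V -> \bar R}.
Hypothesis lm : is_lebesgue m.
Variables (k C0 delta : R).
Hypotheses (k01 : 0 <= k < 1) (C00 : 0 <= C0) (d0 : 0 < delta).

Lemma jbr_ge_vnorm (x : V) : vnorm x <= jbr x.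
Proof.
rewrite /jbr -{1}(ger0_norm (vnorm_ge0 x)) -sqrtr_sqr ler_wsqrtr//.
by rewrite lerDr.
Qed.

Lemma jbr_le (x : V) (v : R) : 1 <= v -> vnorm x <= v -> jbr x <= 3 / 2 * v.
Proof.
move=> v1 xv; have v0 : 0 <= v by exact: le_trans v1.
rewrite /jbr -[leRHS](ger0_norm (_ : 0 <= 3 / 2 * v)); last by rewrite mulr_ge0// divr_ge0.
rewrite -sqrtr_sqr ler_wsqrtr//.
have h1 : 1 <= v ^+ 2 by rewrite expr_ge1.
have h2 : vnorm x ^+ 2 <= v ^+ 2 by rewrite ler_pXn2r// nnegrE// vnorm_ge0.
by rewrite exprMn (_ : (3 / 2) ^+ 2 = 9 / 4 :> R); [lra|field].
Qed.

Lemma jbr_powR_le (x : V) (v : R) : 1 <= v -> vnorm x <= v -> jbr x `^ k <= 3 / 2 * v `^ k.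
Proof.
move=> v1 xv; have /andP[k0 k1] := k01; have v0 : 0 <= v by exact: le_trans v1.
have j0 : 0 <= jbr x by exact: sqrtr_ge0.
apply: (@le_trans _ _ ((3 / 2 * v) `^ k)).
  by rewrite ge0_ler_powR// ?nnegrE ?mulr_ge0 ?divr_ge0// jbr_le.
rewrite powRM// ?divr_ge0// ler_wpM2r ?powR_ge0//.
rewrite -[leRHS]powRr1 ?divr_ge0//; apply: ler_powR; last exact: ltW.
by lra.
Qed.

(** If [x] lies in the shell from [v = 2^j M] to [2 v], the single term at [v] suffices:
    [<x>^k <= 3/2 (2 v)^k <= 3 v^k] and [1 <= 3 psi v x]. *)
Lemma dyadic_cover N M (x : V) : 1 <= M -> M < vnorm x -> vnorm x <= 2 ^+ N * M ->
  jbr x `^ k <= 9 * \sum_(j < N) (2 ^+ j * M) `^ k * psi (2 ^+ j * M) x.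
Proof.
move=> M1 Mx; have M0 : 0 < M by exact: lt_le_trans M1.
have t0 v : 0 <= v `^ k * psi v x by rewrite mulr_ge0 ?powR_ge0// psi_ge0.
elim: N => [|N IH] xN.
  by move: xN; rewrite expr0 mul1r => /(lt_le_trans Mx); rewrite ltxx.
rewrite big_ord_recr/=; have [xN'|xN'] := leP (vnorm x) (2 ^+ N * M).
  by apply: le_trans (IH xN') _; rewrite ler_pM2l// lerDl t0.
set v := 2 ^+ N * M in xN' *.
have v1 : 1 <= v by rewrite -[leLHS]mul1r ler_pM// exprn_ege1// ler1n.
have v0 : 0 < v by exact: lt_le_trans v1.
have S0 : 0 <= \sum_(j < N) (2 ^+ j * M) `^ k * psi (2 ^+ j * M) x by rewrite sumr_ge0.
apply: (@le_trans _ _ (9 * (v `^ k * psi v x))); last by rewrite ler_pM2l// lerDr.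
have h1 := psi_ge v0 (ltW xN').
have x2v : vnorm x <= 2 * v by rewrite /v mulrA -exprS.
have v2 : 1 <= 2 * v by lra.
have /andP[k0 k1] := k01.
apply: le_trans (jbr_powR_le v2 x2v) _; rewrite powRM ?(ltW v0)//.
have p2 : 2 `^ k <= 2 :> R.
  by rewrite -[leRHS]powRr1//; apply: ler_powR; [lra|exact: ltW].
have vk : 0 <= v `^ k by exact: powR_ge0.
apply: (@le_trans _ _ (3 * v `^ k)).
  by rewrite mulrA ler_wpM2r//; lra.
rewrite (_ : 9 * _ = 3 * v `^ k * (3 * psi v x)); last by ring.
by rewrite ler_peMr// mulr_ge0.
Qed.

Section one_solution.
Variables (s eps : R) (J u0 : V -> R) (u : R -> V -> R).
Hypotheses (s12 : 1/2 <= s <= 1) (e01 : 0 < eps <= 1).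
Hypotheses (pJ : prob_density m J) (sf : small_freq m J s C0 delta).
Hypotheses (pu0 : prob_density m u0) (u0k : (L1k_norm m k u0 < +oo)%E)
  (ms : mild_solution m k s eps J u0 u).

Let k0 : 0 <= k. Proof. by case/andP: k01. Qed.
Let eps0 : 0 < eps. Proof. by case/andP: e01. Qed.

(** As [2 s >= 1] and [eps^(-2s)] cancels in the main term, the rescaled symbol at [e^(r-t) zeta] is
    at most [(1 + C0) e^(r-t) |zeta|], whose time integral is bounded uniformly in [eps] and [t]. *)
Lemma exponent_small t zeta : 0 <= t -> vnorm zeta <= 1 ->
  [/\ 0 <= decay_exponent m s eps J t zeta,
    decay_exponent m s eps J t zeta <= (1 + C0) * vnorm zeta &
    `|phase_exponent m s eps J t zeta| <= (1 + C0) * vnorm zeta].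
Proof.
move=> t0 z1; have /andP[s1 s2] := s12; have /andP[e0 e1] := e01; have C00' := C00; have d0' := d0.
have [_ LJ _] := prob_densityP pJ.
have half : 0 < 1 :> R by [].
set y := vnorm zeta in z1 *; have y0 : 0 <= y by exact: vnorm_ge0.
have pt r : 0 <= r <= t -> vnorm (vscale eps (vscale (expR (r - t)) zeta)) <= 1 /\
    eps `^ (- (2 * s)) * vnorm (vscale eps (vscale (expR (r - t)) zeta)) `^ (2 * s) <=
    y * expR (- (1 * (t - r))) /\
    vnorm (vscale eps (vscale (expR (r - t)) zeta)) `^ (2 * s + delta) <=
    vnorm (vscale eps (vscale (expR (r - t)) zeta)) `^ (2 * s).
  move=> /andP[r0 rt]; rewrite !vnormZ (gtr0_norm e0) (ger0_norm (expR_ge0 _)) -/y.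
  have w0 : 0 <= expR (r - t) * y by rewrite mulr_ge0 ?expR_ge0.
  have e1' : expR (r - t) <= 1 by rewrite -expR0 ler_expR subr_le0.
  have w1 : expR (r - t) * y <= 1 by rewrite -[leRHS]mulr1 ler_pM ?expR_ge0.
  have ew1 : eps * (expR (r - t) * y) <= 1 by rewrite -[leRHS]mulr1 ler_pM// ltW.
  have ew0 : 0 <= eps * (expR (r - t) * y) by rewrite mulr_ge0// ltW.
  have low (z e f : R) : 0 <= z <= 1 -> 0 < e -> e <= f -> z `^ f <= z `^ e.
    move=> /andP[z0 z1'] ee ef; have [->|zn0] := eqVneq z 0.
      by rewrite !powR0 ?gt_eqF// (lt_le_trans ee).
    rewrite /powR (negbTE zn0) ler_expR ler_wnM2r// ln_le0//.
  split=> //; split; last by apply: low; [rewrite ew0|lra|lra].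
  rewrite powRM ?(ltW e0)// mulrA powRN mulVf ?gt_eqF ?powR_gt0// !mul1r.
  apply: (@le_trans _ _ ((expR (r - t) * y) `^ 1)).
    by apply: low; [rewrite w0|by []|lra].
  by rewrite powRr1// mulrC opprB.
have a0 : 0 <= eps `^ (- (2 * s)) by exact: powR_ge0.
have [Ed cd] := decay_exponent_int s eps zeta pJ t0.
have [Ep cp] := phase_exponent_int s eps zeta LJ t0.
have W f : continuous f -> (forall r, 0 <= r <= t -> `|f r| <= (1 + C0) *
     (eps `^ (- (2 * s)) * vnorm (vscale eps (vscale (expR (r - t)) zeta)) `^ (2 * s))) ->
   `|Rintegral leb `[0, t] f| <= (1 + C0) * y.
  move=> cf Hf; rewrite (_ : (1 + C0) * y = (1 + C0) * (y / 1 + 0 / 1)); last by field.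
  apply: window_weight => //; first by rewrite addr_ge0.
  move=> r rt; apply: le_trans (Hf r rt) _; rewrite mul0r addr0 ler_wpM2l ?addr_ge0//.
  exact: (pt r rt).2.1.
split.
- by rewrite decay_exponentE// mulr_ge0 ?powR_ge0// log_decay_ge0.
- apply: le_trans (ler_norm _) _; rewrite Ed; apply: W => // r rt.
  have [v1 [_ vd]] := pt r rt; have [h _] := sf v1.
  rewrite normrM (ger0_norm a0) mulrCA ler_wpM2l//.
  move: h vd; set X := ft_re _ _ _; set p := _ `^ (2 * s); set q := _ `^ (2 * s + delta) => h vd.
  have p0 : 0 <= p by exact: powR_ge0.
  have qq : C0 * q <= C0 * p by rewrite ler_wpM2l.
  by move: h; rewrite !ler_norml => /andP[? ?]; apply/andP; split; lra.
- rewrite Ep; apply: W => // r rt.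
  have [v1 [_ vd]] := pt r rt; have [_ h] := sf v1.
  rewrite normrM (ger0_norm a0) mulrCA ler_wpM2l//.
  move: h vd; set X := ft_s _ _ _; set p := _ `^ (2 * s); set q := _ `^ (2 * s + delta) => h vd.
  have p0 : 0 <= p by exact: powR_ge0.
  have qq : C0 * q <= C0 * p by rewrite ler_wpM2l.
  by move: h; lra.
Qed.

(** The mass is the transform at frequency 0, where both exponents vanish. *)
Lemma mild_density t : 0 <= t -> L1 m (u t) /\ I[m] (u t) = 1.
Proof.
move=> t0; have Lu := mild_L1 k0 ms t0; split=> //.
pose z : V := [tuple 0 | _ < n].
have z1 : vnorm z <= 1 by rewrite vnorm0.
have [p0 p1 q1] := exponent_small t0 z1; rewrite vnorm0 mulr0 in p1 q1.
have pE : decay_exponent m s eps J t z = 0 by apply/eqP; rewrite eq_le p1.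
have qE : phase_exponent m s eps J t z = 0 by apply/eqP; rewrite -normr_le0.
have [+ _] := mild_fourier lm k0 eps0 pJ pu0 ms z t0.
rewrite pE qE oppr0 expR0 cos0 sin0 mulr0 subr0 mul1r mulr1.
have z0 : vscale (expR (- t)) z = z by apply: eq_tnthP => i; rewrite tnth_vscale tnth_mktuple mulr0.
have v0 (x : V) : vdot x z = 0 by rewrite vdotC vdot0l.
have fz f : ft_re m f z = I[m] f by apply: I_ext => x; rewrite v0 cos0 mul1r.
by rewrite z0 !fz => ->; have [] := prob_densityP pu0.
Qed.

Lemma mild_ft_near1 t zeta : 0 <= t ->
  1 - ft_re m (u t) zeta <= (1 - ft_re m u0 (vscale (expR (- t)) zeta)) +
    3 * (1 + C0) * vnorm zeta.
Proof.
move=> t0; have C00' := C00; have [_ Lu0 Iu0] := prob_densityP pu0.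
have c1 := ft_re_prob_le1 pu0 (vscale (expR (- t)) zeta).
have s1 := ft_s_prob_le1 pu0 (vscale (expR (- t)) zeta).
(* For [|zeta| > 1] the left side is at most 2, below the linear term on the right. *)
have [z1|z1] := leP (vnorm zeta) 1; last first.
  have [Lu Iu] := mild_density t0.
  have nu : I[m] (fun x => `|u t x|) = 1.
    rewrite -[RHS]Iu; apply: I_ae; [exact: L1_measurable (L1_norm Lu)|exact: L1_measurable Lu|].
    by apply: filterS (mild_ge0 lm k0 eps0 pJ pu0 ms t0) => x ux; rewrite ger0_norm.
  have := ft_re_le1 zeta Lu; rewrite nu ler_norml => /andP[h _].
  move: c1; rewrite ler_norml => /andP[_ c1].
  have : 3 <= 3 * (1 + C0) * vnorm zeta by rewrite -[leLHS]mulr1 ler_pM//; lra.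
  by move: h c1; lra.
have [p0 p1 q1] := exponent_small t0 z1.
have [-> _] := mild_fourier lm k0 eps0 pJ pu0 ms zeta t0.
move: p0 p1 q1 c1 s1; set p := decay_exponent _ _ _ _ _ _; set q := phase_exponent _ _ _ _ _ _.
set c := ft_re _ _ _; set sn := ft_s _ _ _; set y := vnorm zeta => p0 p1 q1 c1 s1.
have ep1 : expR (- p) <= 1 by rewrite -expR0 ler_expR oppr_le0.
have ep := expR_ge1Dx (- p); have e0 := expR_ge0 (- p).
have [cq sq] := cos_sub_le q 0; rewrite cos0 sin0 !subr0 in cq sq.
(* The decay exponent enters once and the phase twice, which is the origin of the factor 3. *)
have h1 : c - expR (- p) * (c * cos q - sn * sin q) =
  c * (1 - expR (- p)) + expR (- p) * (- (c * (cos q - 1)) + sn * sin q) by ring.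
have h2 : `|c * (1 - expR (- p))| <= p.
  rewrite normrM -[leRHS]mul1r; apply: ler_pM => //.
  by rewrite ger0_norm ?subr_ge0//; lra.
have h3 : `|c * (cos q - 1)| <= `|q| by rewrite normrM -[leRHS]mul1r ler_pM.
have h4 : `|sn * sin q| <= `|q| by rewrite normrM -[leRHS]mul1r ler_pM.
have h5 : `|expR (- p) * (- (c * (cos q - 1)) + sn * sin q)| <= `|q| + `|q|.
  rewrite normrM ger0_norm// -[leRHS]mul1r; apply: ler_pM => //.
  apply: le_trans (ler_normD _ _) _; rewrite normrN; exact: lerD.
have h6 := le_trans (ler_norm _) h2; have h7 := le_trans (ler_norm _) h5.
by move: h1 h6 h7 p1 q1; lra.
Qed.

Definition tail_cst := 3 * (1 + C0) * (I[m] (fun x => gauss x * vnorm x) / I[m] gauss).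

(** The datum enters at frequency [e^-t xi / v], so its tail is tested at the radius [e^t v], which
    recedes with time. The kernel contributes the linear bound near frequency 0, hence [1 / v]. *)
Lemma psi_mild t v : 0 <= t -> 0 < v ->
  I[m] (fun x => psi v x * u t x) <= I[m] (fun x => psi (expR t * v) x * u0 x) + tail_cst / v.
Proof.
move=> t0 v0; have [Lu Iu] := mild_density t0; have [_ Lu0 Iu0] := prob_densityP pu0.
have [_ _ c0 _] := gauss_fourier lm.
have [L1u E1] := I_psi lm v Lu; have [L2u E2] := I_psi lm (expR t * v) Lu0.
have Lgv := L1_gauss_vnorm lm.
rewrite -(ler_pM2l c0) mulrDr E1 E2.
have -> : I[m] gauss * (tail_cst / v) =
    I[m] (fun x => (3 * (1 + C0) / v) * (gauss x * vnorm x)).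
  rewrite I_Z// /tail_cst; field.
  by rewrite !gt_eqF.
rewrite -I_D//; last exact: L1Z.
apply: I_le => //; first by apply: L1D => //; exact: L1Z.
move=> x; rewrite Iu Iu0.
have -> : gauss x * (1 - ft_re m u0 (vscale (expR t * v)^-1 x)) +
    3 * (1 + C0) / v * (gauss x * vnorm x) =
  gauss x * ((1 - ft_re m u0 (vscale (expR t * v)^-1 x)) + 3 * (1 + C0) * (v^-1 * vnorm x)) by ring.
rewrite ler_wpM2l ?gauss_ge0//.
have := mild_ft_near1 (vscale v^-1 x) t0.
rewrite vnormZ (gtr0_norm (_ : 0 < v^-1)) ?invr_gt0//.
rewrite (_ : vscale (expR (- t)) (vscale v^-1 x) = vscale (expR t * v)^-1 x)//.
by apply: eq_tnthP => i; rewrite !tnth_vscale expRN invfM mulrA.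
Qed.

Lemma measurable_gt_vnorm M : measurable_fun setT (fun x : V => (M < vnorm x)%R%:R : R).
Proof.
rewrite (_ : (fun x : V => _) = \1_[set x : V | M < vnorm x]); last first.
  apply/funext => x; rewrite indicE; case: (ltP M (vnorm x)) => h; first by rewrite mem_set.
  by rewrite memNset//=; apply/negP; rewrite -leNgt.
apply: measurable_indic.
rewrite (_ : [set x | _] = (@vnorm R n) @^-1` `]M, +oo[).
  by rewrite -[X in measurable X]setTI; exact: measurable_vnorm.
by apply/seteqP; split=> x /=; rewrite in_itv/= andbT.
Qed.

Lemma L1k_mild t : 0 <= t -> L1 m (fun x => jbr x `^ k * `|u t x|).
Proof. by move=> /ms.1[mu uk]; have [] := L1k_lty k0 mu uk. Qed.

Lemma measurable_tail M t : 0 <= t ->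
  measurable_fun setT (fun x => (M < vnorm x)%R%:R * (jbr x `^ k * `|u t x|)).
Proof.
by move=> t0; apply: measurable_funM; [exact: measurable_gt_vnorm|exact: L1_measurable (L1k_mild t0)].
Qed.

(** For [k = 0] the dyadic weights do not grow geometrically, and a single radius is enough. The
    tail of the datum tends to 0 without a rate, by dominated convergence. *)
Lemma mild_tail_k0 : k = 0 -> forall M e, 1 <= M -> 0 < e -> exists2 T, 0 < T &
  forall t, T <= t -> I[m] (fun x => (M < vnorm x)%R%:R * (jbr x `^ k * `|u t x|)) <=
    3 * tail_cst * M `^ (k - 1) + e.
Proof.
move=> kE M e M1 e0; have M0 : 0 < M by exact: lt_le_trans M1.
have [_ Lu0 Iu0] := prob_densityP pu0.
have [T T0 HT] : exists2 T, 0 < T & forall t, T <= t ->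
    I[m] (fun x => psi (expR t * M) x * u0 x) <= e / 3.
  apply: eventually_le_seq; last by rewrite divr_gt0.
  move=> t_ ht; rewrite -[X in _ --> X](I_0 m).
  apply: (I_dct (g := fun x => `|u0 x|) _ _ _ _).2.
  - move=> j; apply: measurable_funM; [exact: measurable_psi|exact: L1_measurable Lu0].
  - exact: L1_norm.
  - by move=> j x; rewrite normrM ler_piMl// ger0_norm ?psi_ge0// psi_le1.
  - move=> x; rewrite -[X in _ --> X](mul0r (u0 x)); apply: cvgnM; last exact: cvgn_cst.
    apply: (@squeeze_cvg0 _ _ (fun j => vnorm x / M * j.+1%:R^-1)).
      move=> j; rewrite psi_ge0/=.
      apply: le_trans (psi_le_min _ _) _; first by rewrite mulr_gt0 ?expR_gt0.
      rewrite ge_min; apply/orP; right; rewrite invfM mulrCA mulrC ler_wpM2l ?divr_ge0 ?vnorm_ge0 ?(ltW M0)//.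
      rewrite lef_pV2 ?posrE ?expR_gt0 ?ltr0n//.
      apply: le_trans (expR_ge1Dx _); rewrite -natr1 addrC lerD2l; exact: ht.
    rewrite -[X in _ --> X](mulr0 (vnorm x / M)); apply: cvgnZ.
    exact: cvg_harmonic.
exists T => // t Tt; have t0 : 0 <= t by exact: le_trans (ltW T0) Tt.
have [Lu Iu] := mild_density t0.
have h := psi_mild t0 M0; have hT := HT t Tt.
apply: (@le_trans _ _ (3 * I[m] (fun x => psi M x * u t x))); last first.
  by rewrite kE sub0r powR_inv1 ?(ltW M0)//; move: h hT; lra.
have Lp := L1_psi M Lu.
have mk := measurable_tail M t0.
have u0' := mild_ge0 lm k0 eps0 pJ pu0 ms t0.
have pt : {ae m, forall x, `|(M < vnorm x)%R%:R * (jbr x `^ k * `|u t x|)| <= 3 * (psi M x * u t x)}.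
  apply: filterS u0' => x ux; rewrite kE powRr0 mul1r normrM normr_id ger0_norm// (ger0_norm ux).
  case: (ltP M (vnorm x)) => [Mx|_]; last by rewrite mul0r !mulr_ge0// psi_ge0.
  by rewrite mulrA ler_wpM2r// psi_ge// ltW.
rewrite -I_Z//; apply: I_ae_le; [|exact: L1Z|].
  exact: L1_ae_le mk (L1Z 3 Lp) pt.
by apply: filterS pt => x; apply: le_trans; exact: ler_norm.
Qed.

(** [psi_mild] is summed over dyadic radii with weights [v^k]: the datum gives [z^k] with
    [z = e^-t |x|], hence the factor [e^(-k t)], and the remaining terms [v^(k-1)] form a geometric
    series as [k < 1]. *)
Lemma mild_tail_kpos C : 0 < k -> 0 < C ->
  (forall N M z, 0 <= z -> 0 < M ->
    \sum_(j < N) ((2 ^+ j * M) `^ k * Order.min 1 (z / (2 ^+ j * M))) <= C * z `^ k) ->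
  forall M t, 1 <= M -> 0 <= t ->
  I[m] (fun x => (M < vnorm x)%R%:R * (jbr x `^ k * `|u t x|)) <=
    9 * (C * expR (- (k * t)) * I[m] (fun x => jbr x `^ k * `|u0 x|) +
      tail_cst * ((1 - 2 `^ (k - 1))^-1 * M `^ (k - 1))).
Proof.
move=> kp C0' HC M t M1 t0; have M0 : 0 < M by exact: lt_le_trans M1.
have [u00 Lu0 Iu0] := prob_densityP pu0.
have [Lku0 _ _ _] := L1k_lty k0 (L1_measurable Lu0) u0k.
have [Lu Iu] := mild_density t0.
have Lku := L1k_mild t0.
have k1 : k < 1 by case/andP: k01.
have vp (j : nat) : 0 < 2 ^+ j * M by rewrite mulr_gt0// exprn_gt0.
have tc0 : 0 <= tail_cst.
  have C00' := C00; rewrite /tail_cst !mulr_ge0 ?addr_ge0//.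
    by apply: I_ge0 => x; rewrite mulr_ge0 ?gauss_ge0 ?vnorm_ge0.
  by rewrite invr_ge0; apply: I_ge0 => x; exact: gauss_ge0.
(* The cut at [2^N M] leaves finitely many dyadic radii; Fatou removes it at the end. *)
pose f (N : nat) (x : V) : R := (vnorm x <= 2 ^+ N * M)%R%:R * ((M < vnorm x)%R%:R * (jbr x `^ k * `|u t x|)).
have jk0 (x : V) : 0 <= jbr x `^ k * `|u t x| by rewrite mulr_ge0// powR_ge0.
have b01 (b : bool) : 0 <= (b%:R : R) <= 1 by case: b; rewrite ?lexx ?ler01.
have Lf N : L1 m (f N).
  rewrite /f (_ : (fun _ => _) = (fun x => (1 - (2 ^+ N * M < vnorm x)%R%:R) *
      ((M < vnorm x)%R%:R * (jbr x `^ k * `|u t x|)))); last first.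
    by apply/funext => x; congr (_ * _); rewrite leNgt; case: (_ < _); rewrite ?subrr ?subr0.
  apply: (L1M (c := 1)); first by apply: measurable_funB => //; exact: measurable_gt_vnorm.
    by move=> x; case: (_ < _); rewrite ?subrr ?subr0 ?normr0 ?normr1.
  apply: (L1M (c := 1)) => //; first exact: measurable_gt_vnorm.
  by move=> x; case/andP: (b01 (M < vnorm x)%R) => ? ?; rewrite ger0_norm.
have bound N : I[m] (f N) <=
    9 * (C * expR (- (k * t)) * I[m] (fun x => jbr x `^ k * `|u0 x|) +
      tail_cst * ((1 - 2 `^ (k - 1))^-1 * M `^ (k - 1))).
  pose v (j : 'I_N) := 2 ^+ j * M : R.
  have v0 j : 0 < v j by exact: vp.
  pose Gu j x := v j `^ k * (psi (v j) x * u t x).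
  pose Gw j x := v j `^ k * (psi (expR t * v j) x * u0 x).
  have LGu j : L1 m (Gu j) by apply: L1Z; exact: L1_psi.
  have LGw j : L1 m (Gw j) by apply: L1Z; exact: L1_psi.
  have [LSu ESu] := I_sum LGu; have [LSw ESw] := I_sum LGw.
  have ft : {ae m, forall x, f N x <= 9 * \sum_(j < N) Gu j x}.
    apply: filterS (mild_ge0 lm k0 eps0 pJ pu0 ms t0) => x ux.
    have S0 : 0 <= \sum_(j < N) Gu j x.
      by rewrite sumr_ge0// => j _; rewrite !mulr_ge0 ?powR_ge0// psi_ge0.
    rewrite /f; have [xN|_] := leP (vnorm x) (2 ^+ N * M); last by rewrite mul0r mulr_ge0.
    have [Mx|_] := ltP M (vnorm x); last by rewrite mul0r mulr0 mulr_ge0.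
    rewrite !mul1r ger0_norm//.
    have -> : \sum_(j < N) Gu j x = (\sum_(j < N) (2 ^+ j * M) `^ k * psi (2 ^+ j * M) x) * u t x.
      by rewrite mulr_suml; apply: eq_bigr => j _; rewrite /Gu /v mulrA.
    by rewrite mulrA ler_wpM2r//; exact: dyadic_cover.
  apply: (@le_trans _ _ (I[m] (fun x => 9 * \sum_(j < N) Gu j x))).
    by apply: I_ae_le => //; exact: L1Z.
  rewrite I_Z// ler_pM2l// ESu.
  apply: (@le_trans _ _ (\sum_(j < N) (I[m] (Gw j) + tail_cst * (v j `^ (k - 1))))).
    apply: ler_sum => j _; rewrite /Gu I_Z; last exact: L1_psi.
    rewrite /Gw I_Z; last exact: L1_psi.
    rewrite powRB ?(gt_eqF (v0 j)) ?implybT// powRr1 ?(ltW (v0 j))//.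
    rewrite (_ : tail_cst * _ = v j `^ k * (tail_cst / v j)); last by ring.
    rewrite -mulrDr ler_wpM2l ?powR_ge0//; exact: psi_mild.
  rewrite big_split/= -mulr_sumr; apply: lerD; last first.
    by rewrite ler_wpM2l//; exact: (dyadic_sum1 (introT andP (conj kp k1))).
  rewrite -ESw -I_Z//; apply: I_le => //; first exact: L1Z.
  move=> x; rewrite /Gw ger0_norm//.
  have -> : \sum_(j < N) v j `^ k * (psi (expR t * v j) x * u0 x) =
      (\sum_(j < N) v j `^ k * psi (expR t * v j) x) * u0 x.
    by rewrite mulr_suml; apply: eq_bigr => j _; rewrite mulrA.
  rewrite mulrA ler_wpM2r//.
  have z0 : 0 <= expR (- t) * vnorm x by rewrite mulr_ge0 ?expR_ge0 ?vnorm_ge0.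
  apply: (@le_trans _ _ (C * (expR (- t) * vnorm x) `^ k)).
    apply: le_trans (HC N M _ z0 M0); apply: ler_sum => j _; rewrite ler_wpM2l ?powR_ge0//.
    apply: le_trans (psi_le_min _ _) _; first by rewrite mulr_gt0 ?expR_gt0.
    rewrite (_ : vnorm x / (expR t * v j) = expR (- t) * vnorm x / (2 ^+ j * M))//.
    by rewrite /v invfM expRN mulrCA mulrA.
  rewrite powRM ?expR_ge0 ?vnorm_ge0// -mulrA ler_wpM2l ?(ltW C0')//.
  rewrite {1}/powR gt_eqF ?expR_gt0// expRK mulrN ler_wpM2l ?expR_ge0//.
  by rewrite ge0_ler_powR ?nnegrE ?vnorm_ge0 ?sqrtr_ge0// jbr_ge_vnorm.
have fc x : f N x @[N --> \oo] --> (M < vnorm x)%R%:R * (jbr x `^ k * `|u t x|).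
  apply: cvg_near_cst; exists (Num.bound (vnorm x / M)) => // N /= NN.
  rewrite /f (_ : vnorm x <= 2 ^+ N * M) ?mul1r//.
  have h : vnorm x / M < N%:R.
    apply: lt_le_trans (_ : _ < (Num.bound (vnorm x / M))%:R) _; last by rewrite ler_nat.
    by apply: archi_boundP; rewrite divr_ge0 ?vnorm_ge0// ltW.
  rewrite -ler_pdivrMr//; apply: le_trans (ltW h) _.
  by rewrite -natrX ler_nat ltnW// ltn_expl.
have f0 N x : 0 <= f N x by rewrite /f !mulr_ge0// powR_ge0.
exact: (L1_fatou Lf f0 bound fc).2.
Qed.

End one_solution.
Lemma mild_tail : exists2 C, 0 < C & forall s eps J u0 u,
  1/2 <= s <= 1 -> 0 < eps <= 1 -> prob_density m J -> small_freq m J s C0 delta ->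
  prob_density m u0 -> (L1k_norm m k u0 < +oo)%E -> mild_solution m k s eps J u0 u ->
  forall M e, 1 <= M -> 0 < e -> exists2 T, 0 < T & forall t, T <= t ->
  I[m] (fun x => (M < vnorm x)%R%:R * (jbr x `^ k * `|u t x|)) <= C * M `^ (k - 1) + e.
Proof.
have /andP[k0 k1] := k01.
have tc0 : 0 <= tail_cst.
  have C00' := C00; rewrite /tail_cst !mulr_ge0 ?addr_ge0//.
    by apply: I_ge0 => x; rewrite mulr_ge0 ?gauss_ge0 ?vnorm_ge0.
  by rewrite invr_ge0; apply: I_ge0 => x; exact: gauss_ge0.
have [kE|kn0] := eqVneq k 0.
  exists (3 * tail_cst + 1); first by rewrite ltr_wpDl// mulr_ge0.
  move=> s eps J u0 u s12 e01 pJ sf pu0 u0k ms M e M1 e0.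
  have [T T0 HT] := mild_tail_k0 s12 e01 pJ sf pu0 ms kE M1 e0; exists T => // t Tt.
  apply: le_trans (HT t Tt) _; rewrite lerD2r ler_wpM2r ?powR_ge0//.
  by rewrite lerDl.
have kp : 0 < k by rewrite lt_neqAle eq_sym kn0.
have kk : 0 < k < 1 by rewrite kp.
have [C Cp HC] := dyadic_sum2 kk.
set A := (1 - 2 `^ (k - 1))^-1.
have A0 : 0 <= A.
  by have := dyadic_sum1 kk 0 ltr01; rewrite big_ord0 (congr1 (@^~ _) (powR1 R)) mulr1.
exists (9 * (tail_cst * A) + 1); first by rewrite ltr_wpDl// mulr_ge0// mulr_ge0.
move=> s eps J u0 u s12 e01 pJ sf pu0 u0k ms M e M1 e0.
pose X := 9 * (C * I[m] (fun x => jbr x `^ k * `|u0 x|)).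
have X0 : 0 <= X.
  by rewrite !mulr_ge0 ?(ltW Cp)//; apply: I_ge0 => x; rewrite mulr_ge0 ?powR_ge0.
(* From this time on [X e^(-k t) <= e], because [e^(k t) >= k t]. *)
exists (X / (k * e) + 1); first by rewrite ltr_wpDl// divr_ge0// ltW// mulr_gt0.
move=> t Tt; have q0 : 0 <= X / (k * e) by rewrite divr_ge0// ltW// mulr_gt0.
have t0 : 0 < t by lra.
apply: le_trans (mild_tail_kpos s12 e01 pJ sf pu0 u0k ms kp Cp HC M1 (ltW t0)) _.
have : X * expR (- (k * t)) <= e.
  rewrite expRN ler_pdivrMr ?expR_gt0//.
  apply: (@le_trans _ _ (e * (k * t))).
    have Xt : X / (k * e) <= t by lra.
    rewrite ler_pdivrMr ?mulr_gt0// in Xt.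
    by rewrite (_ : e * (k * t) = t * (k * e)); [exact: Xt|ring].
  rewrite ler_pM2l//; have := expR_ge1Dx (k * t); lra.
have Mk : 0 <= M `^ (k - 1) by exact: powR_ge0.
rewrite -/A /X (_ : 9 * (C * _ * _ + _) = 9 * (C * I[m] (fun x => jbr x `^ k * `|u0 x|)) * expR (- (k * t)) +
   9 * (tail_cst * A) * M `^ (k - 1)); last by ring.
rewrite mulrDl mul1r; lra.
Qed.

End tails.

(** * Local comparison by mollification *)

Section smoothing.
Context {R : realType} {n : nat}.
Notation V := (n.-tuple R).
Variable m : {sigma_finite_measure set V -> \bar R}.
Hypothesis lm : is_lebesgue m.

Let gF := gauss_fourier lm.
Let Lg : L1 m gauss. Proof. by have [] := gF. Qed.
Let c0 : 0 < I[m] gauss. Proof. by have [] := gF. Qed.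
Notation c := (I[m] gauss).

Definition mollify (tau : R) (h : V -> R) (x : V) : R :=
  c^-1 * I[m] (fun y => gauss y * h (vsub x (vscale tau y))).

Lemma gauss_pair (tau : R) h : L1 m h ->
  L1 (m \x m)%E (fun q : V * V => gauss q.1 * h (vsub q.2 (vscale tau q.1))).
Proof.
move=> hh; have mh := L1_measurable hh.
apply: (@L1_prodI _ _ _ _ _ m m _ (fun y => I[m] (fun x => `|h x|) * gauss y)).
- apply: measurable_funM; first by apply: (measurableT_comp measurable_gauss); exact: measurable_fst.
  apply: measurable_fun_shift => //.
  by apply: measurable_fun_vscale => //; exact: measurable_fst.
- exact: L1Z.
- move=> y /=; have Ls := L1_shift lm (vscale tau y) hh; split; first exact: L1Z.
  rewrite -(I_shift lm (vscale tau y) (L1_norm hh)) mulrC -I_Z; last exact: L1_norm.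
  rewrite le_eqVlt; apply/orP; left; apply/eqP; apply: I_ext => x.
  by rewrite normrM ger0_norm ?gauss_ge0.
Qed.

Lemma L1_mollify tau h : L1 m h -> L1 m (mollify tau h).
Proof. by move=> hh; apply: L1Z; exact: (I_prod2 (gauss_pair tau hh)).1. Qed.

(** Minkowski's inequality: [h - mollify tau h] is a Gaussian average of differences of [h] with its
    translates. *)
Lemma mollify_dist tau h : L1 m h ->
  I[m] (fun x => `|h x - mollify tau h x|) <=
  c^-1 * I[m] (fun y => gauss y * shift_dist m h (vscale tau y)).
Proof.
move=> hh.
have mh := L1_measurable hh.
pose F (q : V * V) := gauss q.1 * `|h (vsub q.2 (vscale tau q.1)) - h q.2|.
have LF : L1 (m \x m)%E F.
  apply: (@L1_prodI _ _ _ _ _ m m _ (fun y => 2 * I[m] (fun x => `|h x|) * gauss y)).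
  - apply: measurable_funM; first by apply: (measurableT_comp measurable_gauss); exact: measurable_fst.
    apply: measurableT_comp => //; apply: measurable_funB; last first.
      by apply: (measurableT_comp mh); exact: measurable_snd.
    apply: measurable_fun_shift => //.
    by apply: measurable_fun_vscale => //; exact: measurable_fst.
  - exact: L1Z.
  - move=> y; rewrite /F/=; have Ls := L1_shift_dist lm (vscale tau y) hh.
    split; first exact: (L1Z _ Ls).
    rewrite (I_ext m (g := fun x => gauss y * `|h (vsub x (vscale tau y)) - h x|)); last first.
      by move=> x; rewrite ger0_norm// mulr_ge0// gauss_ge0.
    rewrite I_Z// mulrC ler_wpM2r ?gauss_ge0//; exact: shift_dist_le.
have [LF1 E1] := I_prod1 LF; have [LF2 E2] := I_prod2 LF.
have ES y : I[m] (fun x => F (y, x)) = gauss y * shift_dist m h (vscale tau y).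
  by rewrite /F/= I_Z//; exact: L1_shift_dist.
rewrite -(I_ext m ES) E1 -E2 -I_Z//.
have LD : L1 m (fun x => h x - mollify tau h x) by apply: L1B => //; exact: L1_mollify.
have A1 := L1_prod_sec2 (gauss_pair tau hh); have A2 := L1_prod_sec2 LF.
apply: I_ae_le; [exact: L1_norm|exact: L1Z|].
apply: filterS2 A1 A2 => x L1x L2x.
have -> : h x - mollify tau h x =
    - (c^-1 * I[m] (fun y => gauss y * h (vsub x (vscale tau y)) - gauss y * h x)).
  rewrite I_B//; last by apply: L1_ext (L1Z (h x) Lg) => y; rewrite mulrC.
  by rewrite I_Zr// /mollify mulrBr mulKf ?gt_eqF//; ring.
rewrite normrN normrM ger0_norm ?invr_ge0 ?(ltW c0)// ler_wpM2l ?invr_ge0 ?(ltW c0)//.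
have Lx : L1 m (fun y => gauss y * h (vsub x (vscale tau y)) - gauss y * h x).
  by apply: L1B => //; apply: L1_ext (L1Z (h x) Lg) => y; rewrite mulrC.
apply: le_trans (I_norm Lx) _; rewrite le_eqVlt; apply/orP; left; apply/eqP.
by apply: I_ext => y; rewrite /F/= -mulrBr normrM ger0_norm ?gauss_ge0.
Qed.

Lemma mollify_fourier tau h x : 0 < tau -> L1 m h ->
  mollify tau h x = (c ^+ 2 * tau ^+ n)^-1 *
    I[m] (fun xi => gauss xi * (cos (vdot x (vscale tau^-1 xi)) * ft_re m h (vscale tau^-1 xi) +
    sin (vdot x (vscale tau^-1 xi)) * ft_s m h (vscale tau^-1 xi))).
Proof.
move=> tau0 hh; have [_ <-] := gauss_conv lm tau^-1 x hh.
(* The substitution [z = x - tau y] is the affine map of negative ratio [- tau]. *)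
have t0 : - tau != 0 by rewrite oppr_eq0 gt_eqF.
have Lgh : L1 m (fun z => gauss (vscale tau^-1 (vsub x z)) * h z).
  apply: (L1M (c := 1)) => //; last by move=> z; rewrite ger0_norm ?gauss_ge0// gauss_le1.
  apply: (measurableT_comp measurable_gauss); apply: measurable_fun_vscale => //.
  exact: measurable_fun_vsub.
have := I_affine lm (vscale (-1) x) t0 Lgh.
have E y : gauss (vscale tau^-1 (vsub x (affine (- tau) (vscale (-1) x) y))) *
    h (affine (- tau) (vscale (-1) x) y) = gauss y * h (vsub x (vscale tau y)).
  have -> : affine (- tau) (vscale (-1) x) y = vsub x (vscale tau y).
    by apply: eq_tnthP => i; rewrite !tnth_vsub !tnth_vscale; ring.
  congr (gauss _ * _); apply: eq_tnthP => i; rewrite tnth_vscale !tnth_vsub !tnth_vscale.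
  by field; rewrite gt_eqF.
rewrite (I_ext m E) normrN (gtr0_norm tau0) => E'.
rewrite /mollify E' expr2 invfM; field.
by rewrite !gt_eqF ?exprn_gt0.
Qed.

(** Parseval's identity in a form that holds for integrable functions: the Gaussian factor makes the
    frequency integral converge absolutely. *)
Lemma mollify_pairing tau f h : 0 < tau -> L1 m f -> L1 m h ->
  L1 m (fun xi => gauss xi * (ft_re m f (vscale tau^-1 xi) * ft_re m h (vscale tau^-1 xi) +
    ft_s m f (vscale tau^-1 xi) * ft_s m h (vscale tau^-1 xi))) /\
  I[m] (fun x => f x * mollify tau h x) = (c ^+ 2 * tau ^+ n)^-1 *
    I[m] (fun xi => gauss xi * (ft_re m f (vscale tau^-1 xi) * ft_re m h (vscale tau^-1 xi) +
    ft_s m f (vscale tau^-1 xi) * ft_s m h (vscale tau^-1 xi))).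
Proof.
move=> tau0 hf hh.
have mft (th : R -> R) : continuous th -> measurable_fun setT (fun xi : V =>
    I[m] (fun z => th (vdot z (vscale tau^-1 xi)) * h z)).
  move=> cth; apply: (@measurable_I _ _ _ _ _ m (fun q : V * V =>
      th (vdot q.2 (vscale tau^-1 q.1)) * h q.2)).
  apply: measurable_funM; last by apply: (measurableT_comp (L1_measurable hh)); exact: measurable_snd.
  apply: measurable_fun_trig => //; apply: measurable_fun_vdot; first exact: measurable_snd.
  by apply: measurable_fun_vscale => //; exact: measurable_fst.
pose Nh := I[m] (fun z => `|h z|).
pose F (q : V * V) := f q.2 * (gauss q.1 *
  (cos (vdot q.2 (vscale tau^-1 q.1)) * ft_re m h (vscale tau^-1 q.1) +
   sin (vdot q.2 (vscale tau^-1 q.1)) * ft_s m h (vscale tau^-1 q.1))).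
have mv : measurable_fun setT (fun q : V * V => vdot q.2 (vscale tau^-1 q.1)).
  apply: measurable_fun_vdot; first exact: measurable_snd.
  by apply: measurable_fun_vscale => //; exact: measurable_fst.
have mF : measurable_fun setT F.
  apply: measurable_funM; first by apply: (measurableT_comp (L1_measurable hf)); exact: measurable_snd.
  apply: measurable_funM; first by apply: (measurableT_comp measurable_gauss); exact: measurable_fst.
  apply: measurable_funD; apply: measurable_funM.
  - by apply: measurable_fun_trig mv; exact: continuous_cos.
  - by apply: (measurableT_comp (mft _ (@continuous_cos R))); exact: measurable_fst.
  - by apply: measurable_fun_trig mv; exact: continuous_sin.
  - by apply: (measurableT_comp (mft _ (@continuous_sin R))); exact: measurable_fst.
have Esec xi x : F (xi, x) = gauss xi * (ft_re m h (vscale tau^-1 xi) * (cos (vdot x (vscale tau^-1 xi)) * f x) +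
   ft_s m h (vscale tau^-1 xi) * (sin (vdot x (vscale tau^-1 xi)) * f x)).
  by rewrite /F/=; ring.
have Lsec xi : L1 m (fun x => F (xi, x)).
  apply: (L1_ext (fun x => esym (Esec xi x))); apply: L1Z.
  by apply: L1D; apply: L1Z; [exact: L1_cos|exact: L1_sin].
have A xi : I[m] (fun x => F (xi, x)) = gauss xi *
    (ft_re m f (vscale tau^-1 xi) * ft_re m h (vscale tau^-1 xi) +
    ft_s m f (vscale tau^-1 xi) * ft_s m h (vscale tau^-1 xi)).
  have L1' := L1Z (ft_re m h (vscale tau^-1 xi)) (L1_cos (vscale tau^-1 xi) hf).
  have L2' := L1Z (ft_s m h (vscale tau^-1 xi)) (L1_sin (vscale tau^-1 xi) hf).
  rewrite (I_ext m (Esec xi)) I_Z; last exact: L1D.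
  rewrite I_D// !I_Z; [|exact: L1_sin|exact: L1_cos].
  by rewrite /ft_re /ft_s; ring.
have LF : L1 (m \x m)%E F.
  apply: (@L1_prodI _ _ _ _ _ m m _ (fun xi => (2 * Nh * I[m] (fun z => `|f z|)) * gauss xi)) => //.
    exact: L1Z.
  move=> xi; split=> //.
  rewrite (_ : _ * gauss xi = I[m] (fun x => (2 * Nh * gauss xi) * `|f x|)); last first.
    by rewrite I_Z; [ring|exact: L1_norm].
  apply: I_le; [exact: L1_norm|by apply: L1Z; exact: L1_norm|].
  move=> x; rewrite /F/= !normrM (ger0_norm (gauss_ge0 _)) mulrC ler_wpM2r//.
  rewrite mulrC ler_wpM2r ?gauss_ge0//.
  apply: le_trans (ler_normD _ _) _; rewrite !normrM mulr_natl mulr2n.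
  have cm := cos_max (vdot x (vscale tau^-1 xi)); have sm := sin_max (vdot x (vscale tau^-1 xi)).
  have h1 := ft_re_le1 (vscale tau^-1 xi) hh; have h2 := ft_s_le1 (vscale tau^-1 xi) hh.
  by apply: lerD; rewrite -[leRHS]mul1r; apply: ler_pM.
have [L1' E1] := I_prod1 LF; have [L2' E2] := I_prod2 LF.
split; first by apply: L1_ext L1' => xi; rewrite A.
rewrite -(I_ext m A) E1 -E2 -I_Z//; apply: I_ext => x.
rewrite mollify_fourier// mulrCA; congr (_ * _).
by rewrite /F/= I_Z//; exact: (gauss_conv lm tau^-1 x hh).1.
Qed.

Lemma mollify_le1 tau (f : V -> R) x : measurable_fun setT f -> (forall x, `|f x| <= 1) ->
  `|mollify tau f x| <= 1.
Proof.
move=> mf f1; rewrite /mollify normrM ger0_norm ?invr_ge0 ?(ltW c0)// ler_pdivrMl// mulr1.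
apply: I_le_norm => //.
  apply: measurable_funM; first exact: measurable_gauss.
  by apply: measurable_fun_shift => //; exact: measurable_fun_vscale.
by move=> y; rewrite normrM ger0_norm ?gauss_ge0// ler_piMr// gauss_ge0.
Qed.

(** The squared L2 norm of the transform, damped by a Gaussian of width [1 / tau] in frequency: it
    is finite for every integrable [h], even when [h] is not in L2. *)
Definition energy tau (h : V -> R) := (c ^+ 2)^-1 * I[m] (fun xi => gauss (vscale tau xi) *
  (ft_re m h xi ^+ 2 + ft_s m h xi ^+ 2)).

Lemma energyE tau h : 0 < tau -> L1 m h ->
  L1 m (fun xi => gauss (vscale tau xi) * (ft_re m h xi ^+ 2 + ft_s m h xi ^+ 2)) /\
  (c ^+ 2 * tau ^+ n)^-1 * I[m] (fun xi => gauss xi *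
    (ft_re m h (vscale tau^-1 xi) * ft_re m h (vscale tau^-1 xi) +
     ft_s m h (vscale tau^-1 xi) * ft_s m h (vscale tau^-1 xi))) = energy tau h.
Proof.
move=> tau0 hh; have [L _] := mollify_pairing tau0 hh hh.
have tn0 : tau != 0 by rewrite gt_eqF.
have La := L1_affine lm [tuple 0 | _ < n] tn0 L.
have := I_affine lm [tuple 0 | _ < n] tn0 L.
have E xi : affine tau [tuple 0 | _ < n] xi = vscale tau xi.
  by apply: eq_tnthP => i; rewrite tnth_vsub [X in _ - X]tnth_mktuple subr0.
have E' xi : vscale tau^-1 (vscale tau xi) = xi.
  by apply: eq_tnthP => i; rewrite !tnth_vscale mulKf.
have EE xi : gauss (affine tau [tuple 0 | _ < n] xi) *
    (ft_re m h (vscale tau^-1 (affine tau [tuple 0 | _ < n] xi)) * ft_re m h (vscale tau^-1 (affine tau [tuple 0 | _ < n] xi)) +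
     ft_s m h (vscale tau^-1 (affine tau [tuple 0 | _ < n] xi)) * ft_s m h (vscale tau^-1 (affine tau [tuple 0 | _ < n] xi))) =
  gauss (vscale tau xi) * (ft_re m h xi ^+ 2 + ft_s m h xi ^+ 2).
  by rewrite !E !E' !expr2.
move=> Ea; split; first exact: (L1_ext EE La).
by rewrite /energy -(I_ext m EE) Ea (gtr0_norm tau0) invfM mulrA.
Qed.

Lemma young_form (lam w p q p' q' : R) : 0 < lam -> 0 <= w ->
  w * (p * p' + q * q') <=
  (2 * lam)^-1 * (w * (p * p + q * q)) + lam / 2 * (w * (p' * p' + q' * q')).
Proof.
move=> lam0 w0; have l0 : 0 <= (2 * lam)^-1 by rewrite invr_ge0 mulr_ge0// ltW.
have young x y : x * y <= (2 * lam)^-1 * (x * x) + lam / 2 * (y * y).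
  rewrite -subr_ge0 (_ : _ - _ = (2 * lam)^-1 * (x - lam * y) ^+ 2).
    by rewrite mulr_ge0 ?sqr_ge0.
  by field; rewrite gt_eqF.
rewrite (_ : (2 * lam)^-1 * _ + _ = w * ((2 * lam)^-1 * (p * p + q * q) +
  lam / 2 * (p' * p' + q' * q'))); last by ring.
rewrite ler_wpM2l//; have := young p p'; have := young q q'; rewrite !mulrDr; lra.
Qed.

(* Testing with [phi = 1_B * sgn (mollify tau h)] replaces Plancherel's identity: the
   quadratic form [f |-> int f * mollify tau f] is nonnegative on the Fourier side. *)
Lemma mollify_local_L1 tau h (B : set V) lam : 0 < tau -> L1 m h -> measurable B ->
  (m B < +oo)%E -> 0 < lam ->
  I[m] (fun x => \1_B x * `|mollify tau h x|) <=
    (2 * lam)^-1 * fine (m B) + lam / 2 * energy tau h.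
Proof.
move=> tau0 hh mB Bfin lam0.
have l0 : 0 <= (2 * lam)^-1 by rewrite invr_ge0 mulr_ge0// ltW.
have K0 : 0 <= (c ^+ 2 * tau ^+ n)^-1.
  by rewrite invr_ge0 mulr_ge0 ?exprn_ge0 ?(ltW c0) ?(ltW tau0).
have Lm := L1_mollify tau hh.
set F := mollify tau h in Lm *.
pose phi x : R := \1_B x * (2 * \1_[set x | 0 <= F x] x - 1).
have phiF x : phi x * F x = \1_B x * `|F x|.
  rewrite /phi -mulrA; congr (_ * _); rewrite indicE.
  have [Fx|Fx] := leP 0 (F x); first by rewrite mem_set//= ger0_norm//; ring.
  by rewrite (ltr0_norm Fx) memNset/=; [ring|apply/negP; rewrite -ltNge].
have LB : L1 m (\1_B : V -> R) by exact: L1_indic.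
have mS : measurable [set x | 0 <= F x].
  rewrite (_ : [set x | _] = F @^-1` `[0, +oo[).
    by rewrite -[X in measurable X]setTI; exact: (L1_measurable Lm).
  by apply/seteqP; split=> x /=; rewrite in_itv/= andbT.
have phi1 x : `|phi x| <= \1_B x.
  rewrite /phi normrM (ger0_norm (_ : 0 <= \1_B x)) ?indicE//.
  by rewrite ler_piMr//; case: (_ \in [set x | _]); rewrite ler_norml/=; apply/andP; split; lra.
have mphi : measurable_fun setT phi.
  apply: measurable_funM; first exact: measurable_indic.
  by apply: measurable_funB => //; apply: measurable_funM => //; exact: measurable_indic.
have Lphi : L1 m phi by exact: L1_le LB.
pose G (f1 f2 : V -> R) xi := gauss xi * (ft_re m f1 (vscale tau^-1 xi) * ft_re m f2 (vscale tau^-1 xi) +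
    ft_s m f1 (vscale tau^-1 xi) * ft_s m f2 (vscale tau^-1 xi)).
set K := (c ^+ 2 * tau ^+ n)^-1 in K0 *.
have pairing f1 f2 : L1 m f1 -> L1 m f2 ->
    L1 m (G f1 f2) /\ I[m] (fun x => f1 x * mollify tau f2 x) = K * I[m] (G f1 f2).
  exact: mollify_pairing.
have [Lp Ep] := pairing _ _ Lphi hh; have [Lpp Epp] := pairing _ _ Lphi Lphi.
have [Lhh _] := pairing _ _ hh hh.
have Eh : K * I[m] (G h h) = energy tau h by exact: (energyE tau0 hh).2.
rewrite -(I_ext m phiF) Ep -Eh.
(* [|phi| <= 1_B], and the mollification of [phi] is at most 1 in modulus. *)
have hB : K * I[m] (G phi phi) <= fine (m B).
  rewrite -Epp; apply: (@le_trans _ _ (I[m] (\1_B : V -> R))); last by rewrite I_indic.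
  apply: le_trans (ler_norm _) _; apply: (I_le_norm LB).
    by apply: measurable_funM; [exact: mphi|exact: L1_measurable (L1_mollify tau Lphi)].
  move=> x; rewrite normrM -[leRHS]mulr1; apply: ler_pM; [exact: normr_ge0|exact: normr_ge0|exact: phi1|].
  apply: (mollify_le1 tau x mphi) => y; apply: le_trans (phi1 y) _.
  by rewrite indicE lern1 leq_b1.
have key : I[m] (G phi h) <= (2 * lam)^-1 * I[m] (G phi phi) + lam / 2 * I[m] (G h h).
  rewrite -(I_Z _ Lpp) -(I_Z _ Lhh) -I_D; [|exact: (L1Z _ Lpp)|exact: (L1Z _ Lhh)].
  apply: I_le; [exact: Lp|by apply: L1D; [exact: (L1Z _ Lpp)|exact: (L1Z _ Lhh)]|].
  by move=> xi; exact: (young_form _ _ _ _ lam0 (gauss_ge0 xi)).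
move: hB (ler_wpM2l K0 key); move: (I[m] (G phi h)) (I[m] (G phi phi)) (I[m] (G h h)) => a b d hB.
rewrite mulrDr mulrCA (mulrCA K _ d); move=> h1; apply: (le_trans h1); rewrite lerD2r.
exact: ler_wpM2l.
Qed.

End smoothing.

(** * Energy of the difference of two solutions *)

Section energy_estimate.
Context {R : realType} {n : nat}.
Notation V := (n.-tuple R).
Variable m : {sigma_finite_measure set V -> \bar R}.
Hypothesis lm : is_lebesgue m.

Let gF := gauss_fourier lm.
Let Lg : L1 m gauss. Proof. by have [] := gF. Qed.
Let c0 : 0 < I[m] gauss. Proof. by have [] := gF. Qed.
Notation c := (I[m] gauss).

Lemma measurable_trig_transform (th : R -> R) (f : V -> R) b : continuous th -> L1 m f ->
  measurable_fun setT (fun xi : V => I[m] (fun z => th (vdot z (vscale b xi)) * f z)).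
Proof.
move=> cth hf; apply: (@measurable_I _ _ _ _ _ m (fun q : V * V =>
      th (vdot q.2 (vscale b q.1)) * f q.2)).
apply: measurable_funM; last by apply: (measurableT_comp (L1_measurable hf)); exact: measurable_snd.
apply: measurable_fun_trig => //; apply: measurable_fun_vdot; first exact: measurable_snd.
by apply: measurable_fun_vscale => //; exact: measurable_fst.
Qed.

Lemma trig_transform_cvg (th : R -> R) (f : V -> R) xi (b : nat -> R) : continuous th ->
  (forall x, `|th x| <= 1) -> L1 m f -> b j @[j --> \oo] --> (0 : R) ->
  I[m] (fun z => th (vdot z (vscale (b j) xi)) * f z) @[j --> \oo] --> th 0 * I[m] f.
Proof.
move=> cth th1 hf b0; rewrite -I_Z//.
apply: (I_dct (g := fun x => `|f x|) _ _ _ _).2.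
- move=> j; apply: measurable_funM; last exact: L1_measurable hf.
  exact: measurable_trig.
- exact: L1_norm.
- by move=> j x; rewrite normrM ler_piMl.
- move=> x; apply: cvgnM; last exact: cvgn_cst.
  apply: continuous_cvg; first exact: cth.
  rewrite (_ : (fun j => _) = (fun j => b j * vdot x xi)); last by apply/funext => j; rewrite vdotZr.
  rewrite -[X in _ --> X](mul0r (vdot x xi)); apply: cvgnM => //; exact: cvgn_cst.
Qed.

(** The error of replacing both initial transforms by 1; it is at most 6 for probability densities
    and tends to 0 with [b = e^-t]. *)
Definition deviation (u0 v0 : V -> R) b xi : R :=
  (`|ft_re m u0 (vscale b xi) - 1| + `|ft_s m u0 (vscale b xi)|) +
  (`|ft_re m v0 (vscale b xi) - 1| + `|ft_s m v0 (vscale b xi)|).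

Lemma deviation_le u0 v0 b xi : prob_density m u0 -> prob_density m v0 ->
  0 <= deviation u0 v0 b xi <= 6.
Proof.
move=> pu pv; rewrite !addr_ge0//=.
have h f : prob_density m f -> `|ft_re m f (vscale b xi) - 1| + `|ft_s m f (vscale b xi)| <= 3.
  move=> pf; have := ft_re_prob_le1 pf (vscale b xi); have := ft_s_prob_le1 pf (vscale b xi).
  move=> h1 h2; rewrite (_ : 3 = (1 + 1) + 1 :> R); last by ring.
  apply: lerD => //; apply: le_trans (ler_normB _ _) _; rewrite normr1.
  by rewrite lerD2r.
by have := h _ pu; have := h _ pv; rewrite /deviation; lra.
Qed.

Lemma deviation_cvg u0 v0 (W : V -> R) (b : nat -> R) : prob_density m u0 -> prob_density m v0 ->
  L1 m W -> b j @[j --> \oo] --> (0 : R) ->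
  I[m] (fun xi => W xi * deviation u0 v0 (b j) xi ^+ 2) @[j --> \oo] --> (0 : R).
Proof.
move=> pu pv LW b0; rewrite -[X in _ --> X](I_0 m).
have [_ Lu Iu] := prob_densityP pu; have [_ Lv Iv] := prob_densityP pv.
apply: (I_dct (g := fun x => 36 * `|W x|) _ _ _ _).2.
- move=> j; apply: measurable_funM; first exact: (L1_measurable LW).
  apply: measurable_funX.
  have mr f : L1 m f -> measurable_fun setT (fun xi => `|ft_re m f (vscale (b j) xi) - 1| + `|ft_s m f (vscale (b j) xi)|).
    move=> hf; apply: measurable_funD; apply: measurableT_comp => //.
      apply: measurable_funB => //.
      by apply: measurable_trig_transform => //; exact: continuous_cos.
    by apply: measurable_trig_transform => //; exact: continuous_sin.
  by apply: measurable_funD; exact: mr.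
- by apply: L1Z; exact: L1_norm.
- move=> j x; have /andP[d0 d6] := deviation_le (b j) x pu pv.
  rewrite normrM mulrC ger0_norm ?sqr_ge0// ler_wpM2r//.
  by rewrite (_ : 36 = 6 ^+ 2 :> R); [rewrite ler_pXn2r// nnegrE|ring].
- move=> x; rewrite -[X in _ --> X](mulr0 (W x)); apply: cvgnZ.
  have dc f : L1 m f -> I[m] f = 1 ->
      `|ft_re m f (vscale (b j) x) - 1| + `|ft_s m f (vscale (b j) x)| @[j --> \oo] --> (0 : R).
    move=> hf If; rewrite -[X in _ --> X](addr0 0); apply: cvgnD.
      rewrite -[X in _ --> X](normr0 R); apply: cvgn_norm; rewrite -[X in _ --> X](subrr 1).
      apply: cvgnB; last exact: cvgn_cst.
      have := trig_transform_cvg x (@continuous_cos R) (@cos_max R) hf b0.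
      by rewrite cos0 mul1r If.
    rewrite -[X in _ --> X](normr0 R); apply: cvgn_norm.
    have := trig_transform_cvg x (@continuous_sin R) (@sin_max R) hf b0.
    by rewrite sin0 mul0r.
  have D : deviation u0 v0 (b j) x @[j --> \oo] --> (0 : R).
    by rewrite -[X in _ --> X](addr0 0); apply: cvgnD; exact: dc.
  rewrite -[X in _ --> X](mulr0 0).
  under eq_fun do rewrite expr2.
  exact: cvgnM.
Qed.

Variables (P Q g C1 C2 : R).
Hypotheses (g01 : 0 < g <= 1) (PQ : n%:R < 2 * (P - g * Q)) (Q0 : 0 <= Q)
  (C10 : 0 <= C1) (C20 : 0 <= C2).

(** The square of the decay [(1 + |xi|)^-P] times the growth [(1 + |xi|)^(g Q)] left by the
    interpolation; [PQ] makes it integrable. *)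
Let W (xi : V) : R := (1 + vnorm xi) `^ (- (2 * (P - g * Q))).

Let LW : L1 m W. Proof. exact: L1_decay. Qed.

Definition energy_cst := (c ^+ 2)^-1 * (24 * C1 ^+ 2 * C2 `^ (2 * g) * I[m] W).

Lemma fourier_pair_bound (sg t : R) (u0 v0 u v : V -> R) xi (p p' q q' : R) :
  prob_density m u0 -> prob_density m v0 -> 0 <= sg ->
  ft_re m u xi = expR (- p) * (ft_re m u0 (vscale (expR (- t)) xi) * cos q -
     ft_s m u0 (vscale (expR (- t)) xi) * sin q) /\
  ft_s m u xi = expR (- p) * (ft_re m u0 (vscale (expR (- t)) xi) * sin q +
     ft_s m u0 (vscale (expR (- t)) xi) * cos q) ->
  ft_re m v xi = expR (- p') * (ft_re m v0 (vscale (expR (- t)) xi) * cos q' -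
     ft_s m v0 (vscale (expR (- t)) xi) * sin q') /\
  ft_s m v xi = expR (- p') * (ft_re m v0 (vscale (expR (- t)) xi) * sin q' +
     ft_s m v0 (vscale (expR (- t)) xi) * cos q') ->
  expR (- p) <= C1 * ((1 + vnorm xi) `^ (- P) + expR (- (P * t))) ->
  expR (- p') <= C1 * ((1 + vnorm xi) `^ (- P) + expR (- (P * t))) ->
  `|p - p'| + `|q - q'| <= C2 * sg * (1 + vnorm xi) `^ Q ->
  (ft_re m u xi - ft_re m v xi) ^+ 2 + (ft_s m u xi - ft_s m v xi) ^+ 2 <=
   24 * C1 ^+ 2 * C2 `^ (2 * g) * sg `^ (2 * g) * W xi +
   384 * C1 ^+ 2 * expR (- (P * t)) ^+ 2 +
   6 * C1 ^+ 2 * (W xi * deviation u0 v0 (expR (- t)) xi ^+ 2).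
Proof.
move=> pu pv sg0 [-> ->] [-> ->] hp hp' hZ; have /andP[g0 g1] := g01.
have [C10' C20' Q0'] := And3 C10 C20 Q0.
(* [E1] decays in [xi] and carries the interpolation; [E2] is constant in [xi] and is made small by
   time alone. *)
set E1 := C1 * (1 + vnorm xi) `^ (- P); set E2 := C1 * expR (- (P * t)).
have E10 : 0 <= E1 by rewrite mulr_ge0// powR_ge0.
have E20 : 0 <= E2 by rewrite mulr_ge0// expR_ge0.
rewrite mulrDr -/E1 -/E2 in hp hp'.
have w0 : 0 < 1 + vnorm xi by rewrite ltr_pwDl// vnorm_ge0.
have w1 : 1 <= 1 + vnorm xi by rewrite lerDl vnorm_ge0.
have [tc ts] := trig_exp_diff q q' hp hp' g01.
set Z := _ + _ in hZ tc ts; have Z0 : 0 <= Z by rewrite addr_ge0.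
set Y := (C2 * sg * (1 + vnorm xi) `^ Q) `^ g.
have ZY : Z `^ g <= Y.
  by rewrite ge0_ler_powR ?nnegrE ?(ltW g0)// !mulr_ge0// powR_ge0.
have Y0 : 0 <= Y by exact: powR_ge0.
have Zg0 : 0 <= Z `^ g by exact: powR_ge0.
(* The part with [E2] is kept free of the interpolation factor, so that no growing power of [|xi|]
   multiplies a term without decay. *)
have split2 X b b' : `|b| <= 1 -> `|b'| <= 1 ->
    X = expR (- p) * b - expR (- p') * b' -> `|X| <= 2 * (E1 + E2) * Z `^ g ->
    `|X| <= 2 * E1 * Y + 2 * E2.
  move=> b1 b1' EX h; have [Zg|Zg] := leP (Z `^ g) 1.
    apply: le_trans h _; rewrite mulrDr mulrDl; apply: lerD.
      by apply: ler_wpM2l => //; exact: mulr_ge0.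
    by apply: ler_piMr => //; exact: mulr_ge0.
  apply: (@le_trans _ _ (2 * (E1 + E2))).
    rewrite EX; apply: le_trans (ler_normB _ _) _; rewrite !normrM !(ger0_norm (expR_ge0 _)).
    have h1 : expR (- p) * `|b| <= E1 + E2 by rewrite -[leRHS]mulr1 ler_pM// expR_ge0.
    have h2 : expR (- p') * `|b'| <= E1 + E2 by rewrite -[leRHS]mulr1 ler_pM// expR_ge0.
    by lra.
  rewrite mulrDr lerD2r; apply: ler_peMr; first exact: mulr_ge0.
  by apply: le_trans ZY; exact: ltW.
have {}tc := split2 _ _ _ (cos_max q) (cos_max q') erefl tc.
have {}ts := split2 _ _ _ (sin_max q) (sin_max q') erefl ts.
set b := expR (- t); set om := deviation u0 v0 b xi.
have /andP[om0 om6] := deviation_le b xi pu pv; rewrite -/om in om0 om6.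
have bd (e a d : R) (th th' : R) : expR (- e) <= E1 + E2 -> `|th| <= 1 -> `|th'| <= 1 ->
    `|expR (- e) * (a * th + d * th')| <= (E1 + E2) * (`|a| + `|d|).
  move=> he h1 h2; rewrite normrM (ger0_norm (expR_ge0 _)) ler_pM ?expR_ge0//.
  apply: le_trans (ler_normD _ _) _; rewrite !normrM.
  by apply: lerD; rewrite ler_piMr.
have cq := cos_max q; have sq := sin_max q; have cq' := cos_max q'; have sq' := sin_max q'.
(* This is [(x + y + z)^2 <= 3 (x^2 + y^2 + z^2)], where the coefficient [8 = 2 + 6] of [E2] uses
   the bound 6 on the deviation. Adding the real and imaginary parts doubles 12, 192 and 3 into the
   constants 24, 384 and 6. *)
have tot X0 X1 X2 : `|X0| <= 2 * E1 * Y + 2 * E2 ->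
   `|X1| <= (E1 + E2) * (`|ft_re m u0 (vscale b xi) - 1| + `|ft_s m u0 (vscale b xi)|) ->
   `|X2| <= (E1 + E2) * (`|ft_re m v0 (vscale b xi) - 1| + `|ft_s m v0 (vscale b xi)|) ->
   (X0 + X1 - X2) ^+ 2 <= 3 * (4 * (E1 * Y) ^+ 2 + 64 * E2 ^+ 2 + (E1 * om) ^+ 2).
  move=> h0 h1 h2.
  have h : `|X0 + X1 - X2| <= 2 * (E1 * Y) + 8 * E2 + E1 * om.
    apply: le_trans (ler_normB _ _) _; apply: le_trans (lerD (ler_normD _ _) h2) _.
    have : (E1 + E2) * om <= E1 * om + 6 * E2.
      by rewrite mulrDl lerD2l mulrC ler_wpM2r.
    rewrite /om /deviation mulrDr; move: h0 h1; lra.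
  apply: (@le_trans _ _ ((2 * (E1 * Y) + 8 * E2 + E1 * om) ^+ 2)).
    rewrite -real_normK ?num_real// ler_pXn2r// nnegrE.
    by rewrite !addr_ge0// mulr_ge0// mulr_ge0.
  set x := E1 * Y; set z := E1 * om; rewrite -subr_ge0.
  rewrite (_ : _ - _ = (2 * x - 8 * E2) ^+ 2 + (2 * x - z) ^+ 2 + (8 * E2 - z) ^+ 2); last by ring.
  by rewrite !addr_ge0// sqr_ge0.
have nsq : `|- sin q| <= 1 by rewrite normrN.
have nsq' : `|- sin q'| <= 1 by rewrite normrN.
have R1 := tot _ _ _ tc (bd p (ft_re m u0 (vscale b xi) - 1) (ft_s m u0 (vscale b xi)) _ _ hp cq nsq)
  (bd p' (ft_re m v0 (vscale b xi) - 1) (ft_s m v0 (vscale b xi)) _ _ hp' cq' nsq').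
have R2 := tot _ _ _ ts (bd p (ft_re m u0 (vscale b xi) - 1) (ft_s m u0 (vscale b xi)) _ _ hp sq cq)
  (bd p' (ft_re m v0 (vscale b xi) - 1) (ft_s m v0 (vscale b xi)) _ _ hp' sq' cq').
have e1 : expR (- p) * (ft_re m u0 (vscale b xi) * cos q - ft_s m u0 (vscale b xi) * sin q) -
    expR (- p') * (ft_re m v0 (vscale b xi) * cos q' - ft_s m v0 (vscale b xi) * sin q') =
   expR (- p) * cos q - expR (- p') * cos q' +
   expR (- p) * ((ft_re m u0 (vscale b xi) - 1) * cos q + ft_s m u0 (vscale b xi) * - sin q) -
   expR (- p') * ((ft_re m v0 (vscale b xi) - 1) * cos q' + ft_s m v0 (vscale b xi) * - sin q') by ring.
have e2 : expR (- p) * (ft_re m u0 (vscale b xi) * sin q + ft_s m u0 (vscale b xi) * cos q) -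
    expR (- p') * (ft_re m v0 (vscale b xi) * sin q' + ft_s m v0 (vscale b xi) * cos q') =
   expR (- p) * sin q - expR (- p') * sin q' +
   expR (- p) * ((ft_re m u0 (vscale b xi) - 1) * sin q + ft_s m u0 (vscale b xi) * cos q) -
   expR (- p') * ((ft_re m v0 (vscale b xi) - 1) * sin q' + ft_s m v0 (vscale b xi) * cos q') by ring.
rewrite e1 e2; apply: le_trans (lerD R1 R2) _.
have powE (z e : R) : 0 <= z -> (z `^ e) ^+ 2 = z `^ (2 * e).
  by move=> z0; rewrite -powR_mulrn ?powR_ge0// -powRrM mulrC.
have EY : (E1 * Y) ^+ 2 = C1 ^+ 2 * C2 `^ (2 * g) * sg `^ (2 * g) * W xi.
  rewrite /E1 /Y !exprMn powE ?mulr_ge0 ?powR_ge0//; last exact: ltW.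
  have b0 : 0 <= C2 * sg * (1 + vnorm xi) `^ Q by rewrite !mulr_ge0// powR_ge0.
  rewrite (powE _ g b0) (powRM _ (mulr_ge0 C20' sg0) (powR_ge0 _ _)) (powRM _ C20' sg0) -powRrM.
  rewrite /W (_ : - (2 * (P - g * Q)) = 2 * - P + Q * (2 * g)); last by ring.
  rewrite (powRD _ (r := 2 * - P)) ?(gt_eqF w0) ?implybT//; ring.
have EW : E1 ^+ 2 <= C1 ^+ 2 * W xi.
  rewrite /E1 exprMn powE ?(ltW w0)// ler_wpM2l ?sqr_ge0//.
  apply: ler_powR => //; have : 0 <= g * Q by rewrite mulr_ge0// ltW.
  by lra.
have EO : (E1 * om) ^+ 2 <= C1 ^+ 2 * (W xi * om ^+ 2).
  by rewrite exprMn mulrA ler_wpM2r// sqr_ge0.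
rewrite EY (_ : E2 ^+ 2 = C1 ^+ 2 * expR (- (P * t)) ^+ 2); last by rewrite /E2 exprMn.
move: EO; set A1 := C1 ^+ 2 * C2 `^ _ * _ * _; set A2 := C1 ^+ 2 * expR _ ^+ 2.
rewrite -(mulrA 384) -/A2 -(mulrA 6) (_ : 24 * _ * _ * _ * _ = 24 * A1); last by rewrite /A1; ring.
by lra.
Qed.

Lemma I_gauss_dilate tau : 0 < tau ->
  L1 m (fun xi => gauss (vscale tau xi)) /\ I[m] (fun xi => gauss (vscale tau xi)) = tau ^- n * c.
Proof.
move=> t0; have tn0 : tau != 0 by rewrite gt_eqF.
have E (xi : V) : affine tau [tuple 0 | _ < n] xi = vscale tau xi.
  by apply: eq_tnthP => i; rewrite tnth_vsub [X in _ - X]tnth_mktuple subr0.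
split; first by apply: L1_ext (L1_affine lm [tuple 0 | _ < n] tn0 Lg) => xi; rewrite E.
have := I_affine lm [tuple 0 | _ < n] tn0 Lg; rewrite (gtr0_norm t0) => <-.
by apply: I_ext => xi; rewrite E.
Qed.

Lemma energy_eventually (sg T1 eta e : R) (u0 v0 : V -> R) (u v p p' q q' : R -> V -> R) :
  prob_density m u0 -> prob_density m v0 -> 0 <= sg -> 0 < eta -> 0 < e ->
  (forall t, T1 <= t -> L1 m (u t) /\ L1 m (v t)) ->
  (forall t xi, T1 <= t -> 
  ft_re m (u t) xi = expR (- p t xi) * (ft_re m u0 (vscale (expR (- t)) xi) * cos (q t xi) -
     ft_s m u0 (vscale (expR (- t)) xi) * sin (q t xi)) /\
  ft_s m (u t) xi = expR (- p t xi) * (ft_re m u0 (vscale (expR (- t)) xi) * sin (q t xi) +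
     ft_s m u0 (vscale (expR (- t)) xi) * cos (q t xi))) ->
  (forall t xi, T1 <= t -> 
  ft_re m (v t) xi = expR (- p' t xi) * (ft_re m v0 (vscale (expR (- t)) xi) * cos (q' t xi) -
     ft_s m v0 (vscale (expR (- t)) xi) * sin (q' t xi)) /\
  ft_s m (v t) xi = expR (- p' t xi) * (ft_re m v0 (vscale (expR (- t)) xi) * sin (q' t xi) +
     ft_s m v0 (vscale (expR (- t)) xi) * cos (q' t xi))) ->
  (forall t xi, T1 <= t -> expR (- p t xi) <= C1 * ((1 + vnorm xi) `^ (- P) + expR (- (P * t)))) ->
  (forall t xi, T1 <= t -> expR (- p' t xi) <= C1 * ((1 + vnorm xi) `^ (- P) + expR (- (P * t)))) ->
  (forall t xi, T1 <= t -> `|p t xi - p' t xi| + `|q t xi - q' t xi| <= C2 * sg * (1 + vnorm xi) `^ Q) ->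
  exists2 T, 0 < T & forall t, T <= t ->
    energy m (eta * expR (- t)) (fun x => u t x - v t x) <= energy_cst * sg `^ (2 * g) + e.
Proof.
move=> pu pv sg0 eta0 e0 LL hu hv hp hp' hZ.
have /andP[g0 g1] := g01; have [C10' C20' Q0'] := And3 C10 C20 Q0; have PQ' := PQ.
have gQ : 0 <= g * Q by rewrite mulr_ge0// ltW.
(* The terms that vanish in the limit. The Gaussian integral is of order [tau^-n] with
   [tau = eta e^-t], which turns [e^(-2 P t)] into [e^(-(2 P - n) t)]; [PQ] gives [2 P > n]. *)
pose F t := (c ^+ 2)^-1 * (384 * C1 ^+ 2 * eta ^- n * c * expR (- ((2 * P - n%:R) * t)) +
   6 * C1 ^+ 2 * I[m] (fun xi => W xi * deviation u0 v0 (expR (- t)) xi ^+ 2)).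
have cc0 : 0 <= (c ^+ 2)^-1 by rewrite invr_ge0 exprn_ge0// ltW.
have expcvg (b : R) (t_ : nat -> R) : 0 < b -> (forall j, j%:R <= t_ j) ->
    expR (- (b * t_ j)) @[j --> \oo] --> (0 : R).
  move=> b0 ht; apply: (@squeeze_cvg0 _ _ (fun j => (Num.max 1 b^-1) * j.+1%:R^-1)).
    move=> j; rewrite expR_ge0/= expRN.
    have M0 : 0 < Num.max 1 b^-1 by rewrite lt_max ltr01.
    rewrite -[Num.max _ _]invrK -invfM lef_pV2 ?posrE ?expR_gt0 ?mulr_gt0 ?invr_gt0 ?ltr0n//.
    apply: le_trans (expR_ge1Dx _).
    have M1 : 1 <= Num.max 1 b^-1 by rewrite le_max lexx.
    have M2 : (Num.max 1 b^-1)^-1 <= b by rewrite invf_ple ?posrE// le_max lexx orbT.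
    have M3 : (Num.max 1 b^-1)^-1 <= 1 by rewrite invf_le1.
    rewrite -natr1 mulrDr mulr1 addrC; apply: lerD => //.
    by apply: ler_pM; rewrite ?invr_ge0 ?(ltW M0).
  rewrite -[X in _ --> X](mulr0 (Num.max 1 b^-1)); apply: cvgnZ; exact: cvg_harmonic.
have [T2 T20 HT] : exists2 T, 0 < T & forall t, T <= t -> F t <= e.
  apply: eventually_le_seq => // t_ ht.
  rewrite /F -[X in _ --> X](mulr0 (c ^+ 2)^-1); apply: cvgnZ.
  rewrite -[X in _ --> X](addr0 0); apply: cvgnD.
    rewrite -[X in _ --> X](mulr0 (384 * C1 ^+ 2 * eta ^- n * c)); apply: cvgnZ.
    by apply: expcvg => //; lra.
  rewrite -[X in _ --> X](mulr0 (6 * C1 ^+ 2)); apply: cvgnZ.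
  apply: deviation_cvg => //.
  have := expcvg 1 t_ ltr01 ht.
  by under eq_fun do rewrite mul1r.
exists (T2 + `|T1|); first by rewrite ltr_pwDl.
move=> t Tt; have tT2 : T2 <= t by apply: le_trans Tt; rewrite lerDl.
have tT1 : T1 <= t.
  by apply: le_trans (ler_norm _) _; apply: le_trans Tt; rewrite lerDr ltW.
have [Lu Lv] := LL t tT1.
have tau0 : 0 < eta * expR (- t) by rewrite mulr_gt0// expR_gt0.
have [Len _] := energyE lm tau0 (L1B Lu Lv).
have [Lgt Egt] := I_gauss_dilate tau0.
rewrite /energy /energy_cst -mulrA.
have Ld : L1 m (fun xi => W xi * deviation u0 v0 (expR (- t)) xi ^+ 2).
  have [_ Lu0 _] := prob_densityP pu; have [_ Lv0 _] := prob_densityP pv.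
  apply: (L1_le (g := fun x => 36 * W x)); last exact: L1Z.
    apply: measurable_funM; first exact: L1_measurable LW.
    apply: measurable_funX.
    have mr f : L1 m f -> measurable_fun setT (fun xi => `|ft_re m f (vscale (expR (- t)) xi) - 1| + `|ft_s m f (vscale (expR (- t)) xi)|).
      move=> hf; apply: measurable_funD; apply: measurableT_comp => //.
        apply: measurable_funB => //.
        by apply: measurable_trig_transform => //; exact: continuous_cos.
      by apply: measurable_trig_transform => //; exact: continuous_sin.
    by apply: measurable_funD; exact: mr.
  move=> x; have /andP[dd0 dd6] := deviation_le (expR (- t)) x pu pv.
  rewrite normrM mulrC (ger0_norm (sqr_ge0 _)) (ger0_norm (powR_ge0 _ _)) ler_wpM2r ?powR_ge0//.
  by rewrite (_ : 36 = 6 ^+ 2 :> R); [rewrite ler_pXn2r// nnegrE|ring].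
pose A1 := 24 * C1 ^+ 2 * C2 `^ (2 * g) * sg `^ (2 * g).
pose A2 := 384 * C1 ^+ 2 * expR (- (P * t)) ^+ 2.
pose A3 := 6 * C1 ^+ 2.
apply: (@le_trans _ _ ((c ^+ 2)^-1 * (A1 * I[m] W + A2 * I[m] (fun xi => gauss (vscale (eta * expR (- t)) xi)) +
    A3 * I[m] (fun xi => W xi * deviation u0 v0 (expR (- t)) xi ^+ 2)))).
  rewrite ler_wpM2l// -!I_Z// -I_D; [|exact: L1Z|exact: L1Z].
  rewrite -I_D; [|by apply: L1D; exact: L1Z|exact: L1Z].
  apply: I_le => //; first by apply: L1D; [apply: L1D; exact: L1Z|exact: L1Z].
  move=> xi.
  have -> : ft_re m (fun x => u t x - v t x) xi = ft_re m (u t) xi - ft_re m (v t) xi.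
    rewrite /ft_re -I_B; [|exact: L1_cos|exact: L1_cos].
    by apply: I_ext => x; rewrite mulrBr.
  have -> : ft_s m (fun x => u t x - v t x) xi = ft_s m (u t) xi - ft_s m (v t) xi.
    rewrite /ft_s -I_B; [|exact: L1_sin|exact: L1_sin].
    by apply: I_ext => x; rewrite mulrBr.
  have := fourier_pair_bound pu pv sg0 (hu t xi tT1) (hv t xi tT1) (hp t xi tT1) (hp' t xi tT1) (hZ t xi tT1).
  rewrite -/A1 -/A2 -/A3.
  have G0 := gauss_ge0 (vscale (eta * expR (- t)) xi); have G1 := gauss_le1 (vscale (eta * expR (- t)) xi).
  set X := _ + _; move=> hX.
  have A10 : 0 <= A1 * W xi by rewrite !mulr_ge0 ?powR_ge0 ?sqr_ge0.
  have A30 : 0 <= A3 * (W xi * deviation u0 v0 (expR (- t)) xi ^+ 2).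
    apply: mulr_ge0; first by rewrite /A3 mulr_ge0// sqr_ge0.
    by apply: mulr_ge0; [exact: powR_ge0|exact: sqr_ge0].
  apply: le_trans (ler_wpM2l G0 hX) _; rewrite !mulrDr.
  apply: lerD; last by rewrite ler_piMl.
  by apply: lerD; [rewrite ler_piMl|rewrite mulrC].
have -> : (c ^+ 2)^-1 * (A1 * I[m] W + A2 * I[m] (fun xi => gauss (vscale (eta * expR (- t)) xi)) +
    A3 * I[m] (fun xi => W xi * deviation u0 v0 (expR (- t)) xi ^+ 2)) =
   (c ^+ 2)^-1 * (24 * C1 ^+ 2 * C2 `^ (2 * g) * I[m] W * sg `^ (2 * g)) + F t.
  rewrite Egt /F -mulrDr; congr (_ * _).
  have -> : A2 * ((eta * expR (- t)) ^- n * c) = 384 * C1 ^+ 2 * eta ^- n * c * expR (- ((2 * P - n%:R) * t)).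
    rewrite (_ : expR (- ((2 * P - n%:R) * t)) = expR (- (P * t)) ^+ 2 * (expR (- t) ^- n)).
      by rewrite /A2 exprMn invfM; ring.
    rewrite -!expRM_natl -expRN -expRD; congr expR; ring.
  by rewrite /A1 -/A3; ring.
by rewrite lerD2l; exact: HT.
Qed.

End energy_estimate.

(** * Comparison of the two solutions *)

Lemma sum_bounds (R : realType) (c w X A B Y : R) : 0 <= X ->
  A <= c * X + X -> B <= c * X + X -> Y <= X + w * X ->
  A + B + 3 / 2 * Y <= (2 * c + 4 + 3 / 2 * w) * X.
Proof.
move=> X0 hA hB hY; rewrite -subr_ge0.
rewrite (_ : _ - _ = (c * X + X - A) + (c * X + X - B) + 3 / 2 * (X + w * X - Y) + X / 2); last by field.
apply: addr_ge0; last by rewrite divr_ge0.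
apply: addr_ge0; first by rewrite addr_ge0 ?subr_ge0.
by apply: mulr_ge0; [rewrite divr_ge0|rewrite subr_ge0].
Qed.

Section comparison.
Context {R : realType} {n : nat}.
Notation V := (n.-tuple R).
Variable m : {sigma_finite_measure set V -> \bar R}.
Hypothesis lm : is_lebesgue m.
Notation ball M := [set x : V | vnorm x <= M].

Lemma measurable_ball M : measurable (ball M).
Proof.
rewrite (_ : [set x | _] = (@vnorm R n) @^-1` `]-oo, M]).
  by rewrite -[X in measurable X]setTI; exact: measurable_vnorm.
by apply/seteqP; split=> x /=; rewrite in_itv.
Qed.

Lemma measure_ball M : 0 <= M -> (m (ball M) <= ((2 * M) ^+ n)%:E)%E.
Proof.
move=> M0; rewrite -(lebesgue_cube lm M0); apply: le_measure; rewrite ?inE.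
- exact: measurable_ball.
- exact: measurable_cube.
- by move=> x; exact: cube_vnorm.
Qed.

Lemma L1k_split (k M : R) (f g : V -> R) : 0 <= k < 1 -> 1 <= M ->
  L1 m (fun x => jbr x `^ k * `|f x|) -> L1 m (fun x => jbr x `^ k * `|g x|) ->
  L1 m f -> L1 m g ->
  I[m] (fun x => jbr x `^ k * `|f x - g x|) <=
  I[m] (fun x => (M < vnorm x)%R%:R * (jbr x `^ k * `|f x|)) +
  I[m] (fun x => (M < vnorm x)%R%:R * (jbr x `^ k * `|g x|)) +
  3 / 2 * M `^ k * I[m] (fun x => \1_(ball M) x * `|f x - g x|).
Proof.
move=> k01 M1 Lf Lg Lf' Lg'.
have Lt h : L1 m (fun x => jbr x `^ k * `|h x|) ->
    L1 m (fun x => (M < vnorm x)%R%:R * (jbr x `^ k * `|h x|)).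
  move=> Lh; apply: (L1M (c := 1)) => //; first exact: measurable_gt_vnorm.
  by move=> x; case: (_ < _); rewrite ?normr1 ?normr0.
have LB : L1 m (fun x => \1_(ball M) x * `|f x - g x|).
  apply: (L1M (c := 1)); last exact: L1_norm (L1B Lf' Lg').
    by apply: measurable_indic; exact: measurable_ball.
  by move=> x; rewrite indicE; case: (_ \in _); rewrite ?normr1 ?normr0.
have L2 := L1Z (3 / 2 * M `^ k) LB.
rewrite -I_D; [|exact: Lt|exact: Lt].
rewrite -(I_Z _ LB) -I_D; [|by apply: L1D; exact: Lt|exact: L2].
have jk0 (x : V) : 0 <= jbr x `^ k by exact: powR_ge0.
have tri x : jbr x `^ k * `|f x - g x| <= jbr x `^ k * `|f x| + jbr x `^ k * `|g x|.
  by rewrite -mulrDr ler_wpM2l// ler_normB.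
apply: I_le; [|by apply: L1D => //; apply: L1D; exact: Lt|].
  apply: (L1_le (g := fun x => jbr x `^ k * `|f x| + jbr x `^ k * `|g x|)); last exact: L1D.
    by apply: measurable_funM; [exact: measurable_jbr_powR|exact: L1_measurable (L1_norm (L1B Lf' Lg'))].
  by move=> x; rewrite ger0_norm// mulr_ge0.
move=> x; have [Mx|xM] := ltP M (vnorm x).
  rewrite !mul1r; apply: le_trans (tri x) _; rewrite lerDl; apply: mulr_ge0.
    by rewrite mulr_ge0 ?powR_ge0// divr_ge0.
  by rewrite mulr_ge0// indicE.
rewrite !mul0r add0r indicE mem_set//= mul1r add0r; apply: ler_wpM2r => //.
exact: jbr_powR_le.
Qed.

Lemma shift_distB f g y : L1 m f -> L1 m g ->
  shift_dist m (fun x => f x - g x) y <= shift_dist m f y + shift_dist m g y.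
Proof.
move=> hf hg; have L1' := L1_shift_dist lm y hf; have L2' := L1_shift_dist lm y hg.
rewrite /shift_dist -I_D//; apply: I_le; [exact: (L1_shift_dist lm y (L1B hf hg))|exact: L1D|].
move=> x; apply: le_trans (ler_normB _ _); rewrite le_eqVlt; apply/orP; left; apply/eqP.
by congr `|_|; ring.
Qed.

Section estimates.
Variables (k delta : R).
Hypotheses (k01 : 0 <= k < 1) (d0 : 0 < delta).
Variables (J : R -> V -> R) (J1 : V -> R) (u0 v0 : V -> R).
Hypotheses (h1 : H1 m J delta) (h2 : H2 m J J1 delta)
  (pu0 : prob_density m u0) (u0k : (L1k_norm m k u0 < +oo)%E)
  (pv0 : prob_density m v0) (v0k : (L1k_norm m k v0 < +oo)%E).

Let k0 : 0 <= k. Proof. by case/andP: k01. Qed.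
Let hJ s : 1/2 < s < 1 -> prob_density m (J s). Proof. by move=> /h1.1[]. Qed.

Lemma small_freq_family : exists2 C0, 0 < C0 &
  (forall s, 1/2 < s < 1 -> small_freq m (J s) s C0 delta) /\ small_freq m J1 1 C0 delta.
Proof.
have [A A0 HA] := H1_small_freq h1; have [B B0 HB] := H2_small_freq h2.
exists (A + B); first exact: addr_gt0.
split=> [s hs|].
  by apply: small_freqW (HA s hs); rewrite lerDl ltW.
by apply: small_freqW HB; rewrite lerDr ltW.
Qed.

Lemma mild_mass s eps (K w0 : V -> R) (w : R -> V -> R) t : 1/2 <= s <= 1 -> 0 < eps <= 1 ->
  prob_density m K -> (exists2 C0, 0 < C0 & small_freq m K s C0 delta) -> prob_density m w0 ->
  mild_solution m k s eps K w0 w -> 0 <= t -> L1 m (w t) /\ I[m] (fun x => `|w t x|) = 1.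
Proof.
move=> s12 e01 pK [C0 C00 sf] pw0 ms t0; have /andP[e0 _] := e01.
have [Lw Iw] := mild_density lm k01 (ltW C00) d0 s12 e01 pK sf pw0 ms t0.
split=> //; rewrite -[RHS]Iw; apply: I_ae.
- exact: L1_measurable (L1_norm Lw).
- exact: L1_measurable Lw.
- by apply: filterS (mild_ge0 lm k0 e0 pK pw0 ms t0) => x wx; rewrite ger0_norm.
Qed.

(** For [s] below the threshold of [comparison_near1] this takes the place of a rate: the tail bound
    with [M = 1] controls the part outside the unit ball, and the unit masses control the part
    inside. *)
Lemma uniform_bound : exists2 C, 0 < C & forall s, 1/2 < s < 1 -> forall eps, 0 < eps <= 1 ->
  forall us u, mild_solution m k s eps (J s) u0 us -> mild_solution m k 1 eps J1 v0 u ->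
  exists2 T, 0 < T & forall t, T <= t ->
    I[m] (fun x => jbr x `^ k * `|us t x - u t x|) <= C.
Proof.
have [C0 C00 [sfs sf1]] := small_freq_family.
have [C C_0 HC] := mild_tail lm k01 (ltW C00) d0.
exists (2 * (C + 1) + 3); first by rewrite addr_gt0// mulr_gt0// addr_gt0.
move=> s hs eps e01 us u mus mu; have /andP[s1 s2] := hs.
have s12 : 1/2 <= s <= 1 by rewrite !ltW.
have s12' : 1/2 <= (1 : R) <= 1 by rewrite lexx andbT ler_pdivrMr ?ltr0n// mul1r ler1n.
have one : (1 : R) <= 1 by [].
have [Ts Ts0 Hs] := HC s eps (J s) u0 us s12 e01 (hJ hs) (sfs s hs) pu0 u0k mus 1 1 one ltr01.
have [Tu Tu0 Hu] := HC 1 eps J1 v0 u s12' e01 h2.1 sf1 pv0 v0k mu 1 1 one ltr01.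
rewrite (congr1 (@^~ _) (powR1 R)) mulr1 in Hs Hu.
exists (Ts + Tu); first exact: addr_gt0.
move=> t Tt; have tTs : Ts <= t by apply: le_trans Tt; rewrite lerDl ltW.
have tTu : Tu <= t by apply: le_trans Tt; rewrite lerDr ltW.
have t0 : 0 <= t by exact: le_trans (ltW Ts0) tTs.
have [Lus Ius] := mild_mass s12 e01 (hJ hs) (ex_intro2 _ _ C0 C00 (sfs s hs)) pu0 mus t0.
have [Lu Iu] := mild_mass s12' e01 h2.1 (ex_intro2 _ _ C0 C00 sf1) pv0 mu t0.
apply: le_trans (L1k_split k01 one (L1k_mild k01 mus t0) (L1k_mild k01 mu t0) Lus Lu) _.
rewrite (congr1 (@^~ _) (powR1 R)) mulr1.
have hB : I[m] (fun x => \1_(ball 1) x * `|us t x - u t x|) <= 2.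
  apply: (@le_trans _ _ (I[m] (fun x => `|us t x| + `|u t x|))); last first.
    by rewrite I_D; [rewrite Ius Iu; lra|exact: L1_norm|exact: L1_norm].
  apply: I_le; [|by apply: L1D; exact: L1_norm|].
    apply: (L1M (c := 1)); last exact: L1_norm (L1B Lus Lu).
      by apply: measurable_indic; exact: measurable_ball.
    by move=> x; rewrite indicE; case: (_ \in _); rewrite ?normr1 ?normr0.
  move=> x; apply: le_trans (ler_normB _ _).
  by rewrite ler_piMl// indicE; case: (_ \in _).
by have := Hs t tTs; have := Hu t tTu; lra.
Qed.

Variable q : R.
Hypotheses (kq : k < q) (q1 : q < 1) (n0 : (0 < n)%N).

Let N : R := n%:R.
Let theta := (q - k) / (q + N / 2).
Let gam := theta * (1 + N / 2) / (1 - k).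
Let D := 2 + delta + N / 2.

Let N1 : 1 <= N. Proof. by rewrite /N ler1n. Qed.

Let theta0 : 0 < theta.
Proof.
have [[[a b] c] d'] := (k0, kq, q1, N1).
by rewrite /theta divr_gt0//; [lra|have := d'; lra].
Qed.

Let gam01 : 0 < gam < 1.
Proof.
have [[[a b] c] d'] := (k0, kq, q1, N1).
have k1 : 0 < 1 - k by lra.
have qN : 0 < q + N / 2 by lra.
apply/andP; split.
  by apply: divr_gt0 => //; apply: mulr_gt0; [exact: theta0|lra].
rewrite /gam ltr_pdivrMr// mul1r /theta mulrAC ltr_pdivrMr//.
(* [1 - gam] is a positive multiple of [(1 - q)(N/2 + k)]: here [q < 1] makes the interpolation
   exponent admissible. *)
rewrite -subr_gt0 (_ : _ - _ = (1 - q) * (N / 2 + k)); last by field.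
by rewrite mulr_gt0//; lra.
Qed.

(* The exponents: [theta] is what the balance [M ^ (k-1) = M ^ (k+N/2) (1-s) ^ gam] gives. *)
Let balance (sg : R) : 0 < sg -> let M := sg `^ (- (gam / (1 + N / 2))) in
  M `^ (k - 1) = sg `^ theta /\ M `^ k * (M `^ (N / 2) * sg `^ gam) = sg `^ theta.
Proof.
move=> sg0 M; have [[[a b] c] d'] := (k0, kq, q1, N1).
have k1 : 1 - k != 0 by rewrite gt_eqF//; lra.
have N2 : 1 + N / 2 != 0 by rewrite gt_eqF//; lra.
have sD e e' : sg `^ e * sg `^ e' = sg `^ (e + e').
  by rewrite powRD// (gt_eqF sg0) implybT.
rewrite /M -!powRrM !sD; split; congr (_ `^ _); rewrite /gam; field.
- by rewrite k1 ?andbT /= gt_eqF//; move: d'; rewrite /N; lra.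
- by rewrite k1 ?andbT /= gt_eqF//; move: d'; rewrite /N; lra.
Qed.

Lemma comparison_near1 : exists2 C, 0 < C & exists2 s0, s0 < 1 &
  forall s, 1/2 < s < 1 -> s0 <= s -> forall eps, 0 < eps <= 1 -> eps ^+ 2 < D^-1 ->
  forall us u, mild_solution m k s eps (J s) u0 us -> mild_solution m k 1 eps J1 v0 u ->
  exists2 T, 0 < T & forall t, T <= t ->
    I[m] (fun x => jbr x `^ k * `|us t x - u t x|) <= C * (1 - s) `^ theta.
Proof.
have [[[[a b] c'] d'] dd] := (k0, kq, q1, N1, d0).
have /andP[g0 g1] := gam01.
(* The slack of the L2 condition: with [P = D - gp/2] and [Q = 2 + delta + iota] one has
   [P - gam Q - N/2 = gp/2 - gam iota], positive since [iota <= gp/4]. *)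
pose gp := (2 + delta) * (1 - gam); have gp0 : 0 < gp by rewrite mulr_gt0//; lra.
have gp2 : gp < 2 + delta by rewrite /gp gtr_pMr; lra.
pose iota := Order.min (1 / 2) (Order.min (delta / 2) (gp / 4)).
have i0 : 0 < iota by rewrite !lt_min; apply/and3P; split; lra.
have i2 : iota <= 1 / 2 by rewrite ge_min lexx.
have id2 : iota <= delta / 2 by rewrite !ge_min lexx orbT.
have ig : iota <= gp / 4 by rewrite !ge_min lexx !orbT.
(* [P < a0 < D]: the gap below [D] leaves room for [s < 1] in [eps^(-2s) >= a0], the gap above [P]
   for a slab mass [kappa > 0] with [a0 (1 - kappa) = P]. *)
pose Q := 2 + delta + iota; pose P := D - gp / 2; pose a0 := D - gp / 4.
have gpE : gp = (2 + delta) - gam * (2 + delta) by rewrite /gp; ring.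
have D1 : 1 < D by rewrite /D; lra.
have a01 : 1 < a0 by rewrite /a0 /D; lra.
have aD : a0 < D by rewrite /a0; lra.
have P0 : 0 < P by rewrite /P /D; lra.
have Pa : P < a0 by rewrite /P /a0; lra.
have Q0 : 0 <= Q by rewrite /Q; lra.
have PQ : n%:R < 2 * (P - gam * Q).
  have gi : gam * iota <= gp / 4 by apply: le_trans ig; rewrite ler_piMl// ltW.
  by rewrite /P /Q /D mulrDr -/N; move: gpE; lra.
pose kappa := 1 - P / a0.
have kap : 0 < kappa < 1.
  have Pr : P / a0 < 1 by rewrite ltr_pdivrMr ?mul1r//; lra.
  have Pr0 : 0 < P / a0 by rewrite divr_gt0//; lra.
  by rewrite /kappa; lra.
have PE : a0 * (1 - kappa) = P by rewrite /kappa; field; rewrite gt_eqF//; lra.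
have [C0 C00 [sfs sf1]] := small_freq_family.
(* Chosen so that the relative remainder [C0 |eta|^delta] is at most 1/2 for [|eta| <= c0]. *)
pose c0 := Order.min 1 ((2 * C0)^-1 `^ delta^-1).
have c01 : 0 < c0 <= 1.
  by rewrite lt_min ltr01 powR_gt0 ?invr_gt0 ?mulr_gt0//= ge_min lexx.
have hC : C0 * c0 `^ delta <= 1 / 2.
  have h : c0 `^ delta <= (2 * C0)^-1.
    apply: (@le_trans _ _ (((2 * C0)^-1 `^ delta^-1) `^ delta)).
      rewrite ge0_ler_powR ?nnegrE ?powR_ge0 ?(ltW d0)//; first by case/andP: c01 => /ltW.
      by rewrite ge_min lexx orbT.
    by rewrite -powRrM mulVf ?gt_eqF// powRr1// invr_ge0 mulr_ge0// ltW.
  apply: le_trans (ler_wpM2l (ltW C00) h) _.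
  by rewrite le_eqVlt; apply/orP; left; apply/eqP; field; rewrite gt_eqF.
have kap2 : 0 < kappa / 2 by case/andP: kap => k' _; rewrite divr_gt0.
have [rho rho01 [s1 s11 Hdir]] := dir_mass_uniform lm hJ h2 i0 i2 id2 kap2.
have a00 : 0 < a0 by lra.
have [C1 C10 [T1 T11 Hexp]] := expR_exponent_le m rho01 c01 (ltW C00) d0 hC a00 kap.
have [C2 C20 Hdiff] := exponent_diff hJ h2 i0 i2 id2.
have [Ct Ct0 Htail] := mild_tail lm k01 (ltW C00) d0.
have lnD : 0 < ln D by rewrite ln_gt0.
(* [eps^-2 > D] gives [eps^(-2s) > D^s], and [D^s >= a0] from this value of [s] on. *)
pose s0' := ln a0 / ln D.
have s0'1 : s0' < 1 by rewrite ltr_pdivrMr// mul1r ltr_ln ?posrE//; lra.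
pose E := energy_cst m P Q gam C1 C2.
have E0 : 0 <= E.
  have cg : 0 <= ((I[m] gauss) ^+ 2)^-1 by rewrite invr_ge0 sqr_ge0.
  rewrite /E /energy_cst; apply: mulr_ge0 => //; apply: mulr_ge0.
    by rewrite !mulr_ge0 ?powR_ge0 ?(ltW C10).
  by apply: I_ge0 => x; exact: powR_ge0.
pose C := 2 * Ct + 4 + 3 / 2 * (2 ^+ n / 2 + (E + 1) / 2).
have C_0 : 0 < C.
  rewrite /C; have : 0 < 2 ^+ n :> R by rewrite exprn_gt0.
  by move: E0 Ct0; lra.
exists C => //; exists (Order.max s1 s0'); first by rewrite gt_max s11.
move=> s hs; rewrite ge_max => /andP[s1s s0s] eps e01 eD us u mus mu.
have /andP[e0 e1] := e01; have /andP[sl sr] := hs.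
have s12 : 1/2 <= s <= 1 by rewrite !ltW.
have s12' : 1/2 <= (1 : R) <= 1 by rewrite lexx andbT ler_pdivrMr ?ltr0n// mul1r ler1n.
have big sx : s0' <= sx -> 0 < sx -> a0 <= eps `^ (- (2 * sx)).
  move=> s0x sx0; rewrite /powR gt_eqF// -[leLHS]lnK ?posrE// ler_expR.
  have l2 : 2 * ln eps <= - ln D.
    rewrite -lnV ?posrE; last by lra.
    rewrite mulr_natl -lnXn// ler_ln ?posrE ?exprn_gt0 ?invr_gt0//; [exact: ltW|lra].
  have h : ln a0 <= sx * ln D by rewrite -ler_pdivrMr.
  apply: le_trans h _; rewrite (_ : - (2 * sx) * ln eps = sx * - (2 * ln eps)); last by ring.
  by rewrite ler_pM2l//; lra.
have nks : nice_kernel m rho C0 delta a0 kappa (J s) s eps.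
  split=> //; [exact: hJ|exact: sfs|split; first by apply: big => //; exact: lt_trans sl].
  by move=> om om1; exact: (Hdir om om1).2.
have nk1 : nice_kernel m rho C0 delta a0 kappa J1 1 eps.
  split=> //; [exact: h2.1|split; first by apply: big => //; exact: ltW].
  by move=> om om1; exact: (Hdir om om1).1.
set sg := 1 - s; have sg0 : 0 < sg by rewrite subr_gt0.
have sg1 : sg <= 1 by rewrite lerBlDr lerDl ltW// (le_lt_trans _ sl)// divr_ge0// ler0n.
pose M := sg `^ (- (gam / (1 + N / 2))).
have [bal1 bal2] := balance sg0; rewrite -/M in bal1 bal2.
have M1 : 1 <= M.
  rewrite /M /powR gt_eqF// -[leLHS]expR0 ler_expR mulNr oppr_ge0 mulr_ge0_le0 ?ln_le0//.
  by rewrite divr_ge0 ?(ltW g0)//; lra.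
have M0 : 0 < M := lt_le_trans ltr01 M1.
have sgt : 0 < sg `^ theta by exact: powR_gt0.
have [Ts Ts0 Hs] := Htail s eps (J s) u0 us s12 e01 (hJ hs) (sfs s hs) pu0 u0k mus M _ M1 sgt.
have [Tu Tu0 Hu] := Htail 1 eps J1 v0 u s12' e01 h2.1 sf1 pv0 v0k mu M _ M1 sgt.
rewrite bal1 in Hs Hu.
have cg0 : 0 < I[m] gauss by have [] := gauss_fourier lm.
have [_ Lu0 _] := prob_densityP pu0; have [_ Lv0 _] := prob_densityP pv0.
pose S j := (I[m] gauss)^-1 *
  (I[m] (fun y => gauss y * shift_dist m u0 (vscale j.+1%:R^-1 y)) +
   I[m] (fun y => gauss y * shift_dist m v0 (vscale j.+1%:R^-1 y))).
have Mk0 : 0 < M `^ k by exact: powR_gt0.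
(* The mollification parameter is fixed from the initial data, before [t]: by contraction of
   translations the error is at most [S j] at every time, and the weight [M^k] of the ball is
   compensated in advance. *)
have [j Sj] : exists j, S j <= (M `^ k)^-1 * sg `^ theta.
  have SS : S j @[j --> \oo] --> (0 : R).
    rewrite -[X in _ --> X](mulr0 (I[m] gauss)^-1); apply: cvgnZ.
    by rewrite -[X in _ --> X](addr0 0); apply: cvgnD; exact: gauss_shift_cvg.
  have pos : 0 < (M `^ k)^-1 * sg `^ theta by rewrite mulr_gt0// invr_gt0.
  move/cvgrPdist_le: SS => /(_ _ pos)[j _ /(_ j (leqnn j))] Sj; exists j.
  by move: Sj; rewrite /= sub0r normrN; apply: le_trans; exact: ler_norm.
set eta := j.+1%:R^-1 : R; have eta0 : 0 < eta by rewrite invr_gt0 ltr0n.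
pose p t xi := decay_exponent m s eps (J s) t xi.
pose ph t xi := phase_exponent m s eps (J s) t xi.
pose p' t xi := decay_exponent m 1 eps J1 t xi.
pose ph' t xi := phase_exponent m 1 eps J1 t xi.
have mass_s t : 0 <= t -> L1 m (us t) /\ I[m] (fun x => `|us t x|) = 1.
  exact: (mild_mass s12 e01 (hJ hs) (ex_intro2 _ _ C0 C00 (sfs s hs)) pu0 mus).
have mass_u t : 0 <= t -> L1 m (u t) /\ I[m] (fun x => `|u t x|) = 1.
  exact: (mild_mass s12' e01 h2.1 (ex_intro2 _ _ C0 C00 sf1) pv0 mu).
have pos t : T1 <= t -> 0 <= t by move=> h; apply: le_trans h; exact: le_trans T11.
have e2 : 0 < sg `^ (2 * gam) by exact: powR_gt0.
have g01 : 0 < gam <= 1 by rewrite g0 ltW.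
have LL t : T1 <= t -> L1 m (us t) /\ L1 m (u t).
  by move=> /pos t0; split; [exact: (mass_s t t0).1|exact: (mass_u t t0).1].
have hu1 t xi : T1 <= t -> _ := fun h => mild_fourier lm k0 e0 (hJ hs) pu0 mus xi (pos t h).
have hu2 t xi : T1 <= t -> _ := fun h => mild_fourier lm k0 e0 h2.1 pv0 mu xi (pos t h).
have hp t xi : T1 <= t -> expR (- p t xi) <= C1 * ((1 + vnorm xi) `^ (- P) + expR (- (P * t))).
  by move=> h; rewrite -PE; exact: Hexp.
have hp' t xi : T1 <= t -> expR (- p' t xi) <= C1 * ((1 + vnorm xi) `^ (- P) + expR (- (P * t))).
  by move=> h; rewrite -PE; exact: Hexp.
have hZ t xi : T1 <= t -> `|p t xi - p' t xi| + `|ph t xi - ph' t xi| <= C2 * sg * (1 + vnorm xi) `^ Q.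
  by move=> /pos t0; exact: Hdiff.
have [Te Te0 He] := @energy_eventually R n m lm P Q gam C1 C2 g01 PQ Q0 (ltW C10) (ltW C20)
  sg T1 eta _ u0 v0 us u p p' ph ph' pu0 pv0 (ltW sg0) eta0 e2 LL hu1 hu2 hp hp' hZ.
exists (Ts + Tu + Te); first by rewrite !addr_gt0.
move=> t Tt; have t0 : 0 <= t by apply: le_trans Tt; rewrite !addr_ge0 ?ltW.
have tTs : Ts <= t by apply: le_trans Tt; rewrite -addrA lerDl addr_ge0 ?ltW.
have tTu : Tu <= t by apply: le_trans Tt; rewrite addrAC lerDr addr_ge0 ?ltW.
have tTe : Te <= t by apply: le_trans Tt; rewrite lerDr addr_ge0 ?ltW.
have [Lus _] := mass_s t t0; have [Lu _] := mass_u t t0.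
apply: le_trans (L1k_split k01 M1 (L1k_mild k01 mus t0) (L1k_mild k01 mu t0) Lus Lu) _.
have ts := Hs t tTs; have tu := Hu t tTu; have en := He t tTe.
have {Hs Hu He Htail Hexp Hdiff Hdir hu1 hu2 hp hp' hZ LL} _ := I.
pose h x := us t x - u t x; have Lh : L1 m h by exact: L1B.
set tau := eta * expR (- t) in en; have tau0 : 0 < tau by rewrite mulr_gt0// expR_gt0.
have Lmol := L1_mollify lm tau Lh.
have LBf f : L1 m f -> L1 m (fun x => \1_(ball M) x * `|f x|).
  move=> Lf; apply: (L1M (c := 1)); last exact: L1_norm Lf.
    by apply: measurable_indic; exact: measurable_ball.
  by move=> x; rewrite indicE; case: (_ \in _); rewrite ?normr1 ?normr0.
have dist : I[m] (fun x => `|h x - mollify m tau h x|) <= S j.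
  apply: le_trans (mollify_dist lm tau Lh) _.
  rewrite /S ler_wpM2l ?invr_ge0 ?(ltW cg0)// -I_D; [|exact: L1_gauss_shift_dist|exact: L1_gauss_shift_dist].
  apply: I_le; [exact: L1_gauss_shift_dist|by apply: L1D; exact: L1_gauss_shift_dist|].
  move=> y; rewrite -mulrDr ler_wpM2l ?gauss_ge0//.
  apply: le_trans (shift_distB _ Lus Lu) _.
  have -> : vscale tau y = vscale (expR (- t)) (vscale eta y).
    by apply: eq_tnthP => i; rewrite !tnth_vscale mulrA [_ * eta]mulrC.
  apply: lerD.
    exact: (mild_shift lm k0 e0 (hJ hs) pu0 mus).
  exact: (mild_shift lm k0 e0 h2.1 pv0 mu).
(* Balances the two terms of [mollify_local_L1], of orders [M^N / lam] and [lam sg^(2 gam)]: both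
   become multiples of [M^(N/2) sg^gam]. *)
pose lam := M `^ (N / 2) * sg `^ (- gam).
have MN0 : 0 < M `^ (N / 2) by exact: powR_gt0.
have sgg : 0 < sg `^ gam by exact: powR_gt0.
have lam0 : 0 < lam by rewrite mulr_gt0// powR_gt0.
have mB := measure_ball (ltW M0).
have mBfin : (m (ball M) < +oo)%E by apply: le_lt_trans mB _; rewrite ltry.
have mBr : fine (m (ball M)) <= (2 * M) ^+ n.
  by rewrite -lee_fin fineK// ge0_fin_numE.
have loc := mollify_local_L1 lm tau0 Lh (measurable_ball M) mBfin lam0.
have inner : I[m] (fun x => \1_(ball M) x * `|us t x - u t x|) <=
    S j + ((2 * lam)^-1 * (2 * M) ^+ n + lam / 2 * ((E + 1) * sg `^ (2 * gam))).
  apply: (@le_trans _ _ (I[m] (fun x => `|h x - mollify m tau h x|) +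
      I[m] (fun x => \1_(ball M) x * `|mollify m tau h x|))).
    have Ld := L1_norm (L1B Lh Lmol).
    rewrite -I_D//; last exact: LBf.
    apply: I_le; [exact: LBf|by apply: L1D => //; exact: LBf|].
    move=> x; rewrite -/(h x) indicE; case: (_ \in _); rewrite ?mul1r ?mul0r ?addr0//.
    by rewrite -lerBlDr lerB_dist.
  apply: lerD => //; apply: le_trans loc _; apply: lerD.
    by apply: ler_wpM2l => //; rewrite invr_ge0 mulr_ge0// ltW.
  apply: ler_wpM2l; first by rewrite divr_ge0// ltW.
  by rewrite (mulrDl E) mul1r; exact: en.
have e1' : (2 * lam)^-1 * (2 * M) ^+ n = 2 ^+ n / 2 * (M `^ (N / 2) * sg `^ gam).
  have MM : M ^+ n = M `^ (N / 2) * M `^ (N / 2).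
    rewrite -powRD; last by rewrite (gt_eqF M0) implybT.
    by rewrite -splitr /N powR_mulrn// ltW.
  rewrite exprMn MM /lam powRN; field.
  by rewrite !gt_eqF.
have e2' : lam / 2 * ((E + 1) * sg `^ (2 * gam)) = (E + 1) / 2 * (M `^ (N / 2) * sg `^ gam).
  have sgD : sg `^ (2 * gam) = sg `^ gam * sg `^ gam.
    rewrite -powRD; last by rewrite (gt_eqF sg0) implybT.
    by congr (_ `^ _); ring.
  rewrite sgD /lam powRN; field.
  by rewrite gt_eqF.
rewrite e1' e2' -mulrDl in inner.
have := ler_wpM2l (ltW Mk0) (le_trans inner (lerD Sj (lexx _))).
rewrite mulrDr mulVKf ?gt_eqF// mulrCA bal2 => inn.
rewrite -[3 / 2 * _ * _]mulrA.
exact: (sum_bounds (ltW sgt) ts tu inn).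
Qed.

End estimates.
End comparison.

Theorem theorem5p4 (R : realType) (d : nat)
  (mu : {measure set (d.-tuple R) -> \bar R})
  (J : R -> d.-tuple R -> R) (J1 : d.-tuple R -> R) (delta k m : R)
  (u0 ubar0 : d.-tuple R -> R) :
  (0 < d)%N -> is_lebesgue mu ->
  0 < delta -> H1 mu J delta -> H2 mu J J1 delta ->
  0 <= k -> k < m -> m < 1 ->
  prob_density mu u0 -> (L1k_norm mu k u0 < +oo)%E ->
  prob_density mu ubar0 -> (L1k_norm mu k ubar0 < +oo)%E ->
  let theta := (m - k) / (m + d%:R / 2) in
  exists2 C : R, 0 < C &
    forall s : R, 1/2 < s < 1 ->
    forall eps : R, 0 < eps -> eps < Num.sqrt (2 / (4 + 2 * delta + d%:R)) ->
    forall us u : R -> d.-tuple R -> R,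
      mild_solution mu k s eps (J s) u0 us ->
      mild_solution mu k 1 eps J1 ubar0 u ->
      exists2 Tstar : R, 0 < Tstar &
        forall t : R, Tstar <= t ->
          (L1k_norm mu k (fun x => (us t x - u t x)%R) <=
           (C * (1 - s) `^ theta *
              (1 + eps `^ (theta * delta) * `|ln eps|))%:E)%E.
Proof.
move=> d0 lmu delta0 h1 h2 k0 km m1 pu0 u0k pv0 v0k theta.
(* The Fubini lemmas take a sigma-finite structure, while [mu] is a bare measure; it is replaced by
   an equal measure carrying that structure. *)
have [lm lmE] := sigma_finite_pack (lebesgue_sigma_finite lmu); subst mu.
have k01 : 0 <= k < 1 by rewrite k0 (lt_trans km).
have [A A0 HA] := comparison_near1 lmu k01 delta0 h1 h2 pu0 u0k pv0 v0k km m1 d0.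
move: HA => [s0 s01 HA].
have [B B0 HB] := uniform_bound lmu k01 delta0 h1 h2 pu0 u0k pv0 v0k.
have N1 : 1 <= d%:R :> R by rewrite ler1n.
have th0 : 0 < theta by rewrite divr_gt0//; lra.
have s0t : 0 < (1 - s0) `^ theta by rewrite powR_gt0// subr_gt0.
(* Below [s0] only boundedness is available, and [(1-s)^theta >= (1-s0)^theta] converts it into the
   rate. *)
pose C := A + B / (1 - s0) `^ theta.
have C0 : 0 < C by rewrite addr_gt0// divr_gt0.
exists C => // s hs eps eps0 epsD us u mus mu.
have /andP[sl sr] := hs.
have sg0 : 0 < 1 - s by lra.
have X0 : 0 < 2 / (4 + 2 * delta + d%:R) by rewrite divr_gt0//; lra.
have eD : eps ^+ 2 < (2 + delta + d%:R / 2)^-1.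
  have -> : (2 + delta + d%:R / 2)^-1 = 2 / (4 + 2 * delta + d%:R).
    by field; rewrite ?gt_eqF//; lra.
  by rewrite -ltr_sqrt// sqrtr_sqr gtr0_norm.
have e1 : eps <= 1.
  rewrite leNgt; apply/negP => e1; move: eD; apply/negP; rewrite -leNgt.
  apply: (@le_trans _ _ 1); last by rewrite expr_ge1// ltW.
  by rewrite invf_le1; lra.
have e01 : 0 < eps <= 1 by rewrite eps0.
(* The logarithmic factor is at least 1, so a bound by [C (1-s)^theta] implies the stated one. *)
have one : 1 <= 1 + eps `^ (theta * delta) * `|ln eps| by rewrite lerDl mulr_ge0// powR_ge0.
have sgp : 0 < (1 - s) `^ theta by exact: powR_gt0.
have [T T0 HT] : exists2 T, 0 < T & forall t, T <= t ->
    I[lm] (fun x => jbr x `^ k * `|us t x - u t x|) <= C * (1 - s) `^ theta.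
  have [ss|ss] := leP s0 s.
    have [T T0 HT] := HA s hs ss eps e01 eD us u mus mu; exists T => // t Tt.
    apply: le_trans (HT t Tt) _; rewrite ler_wpM2r ?(ltW sgp)// lerDl.
    by rewrite divr_ge0// ltW.
  have [T T0 HT] := HB s hs eps e01 us u mus mu; exists T => // t Tt.
  apply: le_trans (HT t Tt) _.
  apply: (@le_trans _ _ (B / (1 - s0) `^ theta * (1 - s) `^ theta)).
    rewrite -mulrA ler_peMr ?(ltW B0)// mulrC ler_pdivlMr// mul1r.
    by rewrite ge0_ler_powR ?nnegrE ?(ltW th0)//; lra.
  by rewrite ler_wpM2r ?(ltW sgp)// lerDr ltW.
exists T => // t Tt; have t0 : 0 <= t by exact: le_trans (ltW T0) Tt.
have [mus_t usk] := mus.1 t t0; have [mu_t uk] := mu.1 t t0.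
have [Lus Lus' _ _] := L1k_lty k0 mus_t usk; have [Lu Lu' _ _] := L1k_lty k0 mu_t uk.
have Lh : L1 lm (fun x => jbr x `^ k * `|us t x - u t x|).
  apply: (L1_le (g := fun x => jbr x `^ k * `|us t x| + jbr x `^ k * `|u t x|)); last exact: L1D.
    apply: measurable_funM; first exact: measurable_jbr_powR.
    exact: L1_measurable (L1_norm (L1B Lus' Lu')).
  move=> x; rewrite ger0_norm ?mulr_ge0 ?powR_ge0// -mulrDr ler_wpM2l ?powR_ge0//.
  exact: ler_normB.
rewrite /L1k_norm -(L1_EFin Lh) lee_fin; apply: le_trans (HT t Tt) _.
by rewrite ler_peMr// mulr_ge0 ?ltW.
Qed.
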